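(* Let $G=\mathrm{Sp}(2n,\mathbb{C})$, let $V$ be a finite dimensional $G$-module and let $X\subset\mathbb{P}(V)$ be a projective horospherical $G$-variety with homogeneous coordinate ring $R=\bigoplus_{k\ge 0}R_k$. Let $d=\tfrac12(\dim G-\operatorname{rank} G)=n^2$ and $r=\operatorname{rank}(X)$. Then: (i) There is an injective homomorphism of $\mathbb{C}$-algebras $$\Psi: R\hookrightarrow \mathbb{C}[x_1,\dots,x_d,y_1^{\pm1},\dots,y_r^{\pm1},t].$$ (ii) $\Psi$ in (i) can be taken such that the subalgebra $\Psi(R)$ has a SAGBI basis with respect to the term order $\prec$ on $\mathbb{Z}^{d+r+1}$ described in the context, and such that moreover the semi-group of initial terms $S=\mathrm{in}(\Psi(R))\subset\mathbb{Z}^{d+r+1}$ coincides with the semi-group of integral points in the cone over the polytope $\Delta'(X)$, i.e. $$S=\mathbb{Z}^{d+r+1}\cap\bigcup_{k=0}^\infty (k\Delta'(X),k).$$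
   Context: **Spherical and horospherical varieties.** $X\subset\mathbb{P}(V)$ is a closed irreducible $G$-stable subvariety. It is spherical if it is normal and a Borel subgroup of $G$ has a dense orbit in $X$. A spherical variety is horospherical if the stabilizer in $G$ of a point of the dense $G$-orbit contains a maximal unipotent subgroup of $G$. $R=\bigoplus_k R_k$ is the homogeneous coordinate ring of $X$, graded by degree. $V_\lambda$ denotes the irreducible $G$-module of highest weight $\lambda$. **Weights.** Use a basis of $\mathbb{C}^{2n}$ in which the symplectic form has matrix antidiagonal, with entries $1$ in the upper $n$ rows and $-1$ in the lower $n$ rows. $T$ is the diagonal torus, $B_+$ the upper triangular Borel subgroup of $G$, $U_+$ its maximal unipotent subgroup. The weight lattice is $\Lambda=\mathbb{Z}^n$, with $\lambda$ corresponding to the character $x_{11}^{\lambda_1}\cdots x_{nn}^{\lambda_n}$ of $T$; dominant weights are those with $\lambda_1\ge\dots\ge\lambda_n\ge0$. Real dominant $\lambda\in\Lambda_{\mathbb{R}}=\mathbb{R}^n$ are defined by the same inequalities. **Moment polytope and $\Lambda'$.** $\Phi(X)$ is the moment polytope of $X$ (the intersection of the image of the moment map with the positive Weyl chamber); it equals the closure of $\bigcup_{k\ge1}\{\mu/k : V_\mu \text{ appears in } R_k\}$. By a theorem of Brion, recalled and used throughout by the paper, there is a sublattice $\Lambda'\subset\Lambda$ such that $\Phi(X)\subset\Lambda'_{\mathbb{R}}$ (the real span of $\Lambda'$) and $R_k\cong\bigoplus_{\lambda\in k\Phi(X)\cap\Lambda'}V_\lambda$ for all $k\geq 0$. Fix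 this $\Lambda'$. The rank of $X$ is by definition $r=\operatorname{rank}\Lambda'$. Fix a basis of $\Lambda'$, identifying $\Lambda'\cong\mathbb{Z}^r$ and $\Lambda'_{\mathbb{R}}\cong\mathbb{R}^r$; a weight $\lambda\in\Lambda'$ is the exponent vector of the monomial $y^\lambda=y_1^{\lambda_1}\cdots y_r^{\lambda_r}$ (coordinates of $\lambda$ in this basis). **Gelfand-Cetlin polytope $\Delta_\lambda$.** For real dominant $\lambda$, put $\theta^{(0)}=\lambda$. $\Delta_\lambda\subset\mathbb{R}^{d}$ is the set of all families of real numbers $\eta^{(m)}_i$ ($1\le m\le n$, $1\le i\le n-m+1$), $\theta^{(m)}_i$ ($1\le m\le n-1$, $1\le i\le n-m$) with $$\theta^{(m-1)}_i\ge\eta^{(m)}_i\ge\theta^{(m-1)}_{i+1}\ (1\le i\le n-m+1),\qquad \eta^{(m)}_i\ge\theta^{(m)}_i\ge\eta^{(m)}_{i+1}\ (1\le i\le n-m),$$ where $\theta^{(m-1)}_{n-m+2}:=0$. **The polytopes $\Delta'_\lambda$ and $\Delta'(X)$.** Consider real vectors $(p_{ij})$ indexed by the $d$ pairs with $i<j$, $i+j\le 2n+1$. Given $\lambda$ and $(p_{ij})$, define recursively, starting from $\theta^{(0)}=\lambda$, $$\eta^{(m)}_i=\theta^{(m-1)}_i-p_{m,2n-m+2-i}\ (1\le i\le n-m+1),\qquad \theta^{(m)}_i=\eta^{(m)}_{i+1}+p_{m,i+m}\ (1\le i\le n-m).$$ For fixed $\lambda$ this is an invertible affine map $(p_{ij})\mapsto(\eta,\theta)$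 of $\mathbb{R}^d$. $\Delta'_\lambda$ is the set of $(p_{ij})$ whose image lies in $\Delta_\lambda$. Define $\Delta'(X)=\bigcup_{\lambda\in\Phi(X)}(\lambda,\Delta'_\lambda)\subset\Lambda'_{\mathbb{R}}\oplus\mathbb{R}^d$, which is a convex polytope. In the coordinates of $\mathbb{Z}^{d+r+1}$ (exponents of $x$, of $y$, and of $t$), $(k\Delta'(X),k)$ is the set of $(p,\lambda,k)$ with $\lambda\in k\Phi(X)$ and $p\in\Delta'_\lambda$ (for $k=0$ only the origin). **Term order.** A term order on $\mathbb{Z}^N$ is a total order compatible with addition. Identify $x_1,\dots,x_d$ with the variables $x_{ij}$ ($i<j$, $i+j\le2n+1$), which are coordinates on $U_+$. On monomials in the $x_{ij}$: $\prod x_{ij}^{p_{ij}}\succ\prod x_{ij}^{q_{ij}}$ if $p_{1,2n}<q_{1,2n}$, or $p_{1,2n}=q_{1,2n}$ and $p_{1,2n-1}<q_{1,2n-1}$, and so on, the index pairs being taken in the order $(1,2n),(1,2n-1),\dots,(1,2),(2,2n-1),\dots,(2,3),\dots,(n,n+1)$. Extend to $\mathbb{Z}^{d+r+1}$ lexicographically with $t\succ y_r\succ\dots\succ y_1\succ x_i$: compare first the exponents of $t$, then of $y_r,\dots,y_1$ (the larger exponent is larger), then the $x$-monomials by the order just described. **SAGBI basis.** For a nonzero Laurent polynomial $f$, $\mathrm{in}(f)$ is the exponent vector of its $\prec$-largest monomial; for a subalgebra $A$, $\mathrm{in}(A)=\{\mathrm{in}(f):0\ne f\in A\}$. A finite set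 $\{f_1,\dots,f_s\}\subset A$ is a SAGBI basis of $A$ if (a) the $\mathrm{in}(f_i)$ generate $\mathrm{in}(A)$ as a semi-group; and (b) the following subduction algorithm terminates for every $f\in A$, whatever choices are made: if $f\neq0$, write $\mathrm{in}(f)=\sum d_i\,\mathrm{in}(f_i)$ with $d_i\in\mathbb{N}=\{0,1,2,\dots\}$, let $c\in\mathbb{C}$ be such that $f$ and $cf_1^{d_1}\cdots f_s^{d_s}$ have the same leading term, replace $f$ by $f-cf_1^{d_1}\cdots f_s^{d_s}$, stop if this is $0$, and otherwise repeat. *)

(* Defs.v *)
(* The ground field is C = R[i] for an arbitrary R : realType. *)
From HB Require Import structures.
From mathcomp Require Import all_boot all_order all_algebra.
From mathcomp Require Import finmap zify boolp reals complex mpoly.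
From mathcomp Require monalg classical_sets topology.

Set Implicit Arguments.
Unset Strict Implicit.
Unset Printing Implicit Defensive.

Import GRing.Theory Num.Theory.

Local Open Scope quotient_scope.
Local Open Scope ring_scope.

(* ------------------------------------------------------------------------ *)
(* The group algebra F[K] of an abelian group K; for K = Z^N it is the ring
   of Laurent polynomials.  [monalg] only covers monoids without nontrivial
   units, so the convolution product is rebuilt on top of its free module. *)
Module GroupAlgebra.
Import monalg.
Local Open Scope fset_scope.
Local Open Scope ring_scope.

Definition groupAlg (F : comNzRingType) (K : zmodType) : Type := {malg F[K]}.

Section Theory.
Context {F : comNzRingType} {K : zmodType}.

#[export]
HB.instance Definition _ := GRing.Lmodule.copy (groupAlg F K) {malg F[K]}.

Definition gcoef (g : groupAlg F K) (k : K) : F := @mcoeff K F k g.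
Definition gmonom (c : F) (k : K) : groupAlg F K := mkmalgU k c.
Definition gsupp (g : groupAlg F K) : {fset K} := @msupp K F g.

Definition gmul (g h : groupAlg F K) : groupAlg F K :=
  \sum_(k <- gsupp g) \sum_(l <- gsupp h) gmonom (gcoef g k * gcoef h l) (k + l).

Lemma gcoefP (g h : groupAlg F K) : (forall k, gcoef g k = gcoef h k) -> g = h.
Proof. by move=> gh; apply/malgP. Qed.

Lemma gcoef_monom c k l : gcoef (gmonom c k) l = c *+ (k == l).
Proof. exact: mcoeffU. Qed.

Lemma gsuppP g k : (k \in gsupp g) = (gcoef g k != 0).
Proof. by rewrite /gcoef mcoeff_neq0. Qed.

Lemma gmonomD k : {morph (gmonom^~ k) : c1 c2 / c1 + c2}.
Proof. exact: (@monalgUD K F k). Qed.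

Lemma gmonom0 k : gmonom 0 k = 0.
Proof. exact: (@monalgU0 K F k). Qed.

Lemma gmullw (d1 d2 : {fset K}) g h : gsupp g `<=` d1 -> gsupp h `<=` d2 ->
  gmul g h = \sum_(k <- d1) \sum_(l <- d2) gmonom (gcoef g k * gcoef h l) (k + l).
Proof.
move=> le1 le2; rewrite /gmul (big_fset_incl _ le1) /=.
  apply/eq_bigr=> k _; apply/big_fset_incl => // l _.
  by rewrite gsuppP negbK => /eqP ->; rewrite mulr0 gmonom0.
move=> k _; rewrite gsuppP negbK => /eqP gk.
by rewrite big1 // => l _; rewrite gk mul0r gmonom0.
Qed.

Lemma gmulC : commutative gmul.
Proof.
move=> g h; rewrite /gmul exchange_big; apply/eq_bigr => k _.
by apply/eq_bigr => l _; rewrite mulrC addrC.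
Qed.

Lemma gsuppD g h : gsupp (g + h) `<=` gsupp g `|` gsupp h.
Proof. exact: msuppD_le. Qed.

Lemma gmulDl : left_distributive gmul +%R.
Proof.
move=> g1 g2 g; rewrite (gmullw (gsuppD _ _) (fsubset_refl _)).
rewrite (gmullw (fsubsetUl _ (gsupp g2)) (fsubset_refl _)).
rewrite (gmullw (fsubsetUr (gsupp g1) _) (fsubset_refl _)).
rewrite -big_split /=; apply/eq_bigr=> k1 _.
rewrite -big_split /=; apply/eq_bigr=> k2 _.
by rewrite -gmonomD -mulrDl; congr gmonom; congr (_ * _); apply: mcoeffD.
Qed.

Lemma gmulDr : right_distributive gmul +%R.
Proof. by move=> g g1 g2; rewrite gmulC gmulDl; congr (_ + _); rewrite gmulC. Qed.

Lemma gmul0 : left_zero 0 gmul.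
Proof. by move=> g; rewrite /gmul (_ : gsupp 0 = fset0) ?big_seq_fset0 //; apply: msupp0. Qed.

Lemma gmulr0 : right_zero 0 gmul.
Proof. by move=> g; rewrite gmulC gmul0. Qed.

Lemma gsupp_monom c k : gsupp (gmonom c k) `<=` [fset k].
Proof. exact: msuppU_le. Qed.

Lemma gmulUU c1 c2 k1 k2 :
  gmul (gmonom c1 k1) (gmonom c2 k2) = gmonom (c1 * c2) (k1 + k2).
Proof.
rewrite (gmullw (gsupp_monom _ _) (gsupp_monom _ _)) !big_seq_fset1.
by rewrite !gcoef_monom !eqxx.
Qed.

Lemma groupAlgE g : g = \sum_(k <- gsupp g) gmonom (gcoef g k) k.
Proof. exact: monalgE. Qed.

Lemma gmul1 : left_id (gmonom 1 0) gmul.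
Proof.
move=> g; rewrite (gmullw (gsupp_monom _ _) (fsubset_refl _)) big_seq_fset1.
rewrite [RHS]groupAlgE; apply/eq_bigr => k _.
by rewrite gcoef_monom eqxx mul1r add0r.
Qed.

Lemma gmul_suml (I : Type) (s : seq I) (P : pred I) (G : I -> groupAlg F K) h :
  gmul (\sum_(i <- s | P i) G i) h = \sum_(i <- s | P i) gmul (G i) h.
Proof. exact: (big_morph (gmul^~ h) (fun _ _ => gmulDl _ _ _) (gmul0 _)). Qed.

Lemma gmul_sumr (I : Type) (s : seq I) (P : pred I) (G : I -> groupAlg F K) h :
  gmul h (\sum_(i <- s | P i) G i) = \sum_(i <- s | P i) gmul h (G i).
Proof. exact: (big_morph (gmul h) (fun _ _ => gmulDr _ _ _) (gmulr0 _)). Qed.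

Lemma gmulA : associative gmul.
Proof.
move=> f g h; rewrite [f]groupAlgE [g]groupAlgE [h]groupAlgE.
rewrite !gmul_suml; apply/eq_bigr => k _.
rewrite [LHS]gmul_sumr (gmul_sumr (gsupp g)) gmul_suml; apply/eq_bigr => l _.
rewrite !gmul_sumr; apply/eq_bigr => m _.
by rewrite !gmulUU mulrA addrA.
Qed.

Lemma gone_neq0 : gmonom 1 0 != 0.
Proof.
apply/eqP => /(congr1 (fun g => gcoef g 0)); rewrite gcoef_monom eqxx.
by rewrite /gcoef mcoeff0 => /eqP; rewrite oner_eq0.
Qed.

#[export]
HB.instance Definition _ := GRing.Zmodule_isComNzRing.Build (groupAlg F K)
  gmulA gmulC gmul1 gmulDl gone_neq0.

Lemma gscaleAl (c : F) (g h : groupAlg F K) : c *: (g * h) = (c *: g) * h.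
Proof.
have scE (a : F) (f : groupAlg F K) : a *: f = gmonom a 0 * f.
  rewrite [RHS](gmullw (gsupp_monom _ _) (fsubset_refl _)) big_seq_fset1.
  rewrite gcoef_monom eqxx [LHS]malgZ_def; apply: eq_bigr => k _.
  by rewrite add0r.
by rewrite !scE mulrA.
Qed.

#[export]
HB.instance Definition _ := GRing.Lmodule_isLalgebra.Build F (groupAlg F K)
  gscaleAl.

End Theory.

Module Exports. HB.reexport. End Exports.
End GroupAlgebra.
Export GroupAlgebra GroupAlgebra.Exports.

(* ------------------------------------------------------------------------ *)
(* A point of P(C^N) is represented by any nonzero vector on the line, and a
   closed subset by the set of nonzero vectors of its affine cone. *)
Section ProjectiveVarieties.
Context {R : realType} {N : nat}.
Local Notation C := R[i].
Implicit Types (f : {mpoly C[N]}) (v : 'cV[C]_N) (A Z : 'cV[C]_N -> Prop).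

Definition pteval f v : C := f.@[fun i => v i 0].

Definition proj_closed Z : Prop :=
  exists F : {mpoly C[N]} -> Prop,
    (forall f, F f -> exists k, f \is k.-homog for mdeg) /\
    (forall v, Z v <-> v != 0 /\ forall f, F f -> pteval f v = 0).

Definition proj_irreducible A : Prop :=
  (exists v, A v) /\
  forall Z1 Z2, proj_closed Z1 -> proj_closed Z2 ->
    (forall v, A v -> Z1 v \/ Z2 v) ->
    (forall v, A v -> Z1 v) \/ (forall v, A v -> Z2 v).

Definition proj_dense A Z : Prop :=
  forall Z', proj_closed Z' -> (forall v, A v -> Z' v) -> forall v, Z v -> Z' v.

End ProjectiveVarieties.

Record projVariety (R : realType) (N : nat) := ProjVariety {
  pv_pts :> 'cV[R[i]]_N -> Prop;
  pv_closed : proj_closed pv_pts;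
  pv_irreducible : proj_irreducible pv_pts
}.

Section CoordinateRing.
Context {R : realType} {N : nat} (X : projVariety R N).
Local Notation C := R[i].
Implicit Types (f g : {mpoly C[N]}) (v : 'cV[C]_N).

Definition vanishing : {pred {mpoly C[N]}} :=
  fun f => `[< forall v, X v -> pteval f v = 0 >].

Lemma vanishingP f : reflect (forall v, X v -> pteval f v = 0) (f \in vanishing).
Proof. exact: asboolP. Qed.

Fact vanishing_idealr : idealr_closed vanishing.
Proof.
split=> [||a f g /vanishingP f0 /vanishingP g0].
- by apply/vanishingP => v _; rewrite /pteval meval0.
- apply/negP => /vanishingP h; have [v Xv] := (pv_irreducible X).1.
  by have := h v Xv; rewrite /pteval meval1 => /eqP; rewrite oner_eq0.
- by apply/vanishingP => v Xv; rewrite /pteval mevalD mevalM [f.@[_]]f0 // [g.@[_]]g0 // mulr0 addr0.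
Qed.

HB.instance Definition _ := isIdealr.Build {mpoly C[N]} vanishing vanishing_idealr.

Lemma pv_nonzero v : X v -> v != 0.
Proof. by have [F [_ XF]] := pv_closed X; move/XF => []. Qed.

Lemma pteval_homog k f c v : f \is k.-homog for mdeg ->
  pteval f (c *: v) = c ^+ k * pteval f v.
Proof.
move=> /dhomogP fk; rewrite /pteval !mevalE mulr_sumr !big_seq.
apply: eq_bigr => m mf; rewrite mulrCA; congr (_ * _).
have -> : k = (\sum_i m i)%N by rewrite -mdegE; exact/esym/fk.
rewrite -prodrXr -big_split /=; apply: eq_bigr => i _.
by rewrite mxE exprMn.
Qed.

Lemma pv_scale c v : c != 0 -> X v -> X (c *: v).
Proof.
move=> c0; have [F [Fh XF]] := pv_closed X; rewrite !XF => -[v0 Fv].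
split=> [|f Ff]; first by rewrite scalemx_eq0 negb_or c0.
by have [k fk] := Fh f Ff; rewrite (pteval_homog _ _ fk) Fv // mulr0.
Qed.

Lemma vanishing_homog k f : f \in vanishing -> pihomog mdeg k f \in vanishing.
Proof.
move=> /vanishingP f0; apply/vanishingP => v Xv.
have mE := @pihomog_partitionE N _ mdeg _ f (leqnn _).
set d := mmeasure mdeg f in mE.
pose P : {poly C} := \poly_(j < d) pteval (pihomog mdeg j f) v.
have P0 (c : C) : c != 0 -> P.[c] = 0.
  move=> c0; rewrite horner_poly -[RHS](f0 _ (pv_scale c0 Xv)) [in RHS]mE.
  rewrite /pteval raddf_sum; apply: eq_bigr => j _.
  by rewrite mulrC -(pteval_homog _ _ (pihomogP mdeg j f)).
have P_eq0 : P = 0.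
  apply/eqP; apply/negPn/negP => nzP.
  pose s := [seq (j.+1)%:R : C | j <- iota 0 (size P)].
  have us : uniq s.
    rewrite map_inj_uniq ?iota_uniq // => a b /eqP.
    by rewrite eqr_nat => /eqP [].
  have rs : all (root P) s.
    by apply/allP => _ /mapP [j _ ->]; rewrite rootE P0 // pnatr_eq0.
  by have := max_poly_roots nzP rs us; rewrite size_map size_iota ltnn.
have [ltkd|ledk] := ltnP k d.
  have := coef_poly d (fun j => pteval (pihomog mdeg j f) v) k.
  by rewrite ltkd -/P P_eq0 coef0 => <-.
rewrite (_ : pihomog _ _ _ = 0) ?/pteval ?meval0 //.
rewrite pihomogE big_seq_cond big1 // => m /andP [mf /eqP mk].
by have := leq_trans (mmeasure_mnm_lt mdeg mf) ledk; rewrite mk ltnn.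
Qed.

(* The homogeneous pieces of smallest degree outside the ideal reduce primality
   to homogeneous polynomials. *)
Lemma nonvanishing_lowest f : f \notin vanishing ->
  exists k, pihomog mdeg k f \notin vanishing /\
    forall j, (j < k)%N -> pihomog mdeg j f \in vanishing.
Proof.
move=> fn; have ex : exists k, pihomog mdeg k f \notin vanishing.
  apply: contrapT => /forallNP h; move/negP: fn; apply.
  rewrite (@pihomog_partitionE N _ mdeg _ f (leqnn _)) rpred_sum // => k _.
  by apply/negPn/negP/h.
exists (ex_minn ex); case: ex_minnP => k fk kmin; split=> // j.
by apply: contraTT => /kmin; rewrite -leqNgt.
Qed.

Lemma pihomogM_vanishing k l f g :
  (forall j, (j < k)%N -> pihomog mdeg j f \in vanishing) ->
  (forall j, (j < l)%N -> pihomog mdeg j g \in vanishing) ->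
  f * g \in vanishing -> pihomog mdeg k f * pihomog mdeg l g \in vanishing.
Proof.
move=> fk gl /(vanishing_homog (k + l)).
set F := fun i => pihomog mdeg i f; set G := fun i => pihomog mdeg i g.
have [nf fE] : exists nf, (k < nf)%N /\ f = \sum_(i < nf) F i.
  exists (maxn k.+1 (mmeasure mdeg f)); split; first by rewrite leq_maxl.
  by apply: pihomog_partitionE; rewrite leq_maxr.
have [ng gE] : exists ng, (l < ng)%N /\ g = \sum_(i < ng) G i.
  exists (maxn l.+1 (mmeasure mdeg g)); split; first by rewrite leq_maxl.
  by apply: pihomog_partitionE; rewrite leq_maxr.
case: fE gE => knf fE [lng gE].
rewrite {1}fE {1}gE mulr_suml raddf_sum /=.
have homFG i j : F i * G j \is (i + j).-homog for mdeg.
  by apply: dhomogM; apply: pihomogP.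
rewrite (bigD1 (Ordinal knf)) //= mulr_sumr raddf_sum (bigD1 (Ordinal lng)) //=.
rewrite (pihomog_dE (homFG k l)) -addrA rpredDr //.
have zero i j : (i < k)%N || (j < l)%N || (i + j != k + l)%N ->
    pihomog mdeg (k + l) (F i * G j) \in vanishing.
  case/orP => [/orP [ik|jl]|ne].
  - by apply: vanishing_homog; rewrite mulrC idealMr // fk.
  - by apply: vanishing_homog; rewrite idealMr // gl.
  - by rewrite (pihomog_ne0 ne (homFG i j)) rpred0.
apply: rpredD.
  apply: rpred_sum => j; rewrite -val_eqE /= => jl; apply: zero.
  by rewrite eqn_add2l jl orbT.
apply: rpred_sum => i; rewrite -val_eqE /= => ik.
rewrite mulr_sumr raddf_sum; apply: rpred_sum => j _; apply: zero.
case: (ltnP i k) => //= ki; case: (ltnP j l) => //= lj.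
apply: contra ik => /eqP e; rewrite eqn_leq ki andbT.
by rewrite -(leq_add2r l) -e leq_add2l.
Qed.

Fact vanishing_prime : prime_idealr_closed vanishing.
Proof.
move=> f g fg; apply/negPn/negP; rewrite negb_or => /andP [fn gn].
have [k [fk fmin]] := nonvanishing_lowest fn.
have [l [gl gmin]] := nonvanishing_lowest gn.
have /vanishingP h := pihomogM_vanishing fmin gmin fg.
have [F [Fh XF]] := pv_closed X.
pose Z p v := v != 0 /\ forall q, F q \/ q = p -> pteval q v = 0.
have Zc j p : proj_closed (Z (pihomog mdeg j p)).
  exists (fun q => F q \/ q = pihomog mdeg j p); split=> // q [/Fh //|->].
  by exists j; apply: pihomogP.
have Zv p : p \notin vanishing -> ~ forall v, X v -> Z p v.
  move=> /negP pn XZ; apply: pn; apply/vanishingP => v /XZ [_]; apply.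
  by right.
have XZ p v : X v -> pteval p v = 0 -> Z p v.
  by move=> /XF [v0 Fv] pv; split=> // q [/Fv|->].
have [|/(Zv _ fk)|/(Zv _ gl)] // := (pv_irreducible X).2 _ _ (Zc k f) (Zc l g).
move=> v Xv; have := h v Xv; rewrite /pteval mevalM => /eqP.
by rewrite mulf_eq0 => /orP [] /eqP; [left|right]; apply: XZ.
Qed.

HB.instance Definition _ :=
  isPrimeIdealrClosed.Build {mpoly C[N]} vanishing vanishing_prime.

(* The homogeneous coordinate ring R = C[z_1, ..., z_N] / I(X). *)
Definition coordRing : Type := {ideal_quot vanishing}.
HB.instance Definition _ := GRing.ComNzRing.on coordRing.
HB.instance Definition _ := EqQuotient.on coordRing.

Definition proj_coord (f : {mpoly C[N]}) : coordRing := \pi_(coordRing) f.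

Fact proj_coord_zmod : zmod_morphism proj_coord.
Proof. exact: raddfB. Qed.
Fact proj_coord_monoid : monoid_morphism proj_coord.
Proof. by split; [exact: rmorph1 | exact: rmorphM]. Qed.
HB.instance Definition _ :=
  GRing.isZmodMorphism.Build {mpoly C[N]} coordRing proj_coord proj_coord_zmod.
HB.instance Definition _ :=
  GRing.isMonoidMorphism.Build {mpoly C[N]} coordRing proj_coord proj_coord_monoid.

Lemma proj_coord_eq0 f : (proj_coord f == 0) = (f \in vanishing).
Proof. by rewrite -[f in RHS]subr0 Quotient.idealrBE -(rmorph0 proj_coord). Qed.

Definition cscale (c : C) (x : coordRing) : coordRing := proj_coord c%:MP * x.

Fact cscaleA a b x : cscale a (cscale b x) = cscale (a * b) x.
Proof. by rewrite /cscale mulrA -rmorphM /= -mpolyCM. Qed.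
Fact cscale1 : left_id 1 cscale.
Proof. by move=> x; rewrite /cscale mpolyC1 rmorph1 mul1r. Qed.
Fact cscaleDr : right_distributive cscale +%R.
Proof. by move=> c x y; rewrite /cscale mulrDr. Qed.
Fact cscaleDl x : {morph cscale^~ x : a b / a + b}.
Proof. by move=> a b; rewrite /cscale mpolyCD rmorphD mulrDl. Qed.
HB.instance Definition _ := GRing.Zmodule_isLmodule.Build C coordRing
  cscaleA cscale1 cscaleDr cscaleDl.
Fact cscaleAl (c : C) (x y : coordRing) : c *: (x * y) = (c *: x) * y.
Proof. exact: mulrA. Qed.
HB.instance Definition _ := GRing.Lmodule_isLalgebra.Build C coordRing cscaleAl.

Definition cunit : {pred coordRing} := fun x => `[< exists y, y * x = 1 >].
Definition cinv (x : coordRing) : coordRing :=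
  if pselect (exists y, y * x = 1) is left h then projT1 (cid h) else x.
Fact cmulV : {in cunit, left_inverse 1 cinv *%R}.
Proof.
move=> x /asboolP h; rewrite /cinv; case: pselect => // h'.
by case: (cid h').
Qed.
Fact cunitP (x y : coordRing) : y * x = 1 -> x \in cunit.
Proof. by move=> xy; apply/asboolP; exists y. Qed.
Fact cinv_out : {in [predC cunit], cinv =1 id}.
Proof.
move=> x /negP xn; rewrite /cinv; case: pselect => // h.
by case: xn; apply/asboolP.
Qed.
HB.instance Definition _ :=
  GRing.ComNzRing_hasMulInverse.Build coordRing cmulV cunitP cinv_out.
HB.instance Definition _ := GRing.ComUnitRing_isIntegral.Build coordRing
  (@Quotient.rquot_IdomainAxiom _ vanishing).

End CoordinateRing.

Arguments vanishing {R N} X.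
Arguments coordRing {R N} X.
Arguments proj_coord {R N} X f.

(* X is normal: every local ring O_{X,v} is integrally closed in the function
   field C(X), the field of degree 0 homogeneous fractions. *)
Section Normality.
Context {R : realType} {N : nat} (X : projVariety R N).
Local Notation C := R[i].
Local Notation K := {fraction coordRing X}.

Definition frac_of (p q : {mpoly C[N]}) : K :=
  tofrac (proj_coord X p) / tofrac (proj_coord X q).

Definition function_field (u : K) : Prop :=
  exists k (p q : {mpoly C[N]}), p \is k.-homog for mdeg /\
    q \is k.-homog for mdeg /\ q \notin vanishing X /\ u = frac_of p q.

Definition local_ring (v : 'cV[C]_N) (u : K) : Prop :=
  exists k (p q : {mpoly C[N]}), p \is k.-homog for mdeg /\
    q \is k.-homog for mdeg /\ pteval q v != 0 /\ u = frac_of p q.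

Definition integral_over (A : K -> Prop) (u : K) : Prop :=
  exists P : {poly K}, P \is monic /\ (forall i, A P`_i) /\ root P u.

Definition normal_variety : Prop :=
  forall v, X v -> forall u, function_field u ->
    integral_over (local_ring v) u -> local_ring v u.

End Normality.

(* ------------------------------------------------------------------------ *)
Section SymplecticGroup.
Context {R : realType} {n : nat}.
Local Notation C := R[i].
Local Notation M := 'M[C]_(n + n).
Implicit Types (g h : M) (H K : M -> Prop).

Definition symp_form : M :=
  \matrix_(i, j) (if (i + j).+1 == (n + n)%N
                  then if (i < n)%N then 1 else -1 else 0).

Definition Sp g : Prop := g^T *m symp_form *m g = symp_form.

Definition mxeval (f : {mpoly C[(n + n) * (n + n)]}) g : C :=
  f.@[fun k => mxvec g 0 k].

Definition Sp_closed H : Prop :=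
  exists F : {mpoly C[(n + n) * (n + n)]} -> Prop,
    forall g, H g <-> Sp g /\ forall f, F f -> mxeval f g = 0.

Definition Sp_subgroup H : Prop :=
  (forall g, H g -> Sp g) /\ H 1%:M /\
  (forall g h, H g -> H h -> H (g *m h)) /\ (forall g, H g -> H (invmx g)).

Definition connected H : Prop :=
  ~ exists H1 H2, Sp_closed H1 /\ Sp_closed H2 /\
      (exists g, H1 g) /\ (exists g, H2 g) /\
      (forall g, ~ (H1 g /\ H2 g)) /\ (forall g, H g <-> H1 g \/ H2 g).

(* the subgroup generated by the commutators *)
Definition derived H : M -> Prop := fun x =>
  forall K, Sp_subgroup K ->
    (forall g h, H g -> H h -> K (invmx g *m invmx h *m g *m h)) -> K x.

Definition solvable H : Prop :=
  exists k, forall g, iter k derived H g -> g = 1%:M.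

Definition conn_solvable H : Prop :=
  Sp_subgroup H /\ Sp_closed H /\ connected H /\ solvable H.

Definition borel H : Prop :=
  conn_solvable H /\
  forall K, conn_solvable K -> (forall g, H g -> K g) -> forall g, K g -> H g.

Definition unipotent_subgroup H : Prop :=
  Sp_subgroup H /\ Sp_closed H /\
  forall g, H g -> exists k, iter k (mulmx (g - 1%:M)) 1%:M = 0.

Definition maximal_unipotent H : Prop :=
  unipotent_subgroup H /\
  forall K, unipotent_subgroup K -> (forall g, H g -> K g) ->
    forall g, K g -> H g.

Definition torus g : Prop := Sp g /\ is_diag_mx g.

Definition U_plus g : Prop :=
  Sp g /\ forall i j : 'I_(n + n), (j <= i)%N -> g i j = (i == j)%:R.

Definition torus_char (lam : 'rV[int]_n) g : C :=
  \prod_(i < n) g (lshift n i) (lshift n i) ^ lam 0 i.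

End SymplecticGroup.

(* A rational representation on C^N; [rep] is only relevant on Sp.  As
   det = 1 on Sp, its regular functions are the polynomials in the entries. *)
Record spModule (R : realType) (n N : nat) := SpModule {
  rep :> 'M[R[i]]_(n + n) -> 'M[R[i]]_N;
  rep1 : rep 1%:M = 1%:M;
  repM : forall g h, Sp g -> Sp h -> rep (g *m h) = rep g *m rep h;
  rep_regular : exists P : 'I_N -> 'I_N -> {mpoly R[i][(n + n) * (n + n)]},
    forall g, Sp g -> forall i j, rep g i j = mxeval (P i j) g
}.

Section SphericalVarieties.
Context {R : realType} {n N : nat} (rho : spModule R n N) (X : projVariety R N).
Local Notation C := R[i].
Local Notation M := 'M[C]_(n + n).

Definition G_stable : Prop := forall g v, Sp g -> X v -> X (rho g *m v).

Definition orbit (H : M -> Prop) (x : 'cV[C]_N) : 'cV[C]_N -> Prop :=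
  fun v => exists g c, H g /\ c != 0 /\ v = c *: (rho g *m x).

Definition spherical : Prop :=
  normal_variety X /\
  exists B x, borel B /\ X x /\ proj_dense (orbit B x) X.

Definition stabilizer (x : 'cV[C]_N) (g : M) : Prop :=
  Sp g /\ exists c : C, c != 0 /\ rho g *m x = c *: x.

Definition horospherical : Prop :=
  spherical /\
  exists x, X x /\ proj_dense (orbit Sp x) X /\
    exists U, maximal_unipotent U /\ forall g, U g -> stabilizer x g.

(* ------------------------------------------------------------------------ *)
Definition linsubst (A : 'M[C]_N) (f : {mpoly C[N]}) : {mpoly C[N]} :=
  f \mPo [tuple \sum_j A i j *: 'X_j | i < N].

(* (g . f)(v) = f (g^-1 v); independent of the representative of f when X is
   G-stable. *)
Definition gact (g : M) (f : coordRing X) : coordRing X :=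
  proj_coord X (linsubst (rho (invmx g)) (repr f)).

Definition graded_piece (k : nat) (f : coordRing X) : Prop :=
  exists p, p \is k.-homog for mdeg /\ f = proj_coord X p.

Definition submodule (W : coordRing X -> Prop) : Prop :=
  W 0 /\ (forall f g, W f -> W g -> W (f + g)) /\
  (forall c f, W f -> W (c *: f)) /\ (forall g f, Sp g -> W f -> W (gact g f)).

Definition irreducible_submodule (W : coordRing X -> Prop) : Prop :=
  submodule W /\ (exists f, W f /\ f != 0) /\
  forall W', submodule W' -> (forall f, W' f -> W f) ->
    (forall f, W' f -> f = 0) \/ (forall f, W f -> W' f).

(* W is isomorphic to V_lam, i.e. irreducible with a highest weight vector of
   weight lam *)
Definition is_V (lam : 'rV[int]_n) (W : coordRing X -> Prop) : Prop :=
  irreducible_submodule W /\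
  exists w, W w /\ w != 0 /\ (forall u, U_plus u -> gact u w = w) /\
    (forall t, torus t -> gact t w = torus_char lam t *: w).

Definition V_in (lam : 'rV[int]_n) (k : nat) (W : coordRing X -> Prop) : Prop :=
  is_V lam W /\ forall f, W f -> graded_piece k f.

End SphericalVarieties.

Section MomentPolytope.
Import classical_sets topology numFieldTopology.Exports.
Context {R : realType} {n N : nat} (rho : spModule R n N) (X : projVariety R N).

(* The moment polytope, as the closure of the normalized highest weights. *)
Definition appears (mu : 'rV[int]_n) (k : nat) : Prop :=
  exists W : coordRing X -> Prop, V_in rho mu k W.

Definition moment_polytope : 'rV[R]_n -> Prop :=
  let E : set 'rV[R]_n := fun x => exists k mu,
    (0 < k)%N /\ appears mu k /\ x = k%:R^-1 *: map_mx intr mu in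
  closure E.

End MomentPolytope.

Section BrionLattice.
Context {R : realType} {n N : nat} (rho : spModule R n N) (X : projVariety R N).
Implicit Types (Lam : 'rV[int]_n -> Prop).

Definition real_span Lam (x : 'rV[R]_n) : Prop :=
  exists m (A : 'M[int]_(m, n)) (c : 'rV[R]_m),
    (forall i, Lam (row i A)) /\ x = c *m map_mx intr A.

Definition weights_in Lam (k : nat) (lam : 'rV[int]_n) : Prop :=
  Lam lam /\
  exists x : 'rV[R]_n, moment_polytope rho X x /\ map_mx intr lam = k%:R *: x.

(* R_k is the internal direct sum of submodules V_lam, one for each lam in
   k Phi(X) /\ Lam; the (finite) set of these weights is enumerated by s. *)
Definition brion_lattice Lam : Prop :=
  Lam 0 /\ (forall a b, Lam a -> Lam b -> Lam (a - b)) /\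
  (forall x, moment_polytope rho X x -> real_span Lam x) /\
  forall k, exists (s : seq 'rV[int]_n) (W : 'rV[int]_n -> coordRing X -> Prop),
    uniq s /\ (forall lam, lam \in s <-> weights_in Lam k lam) /\
    (forall lam, lam \in s -> V_in rho lam k (W lam)) /\
    (forall f, graded_piece k f -> exists w : 'rV[int]_n -> coordRing X,
       (forall lam, lam \in s -> W lam (w lam)) /\ f = \sum_(lam <- s) w lam) /\
    (forall w : 'rV[int]_n -> coordRing X,
       (forall lam, lam \in s -> W lam (w lam)) ->
       \sum_(lam <- s) w lam = 0 -> forall lam, lam \in s -> w lam = 0).

(* the rows of e form a basis of Lam *)
Definition lattice_basis Lam r (e : 'M[int]_(r, n)) : Prop :=
  forall lam, Lam lam <-> exists! a : 'rV[int]_r, lam = a *m e.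

End BrionLattice.

(* ------------------------------------------------------------------------ *)
(* The index pairs (i, j), 1-based as in the definition of the p_ij. *)
Definition xvar (n : nat) : Type :=
  {ij : 'I_(n + n).+1 * 'I_(n + n).+1 |
    [&& 0 < ij.1, ij.1 < ij.2 & ij.1 + ij.2 <= (n + n).+1]%N}.
HB.instance Definition _ n := Finite.on (xvar n).

Definition xrow n (k : xvar n) : nat := (val k).1.
Definition xcol n (k : xvar n) : nat := (val k).2.

Lemma card_xvar n : #|{: xvar n}| = (n ^ 2)%N.
Proof.
set M := (n + n).+1.
have inner i : (0 < i < M)%N ->
    (\sum_(j < M | (i < j) && (i + j <= M)) 1 = M - i.*2)%N.
  move=> /andP [i0 iM].
  rewrite -(big_mkord (fun j => (i < j) && (i + j <= M))%N (fun=> 1%N)).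
  transitivity (\sum_(i.+1 <= j < (M - i).+1) 1)%N; last first.
    by rewrite sum_nat_const_nat; lia.
  rewrite [RHS](@big_nat_widen _ _ _ _ (M - i).+1 M); last by lia.
  rewrite [RHS](@big_nat_widenl _ _ _ i.+1 0) //; apply: eq_bigl => j /=.
  by apply/idP/idP; lia.
rewrite card_sig -sum1_card.
rewrite -(pair_big_dep predT (fun i j : 'I_M => [&& 0 < i, i < j & i + j <= M])%N (fun _ _ => 1%N)) /=.
transitivity (\sum_(i < M) (if 0 < i then M - i.*2 else 0))%N.
  apply: eq_bigr => i _; case: ifP => [i0|_]; last by rewrite big_pred0.
  by rewrite -inner ?i0 //=.
transitivity (\sum_(0 <= i < n.+1) (if 0 < i then M - i.*2 else 0))%N.
  rewrite -(big_mkord predT (fun i => (if 0 < i then M - i.*2 else 0)%N)).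
  rewrite (@big_cat_nat _ _ _ n.+1) //=; last by rewrite /M; lia.
  rewrite [X in (_ + X)%N](_ : _ = 0%N) ?addn0 //.
  rewrite big_nat_cond big1 // => i; rewrite andbT /M => h.
  by case: ifP => //; lia.
rewrite big_nat_recl //= add0n.
have E k : (k <= n)%N -> (\sum_(0 <= i < k) (M - i.+1.*2) + (n - k) ^ 2 = n ^ 2)%N.
  elim: k => [|k IH] kn; first by rewrite big_nil subn0.
  rewrite big_nat_recr //= -IH; last exact: ltnW.
  rewrite -addnA; congr (_ + _)%N.
  rewrite (_ : n - k = (n - k.+1).+1)%N; last lia.
  rewrite -[(n - k.+1).+1]addn1 sqrnD /M; lia.
by have := E n (leqnn n); rewrite subnn addn0.
Qed.

Section GelfandCetlin.
Context {R : realType} {n : nat}.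
Implicit Types (lam : 'rV[R]_n) (p : {ffun xvar n -> R}) (eta theta : nat -> nat -> R).

(* 1-based coordinates, 0 outside the range *)
Definition wcoord lam (i : nat) : R :=
  if insub i.-1 is Some j then lam 0 j else 0.

Definition pcoord p (i j : nat) : R :=
  if [pick k | (xrow k == i) && (xcol k == j)] is Some k then p k else 0.

(* theta^(0) = lam, and theta^(m)_i is read as 0 for i > n - m *)
Definition gc_theta lam theta (m i : nat) : R :=
  if m == 0%N then wcoord lam i else if (i <= n - m)%N then theta m i else 0.

Definition gelfand_cetlin lam eta theta : Prop :=
  let th := gc_theta lam theta in
  (forall m i, (1 <= m <= n)%N -> (1 <= i <= n - m + 1)%N ->
     th m.-1 i >= eta m i /\ eta m i >= th m.-1 i.+1) /\
  (forall m i, (1 <= m <= n - 1)%N -> (1 <= i <= n - m)%N ->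
     eta m i >= theta m i /\ theta m i >= eta m i.+1).

Definition eta_step p (th : nat -> R) (m i : nat) : R :=
  th i - pcoord p m (2 * n + 2 - m - i).

Fixpoint p_theta lam p (m : nat) : nat -> R :=
  if m is m'.+1 then
    fun i => eta_step p (p_theta lam p m') m i.+1 + pcoord p m (i + m)
  else wcoord lam.

Definition p_eta lam p (m : nat) : nat -> R := eta_step p (p_theta lam p m.-1) m.

(* p lies in Delta'_lam *)
Definition delta'_weight lam p : Prop := gelfand_cetlin lam (p_eta lam p) (p_theta lam p).

End GelfandCetlin.

(* ------------------------------------------------------------------------ *)
(* Exponent vectors ((x, y), t) in Z^(d + r + 1). *)
Definition expo (n r : nat) : zmodType :=
  ({ffun xvar n -> int} * 'rV[int]_r * int)%type.

Section TermOrder.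
Context {n r : nat}.
Implicit Types (u v : expo n r).

Definition xprec (k l : xvar n) : Prop :=
  (xrow k < xrow l)%N \/ (xrow k = xrow l /\ (xcol k > xcol l)%N).

(* x^p is smaller than x^q when p has the larger exponent at the first pair
   where they differ. *)
Definition xlt (p q : {ffun xvar n -> int}) : Prop :=
  exists k, (q k < p k)%R /\ forall l, xprec l k -> p l = q l.

Definition ylt (a b : 'rV[int]_r) : Prop :=
  exists i, (a 0 i < b 0 i)%R /\ forall j : 'I_r, (i < j)%N -> a 0 j = b 0 j.

Definition term_lt u v : Prop :=
  (u.2 < v.2)%R \/
  (u.2 = v.2 /\ (ylt u.1.2 v.1.2 \/ (u.1.2 = v.1.2 /\ xlt u.1.1 v.1.1))).

End TermOrder.

Section Sagbi.
Context {F : comNzRingType} {n r : nat}.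
Local Notation L := (groupAlg F (expo n r)).
Implicit Types (f g : L) (A : L -> Prop).

(* f lies in F[x_1, ..., x_d, y_1^+-1, ..., y_r^+-1, t] *)
Definition in_Fxyt f : Prop :=
  forall u : expo n r, u \in gsupp f -> (forall k, (0 <= u.1.1 k)%R) /\ (0 <= u.2)%R.

(* u = in(f); in particular f <> 0 *)
Definition is_init f (u : expo n r) : Prop :=
  u \in gsupp f /\ forall v : expo n r, v \in gsupp f -> v != u -> term_lt v u.

Definition init_semigroup A (u : expo n r) : Prop := exists f, A f /\ is_init f u.

Definition subduction_step s (f : 'I_s -> L) (m : 'I_s -> expo n r) g g' : Prop :=
  exists (d : 'I_s -> nat) (c : F),
    let u := \sum_i m i *+ d i in
    let h := c *: \prod_i f i ^+ d i in
    is_init g u /\ is_init h u /\ gcoef g u = gcoef h u /\ g' = g - h.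

Definition sagbi_basis A s (f : 'I_s -> L) : Prop :=
  (forall i, A (f i)) /\
  exists m : 'I_s -> expo n r,
    (forall i, is_init (f i) (m i)) /\
    (forall u, init_semigroup A u <-> exists d : 'I_s -> nat, u = \sum_i m i *+ d i) /\
    (forall g, A g -> ~ exists h : nat -> L,
       h 0%N = g /\ forall k, subduction_step f m (h k) (h k.+1)).

End Sagbi.

Section DeltaPrime.
Context {R : realType} {n N : nat} (rho : spModule R n N) (X : projVariety R N).
Context {r : nat} (e : 'M[int]_(r, n)).

(* Delta'(X), with the weight written in the coordinates of the basis e *)
Definition delta' (p : {ffun xvar n -> R}) (a : 'rV[R]_r) : Prop :=
  moment_polytope rho X (a *m map_mx intr e) /\
  delta'_weight (a *m map_mx intr e) p.

(* u is an integral point of (k Delta'(X), k) *)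
Definition cone_slice (k : nat) (u : expo n r) : Prop :=
  u.2 = k%:Z /\
  exists p a, delta' p a /\ (forall x, (u.1.1 x)%:~R = k%:R * p x) /\
    map_mx intr u.1.2 = k%:R *: a.

End DeltaPrime.

(* Main.v *)
(** By Kolchin and the maximality of the unipotent group in the definition of a
    horospherical variety, X contains a point x0 with dense Sp-orbit fixed by the
    lower unitriangular subgroup U_-.  A highest weight vector w of V_lam in R_k
    becomes on the big cell a multiple of the product of the trailing minors of size i
    to the power lam_i - lam_(i+1), hence everywhere on Sp, and V_lam becomes
    the span of the left translates of this product.  Psi f is the Laurent
    polynomial f(c u(x) h(t)^-1 x0), where u(x) parametrizes U_+, h(t) is in the
    torus and a weight lam in Lambda' is turned into the exponent of y through the
    basis e.

    Upper bound for initial terms: multiplying by a simple root subgroup on the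
    right has degree at most lam_i - lam_(i+1), and stripping the variables in the
    term order turns this degree bound into the inequalities of Delta'_lam.
    Lower bound: integral points of Delta'_lam split into patterns of fundamental
    weights, each of which is the exponent of the lowest term of a minor of u(x);
    all products of minors lie in the span of the translates, because the function
    (g0, g) |-> trailing minor of g0^* g is, by Cauchy-Binet, the Gram kernel of the
    minors.

    Since R is generated in degree one, every weight of R_k is a sum of k weights of
    R_1, so the initial terms of degree one generate, and subduction terminates
    because every degree has finitely many initial terms. *)

Require Import Defs.
From HB Require Import structures.
From mathcomp Require Import fingroup perm all_boot all_order all_algebra.
From mathcomp Require Import finmap zify ring lra boolp reals complex mpoly.
From mathcomp Require monalg.

Set Implicit Arguments.
Unset Strict Implicit.
Unset Printing Implicit Defensive.

Import Order.TTheory GRing.Theory Num.Theory.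
Local Open Scope ring_scope.

(** * Stripping variables from polynomials *)

(** The choice of coordinates shapes the proof. U_+ of Sp(2n + 2) is the product of U_+ of Sp(2n),
    placed in the middle block, and a Heisenberg group; row m of the variables is the first row of
    the m-th Heisenberg factor. In these coordinates right multiplication by a simple root element
    is a flow x + s * delta x that moves at most two entries of a row, each by its left neighbour up
    to sign (or, once, by 1), and this neighbour is the very next variable of the term order. If z1
    moves by s z2 and the degree in s is at most M, stripping the lowest powers z1^p z2^q gives p <=
    M and leaves the bound M - p + q. These running bounds are the differences of consecutive theta
    or eta coordinates, so the conditions p <= M are the interlacing inequalities, and no dimension
    count is needed. Conversely V_lam must contain enough functions: positivity of a Hermitian
    kernel on Sp replaces standard monomial theory, because it makes the translates of one function
    span all the features of the kernel. *)

Section PolynomialFunctions.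
Variable F : numFieldType.

(** The integers below [size s + size p] are distinct in characteristic 0 and at most [size s] of
    them lie in [s], so at least [size p] roots remain. *)
Lemma poly_fun_eq0 (p : {poly F}) (s : seq F) :
  (forall x, x \notin s -> p.[x] = 0) -> p = 0.
Proof.
move=> p0; apply/eqP; apply/negPn/negP => nzp.
pose t := [seq x <- [seq (j%:R : F) | j <- iota 0 (size s + size p)%N] | x \notin s].
have ut : uniq t.
  rewrite filter_uniq // map_inj_uniq ?iota_uniq // => a b /eqP.
  by rewrite eqr_nat => /eqP.
have rt : all (root p) t.
  by apply/allP => x; rewrite mem_filter => /andP [xs _]; rewrite rootE p0.
have := max_poly_roots nzp rt ut.
suff : (size p <= size t)%N by move=> h1 h2; have := leq_trans h2 h1; rewrite ltnn.
set u := [seq (j%:R : F) | j <- iota 0 (size s + size p)%N] in t ut rt *.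
have uu : uniq u.
  rewrite map_inj_uniq ?iota_uniq // => a b /eqP.
  by rewrite eqr_nat => /eqP.
have : (size [seq x <- u | x \in s] <= size s)%N.
  apply: uniq_leq_size; first exact: filter_uniq.
  by move=> x; rewrite mem_filter => /andP [].
have := count_predC (mem s) u; rewrite -!size_filter /= -/t.
have -> : size u = (size s + size p)%N by rewrite size_map size_iota.
have -> : size [seq x <- u | predC (mem s) x] = size t by [].
have -> : size [seq x <- u | mem s x] = size [seq x <- u | x \in s] by [].
by move=> e h; rewrite -(leq_add2l (size s)) -e leq_add2r.
Qed.

(** For fixed j >= M the j-th coefficients of the [K a] are the coefficients of a polynomial in z
    that vanishes off [s]. *)
Lemma size_coef_family (L M : nat) (K : nat -> {poly F}) (s : seq F) :
  (forall z, z \notin s -> (size (\sum_(a < L) z ^+ a *: K a)%R <= M)%N) ->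
  forall a, (a < L)%N -> (size (K a) <= M)%N.
Proof.
move=> h a aL; apply/leq_sizeP => j Mj.
pose p := \poly_(i < L) (K i)`_j.
have p0 : p = 0.
  apply: (@poly_fun_eq0 _ s) => z zs; rewrite horner_poly.
  have /leq_sizeP/(_ j Mj) := h z zs; rewrite coef_sum => e; rewrite -[RHS]e.
  by apply: eq_bigr => i _; rewrite coefZ mulrC.
by have := coef_poly L (fun i => (K i)`_j) a; rewrite aL -/p p0 coef0.
Qed.

Lemma size_addX_exp_mul (z : F) (p m : nat) (h : {poly F}) :
  (size ((z%:P + 'X) ^+ p * h)%R <= m.+1)%N ->
  (size h <= m.+1 - p)%N /\ (h != 0 -> (p <= m)%N).
Proof.
have mX : (z%:P + 'X) ^+ p \is monic.
  by rewrite addrC -[z]opprK polyCN; apply: monic_exp; apply: monicXsubC.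
have sX : size ((z%:P + 'X) ^+ p) = p.+1.
  by rewrite addrC -[z]opprK polyCN size_exp_XsubC.
have [->|h0] := eqVneq h 0; first by rewrite size_poly0.
rewrite size_monicM // sX; have := h0; rewrite -size_poly_gt0; lia.
Qed.

(* The sl_2-argument behind the interlacing inequalities: on
   the coefficient of [z2^(p+q)] after the substitution [z1 = a z2] the flow is
   a shift of [a], and [a = - s] isolates [K p q]. *)
Lemma pair_bound (L m p q : nat) (K : nat -> nat -> {poly F}) :
  (p < L)%N -> (q < L)%N ->
  (forall z1 z2, (size (\sum_(a < L) \sum_(b < L)
      ((z1%:P + z2 *: 'X) ^+ a * (z2 ^+ b *: K a b)))%R <= m.+1)%N) ->
  (forall a b, (a < p)%N -> K a b = 0) -> (forall b, (b < q)%N -> K p b = 0) ->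
  K p q != 0 -> (p <= m)%N /\ (size (K p q) <= (m - p + q).+1)%N.
Proof.
move=> pL qL Hdeg Ka Kb Knz.
pose G N z : {poly F} := \sum_(a < L) \sum_(b < L | (a + b == N)%N) ((z%:P + 'X) ^+ a * K a b).
have G_deg z : (size (G (p + q)%N z) <= m.+1)%N.
  apply: (@size_coef_family (L + L) m.+1 (G^~ z) [::]); last by lia.
  move=> y _; apply: leq_trans (Hdeg (y * z) y); rewrite leq_eqVlt; apply/orP; left; apply/eqP.
  congr (size (polyseq _)); rewrite /G.
  transitivity (\sum_(i < L + L) \sum_(a < L) y ^+ i *: \sum_(b < L | (a + b == i)%N) ((z%:P + 'X) ^+ a * K a b)).
    by apply: eq_bigr => i _; rewrite scaler_sumr.
  rewrite exchange_big; apply: eq_bigr => a _ /=.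
  transitivity (\sum_(i < L + L) \sum_(b < L | (a + b == i)%N) y ^+ i *: ((z%:P + 'X) ^+ a * K a b)).
    by apply: eq_bigr => i _; rewrite scaler_sumr.
  rewrite (exchange_big_dep predT) //=; apply: eq_bigr => b _.
  have ab : (a + b < L + L)%N by have := ltn_ord a; have := ltn_ord b; lia.
  rewrite (big_pred1 (Ordinal ab)) /=; last first.
    by move=> i /=; apply/eqP/eqP => [e|->] //; apply: val_inj; rewrite /= e.
  have -> : (y * z)%:P + y *: 'X = y *: (z%:P + 'X) :> {poly F}.
    by rewrite scalerDr polyCM mul_polyC.
  by rewrite exprZn -scalerAl -scalerAr scalerA exprD.
(* By [Ka] the terms with a < p vanish, so (z + s)^p divides [G (p + q) z]. [H] is the quotient with
   z made an outer variable, the inner one being the flow parameter s; the constraint a + b = p + q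
   keeps the outer degree at most q. Its coefficients have degree at most m - p, and the
   substitution z = - s adds at most q. *)
pose H : {poly {poly F}} :=
  \sum_(a < L) \sum_(b < L | (a + b == p + q)%N) ('X + 'X%:P) ^+ (a - p) * (K a b)%:P.
have G_H z : G (p + q)%N z = (z%:P + 'X) ^+ p * H.[z%:P].
  rewrite /H horner_sum mulr_sumr; apply: eq_bigr => a _.
  rewrite horner_sum mulr_sumr; apply: eq_bigr => b _. rewrite !hornerE /=.
  have [pa|ap] := leqP p a; last by rewrite Ka ?mulr0.
  by rewrite -{1}(subnKC pa) exprD ?[z%:P + _]addrC.
have sH : (size H <= q.+1)%N.
  apply: (leq_trans (size_sum _ _ _)); apply/bigmax_leqP => a _.
  apply: (leq_trans (size_sum _ _ _)); apply/bigmax_leqP => b /eqP ab.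
  apply: (leq_trans (size_polyMleq _ _)).
  have : (size ((('X : {poly {poly F}}) + 'X%:P) ^+ (a - p))%R <= (a - p).+1)%N.
    by rewrite -[X in _ + X]opprK -polyCN size_exp_XsubC.
  have aux (u v w : nat) : (u <= w.+1 -> v <= 1 -> w <= q -> (u + v).-1 <= q.+1)%N by lia.
  by move=> h; apply: aux h (size_polyC_leq1 _) _; lia.
have HN : H.[- 'X] = K p q.
  rewrite /H horner_sum (bigD1 (Ordinal pL)) //= horner_sum (big_pred1 (Ordinal qL)) /=; last first.
    move=> b /=; rewrite eqn_add2l; apply/eqP/eqP => [e|-> //].
    by apply: val_inj; rewrite /= e.
  rewrite !hornerE subnn expr0 mul1r big1 ?addr0 // => a ap.
  rewrite horner_sum big1 // => b _; rewrite !hornerE.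
  have [ltpa|leap] := ltnP p a; first by rewrite addNr expr0n subn_eq0 leqNgt ltpa mul0r.
  by rewrite Ka ?mulr0 // ltn_neqAle leap andbT.
have Hcoef z : H.[z%:P] = \sum_(i < q.+1) z ^+ i *: H`_i.
  rewrite (horner_coef_wide _ sH); apply: eq_bigr => i _.
  by rewrite -polyC_exp mulrC mul_polyC.
have Hz z : (size H.[z%:P] <= m.+1 - p)%N /\ (H.[z%:P] != 0 -> (p <= m)%N).
  by apply: (@size_addX_exp_mul z p m); rewrite -G_H.
have sHi i : (i < q.+1)%N -> (size (H`_i)%R <= m.+1 - p)%N.
  move=> iq; apply: (@size_coef_family q.+1 _ (fun i => H`_i) [::]) iq => z _.
  by rewrite -Hcoef; have [] := Hz z.
have pm : (p <= m)%N.
  rewrite leqNgt; apply/negP => mp; move/negP: Knz; apply; rewrite -HN.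
  suff -> : H = 0 by rewrite horner0.
  apply/polyP => i; rewrite coef0; have [iq|qi] := ltnP i q.+1; last by rewrite nth_default // (leq_trans sH).
  by apply/eqP; rewrite -size_poly_eq0; have := sHi i iq; lia.
split=> //; rewrite -HN (horner_coef_wide _ sH).
apply: (leq_trans (size_sum _ _ _)); apply/bigmax_leqP => i _.
apply: (leq_trans (size_polyMleq _ _)).
have := sHi i (ltn_ord i); rewrite exprNn -signr_odd.
have : (size ((-1) ^+ odd i * 'X^i : {poly F})%R <= i.+1)%N.
  by case: (odd i); rewrite ?expr1 ?expr0 ?mulN1r ?mul1r ?size_polyN size_polyXn.
have aux (u v w : nat) : (u <= m.+1 - p -> v <= w.+1 -> w <= q -> (u + v).-1 <= (m - p + q).+1)%N by lia.
by move=> h1 h2; apply: aux h2 h1 _; rewrite -ltnS.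
Qed.

End PolynomialFunctions.

(** The quotient of the sum by (z + s)^p is a polynomial [H] in z and s. If p > m, the degree bound
    forces it to vanish for each z, whereas z = - s specializes it to [K p]. *)
Lemma single_bound (F : numFieldType) (L m p : nat) (K : nat -> {poly F}) : (p < L)%N ->
  (forall z, (size (\sum_(a < L) (z%:P + 'X) ^+ a * K a)%R <= m.+1)%N) ->
  (forall a, (a < p)%N -> K a = 0) -> K p != 0 -> (p <= m)%N.
Proof.
move=> pL Hdeg Ka Knz; rewrite leqNgt; apply/negP => mp.
pose H : {poly {poly F}} := \sum_(a < L) ('X + 'X%:P) ^+ (a - p) * (K a)%:P.
have H0 z : H.[z%:P] = 0.
  have e : \sum_(a < L) (z%:P + 'X) ^+ a * K a = (z%:P + 'X) ^+ p * H.[z%:P].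
    rewrite /H horner_sum mulr_sumr; apply: eq_bigr => a _; rewrite !hornerE /=.
    have [pa|ap] := leqP p a; last by rewrite Ka ?mulr0.
    by rewrite -{1}(subnKC pa) exprD ?[z%:P + _]addrC.
  have := Hdeg z; rewrite e => /size_addX_exp_mul [_ h].
  by apply/eqP; apply/negPn/negP => /h; rewrite leqNgt mp.
have : H = 0.
  apply/polyP => i; rewrite coef0; have [iH|] := ltnP i (size H); last exact: nth_default.
  apply/eqP; rewrite -size_poly_eq0 -leqn0.
  apply: (@size_coef_family F (size H) 0 (fun i => H`_i) [::]) iH => z _.
  rewrite leqn0 size_poly_eq0; apply/eqP; rewrite -[RHS](H0 z) horner_coef.
  by apply: eq_bigr => j _; rewrite -polyC_exp mulrC mul_polyC.
move=> /(congr1 (fun P => P.[- 'X])); rewrite horner0 => h; move/negP: Knz; apply.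
rewrite -[X in _ == X]h /H horner_sum (bigD1 (Ordinal pL)) //= !hornerE subnn expr0 mul1r.
rewrite big1 ?addr0 // => a ap; rewrite !hornerE.
have [ltpa|leap] := ltnP p a; first by rewrite addNr expr0n subn_eq0 leqNgt ltpa mul0r.
by rewrite Ka ?mulr0 // ltn_neqAle leap andbT.
Qed.

(** * Linear independence of characters and stripping of monomials *)

Section CharacterIndependence.
Variables (F : fieldType) (T : eqType) (Q : Type) (D : Q -> Prop) (op : Q -> Q -> Q).
Variable chi : T -> Q -> F.
Hypothesis Dop : forall q r, D q -> D r -> D (op q r).
Hypothesis chiM : forall k q r, D q -> D r -> chi k (op q r) = chi k q * chi k r.
Hypothesis chi_neq0 : forall k, exists2 q, D q & chi k q != 0.

(** Artin's argument: translate a relation by an r that separates the head k from another l, and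
    subtract [chi k r] times the relation. The result no longer involves k, and its coefficient at l
    is [c l * (chi l r - chi k r)]. *)
Lemma char_independent (S : seq T) (c : T -> F) :
  uniq S -> (forall k l, k \in S -> l \in S -> k != l -> exists2 q, D q & chi k q != chi l q) ->
  (forall q, D q -> \sum_(k <- S) c k * chi k q = 0) -> forall k, k \in S -> c k = 0.
Proof.
elim: S c => [|k S IH] c //= /andP [kS uS] dist Hc.
have cS l : l \in S -> c l = 0.
  move=> lS; have [r Dr klr] : exists2 q, D q & chi k q != chi l q.
    apply: dist; rewrite ?inE ?eqxx ?lS ?orbT //.
    by apply: contraNneq kS => ->.
  suff /eqP : c l * (chi l r - chi k r) = 0.
    rewrite mulf_eq0 => /orP [/eqP //|]; rewrite subr_eq0 eq_sym (negbTE klr) //.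
  apply: (IH (fun j => c j * (chi j r - chi k r))) lS => //.
    by move=> i j iS jS; apply: dist; rewrite inE ?iS ?jS orbT.
  move=> q Dq; have := Hc (op r q) (Dop Dr Dq); have := Hc q Dq.
  rewrite !big_cons chiM // => e1 e2.
  have {e1}e1 : chi k r * (c k * chi k q) + chi k r * \sum_(j <- S) c j * chi j q = 0.
    by rewrite -mulrDr e1 mulr0.
  transitivity ((c k * (chi k r * chi k q) + \sum_(j <- S) c j * chi j (op r q)) -
     (chi k r * (c k * chi k q) + chi k r * \sum_(j <- S) c j * chi j q)); last by rewrite e1 e2 subrr.
  have -> : c k * (chi k r * chi k q) = chi k r * (c k * chi k q) by ring.
  rewrite opprD addrACA subrr add0r mulr_sumr -sumrB.
  by apply: eq_bigr => j _; rewrite chiM //; ring.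
move=> l; rewrite inE => /orP [/eqP ->|/cS //].
have [q Dq kq] := chi_neq0 k; have /eqP := Hc q Dq; rewrite big_cons big_seq big1.
  by rewrite addr0 mulf_eq0 (negbTE kq) orbF => /eqP.
by move=> j /cS ->; rewrite mul0r.
Qed.

End CharacterIndependence.

Definition upd (V : eqType) (A : Type) (x : V -> A) (v : V) (z : A) : V -> A :=
  fun u => if u == v then z else x u.

Section Stripping.
Variables (F : numFieldType) (V T : eqType).
Variables (S : seq T) (c : T -> F) (e : T -> V -> nat).
Variable delta : (V -> F) -> V -> F.
Variable p : V -> nat.

Definition mon (vs : seq V) (q : V -> nat) (x : V -> F) : F := \prod_(v <- vs) x v ^+ q v.

(** On points without zero coordinates monomials are characters; two that differ at v are separated
    by the point equal to 2 at v and 1 elsewhere. *)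
Lemma mon_independent_seq (vs : seq V) (S' : seq T) (c' : T -> F) :
  uniq S' -> (forall k l, k \in S' -> l \in S' -> {in vs, e k =1 e l} -> k = l) ->
  (forall x, (forall v, x v != 0) -> \sum_(k <- S') c' k * mon vs (e k) x = 0) ->
  forall k, k \in S' -> c' k = 0.
Proof.
move=> uS dist.
have monM k x y : mon vs (e k) (fun v => x v * y v) = mon vs (e k) x * mon vs (e k) y.
  by rewrite /mon -big_split /=; apply: eq_bigr => v _; rewrite exprMn.
apply: (@char_independent _ _ _ _ (fun x y v => x v * y v) (fun k x => mon vs (e k) x)) => //.
- by move=> x y x0 y0 v; rewrite mulf_neq0.
- move=> k; exists (fun _ => 1); first by move=> _; apply: oner_neq0.
  by rewrite /mon big1 ?oner_neq0 // => v _; rewrite expr1n.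
move=> k l kS lS kl.
have [v vvs klv] : exists2 v, v \in vs & e k v != e l v.
  apply/hasP; rewrite has_predC; apply/negP => /allP h; move/negP: kl; apply.
  by apply/eqP/dist => // v /h /eqP.
exists (upd (fun _ => 1) v 2); first by move=> u; rewrite /upd; case: ifP; rewrite ?oner_neq0 ?pnatr_eq0.
have E j ws : mon ws (e j) (upd (fun _ => 1) v 2) = 2 ^+ (count_mem v ws * e j v).
  rewrite /mon; elim: ws => [|u ws IH]; first by rewrite big_nil.
  rewrite big_cons IH /= mulnDl exprD {1}/upd; congr (_ * _).
  by case: eqP => [->|]; rewrite ?mul1n ?expr1n.
rewrite !E; apply: contra klv.
have n2 j : 2 ^+ j = (2 ^ j)%:R :> F by rewrite natrX.
rewrite !n2 eqr_nat eqn_exp2l // eqn_mul2l => /orP [|//].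
by rewrite -leqn0 leqNgt -has_count has_pred1 vvs.
Qed.

Definition fmon (vs : seq V) (q : V -> nat) (x : V -> F) : {poly F} :=
  \prod_(v <- vs) ((x v)%:P + delta x v *: 'X) ^+ q v.

Definition agree (pre : seq V) (k : T) : bool := all (fun v => e k v == p v) pre.

(* The coefficient of the monomial [p] in the variables [pre], as a polynomial in
   the parameter of the flow x + s delta x in the remaining variables. *)
Definition stripped (pre vs : seq V) (x : V -> F) : {poly F} :=
  \sum_(k <- S | agree pre k) c k *: fmon vs (e k) x.

Definition deg_le (pre vs : seq V) (M : nat) : Prop :=
  forall x, (size (stripped pre vs x) <= M.+1)%N.

(** What is needed to vary [x v] alone: the polynomials [fmon vs] stay the same, so that the powers
    of [x v] can be separated. *)
Definition free_of (v : V) (vs : seq V) : Prop :=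
  v \notin vs /\ forall u x z, u \in vs -> delta (upd x v z) u = delta x u.

Lemma fmon_free v vs q x z : free_of v vs -> fmon vs q (upd x v z) = fmon vs q x.
Proof.
move=> [vvs vfree]; apply: eq_big_seq => u uvs; rewrite vfree // /upd.
by case: eqP => // uv; rewrite -uv uvs in vvs.
Qed.

Definition layer (pre vs : seq V) (v : V) (x : V -> F) (a : nat) : {poly F} :=
  \sum_(k <- S | agree pre k && (e k v == a)) c k *: fmon vs (e k) x.

Definition emax (v : V) : nat := (\max_(k <- S) e k v).+1.

Lemma emax_gt v k : k \in S -> (e k v < emax v)%N.
Proof. by move=> kS; rewrite ltnS (big_rem _ kS) /= leq_maxl. Qed.

Lemma layer_p pre vs v x : layer pre vs v x (p v) = stripped (rcons pre v) vs x.
Proof. by apply: eq_bigl => k; rewrite /agree all_rcons andbC. Qed.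

Lemma stripped_cons pre vs v x :
  stripped pre (v :: vs) x =
  \sum_(a < emax v) ((x v)%:P + delta x v *: 'X) ^+ a * layer pre vs v x a.
Proof.
transitivity (\sum_(a < emax v) \sum_(k <- S | agree pre k && (e k v == a))
    ((x v)%:P + delta x v *: 'X) ^+ a * (c k *: fmon vs (e k) x)); last first.
  by apply: eq_bigr => a _; rewrite mulr_sumr.
rewrite (exchange_big_dep (agree pre)) /=; last by move=> a k _ /andP [].
rewrite /stripped [LHS]big_seq_cond [RHS]big_seq_cond; apply: eq_bigr => k /andP [kS ak].
have ke := emax_gt v kS.
rewrite (big_pred1 (Ordinal ke)) /=; last first.
  by move=> a /=; rewrite ak /=; apply/eqP/eqP => [h|->] //; apply: val_inj.
by rewrite /fmon big_cons -scalerAr.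
Qed.

Lemma layer_emax pre vs v x a : (emax v <= a)%N -> layer pre vs v x a = 0.
Proof.
move=> ea; rewrite /layer big_seq_cond big1 // => k /and3P [kS _ /eqP ka].
have := emax_gt v kS.
by rewrite ka ltnNge ea.
Qed.

(** A variable fixed by the flow enters through the scalars [x v ^+ a]. Varying [x v] separates the
    layers, and each of them, in particular the one of exponent [p v], keeps the bound. *)
Lemma deg_le_skip pre vs v M : free_of v vs -> (forall x, delta x v = 0) ->
  deg_le pre (v :: vs) M -> deg_le (rcons pre v) vs M.
Proof.
move=> vfree v0 Hd x; rewrite -layer_p.
have [pe|ep] := ltnP (p v) (emax v); last by rewrite layer_emax ?size_poly0.
apply: (@size_coef_family F _ M.+1 (layer pre vs v x) [::]) pe => z _.
apply: leq_trans (Hd (upd x v z)); rewrite stripped_cons leq_eqVlt; apply/orP; left.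
apply/eqP; congr (size (polyseq _)); apply: eq_bigr => a _.
rewrite v0 scale0r addr0 {1}/upd eqxx -polyC_exp mul_polyC; congr (_ *: _).
by apply: eq_bigr => k _; rewrite fmon_free.
Qed.

Lemma deg_le_skips pre ws vs M :
  (forall ws1 v ws2, ws = ws1 ++ v :: ws2 -> free_of v (ws2 ++ vs)) ->
  (forall x v, v \in ws -> delta x v = 0) ->
  deg_le pre (ws ++ vs) M -> deg_le (pre ++ ws) vs M.
Proof.
elim: ws pre => [|v ws IH] pre Hf H0 Hd; first by rewrite cats0.
rewrite -cat_rcons; apply: IH.
- by move=> ws1 u ws2 e'; apply: (Hf (v :: ws1)); rewrite e'.
- by move=> x u uws; apply: H0; rewrite inE uws orbT.
- by apply: deg_le_skip Hd => [|x]; [apply: (Hf [::])|apply: H0; rewrite inE eqxx].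
Qed.

Variable allv : seq V.
Hypothesis lexmin : forall k pre v post, k \in S -> allv = pre ++ v :: post ->
  agree pre k -> (p v <= e k v)%N.

Lemma layer_lt pre v post vs x a : allv = pre ++ v :: post -> (a < p v)%N ->
  layer pre vs v x a = 0.
Proof.
move=> Ev ap; rewrite /layer big_seq_cond big1 // => k /and3P [kS ak /eqP ka].
by have := lexmin kS Ev ak; rewrite ka leqNgt ap.
Qed.

(** The flow translates v by the constant d, so the value [d * z] for v turns the powers of v into
    d^a (z + s)^a, the situation of [single_bound]. *)
Lemma deg_le_last pre v post M (d : F) : d != 0 -> allv = pre ++ v :: post -> free_of v post ->
  (forall x, delta x v = d) -> (exists x, stripped (rcons pre v) post x != 0) ->
  deg_le pre (v :: post) M -> (p v <= M)%N.
Proof.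
move=> d0 Ev vfree vd [x nz] Hd; rewrite -layer_p in nz.
have pe : (p v < emax v)%N.
  by rewrite ltnNge; apply/negP => /layer_emax h; rewrite h eqxx in nz.
apply: (@single_bound F (emax v) M (p v) (fun a => d ^+ a *: layer pre post v x a)) => //.
- move=> z; apply: leq_trans (Hd (upd x v (d * z))); rewrite stripped_cons leq_eqVlt.
  apply/orP; left; apply/eqP; congr (size (polyseq _)); apply: eq_bigr => a _.
  rewrite vd {1}/upd eqxx -scalerAr scalerAl -exprZn scalerDr -mul_polyC -polyCM.
  congr (_ * _); apply: eq_bigr => k _; by rewrite fmon_free.
- by move=> a ap; rewrite (layer_lt _ _ Ev ap) scaler0.
- by rewrite scaler_eq0 expf_eq0 (negbTE d0) andbF.
Qed.

(** Here v1 moves by d times v2 while v2 is fixed. Removing the lowest powers of both costs [p v1]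
    and gives back [p v2], by [pair_bound]. *)
Lemma deg_le_pair pre v1 v2 post M (d : F) : d != 0 ->
  allv = pre ++ v1 :: v2 :: post -> v1 != v2 ->
  free_of v1 post -> free_of v2 post ->
  (forall x, delta x v1 = d * x v2) -> (forall x, delta x v2 = 0) ->
  (exists x, stripped (rcons (rcons pre v1) v2) post x != 0) ->
  deg_le pre (v1 :: v2 :: post) M ->
  (p v1 <= M)%N /\ deg_le (rcons (rcons pre v1) v2) post (M - p v1 + p v2).
Proof.
move=> d0 Ev v12 f1 f2 d1 d2 [x0 nz0] Hd.
pose layer2 x a b : {poly F} :=
  \sum_(k <- S | agree pre k && (e k v1 == a) && (e k v2 == b)) c k *: fmon post (e k) x.
have L2p x : layer2 x (p v1) (p v2) = stripped (rcons (rcons pre v1) v2) post x.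
  by apply: eq_bigl => k; rewrite /agree !all_rcons andbC [X in _ && X]andbC.
have L2lt1 x a b : (a < p v1)%N -> layer2 x a b = 0.
  move=> ap; rewrite /layer2 big_seq_cond big1 // => k /andP [kS /andP [/andP [ak /eqP ka] _]].
  by have := lexmin kS Ev ak; rewrite ka leqNgt ap.
have L2lt2 x b : (b < p v2)%N -> layer2 x (p v1) b = 0.
  move=> bp; rewrite /layer2 big_seq_cond big1 // => k /andP [kS /andP [/andP [ak /eqP ka] /eqP kb]].
  have Ev2 : allv = rcons pre v1 ++ v2 :: post by rewrite Ev cat_rcons.
  have := lexmin kS Ev2; rewrite /agree all_rcons ka eqxx => /(_ ak).
  by rewrite kb leqNgt bp.
pose L := maxn (emax v1) (emax v2).
have eL1 k : k \in S -> (e k v1 < L)%N.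
  by move=> kS; rewrite leq_max emax_gt.
have eL2 k : k \in S -> (e k v2 < L)%N.
  by move=> kS; rewrite leq_max emax_gt ?orbT.
have main x z1 z2 : stripped pre (v1 :: v2 :: post) (upd (upd x v1 z1) v2 z2) =
   \sum_(a < L) \sum_(b < L) ((z1%:P + (d * z2) *: 'X) ^+ a * (z2 ^+ b *: layer2 x a b)).
  transitivity (\sum_(a < L) \sum_(b < L) \sum_(k <- S | agree pre k && (e k v1 == a) && (e k v2 == b))
     ((z1%:P + (d * z2) *: 'X) ^+ a * (z2 ^+ b *: (c k *: fmon post (e k) x)))); last first.
    apply: eq_bigr => a _; apply: eq_bigr => b _.
    by rewrite /layer2 scaler_sumr mulr_sumr.
  under eq_bigr => a _.
    rewrite (exchange_big_dep (agree pre)) /=; last by move=> b k _ /andP [/andP []].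
    over.
  rewrite exchange_big /= /stripped [LHS]big_seq_cond [RHS]big_seq_cond.
  apply: eq_bigr => k /andP [kS ak].
  rewrite (bigD1 (Ordinal (eL1 k kS))) //= [X in _ + X]big1 ?addr0; last first.
    move=> a; rewrite -val_eqE /= => ae; rewrite big1 // => b.
    by rewrite eq_sym (negbTE ae) andbF.
  rewrite (big_pred1 (Ordinal (eL2 k kS))) /=; last first.
    by move=> b /=; rewrite ak eqxx /=; apply/eqP/eqP => [h|->] //; apply: val_inj.
  have ev1 : upd (upd x v1 z1) v2 z2 v1 = z1 by rewrite /upd (negbTE v12) eqxx.
  have ev2 : upd (upd x v1 z1) v2 z2 v2 = z2 by rewrite /upd eqxx.
  rewrite /fmon !big_cons d1 d2 scale0r addr0 ev1 ev2 -!/(fmon _ _ _) !fmon_free //.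
  have gen (a y : F) (A P : {poly F}) : a *: (A * (y%:P * P)) = A * (y *: (a *: P)).
    by rewrite -!mul_polyC; ring.
  by rewrite -polyC_exp gen.
have claim x : stripped (rcons (rcons pre v1) v2) post x != 0 ->
    (p v1 <= M)%N /\ (size (stripped (rcons (rcons pre v1) v2) post x) <= (M - p v1 + p v2).+1)%N.
  rewrite -L2p => nz.
  have sz2 b (h : {poly F}) : size (d ^- b *: h) = size h.
    by rewrite size_scale // invr_eq0 expf_eq0 (negbTE d0) andbF.
  rewrite -(sz2 (p v2)).
  apply: (@pair_bound F L M (p v1) (p v2) (fun a b => d ^- b *: layer2 x a b)).
  - rewrite ltnNge; apply/negP => h; move/negP: nz; apply; rewrite /layer2 big_seq_cond big1 //.
    by move=> k /andP [kS /andP [/andP [_ /eqP ka] _]]; have := eL1 k kS; rewrite ka ltnNge h.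
  - rewrite ltnNge; apply/negP => h; move/negP: nz; apply; rewrite /layer2 big_seq_cond big1 //.
    by move=> k /andP [kS /andP [_ /eqP ka]]; have := eL2 k kS; rewrite ka ltnNge h.
  (* The value z2 / d for v2 turns the displacement of v1 into z2; the factor [d ^- b] put on the
     layers accounts for the power of z2 / d. *)
  - move=> z1 z2; apply: leq_trans (Hd (upd (upd x v1 z1) v2 (z2 / d))).
    rewrite main mulrCA divff // mulr1 leq_eqVlt; apply/orP; left; apply/eqP.
    congr (size (polyseq _)); apply: eq_bigr => a _; apply: eq_bigr => b _.
    by rewrite scalerA exprMn exprVn.
  - by move=> a b ap; rewrite L2lt1 ?scaler0.
  - by move=> b bp; rewrite L2lt2 ?scaler0.
  - by rewrite -size_poly_eq0 sz2 size_poly_eq0.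
split; first by have [] := claim x0 nz0.
by move=> x; have [->|/claim []//] := eqVneq (stripped (rcons (rcons pre v1) v2) post x) 0; rewrite size_poly0.
Qed.

Hypothesis S_uniq : uniq S.
Hypothesis S_dist : forall k l, k \in S -> l \in S -> {in allv, e k =1 e l} -> k = l.

(** At flow parameter 0 a stripped polynomial is a combination of monomials in [post]. Those that
    agree with p on [pre] remain distinct there, so vanishing for all x would kill the coefficient
    of k0. *)
Lemma stripped_neq0 pre post k0 : allv = pre ++ post -> k0 \in S -> c k0 != 0 ->
  agree allv k0 -> exists x, stripped pre post x != 0.
Proof.
move=> E k0S ck0 ak0; apply: contrapT => /forallNP h.
have k0pre : agree pre k0 by move: ak0; rewrite E /agree all_cat => /andP [].
suff : c k0 = 0 by move/eqP; rewrite (negbTE ck0).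
apply: (@mon_independent_seq post [seq k <- S | agree pre k] c).
- exact: filter_uniq.
- move=> k l; rewrite !mem_filter => /andP [ak kS] /andP [al lS] kl.
  apply: S_dist => // v; rewrite E mem_cat => /orP [vpre|/kl //].
  by rewrite (eqP (allP ak v vpre)) (eqP (allP al v vpre)).
- move=> x _; have /negP := h x; rewrite negbK => /eqP /(congr1 (fun q => q.[0])).
  rewrite horner0 /stripped horner_sum big_filter => h0; rewrite -[RHS]h0; apply: eq_bigr => k _.
  rewrite hornerZ /fmon horner_prod; congr (_ * _); apply: eq_bigr => v _.
  by rewrite horner_exp !hornerE.
- by rewrite mem_filter k0pre.
Qed.

End Stripping.

(* The coordinate x_(m+1, b+1) of U_+ is indexed by the 0-based pair (m, b). *)
Definition vrow (n m : nat) : seq (nat * nat) := [seq (m, b) | b <- rev (iota m.+1 ((n - m).*2.-1))].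
Definition vrows (n m k : nat) := flatten [seq vrow n j | j <- iota m k].
Definition vars (n : nat) := vrows n 0 n.

(** The order in which the term order compares the pairs, see [xprecE]; within a row the columns
    decrease. *)
Definition vprec (u v : nat * nat) : bool := (u.1 < v.1)%N || ((u.1 == v.1) && (v.2 < u.2)%N).

Lemma vprec_trans : transitive vprec.
Proof. by move=> [a b] [c d] [e f]; rewrite /vprec /=; lia. Qed.

Lemma mem_vrow n m u : (u \in vrow n m) = [&& u.1 == m, (m < u.2)%N & (m + u.2 < n.*2)%N].
Proof.
case: u => a b; apply/mapP/idP => /= [[b' ]|/and3P [/eqP -> h1 h2]].
  by rewrite mem_rev mem_iota => h [-> ->]; lia.
by exists b => //; rewrite mem_rev mem_iota; lia.
Qed.

Lemma mem_vrows n m k u :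
  (u \in vrows n m k) = [&& (m <= u.1)%N, (u.1 < m + k)%N, (u.1 < u.2)%N & (u.1 + u.2 < n.*2)%N].
Proof.
apply/flattenP/idP => [[s /mapP [j]]|].
  by rewrite mem_iota => h ->; rewrite mem_vrow; lia.
move=> h; exists (vrow n u.1); first by apply/mapP; exists u.1; rewrite ?mem_iota //; lia.
by rewrite mem_vrow eqxx; lia.
Qed.

Lemma mem_vars n u : (u \in vars n) = (u.1 < u.2)%N && (u.1 + u.2 < n.*2)%N.
Proof. by rewrite mem_vrows; lia. Qed.

Lemma vrows_pairwise n m k : pairwise vprec (vrows n m k).
Proof.
elim: k m => [|k IH] m //=; rewrite /vrows /= pairwise_cat -/(vrows n m.+1 k) IH andbT.
apply/andP; split.
  by apply/allrelP => -[a b] [a2 b2]; rewrite mem_vrow mem_vrows /vprec /=; lia.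
rewrite /vrow pairwise_map.
have : sorted (fun a b => (b < a)%N) (rev (iota m.+1 ((n - m).*2.-1))).
  by rewrite rev_sorted iota_ltn_sorted.
rewrite sorted_pairwise; last by move=> a b c; lia.
by apply: sub_pairwise => a b /= ab; rewrite /vprec /= eqxx ab orbT.
Qed.

Lemma vars_split n pre v post : vars n = pre ++ v :: post -> forall u, u \in post -> vprec v u.
Proof.
move=> E u upost; have := vrows_pairwise n 0 n; rewrite -/(vars n) E pairwise_cat /=.
by move=> /and3P [_ _ /andP [/allP h _]]; apply: h.
Qed.

Lemma vars_uniq n : uniq (vars n).
Proof.
apply: (@pairwise_uniq _ vprec) => //; last exact: vrows_pairwise.
by move=> u; rewrite /vprec ltnn eqxx ltnn.
Qed.

(* The direction in which right multiplication by [xmx i s] moves u(x): see [umx_xmx]. *)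
Definition delta (F : pzRingType) (n i : nat) (x : nat * nat -> F) (u : nat * nat) : F :=
  if (u.1 <= i)%N then
    if u.2 == i.+1 then (if u.1 == i then 1 else x (u.1, i))
    else if (u.2 == n.*2 - i.+1)%N && (i.+1 < n)%N then - x (u.1, (n.*2 - i.+2)%N)
    else 0
  else 0.

(* The bounds, on 0-based row [m], for the exponents of the two columns moved
   by the simple root of index [i]. *)
Fixpoint bound (n i : nat) (a : int) (p : nat * nat -> int) (m : nat) : int :=
  if m is m'.+1 then
    (if (i.+1 < n)%N then bound n i a p m' - p (m', (n.*2 - i.+1)%N) + p (m', (n.*2 - i.+2)%N)
     else bound n i a p m') - p (m', i.+1) + p (m', i)
  else a.

(** The value between the two moves in row m: the pair of columns beyond the middle precedes the
    pair i+1, i. In Gelfand-Cetlin coordinates [bound] is a difference of consecutive theta, and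
    this one of consecutive eta. *)
Definition bound_half (n i : nat) (a : int) (p : nat * nat -> int) (m : nat) : int :=
  if (i.+1 < n)%N then bound n i a p m - p (m, (n.*2 - i.+1)%N) + p (m, (n.*2 - i.+2)%N)
  else bound n i a p m.

(** * Exponent bounds for a lexicographically least monomial *)

Section UpperBound.
Variables (F : numFieldType) (T : eqType) (n : nat).
Local Notation V := (nat * nat)%type.
Variables (S : seq T) (c : T -> F) (e : T -> V -> nat) (p : V -> nat) (k0 : T).
Hypothesis S_uniq : uniq S.
Hypothesis S_dist : forall k l, k \in S -> l \in S -> {in vars n, e k =1 e l} -> k = l.
Hypothesis lexmin : forall k pre v post, k \in S -> vars n = pre ++ v :: post ->
  agree e p pre k -> (p v <= e k v)%N.
Hypotheses (k0S : k0 \in S) (ck0 : c k0 != 0) (pk0 : agree e p (vars n) k0).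
Variable i : nat.
Hypothesis ltin : (i < n)%N.

Let D := @delta F n i.
Local Notation deg_le := (deg_le S c e D p).

(** The direction at u reads at most the entry one column to the left in the row of u, which follows
    u in the order; so what comes after v does not depend on [x v]. *)
Lemma vars_free pre v post : vars n = pre ++ v :: post -> free_of D v post.
Proof.
move=> E; have h := vars_split E; split; first by apply/negP => /h; rewrite /vprec ltnn eqxx ltnn.
move=> [a b] x z /h {E h}; case: v => [m b'] hp.
have xz w : w.+1 = b -> upd x (m, b') z (a, w) = x (a, w).
  by move=> wb; rewrite /upd; case: eqP => // -[am wb']; move: hp; rewrite /vprec /=; lia.
rewrite /D /delta /=; case: ifP => // _; case: eqP => [e1|_].
  by case: eqP => // _; rewrite xz.
by case: andP => // -[/eqP e2 i1n]; rewrite xz //; lia.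
Qed.

Lemma deg_le_vskips pre ws vs M : vars n = pre ++ ws ++ vs ->
  (forall x v, v \in ws -> D x v = 0) ->
  deg_le pre (ws ++ vs) M -> deg_le (pre ++ ws) vs M.
Proof.
move=> E H0; apply: deg_le_skips H0 => ws1 v ws2 E'.
by apply: (@vars_free (pre ++ ws1)); rewrite E E' /= -!catA.
Qed.

Lemma stripped_nz pre post : vars n = pre ++ post ->
  exists x, stripped S c e D p pre post x != 0.
Proof. by move=> E; apply: (stripped_neq0 D S_uniq S_dist E k0S ck0 pk0). Qed.

Lemma deg_le_vpair pre v1 v2 post M (d : F) : d != 0 ->
  vars n = pre ++ [:: v1, v2 & post] ->
  (forall x, D x v1 = d * x v2) -> (forall x, D x v2 = 0) ->
  deg_le pre [:: v1, v2 & post] M ->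
  (p v1 <= M)%N /\ deg_le (pre ++ [:: v1; v2]) post (M - p v1 + p v2).
Proof.
move=> d0 E d1 d2 Hd; have := vars_uniq n; rewrite E cat_uniq /= inE.
move=> /and4P [_ _ /norP [v12 _] _].
have -> : pre ++ [:: v1; v2] = rcons (rcons pre v1) v2 by rewrite -!cats1 -catA.
apply: (deg_le_pair lexmin d0 E v12 _ _ d1 d2) => //.
- by have [h1 h2] := vars_free E; split=> [|u x z up]; [move: h1; rewrite inE negb_or => /andP []|apply: h2; rewrite inE up orbT].
- by apply: (@vars_free (rcons pre v1)); rewrite cat_rcons.
- by apply: stripped_nz; rewrite !cat_rcons.
Qed.

Lemma deg_le_vlast pre v post M : vars n = pre ++ v :: post -> (forall x, D x v = 1) ->
  deg_le pre (v :: post) M -> (p v <= M)%N.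
Proof.
move=> E d1; apply: (deg_le_last lexmin (oner_neq0 F) E (vars_free E) d1).
by apply: stripped_nz; rewrite cat_rcons.
Qed.

Lemma rev_iotaD a b k : rev (iota a (b + k)) = rev (iota (a + b) k) ++ rev (iota a b).
Proof. by rewrite iotaD rev_cat. Qed.

Definition vseg (m a k : nat) : seq V := [seq (m, b) | b <- rev (iota a k)].

Lemma vseg_cat m a b k : vseg m a (b + k) = vseg m (a + b) k ++ vseg m a b.
Proof. by rewrite /vseg rev_iotaD map_cat. Qed.

Lemma vseg2 m a : vseg m a 2 = [:: (m, a.+1); (m, a)].
Proof. by []. Qed.

Lemma vseg1 m a : vseg m a 1 = [:: (m, a)].
Proof. by []. Qed.

Lemma mem_vseg m a k u : (u \in vseg m a k) = (u.1 == m) && (a <= u.2 < a + k)%N.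
Proof.
case: u => b d; apply/mapP/idP => /= [[b' ]|/andP [/eqP -> h1]].
  by rewrite mem_rev mem_iota => h [-> ->]; rewrite eqxx.
by exists d => //; rewrite mem_rev mem_iota.
Qed.

Let zp v : int := (p v)%:Z.

(** In row m the simple root of index i moves column 2n-i-1 by column 2n-i-2 (only if i+1 < n), then
    column i+1 by column i; every other column is fixed and skipped. Each moved pair updates the
    bound by [deg_le_vpair]. In the last row m = i that is reached, column i+1 moves by the constant
    1 and only the inequality is left. *)
Lemma row_chain m pre post (a : int) M : (m <= i)%N ->
  vars n = pre ++ vrow n m ++ post -> M%:Z = bound n i a zp m ->
  deg_le pre (vrow n m ++ post) M ->
  ((i.+1 < n)%N -> zp (m, (n.*2 - i.+1)%N) <= bound n i a zp m) /\
  zp (m, i.+1) <= bound_half n i a zp m /\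
  ((m < i)%N -> exists M', M'%:Z = bound n i a zp m.+1 /\ deg_le (pre ++ vrow n m) post M').
Proof.
move=> mi E EM Hd.
have [pre1 [M1 [E1 [hb [EM1 Hd1]]]]] : exists pre1 M1, pre1 ++ vseg m m.+1 (i.+1 - m) = pre ++ vrow n m /\
   ((i.+1 < n)%N -> zp (m, (n.*2 - i.+1)%N) <= bound n i a zp m) /\
   M1%:Z = bound_half n i a zp m /\ deg_le pre1 (vseg m m.+1 (i.+1 - m) ++ post) M1.
  have [i1n|ni1] := ltnP i.+1 n; last first.
    have Er : vrow n m = vseg m i.+2 (i - m) ++ vseg m m.+1 (i.+1 - m).
      by rewrite /vrow (_ : (n - m).*2.-1 = (i.+1 - m) + (i - m))%N ?[LHS]vseg_cat; [congr (vseg _ _ _ ++ _); lia|lia].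
    exists (pre ++ vseg m i.+2 (i - m)), M; split; first by rewrite Er catA.
    split=> //; split; first by rewrite /bound_half ltnNge ni1.
    move: Hd; rewrite Er -catA; apply: deg_le_vskips; first by rewrite E Er -catA.
    move=> x [b d]; rewrite mem_vseg /D /delta /= => h; case: ifP => // _.
    case: eqP => [|_]; first by lia.
    by case: andP => // -[/eqP]; lia.
  have Er : vrow n m = vseg m (n.*2 - i) (i - m) ++ [:: (m, n.*2 - i.+1); (m, n.*2 - i.+2)]%N
     ++ vseg m i.+2 (n.*2 - i.*2 - 4)%N ++ vseg m m.+1 (i.+1 - m).
    rewrite /vrow (_ : (n - m).*2.-1 = (i.+1 - m) + ((n.*2 - i.*2 - 4) + (2 + (i - m))))%N; last lia.
    rewrite [LHS]vseg_cat vseg_cat vseg_cat vseg2 -!catA.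
    congr (vseg _ _ _ ++ [:: (_, _); (_, _)] ++ vseg _ _ _ ++ _); lia.
  pose A := vseg m (n.*2 - i) (i - m); pose B := vseg m i.+2 (n.*2 - i.*2 - 4)%N.
  have H1 : deg_le (pre ++ A) ([:: (m, n.*2 - i.+1); (m, n.*2 - i.+2)]%N ++ B ++ vseg m m.+1 (i.+1 - m) ++ post) M.
    move: Hd; rewrite Er -!catA; apply: deg_le_vskips; first by rewrite E Er -!catA.
    move=> x [b d]; rewrite mem_vseg /D /delta /= => h; case: ifP => // _.
    case: eqP => [|_]; first by lia.
    by case: andP => // -[/eqP]; lia.
  have [] := @deg_le_vpair (pre ++ A) (m, n.*2 - i.+1)%N (m, n.*2 - i.+2)%N (B ++ vseg m m.+1 (i.+1 - m) ++ post) M (-1) _ _ _ _ H1.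
  - by rewrite oppr_eq0 oner_eq0.
  - by rewrite E Er -!catA.
  - move=> x; rewrite /D /delta /= mi i1n eqxx /=; case: eqP => [|_]; first by lia.
    by rewrite mulN1r.
  - move=> x; rewrite /D /delta /= mi; case: eqP => [|_]; first by lia.
    by case: andP => // -[/eqP]; lia.
  move=> pM H2.
  exists ((pre ++ A) ++ [:: (m, n.*2 - i.+1); (m, n.*2 - i.+2)]%N ++ B).
  exists (M - p (m, n.*2 - i.+1) + p (m, n.*2 - i.+2))%N.
  split; first by rewrite Er -!catA.
  split; first by move=> _; rewrite -EM /zp; lia.
  split; first by rewrite /bound_half i1n -EM /zp; lia.
  rewrite catA; move: H2; apply: deg_le_vskips; first by rewrite E Er -!catA.
  move=> x [b d]; rewrite mem_vseg /D /delta /= => h; case: ifP => // _.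
  case: eqP => [|_]; first by lia.
  by case: andP => // -[/eqP]; lia.
split=> //.
have [ltmi|leim] := ltnP m i; last first.
  have eim : i = m by lia.
  split=> //; rewrite -EM1 /zp lez_nat.
  move: Hd1; rewrite (_ : i.+1 - m = 1)%N ?vseg1; last lia.
  rewrite eim; apply: (deg_le_vlast (post := post)).
    by rewrite E catA -E1 -catA (_ : i.+1 - m = 1)%N //; lia.
  by move=> x; rewrite /D /delta /= eim leqnn !eqxx.
have Es : vseg m m.+1 (i.+1 - m) = [:: (m, i.+1); (m, i)] ++ vseg m m.+1 (i - m).-1.
  rewrite (_ : i.+1 - m = (i - m).-1 + 2)%N; last lia.
  by rewrite vseg_cat vseg2; congr ([:: (_, _); (_, _)] ++ _); lia.
have [] := @deg_le_vpair pre1 (m, i.+1)%N (m, i)%N (vseg m m.+1 (i - m).-1 ++ post) M1 1 _ _ _ _ _.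
- exact: oner_neq0.
- by rewrite E catA -E1 Es -!catA.
- by move=> x; rewrite /D /delta /= mi eqxx mul1r ltn_eqF.
- move=> x; rewrite /D /delta /= mi; case: eqP => [|_]; first by lia.
  by case: andP => // -[/eqP]; lia.
- by move: Hd1; rewrite Es -catA.
move=> pM H2; split; first by rewrite -EM1 /zp; lia.
move=> _; exists (M1 - p (m, i.+1) + p (m, i))%N; split.
  by rewrite /= -/(bound_half n i a zp m) -EM1 /zp; lia.
rewrite -E1 Es catA; move: H2; apply: deg_le_vskips; first by rewrite E catA -E1 Es -!catA.
move=> x [b d]; rewrite mem_vseg /D /delta /= => h; case: ifP => // _.
case: eqP => [|_]; first by lia.
by case: andP => // -[/eqP]; lia.
Qed.

Lemma vrowsS m k : vrows n m k.+1 = vrow n m ++ vrows n m.+1 k.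
Proof. by []. Qed.

Lemma vrows_add m k l : vrows n m (k + l) = vrows n m k ++ vrows n (m + k) l.
Proof. by rewrite /vrows iotaD map_cat flatten_cat. Qed.

Lemma exponent_bounds (a : nat) : deg_le [::] (vars n) a -> forall m, (m <= i)%N ->
  ((i.+1 < n)%N -> zp (m, (n.*2 - i.+1)%N) <= bound n i a%:Z zp m) /\
  zp (m, i.+1) <= bound_half n i a%:Z zp m.
Proof.
move=> Hd.
have Ev m : (m <= i)%N -> vars n = vrows n 0 m ++ vrow n m ++ vrows n m.+1 (n - m.+1)%N.
  by move=> mi; rewrite -vrowsS -[m in vrows n m _]add0n -vrows_add; congr vrows; lia.
have step m : (m <= i)%N -> exists M : nat, M%:Z = bound n i a%:Z zp m /\
    deg_le (vrows n 0 m) (vrow n m ++ vrows n m.+1 (n - m.+1)%N) M.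
  elim: m => [|m IH] mi; first by exists a; split=> //; have := Ev 0%N mi; rewrite [vrows n 0 0]/= cat0s => <-.
  have [M [EM HM]] := IH (ltnW mi).
  have [_ [_ /(_ mi) [M' [EM' HM']]]] := row_chain (ltnW mi) (Ev m (ltnW mi)) EM HM.
  exists M'; split=> //.
  have -> : vrows n 0 m.+1 = vrows n 0 m ++ vrow n m.
    by rewrite -addn1 vrows_add add0n /vrows /= cats0.
  by have -> : vrow n m.+1 ++ vrows n m.+2 (n - m.+2) = vrows n m.+1 (n - m.+1);
    [rewrite -vrowsS; congr vrows; lia|].
move=> m mi; have [M [EM HM]] := step m mi.
by have [h1 [h2 _]] := row_chain mi (Ev m mi) EM HM.
Qed.

End UpperBound.

(** * The symplectic group in recursive block form *)

Section SympForm.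
Context {R : realType}.
Local Notation C := R[i].

Definition sg n (i : 'I_(n + n)) : C := if (i < n)%N then 1 else -1.

Lemma sympE n (i j : 'I_(n + n)) : symp_form i j = (j == rev_ord i)%:R * sg i.
Proof.
rewrite mxE -val_eqE /= /sg.
have -> : ((i + j).+1 == n + n)%N = ((j : nat) == n + n - i.+1)%N.
  by have := ltn_ord i => h; apply/eqP/eqP; lia.
by case: eqP; rewrite ?mul1r ?mul0r.
Qed.

Lemma sg_rev n (i : 'I_(n + n)) : sg (rev_ord i) = - sg i.
Proof.
rewrite /sg /=; have := ltn_ord i.
by case: (ltnP i n) => h1 h2; case: ifP => h3; rewrite ?opprK //; lia.
Qed.

Lemma sg2 n (i : 'I_(n + n)) : sg i * sg i = 1.
Proof. by rewrite /sg; case: ifP; rewrite ?mulrNN mulr1. Qed.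

Lemma sumJ n (i : 'I_(n + n)) (f : 'I_(n + n) -> C) :
  \sum_j symp_form i j * f j = sg i * f (rev_ord i).
Proof.
rewrite (bigD1 (rev_ord i)) //= sympE eqxx mul1r big1 ?addr0 // => j ji.
by rewrite sympE (negbTE ji) !mul0r.
Qed.

Lemma formE n m1 m2 (A : 'M[C]_(n + n, m1)) (B : 'M[C]_(n + n, m2)) a b :
  (A^T *m symp_form *m B) a b = \sum_i sg i * A i a * B (rev_ord i) b.
Proof.
rewrite -mulmxA mxE; apply: eq_bigr => i _; rewrite !mxE sumJ; ring.
Qed.

Lemma JJ n : symp_form *m symp_form = - 1%:M :> 'M[C]_(n + n).
Proof.
apply/matrixP => i j; rewrite mxE sumJ sympE rev_ordK sg_rev !mxE eq_sym.
by case: eqP; rewrite ?mul1r ?mul0r ?mulr0 ?mulrN ?sg2 ?oppr0.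
Qed.

Definition Spinv n (g : 'M[C]_(n + n)) : 'M[C]_(n + n) := - (symp_form *m g^T *m symp_form).

Lemma SpinvL n (g : 'M[C]_(n + n)) : Sp g -> Spinv g *m g = 1%:M.
Proof. by move=> gS; rewrite /Spinv mulNmx -!mulmxA [_ *m (_ *m g)]mulmxA gS JJ opprK. Qed.

Lemma SpinvR n (g : 'M[C]_(n + n)) : Sp g -> g *m Spinv g = 1%:M.
Proof. by move/SpinvL/mulmx1C. Qed.

Lemma Sp_unit n (g : 'M[C]_(n + n)) : Sp g -> g \in unitmx.
Proof. by move/SpinvR/mulmx1_unit => []. Qed.

Lemma invmx_Sp n (g : 'M[C]_(n + n)) : Sp g -> invmx g = Spinv g.
Proof. by move=> gS; rewrite -[RHS]mul1mx -(mulVmx (Sp_unit gS)) -mulmxA SpinvR // mulmx1. Qed.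

Lemma Sp_tr n (g : 'M[C]_(n + n)) : Sp g -> Sp g^T.
Proof.
move=> gS; rewrite /Sp trmxK.
have := SpinvR gS; rewrite /Spinv mulmxN !mulmxA => /(congr1 (fun A => A *m symp_form)).
by rewrite mulNmx mul1mx -[X in - X]mulmxA JJ mulmxN mulmx1 opprK.
Qed.

Lemma Sp_mul n (g h : 'M[C]_(n + n)) : Sp g -> Sp h -> Sp (g *m h).
Proof. move=> gS hS; transitivity (h^T *m (g^T *m symp_form *m g) *m h); first by rewrite trmx_mul !mulmxA.
by rewrite [X in _ *m X *m _]gS. Qed.

Lemma Sp1 n : Sp (1%:M : 'M[C]_(n + n)).
Proof. by rewrite /Sp trmx1 mul1mx mulmx1. Qed.

Lemma Sp_inv n (g : 'M[C]_(n + n)) : Sp g -> Sp (invmx g).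
Proof.
move=> gS; rewrite /Sp -{1}gS trmx_inv -!mulmxA.
by rewrite mulmxV ?Sp_unit // mulmx1 mulKmx // unitmx_tr Sp_unit.
Qed.

Lemma Sp_conj n (g : 'M[C]_(n + n)) : Sp g -> Sp (map_mx Num.conj g).
Proof.
move=> gS; have := congr1 (map_mx Num.conj) gS; rewrite !map_mxM -map_trmx.
have -> : map_mx Num.conj (symp_form : 'M[C]_(n + n)) = symp_form; last by [].
apply/matrixP => i j; rewrite !mxE; case: ifP => _; last by rewrite rmorph0.
by case: ifP => _; rewrite ?rmorphN1 ?rmorph1.
Qed.

End SympForm.

Section Blocks.
Context {R : realType} {n : nat}.
Local Notation C := R[i].
Local Notation I := 'I_(n + n).
Local Notation I' := 'I_(n.+1 + n.+1).

Fact mid_subproof (i : I) : (i.+1 < n.+1 + n.+1)%N.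
Proof. by have := ltn_ord i; lia. Qed.
Definition mid (i : I) : I' := Ordinal (mid_subproof i).
Definition last' : I' := @ord_max (n + n.+1).

Lemma mid_ind (P : I' -> Prop) : P ord0 -> P last' -> (forall i, P (mid i)) -> forall i, P i.
Proof.
move=> P0 Pl Pm i; have [i0|i0] := posnP i.
  by rewrite (_ : i = ord0) //; apply: val_inj.
have [il|il] := ltnP i (n + n).+1; last first.
  by rewrite (_ : i = last') //; apply: val_inj => /=; have := ltn_ord i; lia.
have h : (i.-1 < n + n)%N by lia.
by rewrite (_ : i = mid (Ordinal h)) //; apply: val_inj => /=; rewrite prednK.
Qed.

Lemma mid_inj : injective mid.
Proof. by move=> i j /(congr1 val) /= [] /val_inj. Qed.

Lemma eq_mid i j : (mid i == mid j) = (i == j).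
Proof. exact: (inj_eq mid_inj). Qed.
Lemma eq_mid0 i : (mid i == ord0) = false.
Proof. by []. Qed.
Lemma eq_0mid i : (ord0 == mid i) = false.
Proof. by []. Qed.
Lemma eq_midl i : (mid i == last') = false.
Proof. by rewrite -val_eqE /=; have := ltn_ord i; lia. Qed.
Lemma eq_lmid i : (last' == mid i) = false.
Proof. by rewrite eq_sym eq_midl. Qed.
Lemma eq_0l : ((ord0 : I') == last') = false.
Proof. by rewrite -val_eqE /=; lia. Qed.
Lemma eq_l0 : (last' == (ord0 : I')) = false.
Proof. by rewrite eq_sym eq_0l. Qed.
Definition eqI := (eq_mid, eq_mid0, eq_0mid, eq_midl, eq_lmid, eq_0l, eq_l0, eqxx).

Lemma big_mid (f : I' -> C) : \sum_i f i = f ord0 + \sum_i f (mid i) + f last'.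
Proof.
pose g k := oapp f 0 (insub k).
have gE (i : I') : f i = g i by rewrite /g valK.
have -> : \sum_i f i = \sum_(i < n.+1 + n.+1) g i by apply: eq_bigr => i _; rewrite gE.
have e : (n.+1 + n.+1 = (n + n).+2)%N by lia.
have gen k l : k = l -> \sum_(i < k) g i = \sum_(i < l) g i by move=> ->.
rewrite (gen _ _ e) big_ord_recl big_ord_recr /= addrA gE; congr (_ + _ + _); last first.
  by rewrite gE /=; congr g; rewrite /bump /=; lia.
by apply: eq_bigr => i _; rewrite gE.
Qed.

Definition pos (i : I') : I + bool :=
  if i == ord0 then inr true else if i == last' then inr false
  else oapp inl (inr true) (insub i.-1).

Lemma pos0 : pos ord0 = inr true. Proof. by []. Qed.
Lemma posl : pos last' = inr false. Proof. by rewrite /pos eq_l0 eqxx. Qed.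
Lemma posm i : pos (mid i) = inl i.
Proof. by rewrite /pos eq_mid0 eq_midl /= valK. Qed.
Definition posE := (pos0, posl, posm).

Definition iota_mx (A : 'M[C]_(n + n)) : 'M[C]_(n.+1 + n.+1) :=
  \matrix_(i, j) match pos i, pos j with
    | inl a, inl b => A a b
    | inr x, inr y => (x == y)%:R
    | _, _ => 0
    end.

Lemma iotaE A : ((forall i j, iota_mx A (mid i) (mid j) = A i j) *
   (forall i, iota_mx A (mid i) ord0 = 0) * (forall i, iota_mx A (mid i) last' = 0) *
   (forall i, iota_mx A ord0 (mid i) = 0) * (forall i, iota_mx A last' (mid i) = 0) *
   (iota_mx A ord0 ord0 = 1) * (iota_mx A last' last' = 1) *
   (iota_mx A ord0 last' = 0) * (iota_mx A last' ord0 = 0))%type.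
Proof. by do !split=> *; rewrite mxE !posE. Qed.

(* The element of the Heisenberg group whose first row is (1, r 1, r 2, ...). *)
Definition hmx (r : nat -> C) : 'M[C]_(n.+1 + n.+1) :=
  \matrix_(i, j) match pos i, pos j with
    | inl a, inl b => (a == b)%:R
    | inr true, inr true => 1
    | inr true, _ => r j
    | inl a, inr false => sg a * r (rev_ord a).+1
    | inr false, inr false => 1
    | _, _ => 0
    end.

Lemma hmxE r : ((forall i j, hmx r (mid i) (mid j) = (i == j)%:R) *
   (forall i, hmx r (mid i) ord0 = 0) * (forall i, hmx r (mid i) last' = (sg i * r (rev_ord i).+1)%R) *
   (forall i, hmx r ord0 (mid i) = r i.+1) * (forall i, hmx r last' (mid i) = 0) *
   (hmx r ord0 ord0 = 1) * (hmx r last' last' = 1) *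
   (hmx r ord0 last' = r (n + n).+1) * (hmx r last' ord0 = 0))%type.
Proof. by do !split=> *; rewrite mxE !posE //=; congr r; lia. Qed.

Lemma rev_mid (i : I) : rev_ord (mid i) = mid (rev_ord i).
Proof. by apply: val_inj => /=; have := ltn_ord i; lia. Qed.
Lemma rev_0 : rev_ord (ord0 : I') = last'.
Proof. by apply: val_inj => /=; lia. Qed.
Lemma rev_l : rev_ord last' = (ord0 : I').
Proof. by rewrite -rev_0 rev_ordK. Qed.

Lemma sg0 : sg (ord0 : I') = 1 :> C.
Proof. by []. Qed.
Lemma sgl : sg last' = -1 :> C.
Proof. by rewrite /sg /=; case: ifP => //; lia. Qed.
Lemma sgm (i : I) : sg (mid i) = sg i :> C.
Proof. by []. Qed.

Lemma form_mid m1 m2 (A : 'M[C]_(n.+1 + n.+1, m1)) (B : 'M[C]_(n.+1 + n.+1, m2)) a b :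
  (A^T *m symp_form *m B) a b = A ord0 a * B last' b - A last' a * B ord0 b
    + \sum_i sg i * A (mid i) a * B (mid (rev_ord i)) b.
Proof.
rewrite formE big_mid rev_0 rev_l sg0 sgl; under eq_bigr do rewrite sgm rev_mid.
ring.
Qed.

Lemma sympM (J' := @symp_form R n.+1) : ((forall i j, J' (mid i) (mid j) = symp_form i j) *
   (forall i, J' (mid i) ord0 = 0) * (forall i, J' (mid i) last' = 0) *
   (forall i, J' ord0 (mid i) = 0) * (forall i, J' last' (mid i) = 0) *
   (J' ord0 ord0 = 0) * (J' last' last' = 0) *
   (J' ord0 last' = 1) * (J' last' ord0 = -1))%type.
Proof.
by do !split=> *; rewrite /J' !sympE ?rev_mid ?rev_0 ?rev_l ?sgm ?sg0 ?sgl ?eqI ?mul0r ?mul1r.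
Qed.

Lemma mx_midP (A B : 'M[C]_(n.+1 + n.+1)) :
  (forall i j, A (mid i) (mid j) = B (mid i) (mid j)) ->
  (forall i, A (mid i) ord0 = B (mid i) ord0) -> (forall i, A (mid i) last' = B (mid i) last') ->
  (forall i, A ord0 (mid i) = B ord0 (mid i)) -> (forall i, A last' (mid i) = B last' (mid i)) ->
  A ord0 ord0 = B ord0 ord0 -> A last' last' = B last' last' ->
  A ord0 last' = B ord0 last' -> A last' ord0 = B last' ord0 -> A = B.
Proof.
by move=> *; apply/matrixP; elim/mid_ind; [| |move=> i]; elim/mid_ind => //.
Qed.

Lemma Sp_iota (A : 'M[C]_(n + n)) : Sp A -> Sp (iota_mx A).
Proof.
move=> AS; apply: mx_midP => *; rewrite form_mid !iotaE ?sympM;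
  try (rewrite big1; [|by move=> *; rewrite !iotaE ?(mulr0, mul0r)]);
  rewrite ?(mulr0, mul0r, mulr1, subr0, add0r, addr0, sub0r, oppr0) //.
by rewrite -[in RHS]AS formE; apply: eq_bigr => k _; rewrite !iotaE.
Qed.

Lemma Sp_hmx r : Sp (hmx r).
Proof.
have e1 (i : I) (f : I -> C) : \sum_k sg k * (k == i)%:R * f k = sg i * f i.
  by rewrite (bigD1 i) //= eqxx mulr1 big1 ?addr0 // => k /negbTE ->; rewrite mulr0 mul0r.
have e2 (i : I) (f : I -> C) : \sum_k sg k * f k * (rev_ord k == i)%:R = - sg i * f (rev_ord i).
  rewrite (bigD1 (rev_ord i)) //= rev_ordK eqxx mulr1 sg_rev big1 ?addr0 // => k.
  by rewrite -(inj_eq rev_ord_inj) rev_ordK => /negbTE ->; rewrite mulr0.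
have Z (f : I -> C) : (forall k, f k = 0) -> \sum_k f k = 0 by move=> f0; apply: big1.
apply: mx_midP => *; rewrite form_mid !hmxE ?sympM.
- under eq_bigr do rewrite !hmxE.
  by rewrite e1 sympE [_ == rev_ord _]eq_sym; ring.
- rewrite Z ?(mulr0, mul0r, mulr1, subr0, add0r, addr0, sub0r, oppr0) // => k.
  by rewrite !hmxE mulr0.
- under eq_bigr do rewrite !hmxE.
  by rewrite e1 sg_rev rev_ordK mulrA mulrN sg2; ring.
- rewrite Z ?(mulr0, mul0r, mulr1, subr0, add0r, addr0, sub0r, oppr0) // => k.
  by rewrite !hmxE mulr0 mul0r.
- under eq_bigr do rewrite !hmxE.
  by rewrite e2 sg_rev rev_ordK mulrA mulrNN sg2; ring.
- rewrite Z ?(mulr0, mul0r, mulr1, subr0, add0r, addr0, sub0r, oppr0) // => k.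
  by rewrite !hmxE mulr0.
- under eq_bigr do rewrite !hmxE.
  (* The pairing of the last column with itself: reversing the index changes the sign of every term,
     so the sum is its own opposite. *)
  rewrite mulr1 mul1r subrr add0r; set s := (\sum_k _).
  have : s = - s.
    rewrite {1}/s (reindex_inj rev_ord_inj) -sumrN; apply: eq_bigr => k _.
    by rewrite !rev_ordK !sg_rev; ring.
  by move/eqP; rewrite -addr_eq0 -mulr2n mulrn_eq0 /= => /eqP.
- rewrite Z ?(mulr0, mul0r, mulr1, subr0, add0r, addr0, sub0r, oppr0) // => k.
  by rewrite !hmxE mulr0 mul0r.
- rewrite Z ?(mulr0, mul0r, mulr1, subr0, add0r, addr0, sub0r, oppr0) // => k.
  by rewrite !hmxE mulr0.
Qed.

Lemma iota_mul (A B : 'M[C]_(n + n)) : iota_mx (A *m B) = iota_mx A *m iota_mx B.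
Proof.
apply: mx_midP => *; rewrite [RHS]mxE big_mid !iotaE;
  try (rewrite big1; [|by move=> *; rewrite !iotaE ?(mulr0, mul0r)]);
  rewrite ?(mulr0, mul0r, mulr1, subr0, add0r, addr0, sub0r, oppr0) //.
by rewrite mxE; apply: eq_bigr => k _; rewrite !iotaE.
Qed.

Lemma iota1 : iota_mx 1%:M = 1%:M.
Proof. by apply: mx_midP => *; rewrite iotaE !mxE ?eqI. Qed.

End Blocks.

(** * The Heisenberg group and coordinates on the unipotent group *)

Section Heisenberg.
Context {R : realType} {n : nat}.
Local Notation C := R[i].

Lemma hmx_ext (r r' : nat -> C) : (forall b, (0 < b <= (n + n).+1)%N -> r b = r' b) ->
  hmx r = hmx r' :> 'M[C]_(n.+1 + n.+1).
Proof.
move=> e; have e1 (a : 'I_(n + n)) : r a.+1 = r' a.+1.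
  by apply: e; have := ltn_ord a; lia.
have e2 : r (n + n).+1 = r' (n + n).+1 by apply: e; lia.
by apply: mx_midP => *; rewrite !hmxE ?e1 ?e2.
Qed.

(** The Heisenberg law: the first rows add, and the central entry in column [(n + n).+1] also
    receives the symplectic form of the two middle parts. *)
Lemma hmx_mul (r r' : nat -> C) : hmx r *m hmx r' = hmx (fun b => r b + r' b +
   (b == (n + n).+1)%:R * \sum_(a < n + n) r a.+1 * (sg a * r' (rev_ord a).+1)) :> 'M[C]_(n.+1 + n.+1).
Proof.
have d1 (i : 'I_(n + n)) (f : 'I_(n + n) -> C) : \sum_k (i == k)%:R * f k = f i.
  by rewrite (bigD1 i) //= eqxx mul1r big1 ?addr0 // => k; rewrite eq_sym => /negbTE ->; rewrite mul0r.
have d2 (i : 'I_(n + n)) (f : 'I_(n + n) -> C) : \sum_k f k * (k == i)%:R = f i.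
  by rewrite (bigD1 i) //= eqxx mulr1 big1 ?addr0 // => k /negbTE ->; rewrite mulr0.
have bl (i : 'I_(n + n)) : (i.+1 == (n + n).+1)%N = false.
  by rewrite eqSS; have := ltn_ord i; lia.
apply: mx_midP => *; rewrite mxE big_mid; under eq_bigr do rewrite !hmxE; rewrite !hmxE ?d1 ?d2 ?bl ?eqxx ?mul0r ?mul1r ?mulr1 ?mulr0 ?addr0 ?add0r //.
all: try ring.
all: by rewrite big1 => [|k _]; [ring|rewrite ?(mulr0, mul0r)].
Qed.

(** Conjugation by the middle block acts linearly on the middle part of the row and fixes the
    centre. For the last column one needs A J A^T = J, that is, that A^T is symplectic as well. *)
Lemma hmx_iota (A : 'M[C]_(n + n)) (r r' : nat -> C) : Sp A ->
  (forall b : 'I_(n + n), r' b.+1 = \sum_(a < n + n) r a.+1 * A a b) ->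
  r' (n + n).+1 = r (n + n).+1 -> hmx r *m iota_mx A = iota_mx A *m hmx r'.
Proof.
move=> AS r'E r'l.
have d1 (i : 'I_(n + n)) (f : 'I_(n + n) -> C) : \sum_k (i == k)%:R * f k = f i.
  by rewrite (bigD1 i) //= eqxx mul1r big1 ?addr0 // => k; rewrite eq_sym => /negbTE ->; rewrite mul0r.
have d2 (i : 'I_(n + n)) (f : 'I_(n + n) -> C) : \sum_k f k * (k == i)%:R = f i.
  by rewrite (bigD1 i) //= eqxx mulr1 big1 ?addr0 // => k /negbTE ->; rewrite mulr0.
apply: mx_midP; [move=> i j|move=> i|move=> i|move=> j|move=> j| | | |]; rewrite mxE [RHS]mxE !big_mid;
  (under [X in _ + X + _ = _]eq_bigr do rewrite !hmxE !iotaE);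
  (under [X in _ = _ + X + _]eq_bigr do rewrite !hmxE !iotaE);
  rewrite !hmxE !iotaE ?d1 ?d2 ?r'E ?mul0r ?mul1r ?mulr1 ?mulr0 ?addr0 ?add0r //.
all: try by rewrite ?r'l ?big1 ?add0r ?addr0 // => *; rewrite ?(mulr0, mul0r).
have E (b : 'I_(n + n)) : sg b * r' (rev_ord b).+1 =
    \sum_d symp_form b d * \sum_(a < n + n) r a.+1 * A a d.
  by rewrite sumJ r'E.
under [RHS]eq_bigr => b _ do rewrite E.
transitivity (\sum_(a < n + n) r a.+1 * (A *m symp_form *m A^T) i a); last first.
  have L a : (A *m symp_form *m A^T) i a = \sum_b A i b * \sum_d symp_form b d * A a d.
    by rewrite -mulmxA mxE; apply: eq_bigr => b _; rewrite mxE; congr (_ * _); apply: eq_bigr => d _; rewrite [A^T _ _]mxE.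
  transitivity (\sum_(a < n + n) \sum_b r a.+1 * (A i b * \sum_d symp_form b d * A a d)).
    by apply: eq_bigr => a _; rewrite L mulr_sumr.
  rewrite exchange_big /=; apply: eq_bigr => b _.
  transitivity (\sum_(a < n + n) A i b * \sum_d symp_form b d * (r a.+1 * A a d)).
    apply: eq_bigr => a _; rewrite mulrCA; congr (_ * _); rewrite mulr_sumr.
    by apply: eq_bigr => d _; rewrite mulrCA.
  rewrite -mulr_sumr; congr (_ * _); rewrite exchange_big /=; apply: eq_bigr => d _.
  by rewrite mulr_sumr.
have := Sp_tr AS; rewrite /Sp trmxK => ->.
under eq_bigr => a _ do rewrite mulrC.
by rewrite sumJ.
Qed.

End Heisenberg.

Section Coordinates.
Context {R : realType}.
Local Notation C := R[i].

Definition shift (A : Type) (y : nat * nat -> A) (v : nat * nat) : A := y (v.1.+1, v.2.+1).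

(** By the recursion [y (m, b)] is the matrix entry in position (m, b) whenever m < b and m + b <
    2n; the other entries above the diagonal are forced by the form. The Heisenberg factor stands on
    the right so that root elements, multiplied from the right, meet row 0 first. *)
Fixpoint umx (n : nat) : (nat * nat -> C) -> 'M[C]_(n + n) :=
  if n is n'.+1 then fun y => iota_mx (umx n' (shift y)) *m hmx (fun b => y (0%N, b))
  else fun _ => 1%:M.

Lemma umx_ext n y y' : {in vars n, y =1 y'} -> umx n y = umx n y'.
Proof.
elim: n y y' => [|n IH] y y' e //=; congr (iota_mx _ *m _).
  by apply: IH => -[a b]; rewrite mem_vars /= => h; apply: e; rewrite mem_vars /=; lia.
by apply: hmx_ext => b h; apply: e; rewrite mem_vars /=; lia.
Qed.

Lemma umx_Sp n y : Sp (umx n y).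
Proof.
elim: n y => [|n IH] y /=; first exact: Sp1.
by apply: Sp_mul; [apply: Sp_iota; apply: IH | apply: Sp_hmx].
Qed.

Definition utri n (g : 'M[C]_(n + n)) : Prop :=
  forall i j : 'I_(n + n), (j <= i)%N -> g i j = (i == j)%:R.

Lemma utri_mul n (g h : 'M[C]_(n + n)) : utri g -> utri h -> utri (g *m h).
Proof.
move=> gu hu i j ji; rewrite mxE (bigD1 i) //= [g i i]gu // eqxx mul1r hu // big1 ?addr0 // => k ki.
have [lik|leki] := ltnP i k; first by rewrite [h k j]hu ?(leq_trans ji (ltnW lik)) // -val_eqE gtn_eqF ?mulr0 // (leq_ltn_trans ji).
by rewrite gu // eq_sym (negbTE ki) mul0r.
Qed.

Lemma utri_iota n (g : 'M[C]_(n + n)) : utri g -> utri (iota_mx g).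
Proof.
move=> gu; apply: (@mid_ind n) => [||i]; apply: (@mid_ind n) => [||j]; rewrite !iotaE ?eqI //.
by rewrite ltnS => /gu.
Qed.

Lemma utri_hmx n r : utri (hmx r : 'M[C]_(n.+1 + n.+1)).
Proof.
apply: (@mid_ind n) => [||i]; apply: (@mid_ind n) => [||j]; rewrite !hmxE ?eqI //= => h; exfalso;
  by [lia|have := ltn_ord i; lia|have := ltn_ord j; lia].
Qed.

Lemma umx_utri n y : utri (umx n y).
Proof.
elim: n y => [|n IH] y /=; first by move=> i j _; rewrite mxE.
by apply: utri_mul; [apply: utri_iota; apply: IH | apply: utri_hmx].
Qed.

Lemma umx_U n y : U_plus (umx n y).
Proof. by split; [apply: umx_Sp | apply: umx_utri]. Qed.

Fact o1_subproof n (i : 'I_n) : (i.+1 < n + n)%N.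
Proof. by have := ltn_ord i; lia. Qed.
(** For the last i the index [o1 i] is [rev_ord (o0 i)], and a single matrix unit gives a symplectic
    element: the long simple root. Hence the indicator of i+1 < n on the second term of [xmx]. *)
Definition o0 n (i : 'I_n) : 'I_(n + n) := lshift n i.
Definition o1 n (i : 'I_n) : 'I_(n + n) := Ordinal (o1_subproof i).

(* The one-parameter subgroup of the simple root of index [i]. *)
Definition xmx n (i : 'I_n) (s : C) : 'M[C]_(n + n) :=
  1%:M + s *: (delta_mx (o0 i) (o1 i) - (i.+1 < n)%N%:R *: delta_mx (rev_ord (o1 i)) (rev_ord (o0 i))).

Lemma xmxE n (i : 'I_n) s (a b : 'I_(n + n)) : xmx i s a b =
  (a == b)%:R + s * (((a == o0 i) && (b == o1 i))%:R -
    ((i.+1 < n)%N && (a == rev_ord (o1 i)) && (b == rev_ord (o0 i)))%:R).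
Proof.
rewrite !mxE -andbA; congr (_ + _ * (_ - _)).
by case: (i.+1 < n)%N; rewrite ?mul1r ?mul0r.
Qed.

Lemma xmx_0 n s : xmx (ord0 : 'I_n.+1) s = hmx (fun b => s * (b == 1%N)%:R).
Proof.
apply: mx_midP; [move=> i j|move=> i|move=> i|move=> j|move=> j| | | |];
  rewrite xmxE hmxE -?val_eqE /= ?eqSS.
all: try have li := ltn_ord i; try have lj := ltn_ord j.
3: {
  have -> : (i.+1 == n + n.+1)%N = false by lia.
  have -> : ((n + n - i.+1)%N == 0)%N = (i.+1 == n + n)%N by lia.
  have -> : ((1 < n.+1) && (i.+1 == n.+1 + n.+1 - 2) && (n + n.+1 == n.+1 + n.+1 - 1))%N =
    (i.+1 == n + n)%N by lia.
  case: eqP => h; last by rewrite ?(mulr0, subr0, addr0).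
  rewrite /sg; case: ifP; first by lia.
  by move=> _; rewrite sub0r !mulr1 mulrN1 mulN1r add0r. }
all: repeat match goal with |- context [nat_of_bool ?b] =>
  first [have -> : b = false by lia | have -> : b = true by lia
        | let e := fresh "e" in set e := nat_of_bool b] end.
all: repeat match goal with e := nat_of_bool _ |- _ => unfold e; clear e end.
all: try by rewrite /= ?(mulr0n, mulr1n) ?(subrr, subr0, mulr0, addr0, add0r).
have -> : (n + n.+1 == 1)%N = (n + n == 0)%N by lia.
by rewrite /= ?(mulr0n, mulr1n) subr0 add0r.
Qed.

Lemma xmx_S n (i : 'I_n) s : xmx (lift ord0 i) s = iota_mx (xmx i s).
Proof.
have e0 : o0 (lift ord0 i) = mid (o0 i) by apply: val_inj.
have e1 : o1 (lift ord0 i) = mid (o1 i) by apply: val_inj.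
apply: mx_midP => *; rewrite iotaE xmxE e0 e1 !rev_mid !eqI ?andbF /= ?subrr ?mulr0 ?addr0 //.
by rewrite xmxE.
Qed.

Lemma Sp_xmx n (i : 'I_n) s : Sp (xmx i s).
Proof.
elim: n i => [[] //|n IH] i; case: (unliftP ord0 i) => [j|] ->.
  by rewrite xmx_S; apply: Sp_iota.
by rewrite xmx_0; apply: Sp_hmx.
Qed.

Lemma row_xmx n (i : 'I_n) s (f : 'I_(n + n) -> C) b : \sum_a f a * xmx i s a b =
  f b + s * ((b == o1 i)%:R * f (o0 i) - ((i.+1 < n)%N && (b == rev_ord (o0 i)))%:R * f (rev_ord (o1 i))).
Proof.
have d (c : bool) k : \sum_a f a * ((a == k) && c)%:R = c%:R * f k.
  rewrite (bigD1 k) //= eqxx /= mulrC big1 ?addr0 // => a /negbTE ->.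
  by rewrite mulr0.
under eq_bigr do rewrite xmxE mulrDr mulrCA mulrBr.
rewrite big_split /= -mulr_sumr sumrB d; congr (_ + _ * (_ - _)).
  by have := d true b; rewrite mul1r => <-; apply: eq_bigr => a _; rewrite andbT.
by rewrite -d; apply: eq_bigr => a _; rewrite andbA [(a == _) && _]andbC.
Qed.

(** For index 0 the root element is itself Heisenberg: [hmx_mul] adds s to column 1 and, if n > 0,
    through the symplectic form a multiple of column 2n to column 2n+1. For a larger index it lies
    in the middle block: [hmx_iota] lets it act linearly on row 0, and the induction hypothesis
    treats the other rows. *)
Lemma umx_xmx n (i : 'I_n) s y : umx n y *m xmx i s = umx n (fun v => y v + s * delta n i y v).
Proof.
elim: n i y => [[] //|n IH] i y; case: (unliftP ord0 i) => [j|] ->.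
  rewrite xmx_S /= -mulmxA (@hmx_iota _ _ _ _ (fun b => y (0%N, b) + s * delta n.+1 j.+1 y (0%N, b))); first last.
  - rewrite /delta /=; have lj := ltn_ord j.
    have -> : ((n + n).+1 == j.+2)%N = false by lia.
    have -> : ((n + n).+1 == n.+1.*2 - j.+2)%N = false by lia.
    by rewrite mulr0 addr0.
  - move=> b; have lb := ltn_ord b; have lj := ltn_ord j.
    rewrite row_xmx; congr (_ + _ * _).
    rewrite /delta /= -!val_eqE /= !eqSS !ltnS.
    have -> : (b.+1 == n.+1.*2 - j.+2)%N = ((b : nat) == n + n - j.+1)%N by lia.
    have -> : (n.+1.*2 - j.+3 = (n + n - j.+2).+1)%N by lia.
    case: eqP => [bj|_].
      have bj' : (b : nat) = j.+1 := bj.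
      have -> : (j.+1 < n)%N && ((b : nat) == n + n - j.+1)%N = false by lia.
      by rewrite mul1r mul0r subr0.
    by rewrite andbC mul0r sub0r; case: ifP; rewrite ?mul1r ?mul0r ?oppr0.
  - exact: Sp_xmx.
  rewrite mulmxA -iota_mul IH; congr (iota_mx _ *m _); apply: umx_ext => -[a b] _.
  rewrite /shift /= /delta /= /bump /= add1n !eqSS !ltnS doubleS.
  have -> : (n.*2.+2 - (j.+2)%N)%N = (n.*2 - j)%N by lia.
  have -> : (n.*2.+2 - (j.+3)%N)%N = (n.*2 - j.+1)%N by lia.
  have lj := ltn_ord j.
  have -> : (b.+1 == n.*2 - j)%N = (b == n.*2 - j.+1)%N by lia.
  have -> : (n.*2 - j.+2).+1 = (n.*2 - j.+1)%N by lia.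
  by [].
rewrite xmx_0 /= -mulmxA hmx_mul; congr (iota_mx (umx n _) *m _).
  by apply/funext => -[a b]; rewrite /shift /delta /= mulr0 addr0.
apply: hmx_ext => b hb; rewrite -addrA; congr (_ + _); rewrite /delta /=.
have [->|b1] := eqVneq b 1%N; rewrite ?mulr1 ?mulr0 ?add0r.
  have [n0|n0] := posnP n; last first.
    by rewrite (_ : (1 == (n + n).+1)%N = false) ?mul0r ?addr0 //; lia.
  by rewrite big1 ?mulr0 ?addr0 // => a; have := ltn_ord a; lia.
have [e|ne] := eqVneq b (n + n).+1; last first.
  rewrite mul0r (_ : (b == n.+1.*2 - 1)%N = false) ?mulr0 //; lia.
have n0 : (0 < n)%N by lia.
have pn : ((n + n).-1 < n + n)%N by lia.
rewrite mul1r (bigD1 (Ordinal pn)) //= [X in _ + X]big1 ?addr0; last first.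
  move=> a; rewrite -val_eqE /= => an; have la := ltn_ord a.
  by rewrite (_ : ((n + n - a.+1).+1 == 1)%N = false) ?mulr0 //; lia.
rewrite (_ : ((n + n - (n + n).-1.+1).+1 == 1)%N = true); last lia.
rewrite (_ : (b == n.+1.*2 - 1)%N && (1 < n.+1)%N = true); last lia.
rewrite /sg /= (_ : ((n + n).-1 < n)%N = false); last lia.
rewrite (_ : (n.+1.*2 - 2)%N = (n + n).-1.+1); last lia.
by rewrite mulr1; ring.
Qed.

End Coordinates.

(** * Minors and lowest terms *)

Section Minors.
Context {R : realType}.
Local Notation C := R[i].

Definition lrow n k (kN : (k <= n + n)%N) (a : 'I_k) : 'I_(n + n) := rev_ord (widen_ord kN a).

(** Only the rows are arbitrary; the columns are always the last k. This makes these minors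
    invariant under right multiplication by lower unitriangular matrices, as are the functions g ->
    f(g x0) below. *)
Definition mxminor n k (kN : (k <= n + n)%N) (f : 'I_k -> 'I_(n + n)) (g : 'M[C]_(n + n)) : C :=
  \det (\matrix_(a < k, b < k) g (f a) (lrow kN b)).

Definition tminor n k (kN : (k <= n + n)%N) (g : 'M[C]_(n + n)) : C := mxminor kN (lrow kN) g.

Lemma lrow_inj n k (kN : (k <= n + n)%N) : injective (lrow kN).
Proof. by move=> a b /rev_ord_inj /(congr1 val) /= /val_inj. Qed.

Lemma sum_lrow n k (kN : (k <= n + n)%N) (F : 'I_(n + n) -> C) :
  (forall c : 'I_(n + n), (c < n + n - k)%N -> F c = 0) -> \sum_c F c = \sum_(d < k) F (lrow kN d).
Proof.
move=> F0; rewrite (reindex_inj rev_ord_inj) (bigID (fun c : 'I_(n + n) => (c < k)%N)) /=.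
rewrite (big_ord_narrow kN) [X in _ + X]big1 ?addr0 // => c ck.
by apply: F0 => /=; have := ltn_ord c; lia.
Qed.

Lemma mnr_mulr n k (kN : (k <= n + n)%N) f (g b : 'M[C]_(n + n)) :
  (forall (c : 'I_(n + n)) (l : 'I_k), (c < n + n - k)%N -> b c (lrow kN l) = 0) ->
  mxminor kN f (g *m b) = mxminor kN f g * tminor kN b.
Proof.
move=> b0; rewrite /tminor /mxminor -det_mulmx; congr (\det _); apply/matrixP => a l.
rewrite !mxE (sum_lrow kN) => [|c ck]; last by rewrite b0 ?mulr0.
by apply: eq_bigr => d _; rewrite !mxE.
Qed.

Lemma Dk_tr n k (kN : (k <= n + n)%N) (g : 'M[C]_(n + n)) : tminor kN g^T = tminor kN g.
Proof.
rewrite /tminor /mxminor -[LHS]det_tr; congr (\det _); apply/matrixP => a b; by rewrite !mxE.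
Qed.

Lemma lrow_val n k (kN : (k <= n + n)%N) (a : 'I_k) : lrow kN a = (n + n - a.+1)%N :> nat.
Proof. by []. Qed.

Lemma mnr_mul_lower n k (kN : (k <= n + n)%N) f (g b : 'M[C]_(n + n)) :
  (forall i j : 'I_(n + n), (i < j)%N -> b i j = 0) -> mxminor kN f (g *m b) = mxminor kN f g * tminor kN b.
Proof.
move=> b0; apply: mnr_mulr => c l ck; apply: b0; rewrite lrow_val.
by have := ltn_ord l; lia.
Qed.

Lemma Dk_mul_upper n k (kN : (k <= n + n)%N) (u g : 'M[C]_(n + n)) :
  (forall i j : 'I_(n + n), (j < i)%N -> u i j = 0) -> tminor kN (u *m g) = tminor kN u * tminor kN g.
Proof.
move=> u0; rewrite -Dk_tr trmx_mul /tminor mnr_mul_lower => [|i j ij]; last by rewrite mxE u0.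
by rewrite -!/(tminor _ _) !Dk_tr mulrC.
Qed.

Lemma Dk_upper n k (kN : (k <= n + n)%N) (u : 'M[C]_(n + n)) :
  (forall i j : 'I_(n + n), (j < i)%N -> u i j = 0) -> tminor kN u = \prod_(a < k) u (lrow kN a) (lrow kN a).
Proof.
move=> u0; rewrite /tminor /mxminor det_trig; last first.
  apply/is_trig_mxP => a b ab; rewrite mxE u0 // !lrow_val.
  by have := ltn_ord b; lia.
by apply: eq_bigr => a _; rewrite mxE.
Qed.

Lemma Dk_utri n k (kN : (k <= n + n)%N) (u : 'M[C]_(n + n)) : utri u -> tminor kN u = 1.
Proof.
move=> uu; rewrite Dk_upper => [|i j ij]; last by rewrite uu ?(ltnW ij) // -val_eqE gtn_eqF.
by rewrite big1 // => a _; rewrite uu // eqxx.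
Qed.

Lemma Dk_lower1 n k (kN : (k <= n + n)%N) (u : 'M[C]_(n + n)) : utri u^T -> tminor kN u = 1.
Proof. by move=> uu; rewrite -Dk_tr Dk_utri. Qed.

Lemma xmx_utri n (i : 'I_n) (s : C) : utri (xmx i s).
Proof.
move=> a b ba; rewrite xmxE; have li := ltn_ord i; have la := ltn_ord a.
have -> : (a == o0 i) && (b == o1 i) = false by rewrite -!val_eqE /=; lia.
have -> : (i.+1 < n)%N && (a == rev_ord (o1 i)) && (b == rev_ord (o0 i)) = false.
  by rewrite -!val_eqE /=; lia.
by rewrite subrr mulr0 addr0.
Qed.

(** [xmx i s] adds to a column a multiple of its left neighbour. For k <= n this leads out of the
    last k columns only if k = i+1. *)
Lemma mnr_xmx_neq n k (kN : (k <= n + n)%N) f g (i : 'I_n) s : (k <= n)%N -> k != i.+1 ->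
  mxminor kN f (g *m xmx i s) = mxminor kN f g.
Proof.
move=> kn ki; rewrite mnr_mulr ?Dk_utri ?mulr1 //; first exact: xmx_utri.
move=> c l ck; rewrite xmxE; have li := ltn_ord i; have ll := ltn_ord l.
have -> : (c == lrow kN l) = false by rewrite -val_eqE /=; lia.
have -> : (c == o0 i) && (lrow kN l == o1 i) = false by rewrite -!val_eqE /=; lia.
have -> : (i.+1 < n)%N && (c == rev_ord (o1 i)) && (lrow kN l == rev_ord (o0 i)) = false.
  by rewrite -!val_eqE /=; lia.
by rewrite subrr mulr0 addr0.
Qed.

(** In size i+1 the new column enters only at position [ord_max]; the cofactors along this position
    do not depend on s, so the minor is affine in s. *)
Lemma mnr_xmx_eq n (i : 'I_n) (kN : (i.+1 <= n + n)%N) f g :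
  exists d, forall s, mxminor kN f (g *m xmx i s) = mxminor kN f g + s * d.
Proof.
have li := ltn_ord i.
pose A s := \matrix_(a < i.+1, b < i.+1) (g *m xmx i s) (f a) (lrow kN b).
have colA s a b : A s a b = g (f a) (lrow kN b) + s * (b == ord_max)%:R *
    ((i.+1 == n)%:R * g (f a) (o0 i) - (i.+1 < n)%N%:R * g (f a) (rev_ord (o1 i))).
  have lb := ltn_ord b.
  rewrite !mxE row_xmx -mulrA; congr (_ + _ * _); rewrite mulrBr.
  have -> : (lrow kN b == o1 i) = (b == ord_max) && (i.+1 == n) by rewrite -!val_eqE /=; lia.
  have -> : (lrow kN b == rev_ord (o0 i)) = (b == ord_max) by rewrite -!val_eqE /=; lia.
  by rewrite [(i.+1 < n)%N && _]andbC; case: (b == ord_max); rewrite /= ?(mul0r, mul1r).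
have cofA s a : cofactor (A s) a ord_max = cofactor (A 0) a ord_max.
  congr (_ * \det _); apply/matrixP => x y; rewrite [LHS]mxE [RHS]mxE [LHS]mxE [RHS]mxE !colA.
  have -> : (lift ord_max y == ord_max :> 'I_i.+1) = false.
    by rewrite eq_sym; apply/negbTE/neq_lift.
  by rewrite mulr0 !mul0r.
exists (\sum_a ((i.+1 == n)%:R * g (f a) (o0 i) - (i.+1 < n)%N%:R * g (f a) (rev_ord (o1 i))) * cofactor (A 0) a ord_max).
have E s : mxminor kN f (g *m xmx i s) = \sum_a A s a ord_max * cofactor (A 0) a ord_max.
  rewrite /mxminor -/(A s) (expand_det_col _ ord_max); by apply: eq_bigr => a _; rewrite cofA.
have x0 : xmx i 0 = 1%:M :> 'M[C]_(n + n) by rewrite /xmx scale0r addr0.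
move=> s; rewrite -{2}[g]mulmx1 -x0 !E mulr_sumr -big_split /=; apply: eq_bigr => a _.
by rewrite !colA eqxx mul0r mul0r addr0 mulr1 mulrDl !mulrA.
Qed.

Definition fcons (A : Type) k (a : A) (g : 'I_k -> A) (i : 'I_k.+1) : A :=
  if unlift ord0 i is Some j then g j else a.

Lemma fcons0 A k (a : A) (g : 'I_k -> A) : fcons a g ord0 = a.
Proof. by rewrite /fcons unlift_none. Qed.
Lemma fconsS A k (a : A) (g : 'I_k -> A) j : fcons a g (lift ord0 j) = g j.
Proof. by rewrite /fcons liftK. Qed.

Lemma mnr_row0 n k (kN : (k.+1 <= n + n)%N) (kN' : (k <= n + n)%N) (r : 'I_(n + n)) f (g : 'M[C]_(n + n)) :
  (forall b : 'I_k.+1, b != ord_max -> g r (lrow kN b) = 0) ->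
  mxminor kN (fcons r f) g = g r (lrow kN ord_max) * (-1) ^+ k * mxminor kN' f g.
Proof.
move=> g0; rewrite /mxminor (expand_det_row _ ord0) (bigD1 ord_max) //= big1 ?addr0; last first.
  by move=> b bm; rewrite mxE fcons0 g0 ?mul0r.
rewrite mxE fcons0 -mulrA /cofactor add0n; congr (_ * (_ * \det _)).
apply/matrixP => a b; rewrite !mxE fconsS; congr (g _ _); apply: val_inj => /=.
by rewrite /bump leqNgt ltn_ord.
Qed.

Lemma mnr_last_iota n k (kN : (k.+1 <= n.+1 + n.+1)%N) (kN' : (k <= n + n)%N) f (u : 'M[C]_(n + n)) :
  mxminor kN (fcons last' (fun a => mid (f a))) (iota_mx u) = mxminor kN' f u.
Proof.
have l0 : lrow kN ord0 = last' by apply: val_inj => /=; lia.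
have lS b : lrow kN (lift ord0 b) = mid (lrow kN' b).
  by case: b => b lb; apply: val_inj; rewrite /= /bump leq0n add1n; rewrite /= in lb; lia.
rewrite /mxminor (expand_det_row _ ord0) (bigD1 ord0) //= big1 ?addr0; last first.
  move=> b; rewrite eq_sym => /unlift_some [j -> _].
  by rewrite mxE fcons0 lS iotaE mul0r.
rewrite mxE fcons0 l0 iotaE mul1r /cofactor expr0 mul1r; congr (\det _).
by apply/matrixP => a b; rewrite [LHS]mxE [LHS]mxE [LHS]mxE [RHS]mxE fconsS lS iotaE.
Qed.

(** As r vanishes beyond k+1 (up to the middle's end), the relevant columns of [hmx r] reach only
    the last k+1 columns of u, and a square matrix [T] splits off. Apart from the column for [last']
    its columns are unit vectors, so its determinant is r (k+1) up to sign. *)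
Lemma mnr_midE n k (kN : (k.+1 <= n.+1 + n.+1)%N) (kN' : (k.+1 <= n + n)%N) f
    (u : 'M[C]_(n + n)) (r : nat -> C) : (k < n)%N -> (forall b, (k.+1 < b <= n + n)%N -> r b = 0) ->
  mxminor kN (fun a => mid (f a)) (iota_mx u *m hmx r) = - (-1) ^+ k * r k.+1 * mxminor kN' f u.
Proof.
move=> kn r0.
have l0 : lrow kN ord0 = last' by apply: val_inj => /=; lia.
have lS (b : 'I_k) : lrow kN (lift ord0 b) = mid (lrow kN' (widen_ord (leqnSn k) b)).
  by case: b => b lb; apply: val_inj; rewrite /= /bump leq0n add1n; rewrite /= in lb; lia.
pose T : 'M[C]_k.+1 := \matrix_(l, b) if unlift ord0 b is Some b' then (l == b' :> nat)%:R
   else sg (lrow kN' l) * r l.+1.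
have E : \matrix_(a < k.+1, b < k.+1) (iota_mx u *m hmx r) (mid (f a)) (lrow kN b) =
    (\matrix_(a < k.+1, b < k.+1) u (f a) (lrow kN' b)) *m T.
  apply/matrixP => a b; rewrite [LHS]mxE [LHS]mxE big_mid !iotaE !mul0r add0r addr0.
  under eq_bigr do rewrite iotaE.
  case: (unliftP ord0 b) => [b'|] ->.
    rewrite lS !mxE; under eq_bigr do rewrite hmxE.
    rewrite (bigD1 (lrow kN' (widen_ord (leqnSn k) b'))) //= eqxx mulr1 big1 ?addr0; last first.
      by move=> c /negbTE ->; rewrite mulr0.
    rewrite (bigD1 (widen_ord (leqnSn k) b')) //= !mxE liftK eqxx mulr1 big1 ?addr0 // => l lb.
    by rewrite !mxE liftK -[(_ == _ :> nat)]/(l == widen_ord (leqnSn k) b') (negbTE lb) mulr0.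
  rewrite l0 [RHS]mxE (sum_lrow kN'); last first.
    move=> c ck; rewrite hmxE r0 ?mulr0 //= ; have := ltn_ord c; lia.
  apply: eq_bigr => l _; rewrite hmxE !mxE unlift_none rev_ordK.
  by congr (_ * (_ * r _.+1)).
rewrite {1}/mxminor E det_mulmx -/(mxminor _ _ _).
have -> : \det T = T ord_max ord0 * (-1) ^+ k.
  rewrite (expand_det_row _ ord_max) (bigD1 ord0) //= big1 ?addr0; last first.
    move=> b; rewrite eq_sym => /unlift_some [j -> _]; rewrite mxE liftK.
    by rewrite gtn_eqF ?mul0r //= ltn_ord.
  rewrite /cofactor addn0 [X in \det X](_ : _ = 1%:M) ?det1 ?mulr1 //.
  apply/matrixP => a b; rewrite !mxE liftK /=; congr (_%:R).
  by rewrite /bump leqNgt ltn_ord.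
have TE : T ord_max ord0 = - r k.+1.
  rewrite mxE unlift_none /sg /= ; case: ifP; first by lia.
  by rewrite mulN1r.
by rewrite TE; ring.
Qed.

Lemma umx_row0 n (y : nat * nat -> C) : (umx n.+1 y ord0 ord0 = 1) /\ (forall b : 'I_(n.+1 + n.+1), (0 < b)%N -> umx n.+1 y ord0 b = y (0%N, b : nat)).
Proof.
have E b : umx n.+1 y ord0 b = hmx (fun b => y (0%N, b)) ord0 b.
  rewrite /= mxE big_mid !iotaE mul1r mul0r addr0 big1 ?addr0 // => i _.
  by rewrite iotaE mul0r.
split; first by rewrite E hmxE.
apply: (@mid_ind n) => [||b] // _; rewrite E hmxE //=.
by congr (y (_, _)); lia.
Qed.

Lemma umx_zero_row n (y : nat * nat -> C) : (forall b, (0 < b <= n.*2.+1)%N -> y (0%N, b) = 0) ->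
  umx n.+1 y = iota_mx (umx n (shift y)).
Proof.
move=> y0 /=; rewrite (@hmx_ext _ _ _ (fun b => 0 * (b == 1%N)%:R)); last first.
  by move=> b hb; rewrite y0 ?mul0r //; lia.
by rewrite -xmx_0 /xmx scale0r addr0 mulmx1.
Qed.

End Minors.

(** * Polynomial functions and their lowest exponents *)

Section PolynomialFunctions.
Variables (F : numFieldType) (V : eqType).
Implicit Types (f g : (V -> F) -> F).

(** A predicate on functions, so that the type of variables may be infinite, as [nat * nat] is. Its
    uses are closure under determinants and products, and restriction to lines. *)
Inductive polyfun : ((V -> F) -> F) -> Prop :=
| PFconst c : polyfun (fun _ => c)
| PFvar v : polyfun (fun x => x v)
| PFadd f g : polyfun f -> polyfun g -> polyfun (fun x => f x + g x)
| PFmul f g : polyfun f -> polyfun g -> polyfun (fun x => f x * g x).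

Lemma PF_sum (I : Type) (r : seq I) (P : pred I) (f : I -> (V -> F) -> F) :
  (forall i, polyfun (f i)) -> polyfun (fun x => \sum_(i <- r | P i) f i x).
Proof.
move=> Pf; elim: r => [|i r IH].
  by rewrite (_ : (fun _ => _) = fun _ => 0); [apply: PFconst|apply/funext => x; rewrite big_nil].
have [Pi|nPi] := boolP (P i).
  rewrite (_ : (fun _ => _) = fun x => f i x + \sum_(i <- r | P i) f i x); first exact: PFadd.
  by apply/funext => x; rewrite big_cons Pi.
by rewrite (_ : (fun _ => _) = fun x => \sum_(i <- r | P i) f i x) //; apply/funext => x; rewrite big_cons (negbTE nPi).
Qed.

Lemma PF_prod (I : Type) (r : seq I) (P : pred I) (f : I -> (V -> F) -> F) :
  (forall i, polyfun (f i)) -> polyfun (fun x => \prod_(i <- r | P i) f i x).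
Proof.
move=> Pf; elim: r => [|i r IH].
  by rewrite (_ : (fun _ => _) = fun _ => 1); [apply: PFconst|apply/funext => x; rewrite big_nil].
have [Pi|nPi] := boolP (P i).
  rewrite (_ : (fun _ => _) = fun x => f i x * \prod_(i <- r | P i) f i x); first exact: PFmul.
  by apply/funext => x; rewrite big_cons Pi.
by rewrite (_ : (fun _ => _) = fun x => \prod_(i <- r | P i) f i x) //; apply/funext => x; rewrite big_cons (negbTE nPi).
Qed.

Lemma PF_exp f k : polyfun f -> polyfun (fun x => f x ^+ k).
Proof.
move=> Pf; have := @PF_prod 'I_k (index_enum 'I_k) predT (fun _ => f) (fun _ => Pf).
by congr polyfun; apply/funext => x; rewrite prodr_const card_ord.
Qed.

Lemma PF_det k (A : (V -> F) -> 'M[F]_k) : (forall i j, polyfun (fun x => A x i j)) -> polyfun (fun x => \det (A x)).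
Proof.
move=> PA; apply: PF_sum => s; apply: PFmul; first exact: PFconst.
by apply: PF_prod => i; apply: PA.
Qed.

Lemma PF_mulmx m n p (A : (V -> F) -> 'M[F]_(m, n)) (B : (V -> F) -> 'M[F]_(n, p)) :
  (forall i j, polyfun (fun x => A x i j)) -> (forall i j, polyfun (fun x => B x i j)) ->
  forall i j, polyfun (fun x => (A x *m B x) i j).
Proof.
move=> PA PB i j; rewrite (_ : (fun _ => _) = fun x => \sum_k A x i k * B x k j); last first.
  by apply/funext => x; rewrite mxE.
by apply: PF_sum => k; apply: PFmul.
Qed.

Lemma PF_poly f : polyfun f -> forall x v, exists P : {poly F}, forall z, f (upd x v z) = P.[z].
Proof.
elim=> {f} [c|u|f g _ IHf _ IHg|f g _ IHf _ IHg] x v.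
- by exists c%:P => z; rewrite hornerC.
- have [->|uv] := eqVneq u v; first by exists 'X => z; rewrite hornerX /upd eqxx.
  by exists (x u)%:P => z; rewrite hornerC /upd (negbTE uv).
- by have [P PE] := IHf x v; have [Q QE] := IHg x v; exists (P + Q) => z; rewrite hornerD PE QE.
- by have [P PE] := IHf x v; have [Q QE] := IHg x v; exists (P * Q) => z; rewrite hornerM PE QE.
Qed.

(* [p] is the lowest exponent of [f] for the lexicographic order of [vs]: divide by
   the power of the first variable, set this variable to 0 and go on. *)
Fixpoint Lead (vs : seq V) f (p : V -> nat) : Prop :=
  if vs is v :: vs' then exists g, polyfun g /\ (forall x, f x = x v ^+ p v * g x) /\
     Lead vs' (fun x => g (upd x v 0)) p
  else f (fun _ => 0) != 0.

Lemma Lead_mul vs f g p q : Lead vs f p -> Lead vs g q ->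
  Lead vs (fun x => f x * g x) (fun v => p v + q v)%N.
Proof.
elim: vs f g => [|v vs IH] f g /=; first by move=> f0 g0; rewrite mulf_neq0.
move=> [f' [Pf [fE Lf]]] [g' [Pg [gE Lg]]]; exists (fun x => f' x * g' x).
split; first exact: PFmul.
by split=> [x|]; [rewrite fE gE exprD; ring|apply: IH].
Qed.

Lemma Lead_eqp vs f p q : {in vs, p =1 q} -> Lead vs f p -> Lead vs f q.
Proof.
elim: vs f => [|v vs IH] f //= e [g [Pg [fE L]]]; exists g; split=> //; split.
  by move=> x; rewrite fE e ?inE ?eqxx.
by apply: IH L => u uvs; apply: e; rewrite inE uvs orbT.
Qed.

Lemma Lead1 vs : Lead vs (fun _ => 1) (fun _ => 0%N).
Proof.
elim: vs => [|v vs IH] /=; first exact: oner_neq0.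
by exists (fun _ => 1); split; [exact: PFconst|split=> [x|//]; rewrite mulr1].
Qed.

Lemma Lead_scale vs f p (a : F) : a != 0 -> Lead vs f p -> Lead vs (fun x => a * f x) p.
Proof.
move=> a0; elim: vs f => [|v vs IH] f /=; first by move=> f0; rewrite mulf_neq0.
move=> [g [Pg [fE L]]]; exists (fun x => a * g x); split; first by apply: PFmul => //; apply: PFconst.
by split=> [x|]; [rewrite fE mulrCA|apply: IH].
Qed.

Lemma Lead_prod vs (I : Type) (r : seq I) (f : I -> (V -> F) -> F) (p : I -> V -> nat) :
  (forall i, Lead vs (f i) (p i)) ->
  Lead vs (fun x => \prod_(i <- r) f i x) (fun v => \sum_(i <- r) p i v)%N.
Proof.
move=> L; elim: r => [|i r IH].
  have := Lead1 vs; rewrite (_ : (fun _ => 1) = fun x => \prod_(i <- [::]) f i x); last first.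
    by apply/funext => x; rewrite big_nil.
  by apply: Lead_eqp => v _; rewrite big_nil.
have := Lead_mul (L i) IH; rewrite (_ : (fun _ => _) = fun x => \prod_(i <- i :: r) f i x); last first.
  by apply/funext => x; rewrite big_cons.
by apply: Lead_eqp => v _; rewrite big_cons.
Qed.

Definition zero_on (ws : seq V) (x : V -> F) : V -> F := fun u => if u \in ws then 0 else x u.

Lemma zero_on_cons v ws x : zero_on ws (upd x v 0) = zero_on (v :: ws) x.
Proof. by apply/funext => u; rewrite /zero_on /upd inE; case: (u \in ws); rewrite ?orbT ?orbF. Qed.

Lemma zero_on_eq ws ws' x : ws =i ws' -> zero_on ws x = zero_on ws' x.
Proof. by move=> e; apply/funext => u; rewrite /zero_on e. Qed.

Lemma PF_zero_on f ws : polyfun f -> polyfun (fun x => f (zero_on ws x)).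
Proof.
elim=> {f} [c|u|f g _ IHf _ IHg|f g _ IHf _ IHg].
- exact: PFconst.
- rewrite /zero_on; case: (u \in ws); [exact: PFconst|exact: PFvar].
- exact: PFadd.
- exact: PFmul.
Qed.

(** Where p is 0 the recursion of [Lead] divides by nothing, so all these variables are set to 0 at
    once. *)
Lemma Lead_zero ws vs f p : polyfun f -> {in ws, forall v, p v = 0%N} ->
  Lead vs (fun x => f (zero_on ws x)) p -> Lead (ws ++ vs) f p.
Proof.
elim: ws f => [|v ws IH] f Pf p0 L.
  by move: L; rewrite (_ : (fun _ => _) = f) //; apply/funext => x; congr f; apply/funext.
exists f; split=> //; split; first by move=> x; rewrite p0 ?inE ?eqxx // expr0 mul1r.
have E x : f (upd x v 0) = f (zero_on [:: v] x).
  by congr f; apply/funext => u; rewrite /upd /zero_on inE.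
rewrite (_ : (fun _ => _) = fun x => f (zero_on [:: v] x)); last by apply/funext => x; rewrite E.
apply: IH; first exact: PF_zero_on.
  by move=> u uws; apply: p0; rewrite inE uws orbT.
move: L; congr Lead; apply/funext => x; congr f; apply/funext => u.
by rewrite /zero_on !inE; case: eqP.
Qed.

Lemma Lead_cons v vs f g p : polyfun g -> (forall x, f x = x v ^+ p v * g x) ->
  Lead vs (fun x => g (upd x v 0)) p -> Lead (v :: vs) f p.
Proof. by move=> Pg fE L; exists g. Qed.

Lemma Lead_lexmin (T : eqType) (vs : seq V) (S : seq T) (c : T -> F) (e : T -> V -> nat) f p :
  uniq vs -> uniq S -> (forall k l, k \in S -> l \in S -> {in vs, e k =1 e l} -> k = l) ->
  (forall k, k \in S -> c k != 0) ->
  (forall x, f x = \sum_(k <- S) c k * mon vs (e k) x) -> Lead vs f p ->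
  exists k0, [/\ k0 \in S, {in vs, e k0 =1 p} & forall k pre v post, k \in S ->
     vs = pre ++ v :: post -> agree e p pre k -> (p v <= e k v)%N].
Proof.
elim: vs S f => [|v vs IH] S f /=.
  move=> _ uS dist c0 fE f0; case: S uS dist c0 fE => [|k0 S] uS dist c0 fE.
    by move: f0; rewrite fE big_nil eqxx.
  exists k0; split=> //; first by rewrite inE eqxx.
  by move=> k [].
move=> /andP [vvs uvs] uS dist c0 fE [g [Pg [gE L]]].
pose S' := [seq k <- S | e k v == p v].
have mon_cons q (x : V -> F) : mon (v :: vs) q x = x v ^+ q v * mon vs q x.
  by rewrite /mon big_cons.
have monupd q (x : V -> F) z : mon vs q (upd x v z) = mon vs q x.
  by apply: eq_big_seq => u uvs'; rewrite /upd; case: eqP => // uv; move: vvs; rewrite -uv uvs'.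
have key x : exists P : {poly F}, (forall z, g (upd x v z) = P.[z]) /\
    \sum_(k <- S) (c k * mon vs (e k) x) *: 'X^(e k v) = 'X^(p v) * P.
  have [P PE] := PF_poly Pg x v; exists P; split=> //.
  apply/eqP; rewrite -subr_eq0; apply/eqP; apply: (@poly_fun_eq0 _ _ [::]) => z _.
  have := gE (upd x v z); rewrite fE PE {2}/upd eqxx => E.
  rewrite hornerD hornerN hornerM hornerXn -E horner_sum -sumrB big1 // => k _.
  by rewrite mon_cons monupd {1}/upd eqxx hornerZ hornerXn; ring.
have coefE x a : (\sum_(k <- S) (c k * mon vs (e k) x) *: 'X^(e k v))`_a =
   \sum_(k <- S | e k v == a) c k * mon vs (e k) x.
  rewrite coef_sum [RHS]big_mkcond /=; apply: eq_bigr => k _.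
  by rewrite coefZ coefXn eq_sym; case: eqP; rewrite ?mulr1 ?mulr0.
have ple k : k \in S -> (p v <= e k v)%N.
  move=> kS; rewrite leqNgt; apply/negP => lt.
  suff : c k = 0 by move/eqP; rewrite (negbTE (c0 k kS)).
  apply: (@mon_independent_seq _ _ _ e vs [seq j <- S | e j v == e k v] c); first exact: filter_uniq.
  - move=> i j; rewrite !mem_filter => /andP [/eqP ei iS] /andP [/eqP ej jS] eij.
    apply: dist => // u; rewrite inE => /orP [/eqP ->|/eij //]; by rewrite ei ej.
  - move=> x _; rewrite big_filter -coefE; have [P [_ ->]] := key x.
    by rewrite coefXnM lt.
  - by rewrite mem_filter eqxx.
have gE0 x : g (upd x v 0) = \sum_(k <- S') c k * mon vs (e k) x.
  rewrite big_filter -coefE; have [P [PE ->]] := key x.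
  by rewrite coefXnM ltnn subnn PE horner_coef0.
have [|||k0 [k0S ek0 hk0]] := IH S' (fun x => g (upd x v 0)) uvs _ _ _ gE0 L.
- exact: filter_uniq.
- move=> i j; rewrite !mem_filter => /andP [/eqP ei iS] /andP [/eqP ej jS] eij.
  apply: dist => // u; rewrite inE => /orP [/eqP ->|/eij //]; by rewrite ei ej.
- by move=> k; rewrite mem_filter => /andP [_ /c0].
move: k0S; rewrite mem_filter => /andP [/eqP ek0v k0S]; exists k0; split=> //.
  by move=> u; rewrite inE => /orP [/eqP ->|/ek0].
move=> k [|w pre] u post kS /=; first by move=> [<- _] _; apply: ple.
move=> [<- E] /andP [/eqP ekw ak]; apply: (hk0 k pre u post _ E ak).
by rewrite mem_filter ekw eqxx.
Qed.

End PolynomialFunctions.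

Lemma PF_comp (F : numFieldType) (V V' : eqType) (phi : V -> V') (f : (V -> F) -> F) :
  polyfun f -> polyfun (fun x : V' -> F => f (fun v => x (phi v))).
Proof.
elim=> {f} [c|u|f g _ IHf _ IHg|f g _ IHf _ IHg].
- exact: PFconst.
- exact: (PFvar F (phi u)).
- exact: (PFadd IHf IHg).
- exact: (PFmul IHf IHg).
Qed.

Lemma Lead_map (F : numFieldType) (V V' : eqType) (phi : V -> V') (vs : seq V) (f : (V -> F) -> F) (p : V' -> nat) :
  injective phi -> Lead vs f (fun v => p (phi v)) ->
  Lead (map phi vs) (fun x => f (fun v => x (phi v))) p.
Proof.
move=> phiI; elim: vs f => [|v vs IH] f //= [g [Pg [fE L]]].
exists (fun x => g (fun v => x (phi v))); split; first exact: PF_comp.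
split=> [x|]; first exact: fE.
have := IH _ L; congr Lead; apply/funext => x; congr g; apply/funext => u.
by rewrite /upd (inj_eq phiI).
Qed.

(** * Integer patterns and minors for fundamental weights *)

Definition up (v : nat * nat) := (v.1.+1, v.2.+1).

Lemma up_inj : injective up.
Proof. by move=> [a b] [c d] [-> ->]. Qed.

Lemma varsS n : vars n.+1 = vrow n.+1 0 ++ map up (vars n).
Proof.
rewrite /vars {1}/vrows /=; congr (_ ++ _).
rewrite /vrows map_flatten -map_comp -[1%N]/(1 + 0)%N iotaDl -map_comp; congr flatten.
apply: eq_map => m /=; rewrite /vrow add1n subSS -[m.+2]/(1 + m.+1)%N iotaDl -map_rev -!map_comp.
by apply: eq_map.
Qed.

(* The integral points of Delta'_lam for [a i = lam_i - lam_(i+1)]: see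
   [delta'_pattern]. *)
Definition pattern n (a : nat -> int) (p : nat * nat -> int) : Prop :=
  forall i m, (m <= i)%N -> (i < n)%N ->
    ((i.+1 < n)%N -> 0 <= p (m, (n.*2 - i.+1)%N) <= bound n i (a i) p m) /\
    0 <= p (m, i.+1) <= bound_half n i (a i) p m.

Lemma boundS n i a p m : bound n i a p m.+1 = bound_half n i a p m - p (m, i.+1) + p (m, i).
Proof. by []. Qed.

Lemma bound_shift n i a p m : (i < n)%N ->
  bound n.+1 i.+1 a p m.+1 = bound n i (bound n.+1 i.+1 a p 1) (fun v => p (up v)) m.
Proof.
move=> lin; elim: m => [//|m IH].
rewrite boundS [RHS]boundS /bound_half IH {IH}.
move: (bound n.+1 i.+1 a p 1) => B; rewrite /up /= ltnS; case: ifP => h //.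
have -> : (n.+1.*2 - i.+2 = (n.*2 - i.+1).+1)%N by lia.
by have -> : (n.+1.*2 - i.+3 = (n.*2 - i.+2).+1)%N by lia.
Qed.

(** The lower rows form a pattern for the smaller group, whose weight has the gaps reached by
    [bound] after row 0: one step of branching. *)
Lemma pattern_shift n a p : pattern n.+1 a p ->
  pattern n (fun i => bound n.+1 i.+1 (a i.+1) p 1) (fun v => p (up v)).
Proof.
move=> H i m mi lin; have [h1 h2] := H i.+1 m.+1 mi lin; split.
  move=> i1; move: (h1 i1); rewrite bound_shift //.
  move: (bound n.+1 i.+1 _ p 1) => B; rewrite /up /=.
  by have -> : (n.+1.*2 - i.+2 = (n.*2 - i.+1).+1)%N by lia.
move: h2; rewrite /bound_half bound_shift // ltnS.
move: (bound n.+1 i.+1 _ p 1) => B; rewrite /up /=; case: ifP => // i1.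
have -> : (n.+1.*2 - i.+2 = (n.*2 - i.+1).+1)%N by lia.
by have -> : (n.+1.*2 - i.+3 = (n.*2 - i.+2).+1)%N by lia.
Qed.

Lemma pattern_ext n a a' p : (forall i, (i < n)%N -> a i = a' i) -> pattern n a p -> pattern n a' p.
Proof. by move=> e H i m mi lin; have := H i m mi lin; rewrite e. Qed.

Lemma pattern_ge0 n a p : pattern n a p -> forall v, v \in vars n -> 0 <= p v.
Proof.
move=> H [m b]; rewrite mem_vars /= => /andP [mb bn].
have [bn'|nb] := leqP b n.
  have h1 : (m <= b.-1)%N by lia.
  have h2 : (b.-1 < n)%N by lia.
  by have [_ /andP []] := H _ _ h1 h2; rewrite prednK //; lia.
have h1 : (m <= n.*2 - b.+1)%N by lia.
have h2 : (n.*2 - b.+1 < n)%N by lia.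
have h3 : ((n.*2 - b.+1).+1 < n)%N by lia.
by have [/(_ h3) /andP [] ] := H _ _ h1 h2; rewrite (_ : (n.*2 - (n.*2 - b.+1).+1)%N = b) //; lia.
Qed.

(** For a fundamental weight each line of a Gelfand-Cetlin pattern is a string of ones followed by
    zeros. Here k, k' and k'' count the ones in theta, in eta and in the next theta; interlacing
    lets a count drop by at most one. Row 0 has a 1 in column 2n+2-k if k drops to k', and a 1 in
    column k' if k' > 0 does not drop. *)
Lemma fundamental_row n k p : (k <= n.+1)%N ->
  pattern n.+1 (fun i => (i.+1 == k)%:Z) p ->
  exists k' k'', [/\ (k' <= k <= k'.+1)%N, (k'' <= n)%N,
    forall b, (0 < b <= n.*2.+1)%N -> p (0%N, b) =
       ((b + k == n.*2.+2) && (k' < k))%N%:Z + ((b == k') && (k'' == k'))%N%:Z,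
    (k'' <= k' <= k''.+1)%N &
    pattern n (fun i => (i.+1 == k'')%:Z) (fun v => p (up v))].
Proof.
move=> kn H; have Hs := pattern_shift H.
(* Among the columns beyond n only 2n+2-k can carry a nonzero entry; for k = 0 it is not a
   column. *)
pose q1 := if k is 0 then 0 else p (0%N, (n.*2.+2 - k)%N).
have Z1 b : (n < b <= n.*2.+1)%N -> 0 <= p (0%N, b) <= (b + k == n.*2.+2)%N%:Z.
  move=> hb; have [bn|nb] := eqVneq b n.+1.
    have [_] := H n 0%N (leq0n _) (ltnSn _); rewrite /bound_half ltnn /= -bn.
    by rewrite (_ : (b == k) = (b + k == n.*2.+2)%N); last lia.
  have h2 : (n.*2.+1 - b < n.+1)%N by lia.
  have h3 : ((n.*2.+1 - b).+1 < n.+1)%N by lia.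
  have [/(_ h3)] := H _ 0%N (leq0n _) h2 => + _.
  rewrite /= (_ : (n.+1.*2 - (n.*2.+1 - b).+1)%N = b); last lia.
  by rewrite (_ : ((n.*2.+1 - b).+1 == k) = (b + k == n.*2.+2)%N); last lia.
have q1E b : (n < b <= n.*2.+1)%N -> p (0%N, b) = if (b + k == n.*2.+2)%N then q1 else 0.
  move=> hb; have := Z1 b hb; case: eqP => e; last by lia.
  by move=> _; rewrite /q1; case: k e {kn H Hs q1 Z1} => [|k'] e; [lia|congr (p (_, _)); lia].
have q1b : q1 = 0 \/ (q1 = 1 /\ (0 < k)%N).
  rewrite /q1; case: k kn {H Hs q1 q1E} Z1 => [|k'] kn Z1; first by left.
  have := Z1 (n.*2.+2 - k'.+1)%N; rewrite (_ : (_ + k'.+1 == n.*2.+2)%N = true); last lia.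
  by move=> /(_ ltac:(lia)) h; lia.
have [k' [k'k q1k]] : exists k', (k' <= k <= k'.+1)%N /\ q1 = (k' < k)%N%:Z.
  case: q1b => [->|[-> k0]]; [exists k|exists k.-1]; split; rewrite ?ltnn //; lia.
have bh i : (i < n)%N -> bound_half n.+1 i (i.+1 == k)%:Z p 0 = (i.+1 == k')%:Z.
  move=> lin; rewrite /bound_half ltnS lin /= !q1E; try lia.
  have -> : (n.+1.*2 - i.+1 + k == n.*2.+2)%N = (k == i.+1) by lia.
  have -> : (n.+1.*2 - i.+2 + k == n.*2.+2)%N = (k == i.+2) by lia.
  by rewrite q1k; case: ifP; case: ifP; lia.
have Z2 b : (0 < b <= n)%N -> 0 <= p (0%N, b) <= (b == k')%:Z.
  case: b => // i /= lin; have [_] := H i 0%N (leq0n _) (ltnW lin).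
  by rewrite bh.
pose q2 := if (0 < k' <= n)%N then p (0%N, k') else 0.
have q2E b : (0 < b <= n)%N -> p (0%N, b) = if b == k' then q2 else 0.
  move=> hb; have := Z2 b hb; case: eqP => e; last by lia.
  by rewrite /q2 -e hb.
have q2b : q2 = 0 \/ (q2 = 1 /\ (0 < k' <= n)%N).
  rewrite /q2; case: ifP => h; last by left.
  by have := Z2 k' h; rewrite eqxx; lia.
have [k'' [k''n k''k q2k]] : exists k'', [/\ (k'' <= n)%N, (k'' <= k' <= k''.+1)%N &
    q2 = ((0 < k') && (k'' == k'))%N%:Z].
  by case: q2b => [->|[-> h]]; [exists k'.-1|exists k']; split; lia.
exists k', k''; split=> //.
- move=> b hb; have [bn|nb] := leqP b n.
    rewrite q2E ?bn; last lia.
    by rewrite q2k; case: ifP; lia.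
  rewrite q1E ?nb; last lia.
  by rewrite q1k; case: ifP; lia.
- apply: pattern_ext Hs => i lin /=; rewrite ltnS.
  have E2 : p (0%N, i.+1) = if i.+1 == k' then q2 else 0 by apply: q2E; lia.
  have [i1n|ni1] := ltnP i.+1 n; last first.
    rewrite E2 (q1E i.+2); last lia.
    by rewrite q1k q2k; case: ifP; case: ifP; lia.
  have := bh i.+1 i1n; rewrite /bound_half ltnS i1n /= => ->.
  rewrite E2 (q2E i.+2); last lia.
  by rewrite q2k; case: ifP; case: ifP; lia.
Qed.

Section Fundamental.
Context {R : realType}.
Local Notation C := R[i].

Lemma PF_umx n (i j : 'I_(n + n)) : polyfun (fun y : nat * nat -> C => umx n y i j).
Proof.
elim: n i j => [|n IH] i j /=; first exact: PFconst.
apply: PF_mulmx => {i j} i j.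
  rewrite (_ : (fun _ => _) = fun y : nat * nat -> C => match pos i, pos j with
    | inl a, inl b => umx n (shift y) a b | inr x, inr y => (x == y)%:R | _, _ => 0 end).
    by case: (pos i) (pos j) => [a|?] [b|?]; try exact: PFconst; apply: (PF_comp up (IH a b)).
  by apply/funext => y; rewrite mxE.
rewrite (_ : (fun _ => _) = fun y : nat * nat -> C => match pos i, pos j with
    | inl a, inl b => (a == b)%:R
    | inr true, inr true => 1
    | inr true, _ => y (0%N, j : nat)
    | inl a, inr false => sg a * y (0%N, (rev_ord a).+1)
    | inr false, inr false => 1
    | _, _ => 0
    end); last by apply/funext => y; rewrite mxE.
case: (pos i) (pos j) => [a|[]] [b|[]]; try exact: PFconst; try exact: PFvar.
by apply: PFmul; [exact: PFconst|exact: PFvar].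
Qed.

Lemma PF_mnr n k (kN : (k <= n + n)%N) f (g : 'M[C]_(n + n)) : polyfun (fun y => mxminor kN f (g *m umx n y)).
Proof.
apply: PF_det => i j; rewrite (_ : (fun _ => _) = fun y => (g *m umx n y) (f i) (lrow kN j)); last first.
  by apply/funext => y; rewrite mxE.
by apply: PF_mulmx => a b; [exact: PFconst|exact: PF_umx].
Qed.

Lemma PF_mnr1 n k (kN : (k <= n + n)%N) f : polyfun (fun y : nat * nat -> C => mxminor kN f (umx n y)).
Proof.
have := PF_mnr kN f 1%:M; congr polyfun; apply/funext => y; by rewrite mul1mx.
Qed.

Lemma mnr0 n (kN : (0 <= n + n)%N) f (g : 'M[C]_(n + n)) : mxminor kN f g = 1.
Proof. exact: det_mx00. Qed.

Lemma shift_zero_on n ws (x : nat * nat -> C) : (forall v, v \in ws -> v.1 = 0%N) ->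
  umx n (shift (zero_on ws x)) = umx n (shift x).
Proof.
move=> h; congr umx; apply/funext => v; rewrite /shift /zero_on.
by case: ifP => // /h.
Qed.

Lemma vseg_row0 a k v : v \in vseg 0 a k -> v.1 = 0%N.
Proof. by rewrite mem_vseg => /andP [/eqP]. Qed.

(** The half step from k' to k'', when the columns of row 0 beyond j are already set to 0. If k'' =
    k' > 0, a minor with rows in the middle acquires the factor x (0, k') by [mnr_midE]; if k' = k''
    + 1, the row [last'] is added and row 0 contributes nothing. *)
Lemma lead_lower n k' k'' (kN' : (k' <= n.+1 + n.+1)%N) (kN'' : (k'' <= n + n)%N)
    (f : 'I_k'' -> 'I_(n + n)) (p : nat * nat -> nat) j :
  (k'' <= k' <= k''.+1)%N -> (k'' <= n)%N -> (k' <= j <= n.*2.+1)%N ->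
  (forall b, (0 < b <= j)%N -> p (0%N, b) = ((b == k') && (k'' == k')) :> nat) ->
  Lead (vars n) (fun y : nat * nat -> C => mxminor kN'' f (umx n y)) (fun v => p (up v)) ->
  exists g, Lead (vseg 0 1 j ++ map up (vars n))
    (fun x : nat * nat -> C => mxminor kN' g (umx n.+1 (zero_on (vseg 0 j.+1 (n.*2.+1 - j)) x))) p.
Proof.
move=> kk kn kj pE L; have Lm := Lead_map up_inj L.
pose A := vseg 0 j.+1 (n.*2.+1 - j).
have PFA g : polyfun (fun x : nat * nat -> C => mxminor kN' g (umx n.+1 (zero_on A x))).
  by apply: (PF_zero_on A (f := fun x => mxminor kN' g (umx n.+1 x))); apply: PF_mnr1.
have zeroAll (h : 'I_k' -> 'I_(n.+1 + n.+1)) : (forall u : 'M[C]_(n + n), mxminor kN' h (iota_mx u) = mxminor kN'' f u) ->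
    (forall b, (0 < b <= j)%N -> p (0%N, b) = 0%N) ->
    Lead (vseg 0 1 j ++ map up (vars n)) (fun x : nat * nat -> C => mxminor kN' h (umx n.+1 (zero_on A x))) p.
  move=> hE p0; apply: Lead_zero => //.
    by move=> [m b]; rewrite mem_vseg /= => /andP [/eqP -> hb]; apply: p0; lia.
  move: Lm; congr Lead; apply/funext => x.
  rewrite umx_zero_row; last first.
    move=> b hb; rewrite /zero_on !mem_vseg /=; case: ifP => // h1; case: ifP => // h2; lia.
  by rewrite hE !shift_zero_on // => v; apply: vseg_row0.
have [ek|ek] : k' = k'' \/ k' = k''.+1 by lia.
  case: k' => [|k'] in kN' kk kj pE PFA zeroAll ek *; last first.
    subst k''; exists (fun a => mid (f a)).
    have Es : vseg 0 1 j = vseg 0 k'.+2 (j - k'.+1) ++ (0%N, k'.+1) :: vseg 0 1 k'.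
      rewrite (_ : j = k' + (1 + (j - k'.+1)))%N; last lia.
      rewrite vseg_cat vseg_cat vseg1 -!catA cat1s.
      by congr (vseg _ _ _ ++ (_, _) :: _); lia.
    rewrite Es -catA; apply: Lead_zero => //.
      move=> [m b]; rewrite mem_vseg /= => /andP [/eqP -> hb].
      by rewrite pE; [case: eqP => //=; lia|lia].
    have kn' : (k' < n)%N by lia.
    pose E0 : C := - (-1) ^+ k'.
    have E0n : E0 != 0 by rewrite oppr_eq0 signr_eq0.
    have main (x : nat * nat -> C) : mxminor kN' (fun a => mid (f a)) (umx n.+1 (zero_on A (zero_on (vseg 0 k'.+2 (j - k'.+1)) x))) =
        x (0%N, k'.+1) * (E0 * mxminor kN'' f (umx n (shift x))).
      rewrite /= (mnr_midE kN' kN'') //; last first.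
        move=> b hb; rewrite /zero_on !mem_vseg /=; case: ifP => // h1; case: ifP => // h2; lia.
      rewrite !shift_zero_on; try by move=> v; apply: vseg_row0.
      have -> : zero_on A (zero_on (vseg 0 k'.+2 (j - k'.+1)) x) (0%N, k'.+1) = x (0%N, k'.+1).
        rewrite /zero_on !mem_vseg /=; case: ifP => [h1|_]; first by lia.
        by case: ifP => // h2; lia.
      by rewrite /E0; ring.
    apply: (@Lead_cons _ _ _ _ _ (fun x => E0 * mxminor kN'' f (umx n (shift x)))).
    - by apply: PFmul; [exact: PFconst|exact: (PF_comp up (PF_mnr1 kN'' f))].
    - by move=> x; rewrite main pE ?eqxx ?expr1 //; lia.
    apply: Lead_zero.
    - apply: PFmul; first exact: PFconst.
      apply: (PF_comp up (f := fun x => mxminor kN'' f (umx n x))); exact: PF_mnr1.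
    - move=> [m b]; rewrite mem_vseg /= => /andP [/eqP -> hb].
      by rewrite pE; [case: eqP => //=; lia|lia].
    move: (Lead_scale E0n Lm); congr Lead; apply/funext => x.
    rewrite (_ : umx n (shift (upd _ _ _)) = umx n (shift (zero_on (vseg 0 1 k') x))) //.
    by rewrite shift_zero_on // => v; apply: vseg_row0.
  subst k''; exists (fun a => mid (f a)); apply: zeroAll => [u|b hb]; first by rewrite !mnr0.
  by rewrite pE //; case: eqP => //=; lia.
subst k'; exists (fcons last' (fun a => mid (f a))); apply: zeroAll.
  by move=> u; rewrite (mnr_last_iota kN' kN'').
by move=> b hb; rewrite pE // (_ : (k'' == k''.+1) = false) ?andbF //; lia.
Qed.

(** The remaining half step, from k to k'. In size n+1, if k drops, the row [ord0] is added to the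
    minor: once the variables of row 0 beyond column 2n+2-k are 0, this row meets the last k columns
    only there, and the variable of that column splits off. *)
Lemma fundamental_lead n k (kn : (k <= n)%N) (kN : (k <= n + n)%N) (p : nat * nat -> int) :
  pattern n (fun i => (i.+1 == k)%:Z) p ->
  exists f, Lead (vars n) (fun y : nat * nat -> C => mxminor kN f (umx n y)) (fun v => `|p v|%N).
Proof.
elim: n k kn kN p => [|n IH] k kn kN p H.
  have k0 : k = 0%N by lia.
  by subst k; exists (widen_ord kN); rewrite /= mnr0 oner_neq0.
have [k' [k'' [k'k k''n pE k''k' Hs]]] := fundamental_row kn H.
have kN'' : (k'' <= n + n)%N by lia.
have [f' L'] := IH k'' k''n kN'' _ Hs.
have kN' : (k' <= n.+1 + n.+1)%N by lia.
rewrite varsS (_ : vrow n.+1 0 = vseg 0 1 n.*2.+1); last by [].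
have [e|e] : k' = k \/ k = k'.+1 by lia.
  subst k'; have [||||g L] := @lead_lower n k k'' kN kN'' f' (fun v => `|p v|%N) n.*2.+1 _ _ _ _ L' => //.
  - by lia.
  - by move=> b hb; rewrite pE // ltnn andbF add0r absz_nat.
  exists g; move: L; congr Lead; apply/funext => x; congr (mxminor _ _ (umx _ _)); apply/funext => v.
  by rewrite /zero_on subnn.
subst k; pose j := (n.*2.+1 - k'.+1)%N.
have [||||g L] := @lead_lower n k' k'' kN' kN'' f' (fun v => `|p v|%N) j _ _ _ _ L' => //.
- by rewrite /j; lia.
- move=> b hb; rewrite pE; last by rewrite /j in hb; lia.
  rewrite (_ : (b + k'.+1 == n.*2.+2)%N = false); last by rewrite /j in hb; lia.
  by rewrite add0r absz_nat.
exists (fcons ord0 g).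
have Es : vseg 0 1 n.*2.+1 = vseg 0 j.+2 k' ++ (0%N, j.+1) :: vseg 0 1 j.
  rewrite (_ : n.*2.+1 = j + (1 + k'))%N; last by rewrite /j; lia.
  rewrite vseg_cat vseg_cat vseg1 -!catA cat1s.
  by congr (vseg _ _ _ ++ (_, _) :: _); lia.
rewrite Es -catA; apply: Lead_zero; first exact: PF_mnr1.
  move=> [m b]; rewrite mem_vseg /= => /andP [/eqP -> hb].
  rewrite pE; last by rewrite /j in hb; lia.
  rewrite (_ : (b + k'.+1 == n.*2.+2)%N = false) /= ?add0r ?absz_nat; last by rewrite /j in hb; lia.
  by rewrite (_ : (b == k') = false) //; rewrite /j in hb; lia.
apply: (@Lead_cons _ _ _ _ _ (fun x => (-1) ^+ k' * mxminor kN' g (umx n.+1 (zero_on (vseg 0 j.+2 k') x)))).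
- apply: PFmul; first exact: PFconst.
  by apply: (PF_zero_on (vseg 0 j.+2 k') (f := fun x => mxminor kN' g (umx n.+1 x))); exact: PF_mnr1.
- move=> x; have [_ r0] := umx_row0 n (zero_on (vseg 0 j.+2 k') x).
  rewrite (@mnr_row0 _ _ _ kN kN'); last first.
    move=> [b lb]; rewrite -val_eqE /= => bk.
    rewrite r0; last by rewrite /=; lia.
    by rewrite /zero_on mem_vseg /= ifT // /j; lia.
  rewrite r0; last by rewrite /=; lia.
  rewrite {1}/zero_on mem_vseg /= ifF; last by rewrite /j; lia.
  rewrite pE; last by rewrite /j; lia.
  rewrite (_ : (j.+1 + k'.+1 == n.*2.+2)%N = true); last by rewrite /j; lia.
  rewrite ltnSn (_ : (j.+1 == k') = false) /=; last by rewrite /j; lia.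
  by rewrite ?addn0 expr1 mulrA; congr (x (_, _) * _ * _); rewrite /j; lia.
have sg0' : ((-1) ^+ k' : C) != 0 by rewrite signr_eq0.
move: (Lead_scale sg0' L); congr Lead; apply/funext => x.
rewrite zero_on_cons; congr (_ * mxminor _ _ (umx _ _)); apply: zero_on_eq => -[m b].
by rewrite inE !mem_vseg xpair_eqE /j /=; lia.
Qed.

End Fundamental.

(** * Generation, big cell and density *)

Section Generation.
Context {R : realType}.
Local Notation C := R[i].

Definition uelem n (e : 'M[C]_(n + n)) : Prop := Sp e /\ (utri e \/ utri e^T).

(** Generation by unipotent triangular elements is proved for the sake of [curve]: each of them is
    joined to 1 by a polynomial curve in Sp. *)
Inductive gen n : 'M[C]_(n + n) -> Prop :=
| gen1 : gen 1%:M
| genM e g : uelem e -> gen g -> gen (e *m g).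

Lemma gen_elem n (e : 'M[C]_(n + n)) : uelem e -> gen e.
Proof. by move=> he; rewrite -[e]mulmx1; apply: genM => //; apply: gen1. Qed.

Lemma gen_mul n (g h : 'M[C]_(n + n)) : gen g -> gen h -> gen (g *m h).
Proof.
elim=> [|e g' he _ IH] gh; first by rewrite mul1mx.
by rewrite -mulmxA; apply: genM => //; apply: IH.
Qed.

Lemma gen_Sp n (g : 'M[C]_(n + n)) : gen g -> Sp g.
Proof. by elim=> [|e g' [he _] _ IH]; [exact: Sp1|exact: Sp_mul]. Qed.

Lemma SpinvE n (e : 'M[C]_(n + n)) i j : Spinv e i j = sg i * sg j * e (rev_ord j) (rev_ord i).
Proof.
rewrite /Spinv mxE mxE (bigD1 (rev_ord j)) //= big1 ?addr0; last first.
  by move=> k kj; rewrite sympE -(inj_eq rev_ord_inj) rev_ordK eq_sym (negbTE kj) mul0r mulr0.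
rewrite sympE rev_ordK eqxx mul1r sg_rev mxE sumJ mxE; ring.
Qed.

Lemma utri_Spinv n (e : 'M[C]_(n + n)) : utri e -> utri (Spinv e).
Proof.
move=> eu i j ji; rewrite SpinvE eu; last by rewrite /=; have := ltn_ord i; lia.
rewrite (inj_eq rev_ord_inj) eq_sym; case: eqP => [->|_]; last by rewrite mulr0.
by rewrite mulr1 sg2.
Qed.

Lemma Spinv_tr n (e : 'M[C]_(n + n)) : Spinv e^T = (Spinv e)^T.
Proof. by apply/matrixP => i j; rewrite [RHS]mxE !SpinvE mxE [sg i * _]mulrC. Qed.

Lemma uelem_inv n (e : 'M[C]_(n + n)) : uelem e -> uelem (invmx e).
Proof.
move=> [eS he]; split; first exact: Sp_inv.
rewrite invmx_Sp //; case: he => h; [left|right]; first exact: utri_Spinv.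
by rewrite -Spinv_tr; apply: utri_Spinv.
Qed.

Lemma gen_inv n (g : 'M[C]_(n + n)) : gen g -> gen (invmx g).
Proof.
elim=> [|e g' he hg IH]; first by rewrite invmx1; apply: gen1.
have [eS _] := he; rewrite (_ : invmx _ = invmx g' *m invmx e).
  by apply: gen_mul => //; apply: gen_elem; apply: uelem_inv.
have eU := Sp_unit eS; have gU := Sp_unit (gen_Sp hg).
have h : (e *m g') *m (invmx g' *m invmx e) = 1%:M.
  by rewrite mulmxA mulmxK // mulmxV.
have U : e *m g' \in unitmx by rewrite unitmx_mul eU gU.
by rewrite -[RHS](mulKmx U) h mulmx1.
Qed.

Lemma iota_tr n (A : 'M[C]_(n + n)) : (iota_mx A)^T = iota_mx A^T.
Proof. by apply: mx_midP => *; rewrite mxE !iotaE ?mxE. Qed.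

Lemma uelem_iota n (e : 'M[C]_(n + n)) : uelem e -> uelem (iota_mx e).
Proof.
move=> [eS he]; split; first exact: Sp_iota.
by case: he => h; [left|right; rewrite iota_tr]; apply: utri_iota.
Qed.

Lemma gen_iota n (g : 'M[C]_(n + n)) : gen g -> gen (iota_mx g).
Proof.
elim=> [|e g' he _ IH]; first by rewrite iota1; apply: gen1.
by rewrite iota_mul; apply: genM => //; apply: uelem_iota.
Qed.

Lemma uelem_hmx n r : uelem (hmx r : 'M[C]_(n.+1 + n.+1)).
Proof. by split; [exact: Sp_hmx|left; exact: utri_hmx]. Qed.

Lemma uelem_hmxT n r : uelem (hmx r : 'M[C]_(n.+1 + n.+1))^T.
Proof. by split; [apply: Sp_tr; exact: Sp_hmx|right; rewrite trmxK; exact: utri_hmx]. Qed.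

Definition elast n : 'cV[C]_(n.+1 + n.+1) := \col_i (i == last')%:R.

Lemma hmx_col n (v : 'cV[C]_(n.+1 + n.+1)) : v last' 0 = 1 -> exists r, v = hmx r *m elast n.
Proof.
move=> vl; pose r b := if b == (n + n).+1 then v ord0 0
  else if insub b.-1 is Some a then sg (rev_ord a) * v (mid (rev_ord a)) 0 else 0.
exists r; apply/matrixP => i j; rewrite ord1 mxE big_mid.
have Z (f : 'I_(n + n) -> C) : \sum_k f k * elast n (mid k) 0 = 0.
  by apply: big1 => k _; rewrite mxE eqI mulr0.
rewrite Z [elast n ord0 0]mxE [elast n last' 0]mxE !eqI mulr0 add0r add0r mulr1.
apply: (@mid_ind n (fun i => v i 0 = hmx r i last')) i => [||a]; rewrite hmxE //.
  by rewrite /r eqxx.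
have rE (b : 'I_(n + n)) : r b.+1 = sg (rev_ord b) * v (mid (rev_ord b)) 0.
  by rewrite /r eqSS ltn_eqF ?ltn_ord // -[b.+1.-1]/(val b) valK.
by rewrite rE rev_ordK mulrA sg2 mul1r.
Qed.

Lemma gen_col n (v : 'cV[C]_(n.+1 + n.+1)) : v != 0 -> exists2 a, gen a & a *m v = elast n.
Proof.
move=> v0.
have [a1 ga1 h1] : exists2 a, gen a & (a *m v) ord0 0 != 0.
  have [v00|v00] := eqVneq (v ord0 0) 0; last by exists 1%:M; rewrite ?mul1mx //; apply: gen1.
  have [b bv] : exists b, v b 0 != 0.
    apply: contrapT => /forallNP h; move/negP: v0; apply; apply/eqP/matrixP => i j.
    by rewrite ord1 mxE; apply/eqP/negPn/negP => /h.
  exists (hmx (fun c => (c == b :> nat)%:R)); first by apply: gen_elem; apply: uelem_hmx.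
  rewrite mxE (bigD1 b) //= big1 ?addr0.
    move: bv; apply: (@mid_ind n (fun b => v b 0 != 0 -> hmx (fun c => (c == b :> nat)%:R) ord0 b * v b 0 != 0)) b => [||b'].
    - by rewrite v00 eqxx.
    - by rewrite hmxE (_ : ((n + n).+1 == last' :> nat) = true) ?mul1r //=; apply/eqP; lia.
    - by rewrite hmxE eqxx mul1r.
  move=> i ib.
  have : hmx (fun c => (c == b :> nat)%:R) ord0 i * v i 0 = ((i == b)%:R + (i == ord0)%:R) * v i 0.
    move: (i); apply: (@mid_ind n (fun i => hmx (fun c => (c == b :> nat)%:R) ord0 i * v i 0 = ((i == b)%:R + (i == ord0)%:R) * v i 0)) => [||b'].
    - by rewrite v00 !mulr0.
    - rewrite hmxE eqI addr0; congr (_ * _); congr (_%:R); rewrite -val_eqE /=; congr (nat_of_bool (_ == _)); lia.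
    - by rewrite hmxE eqI addr0.
  rewrite (negbTE ib) add0r => ->; case: eqP => [->|_]; last by rewrite mul0r.
  by rewrite v00 mulr0.
set v1 := a1 *m v in h1.
(* The lower triangular [a2] adds z times the first entry to the last one, which becomes 1; such a
   vector is the last column of a Heisenberg element. *)
pose z := (1 - v1 last' 0) / v1 ord0 0.
pose a2 : 'M[C]_(n.+1 + n.+1) := (hmx (fun c => z * (c == (n + n).+1)%:R))^T.
have h2 : (a2 *m v1) last' 0 = 1.
  rewrite mxE big_mid {1 3}/a2 mxE hmxE eqxx mulr1 [a2 last' last']mxE hmxE mul1r.
  rewrite big1 ?addr0; first by rewrite /z divfK // subrK.
  move=> i _; rewrite mxE hmxE (_ : (_ == _) = false) ?mulr0 ?mul0r //.
  by rewrite eqSS ltn_eqF ?ltn_ord.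
have [r hr] := hmx_col h2.
exists (invmx (hmx r) *m (a2 *m a1)).
  apply: gen_mul; first by apply: gen_elem; apply: uelem_inv; apply: uelem_hmx.
  by apply: gen_mul => //; apply: gen_elem; apply: uelem_hmxT.
by rewrite -!mulmxA -/v1 hr mulKmx // Sp_unit //; apply: Sp_hmx.
Qed.

Definition tau n (c : C) : 'M[C]_(n.+1 + n.+1) :=
  \matrix_(i, j) ((i == j)%:R * (if i == ord0 then c^-1 else if i == last' then c else 1)).

Lemma tauE n c : ((forall i j, tau n c (mid i) (mid j) = (i == j)%:R) *
   (forall i, tau n c (mid i) ord0 = 0) * (forall i, tau n c (mid i) last' = 0) *
   (forall i, tau n c ord0 (mid i) = 0) * (forall i, tau n c last' (mid i) = 0) *
   (tau n c ord0 ord0 = c^-1) * (tau n c last' last' = c) *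
   (tau n c ord0 last' = 0) * (tau n c last' ord0 = 0))%type.
Proof. by do !split=> *; rewrite mxE !eqI ?(mul0r, mul1r, mulr1). Qed.

Lemma Sp_tau n c : c != 0 -> Sp (tau n c).
Proof.
move=> c0; apply: mx_midP; [move=> i j|move=> i|move=> i|move=> j|move=> j| | | |];
  rewrite form_mid !tauE ?sympM;
  try (rewrite big1; [|by move=> *; rewrite !tauE ?(mulr0, mul0r)]);
  rewrite ?(mulr0, mul0r, mulr1, subr0, add0r, addr0, sub0r, oppr0) ?mulVf ?mulfV //.
transitivity (\sum_k sg k * (1%:M : 'M[C]_(n + n)) k i * (1%:M : 'M[C]_(n + n)) (rev_ord k) j).
  by apply: eq_bigr => k _; rewrite !tauE !mxE.
by rewrite -formE trmx1 mul1mx mulmx1.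
Qed.

Definition mid_block n (g : 'M[C]_(n.+1 + n.+1)) : 'M[C]_(n + n) := \matrix_(i, j) g (mid i) (mid j).

(** Pairing column b of g with its last column, which is c times the last basis vector, gives c
    times [g ord0 b]. *)
Lemma last_col_row0 n (g : 'M[C]_(n.+1 + n.+1)) c : c != 0 -> Sp g ->
  (forall i, g i last' = c * (i == last')%:R) -> forall b, g ord0 b = c^-1 * (b == ord0)%:R.
Proof.
move=> c0 gS gl b.
have := congr1 (fun M : 'M[C]_(n.+1 + n.+1) => M b last') gS; rewrite form_mid !gl !eqI mulr1 mulr0 mulr0 subr0.
rewrite big1 ?addr0 => [|i _]; last by rewrite gl eqI mulr0 mulr0.
have -> : symp_form b last' = (b == ord0)%:R :> C.
  by rewrite sympE -(inj_eq rev_ord_inj) rev_ordK rev_l eq_sym; case: eqP => [->|]; rewrite ?mul0r ?sg0 ?mulr1.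
move=> e; apply: (mulIf c0).
by rewrite e mulrAC mulVf // mul1r.
Qed.

Lemma mid_block_Sp n (g : 'M[C]_(n.+1 + n.+1)) c : c != 0 -> Sp g ->
  (forall i, g i last' = c * (i == last')%:R) -> Sp (mid_block g).
Proof.
move=> c0 gS gl; have row0 := last_col_row0 c0 gS gl.
apply/matrixP => i j; have := congr1 (fun M : 'M[C]_(n.+1 + n.+1) => M (mid i) (mid j)) gS.
rewrite form_mid !row0 !eqI !mulr0 !mul0r subr0 add0r sympM => <-.
by rewrite formE; apply: eq_bigr => k _; rewrite !mxE.
Qed.

(** Once the middle block A and the torus part are divided out, the first row, the last column and
    the middle block are those of the identity, so what is left is lower unitriangular. *)
Lemma last_col n (g : 'M[C]_(n.+1 + n.+1)) c : c != 0 -> Sp g ->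
  (forall i, g i last' = c * (i == last')%:R) ->
  exists A l, [/\ Sp A, Sp l, utri l^T & g = iota_mx A *m tau n c *m l].
Proof.
move=> c0 gS gl; have row0 := last_col_row0 c0 gS gl.
pose A := mid_block g; have AS : Sp A := mid_block_Sp c0 gS gl.
have MS : Sp (iota_mx A *m tau n c) by apply: Sp_mul; [exact: Sp_iota|exact: Sp_tau].
exists A, (tau n c^-1 *m (iota_mx (invmx A) *m g)).
have tt : tau n c *m tau n c^-1 = 1%:M.
  apply: mx_midP; [move=> i j|move=> i|move=> i|move=> j|move=> j| | | |];
  rewrite mxE big_mid !tauE ?invrK ?mxE ?eqI;
  try (rewrite big1; [|by move=> *; rewrite !tauE ?(mulr0, mul0r)]);
  rewrite ?(mulr0, mul0r, mulr1, subr0, add0r, addr0, sub0r, oppr0) ?mulVf ?mulfV //.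
  rewrite (bigD1 i) //= !tauE eqxx mul1r big1 ?addr0 // => k; rewrite eq_sym => /negbTE ki.
  by rewrite tauE ki mul0r.
split=> //.
- apply: Sp_mul; first by apply: Sp_tau; rewrite invr_eq0.
  by apply: Sp_mul => //; apply: Sp_iota; apply: Sp_inv.
- pose h := iota_mx (invmx A) *m g.
  have h0 b : h ord0 b = g ord0 b.
    by rewrite mxE big_mid !iotaE mul1r mul0r addr0 big1 ?addr0 // => k _; rewrite iotaE mul0r.
  have hl b : h last' b = g last' b.
    by rewrite mxE big_mid !iotaE mul1r mul0r add0r big1 ?add0r // => k _; rewrite iotaE mul0r.
  have hm a b : h (mid a) b = \sum_k invmx A a k * g (mid k) b.
    by rewrite mxE big_mid !iotaE !mul0r add0r addr0; apply: eq_bigr => k _; rewrite iotaE.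
  have hml a : h (mid a) last' = 0.
    by rewrite hm big1 // => k _; rewrite gl eqI !mulr0.
  have hmm a b : h (mid a) (mid b) = (a == b)%:R.
    rewrite hm; transitivity ((invmx A *m A) a b); last by rewrite mulVmx ?Sp_unit // mxE.
    by rewrite mxE; apply: eq_bigr => k _; rewrite [A _ _]mxE.
  have tE a b : (tau n c^-1 *m h) a b = tau n c^-1 a a * h a b.
    rewrite mxE (bigD1 a) //= big1 ?addr0 // => k ka.
    by rewrite [tau _ _ _ _]mxE eq_sym (negbTE ka) !mul0r.
  move=> i j; rewrite [_^T _ _]mxE -/h tE; move: i j.
  apply: (@mid_ind n) => [||a]; apply: (@mid_ind n) => [||b]; rewrite ?h0 ?hl ?hml ?hmm ?row0 ?gl !tauE ?invrK ?eqI
    ?(mulr0, mul0r, mulr1) ?mulfV ?mulVf ?mul1r //=.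
  + by move=> h'; exfalso; lia.
  + by move=> h'; exfalso; have := ltn_ord a; lia.
  + by rewrite eq_sym.
- rewrite -mulmxA [tau n c *m _]mulmxA tt mul1mx mulmxA -iota_mul mulmxV ?Sp_unit //.
  by rewrite iota1 mul1mx.
Qed.

Lemma mul_elast n (h : 'M[C]_(n.+1 + n.+1)) i : (h *m elast n) i 0 = h i last'.
Proof.
rewrite mxE (bigD1 last') //= mxE eqxx mulr1 big1 ?addr0 // => k /negbTE kl.
by rewrite mxE kl mulr0.
Qed.

Lemma gen_all n (g : 'M[C]_(n + n)) : Sp g -> gen g.
Proof.
elim: n g => [|n IH] g gS.
  by rewrite (_ : g = 1%:M); [exact: gen1|apply/matrixP => -[]].
have [a ga ae] : exists2 a, gen a & a *m (g *m elast n) = elast n.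
  apply: gen_col; apply/eqP => h; have : elast n = 0.
    by rewrite -(mulKmx (Sp_unit gS) (elast n)) h mulmx0.
  by move/matrixP/(_ last' 0); rewrite !mxE eqxx => /eqP; rewrite oner_eq0.
have aS := gen_Sp ga.
have [A [l [AS lS ll E]]] := last_col (oner_neq0 C) (Sp_mul aS gS)
  (fun i => etrans (esym (mul_elast _ i)) (etrans (congr1 (fun v : 'cV_(n.+1 + n.+1) => v i 0) (etrans (esym (mulmxA _ _ _)) ae))
     (etrans (mxE _ _ _ _) (esym (mul1r _))))).
have -> : g = invmx a *m (iota_mx A *m l).
  have t1 : tau n 1 = 1%:M :> 'M[C]_(n.+1 + n.+1).
    by apply/matrixP => i j; rewrite !mxE invr1 !if_same mulr1.
  by move: E; rewrite t1 mulmx1 => <-; rewrite mulKmx // Sp_unit.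
apply: gen_mul; first exact: gen_inv.
by apply: gen_mul; [apply: gen_iota; apply: IH|apply: gen_elem; split=> //; right].
Qed.

Lemma Dk_iota n k (kN : (k.+1 <= n.+1 + n.+1)%N) (kN' : (k <= n + n)%N) (A : 'M[C]_(n + n)) :
  tminor kN (iota_mx A) = tminor kN' A.
Proof.
rewrite /tminor -(@mnr_last_iota _ _ _ kN kN'); congr (mxminor _ _ _); apply/funext => b.
case: (unliftP ord0 b) => [[b' lb]|] ->; rewrite ?fcons0 ?fconsS; apply: val_inj => /=.
  by rewrite /bump leq0n add1n; rewrite /= in lb; lia.
by lia.
Qed.

Lemma tau_iota n c (A : 'M[C]_(n + n)) : tau n c *m iota_mx A = iota_mx A *m tau n c.
Proof.
have d1 (i : 'I_(n + n)) (f : 'I_(n + n) -> C) : \sum_k (i == k)%:R * f k = f i.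
  by rewrite (bigD1 i) //= eqxx mul1r big1 ?addr0 // => k; rewrite eq_sym => /negbTE ->; rewrite mul0r.
have d2 (i : 'I_(n + n)) (f : 'I_(n + n) -> C) : \sum_k f k * (k == i)%:R = f i.
  by rewrite (bigD1 i) //= eqxx mulr1 big1 ?addr0 // => k /negbTE ->; rewrite mulr0.
apply: mx_midP => *; rewrite mxE [RHS]mxE !big_mid;
  (under [X in _ + X + _ = _]eq_bigr do rewrite !tauE !iotaE);
  (under [X in _ = _ + X + _]eq_bigr do rewrite !tauE !iotaE);
  rewrite !tauE !iotaE ?d1 ?d2 ?mul0r ?mul1r ?mulr1 ?mulr0 ?addr0 ?add0r //;
  by rewrite ?big1 // => *; rewrite ?(mulr0, mul0r).
Qed.

(** The corner entry c is a trailing minor, so a Heisenberg factor can clear the last column above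
    it, and [last_col] splits the rest. The trailing minors of A are factors of those of g one size
    larger; hence A decomposes by induction, and [hmx_iota] brings the Heisenberg factor to the
    right of the middle unipotent one, as in [umx]. *)
Lemma big_cell n (g : 'M[C]_(n + n)) : Sp g ->
  (forall k (kN : (k <= n + n)%N), (k <= n)%N -> tminor kN g != 0) ->
  exists y t l, [/\ torus t, Sp l, utri l^T & g = umx n y *m t *m l].
Proof.
elim: n g => [|n IH] g gS Dg.
  exists (fun _ => 0), 1%:M, 1%:M; split; first by split; [exact: Sp1|apply/is_diag_mxP => -[]].
  - exact: Sp1.
  - by move=> [].
  - by apply/matrixP => -[].
pose c := g last' last'.
have c0 : c != 0.
  have h1 : (1 <= n.+1 + n.+1)%N by lia.
  have := Dg 1%N h1 isT; rewrite /tminor /mxminor det_mx11 mxE.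
  by rewrite (_ : lrow h1 0 = last') //; apply: val_inj => /=; lia.
have [r rE] : exists r, c^-1 *: (g *m elast n) = hmx r *m elast n.
  by apply: hmx_col; rewrite mxE mul_elast mulVf.
have hU := Sp_unit (@Sp_hmx R n r).
pose g1 := invmx (hmx r) *m g.
have g1S : Sp g1 by apply: Sp_mul => //; apply: Sp_inv; apply: Sp_hmx.
have g1l i : g1 i last' = c * (i == last')%:R.
  have ge : g *m elast n = c *: (hmx r *m elast n) by rewrite -rE scalerA mulfV // scale1r.
  rewrite -mul_elast -mulmxA ge -scalemxAr mulKmx //.
  by rewrite !mxE.
have [A [l [AS lS ll E]]] := last_col c0 g1S g1l.
have gE : g = hmx r *m (iota_mx A *m (tau n c *m l)) by rewrite [iota_mx A *m _]mulmxA -E mulKVmx.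
have tl0 (i j : 'I_(n.+1 + n.+1)) : (i < j)%N -> (tau n c *m l) i j = 0.
  move=> ij; rewrite mxE (bigD1 i) //= big1 ?addr0 => [|k ki]; last first.
    by rewrite mxE eq_sym (negbTE ki) !mul0r.
  have := ll j i (ltnW ij); rewrite mxE => ->.
  by rewrite -val_eqE gtn_eqF // mulr0.
have DA k (kN : (k <= n + n)%N) : (k <= n)%N -> tminor kN A != 0.
  move=> kn; have kN1 : (k.+1 <= n.+1 + n.+1)%N by lia.
  have := Dg k.+1 kN1 kn; rewrite gE Dk_mul_upper; last first.
    by move=> i j ji; rewrite utri_hmx ?(ltnW ji) // -val_eqE gtn_eqF.
  rewrite {2}/tminor mnr_mul_lower // -/(tminor _ _) (Dk_iota kN1 kN).
  by apply: contraNneq => ->; rewrite mul0r mulr0.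
have [y' [t' [l' [[t'S t'd] l'S l'l AE]]]] := IH A AS DA.
pose U := umx n y'.
pose r' b := if b == (n + n).+1 then r b
  else if insub b.-1 is Some b' then \sum_(a < n + n) r a.+1 * U a b' else 0.
have UE : hmx r *m iota_mx U = iota_mx U *m hmx r'.
  apply: hmx_iota; first exact: umx_Sp.
    by move=> b; rewrite /r' eqSS ltn_eqF ?ltn_ord // -[b.+1.-1]/(val b) valK.
  by rewrite /r' eqxx.
exists (fun v => if v.1 is m.+1 then y' (m, v.2.-1) else r' v.2).
exists (iota_mx t' *m tau n c), (iota_mx l' *m l); split.
- split; first by apply: Sp_mul; [exact: Sp_iota|exact: Sp_tau].
  apply/is_diag_mxP => i j ij; rewrite mxE big1 // => k _.
  have [kj|kj] := eqVneq k j; last by rewrite [tau _ _ _ _]mxE (negbTE kj) mul0r mulr0.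
  rewrite kj in ij *; rewrite [X in X * _](_ : _ = 0) ?mul0r //.
  move: i j ij {kj}; apply: (@mid_ind n) => [||a]; apply: (@mid_ind n) => [||b]; rewrite ?iotaE ?eqxx //= => ab.
  by move/is_diag_mxP : t'd; apply; apply: contraNneq ab => ->.
- by apply: Sp_mul => //; apply: Sp_iota.
- by rewrite trmx_mul iota_tr; apply: utri_mul => //; apply: utri_iota.
have -> : umx n.+1 (fun v => if v.1 is m.+1 then y' (m, v.2.-1) else r' v.2) = iota_mx U *m hmx r'.
  by rewrite /=; congr (iota_mx (umx n _) *m _); apply/funext => -[a b].
rewrite -UE gE AE !iota_mul !mulmxA; congr (_ *m _).
by rewrite -!mulmxA tau_iota !mulmxA.
Qed.

(* Conjugation by the grading element joins 1 to [e] inside the unipotent group. *)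
Definition ecurve n (e : 'M[C]_(n + n)) (s : C) : 'M[C]_(n + n) :=
  \matrix_(i, j) (e i j * s ^+ ((i - j) + (j - i))).

Lemma ecurve1 n (e : 'M[C]_(n + n)) : ecurve e 1 = e.
Proof. by apply/matrixP => i j; rewrite mxE expr1n mulr1. Qed.

Lemma ecurve_tr n (e : 'M[C]_(n + n)) s : (ecurve e s)^T = ecurve e^T s.
Proof. by apply/matrixP => i j; rewrite !mxE addnC. Qed.

Lemma ecurve0 n (e : 'M[C]_(n + n)) : uelem e -> ecurve e 0 = 1%:M.
Proof.
move=> [_ he]; apply/matrixP => i j; rewrite !mxE expr0n addn_eq0 !subn_eq0 -eqn_leq -[(i == j :> nat)%N]/(i == j).
case: eqP => [->|_]; last by rewrite mulr0.
by case: he => h; have := h j j (leqnn _); rewrite ?mxE eqxx => ->; rewrite mulr1.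
Qed.

Lemma ecurve_Sp n (e : 'M[C]_(n + n)) s : uelem e -> Sp (ecurve e s).
Proof.
move=> [eS he]; wlog eu : e eS {he} / utri e.
  move=> hw; case: he => h; first exact: hw.
  by rewrite -[e]trmxK -ecurve_tr; apply: Sp_tr; apply: hw => //; apply: Sp_tr.
apply/matrixP => a b; rewrite formE.
(* A nonzero term has i <= a and [rev_ord i] <= b, so its exponents add up to a + b - (2n - 1),
   whatever i is. Where [symp_form a b] is nonzero this exponent is 0. *)
transitivity (s ^+ (a + b - (n + n).-1) * symp_form a b).
  rewrite -[in RHS]eS formE mulr_sumr; apply: eq_bigr => i _; rewrite !mxE.
  have [ia|ai] := leqP i a; last by rewrite eu ?(ltnW ai) // -val_eqE gtn_eqF // !(mulr0, mul0r).
  have [ib|bi] := leqP (rev_ord i) b; last by rewrite [e _ b]eu ?(ltnW bi) // -val_eqE gtn_eqF // !(mulr0, mul0r).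
  have -> : (a + b - (n + n).-1 = ((i - a) + (a - i)) + ((rev_ord i - b) + (b - rev_ord i)))%N.
    by move: ia ib => /=; have := ltn_ord i; lia.
  move: (i - a + (a - i))%N (rev_ord i - b + (b - rev_ord i))%N => x y.
  by rewrite exprD; ring.
rewrite sympE; case: eqP => [->|_]; last by rewrite mul0r mulr0.
by rewrite (_ : (_ - _)%N = 0%N) ?expr0 ?mul1r //=; have := ltn_ord a; lia.
Qed.

Lemma curve n (g : 'M[C]_(n + n)) : Sp g -> exists G : (unit -> C) -> 'M[C]_(n + n),
  [/\ forall x, Sp (G x), G (fun _ => 0) = 1%:M, G (fun _ => 1) = g & forall i j, polyfun (fun x => G x i j)].
Proof.
move/gen_all; elim=> [|e g' he _ [G [GS G0 G1 PG]]].
  exists (fun _ => 1%:M); split=> //; first by move=> _; apply: Sp1.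
  by move=> i j; apply: PFconst.
exists (fun x => ecurve e (x tt) *m G x); split.
- by move=> x; apply: Sp_mul => //; apply: ecurve_Sp.
- by rewrite ecurve0 // G0 mulmx1.
- by rewrite ecurve1 G1.
- apply: PF_mulmx => // i j.
  rewrite (_ : (fun _ => _) = fun x : unit -> C => e i j * x tt ^+ ((i - j) + (j - i))); last first.
    by apply/funext => x; rewrite mxE.
  by apply: PFmul; [exact: PFconst|apply: PF_exp; exact: PFvar].
Qed.

Lemma PF_mxeval (V : eqType) n (G : (V -> C) -> 'M[C]_(n + n)) P :
  (forall i j, polyfun (fun x => G x i j)) -> polyfun (fun x => mxeval P (G x)).
Proof.
move=> PG; rewrite (_ : (fun _ => _) = fun x => \sum_(m <- msupp P) P@_m * \prod_i mxvec (G x) 0 i ^+ m i); last first.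
  by apply/funext => x; rewrite /mxeval mevalE.
apply: PF_sum => m; apply: PFmul; first exact: PFconst.
apply: PF_prod => i; apply: PF_exp.
by case/mxvec_indexP: i => i j; rewrite (_ : (fun _ => _) = fun x => G x i j) //; apply/funext => x; rewrite mxvecE.
Qed.

Lemma PF_unit_poly (f : (unit -> C) -> C) : polyfun f -> exists P : {poly C}, forall z, f (fun _ => z) = P.[z].
Proof.
move=> Pf; have [P PE] := PF_poly Pf (fun _ => 0) tt; exists P => z; rewrite -PE.
by congr f; apply/funext => -[].
Qed.

(** Join g to 1 by a polynomial curve. The product of the trailing minors along it is a polynomial
    with value 1 at the identity, hence nonzero; wherever it does not vanish the curve is in the big
    cell and P is 0. So P is 0 along the whole curve. *)
Lemma Sp_density n (P : {mpoly C[(n + n) * (n + n)]}) :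
  (forall y t l, torus t -> Sp l -> utri l^T -> mxeval P (umx n y *m t *m l) = 0) ->
  forall g, Sp g -> mxeval P g = 0.
Proof.
move=> P0 g gS; have [G [GS G0 G1 PG]] := curve gS.
have [Q QE] := PF_unit_poly (PF_mxeval P PG).
(* [insub] lets the size k run over the index of the product without a proof that it is at most n +
   n. *)
pose D x := \prod_(k < n.+1) \det (\matrix_(a < k, b < k) if insub (n + n - a.+1)%N is Some i then
   (if insub (n + n - b.+1)%N is Some j then G x i j else 0) else 0).
have DE x k (kN : (k <= n + n)%N) : \det (\matrix_(a < k, b < k) if insub (n + n - a.+1)%N is Some i then
   (if insub (n + n - b.+1)%N is Some j then G x i j else 0) else 0) = tminor kN (G x).
  rewrite /tminor /mxminor; congr (\det _); apply/matrixP => a b; rewrite !mxE.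
  have iE (d : 'I_k) : (insub (n + n - d.+1)%N : option 'I_(n + n)) = Some (lrow kN d) by exact: (valK (lrow kN d)).
  by rewrite !iE.
have [E EE] : exists E : {poly C}, forall z, D (fun _ => z) = E.[z].
  apply: PF_unit_poly; apply: PF_prod => k; apply: PF_det => a b.
  rewrite (_ : (fun _ => _) = fun x => if insub (n + n - a.+1)%N is Some i then
   (if insub (n + n - b.+1)%N is Some j then G x i j else 0) else 0); last by apply/funext => x; rewrite mxE.
  by case: insub => [i|]; [case: insub => [j|]|]; rewrite ?PG; try exact: PFconst; apply: PG.
have E0 : E != 0.
  apply: contraTneq (oner_neq0 C) => E0; rewrite negbK; apply/eqP.
  have : D (fun _ => 0) = 0 by rewrite EE E0 horner0.
  rewrite /D big1 // => k _.
  have kN : (k <= n + n)%N by have := ltn_ord k; lia.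
  by rewrite (DE _ _ kN) G0 Dk_utri // => i j _; rewrite mxE.
suff : Q = 0 by move=> Q0; rewrite -G1 QE Q0 horner0.
have : Q * E = 0.
  apply: (@poly_fun_eq0 _ _ [::]) => z _; rewrite hornerM -QE -EE.
  have [->|Dz] := eqVneq (D (fun _ => z)) 0; first by rewrite mulr0.
  suff -> : mxeval P (G (fun _ => z)) = 0 by rewrite mul0r.
  have [k kN kn|y [t [l [tT lS ll ->]]]] := big_cell (GS (fun _ => z)); last exact: P0.
  rewrite -DE; apply: contraNneq Dz => e; rewrite /D.
  by rewrite (bigD1 (Ordinal (kn : k < n.+1)%N)) //= e mul0r.
by move/eqP; rewrite mulf_eq0 (negbTE E0) orbF => /eqP.
Qed.

End Generation.

(** * Unipotent subgroups *)

Section Kolchin.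
Variable F : numClosedFieldType.

Definition unip d (g : 'M[F]_d) : Prop := exists k, iter k (mulmx (g - 1%:M)) 1%:M = 0.

(** All eigenvalues are 0, so the characteristic polynomial is a power of X, and the trace is one of
    its vanishing coefficients up to sign. *)
Lemma nilp_trace d (g : 'M[F]_d) k : iter k (mulmx g) 1%:M = 0 -> \tr g = 0.
Proof.
case: d g => [|d] g gk; first by rewrite /mxtrace big_ord0.
have ev a : eigenvalue g a -> a = 0.
  case/eigenvalueP => v vg v0.
  have vk j : v *m iter j (mulmx g) 1%:M = a ^+ j *: v.
    elim: j => [|j IH]; first by rewrite mulmx1 expr0 scale1r.
    by rewrite iterS mulmxA vg -scalemxAl IH scalerA -exprS.
  have := vk k; rewrite gk mulmx0 => /esym/eqP; rewrite scaler_eq0 (negbTE v0) orbF expf_eq0.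
  by case/andP => _ /eqP.
have [r E] := closed_field_poly_normal (char_poly g).
have r0 : all (fun a => a == 0) r.
  apply/allP => a ar; apply/eqP/ev; rewrite eigenvalue_root_char E rootZ; last first.
    by rewrite (monicP (char_poly_monic g)) oner_eq0.
  by rewrite root_prod_XsubC.
have Er : char_poly g = 'X^(size r).
  rewrite E (monicP (char_poly_monic g)) scale1r.
  elim: (r) r0 => [|a s IH] /=; first by rewrite big_nil.
  by move=> /andP [/eqP -> /IH IHs]; rewrite big_cons IHs subr0 exprS.
have sr : size r = d.+1.
  by have := size_char_poly g; rewrite Er size_polyXn => -[].
have := char_poly_trace g isT; rewrite Er sr coefXn /=.
by rewrite ltn_eqF //= => /esym/eqP; rewrite oppr_eq0 => /eqP.
Qed.

Lemma unip_trace d (g : 'M[F]_d) : unip g -> \tr g = d%:R.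
Proof.
by move=> [k /nilp_trace]; rewrite linearB /= mxtrace1 => /eqP; rewrite subr_eq0 => /eqP.
Qed.

Section Irreducible.
Variables (m : nat) (G : 'M[F]_m.+1 -> Prop).
Hypotheses (G1 : G 1%:M) (GM : forall g h, G g -> G h -> G (g *m h)).
Hypothesis Gu : forall g, G g -> unip g.
Hypothesis irr : forall U : 'M[F]_m.+1, U != 0 -> (forall g, G g -> (U *m g <= U)%MS) -> row_full U.

Inductive span_of : 'M[F]_m.+1 -> Prop :=
| span_in g : G g -> span_of g
| span_add a b : span_of a -> span_of b -> span_of (a + b)
| span_scale (c : F) a : span_of a -> span_of (c *: a).

Lemma span_mulr a g : span_of a -> G g -> span_of (a *m g).
Proof.
move=> sa gG; elim: sa => {a} [h hG|a b _ IHa _ IHb|c a _ IH].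
- by apply: span_in; apply: GM.
- by rewrite mulmxDl; apply: span_add.
- by rewrite -scalemxAl; apply: span_scale.
Qed.

Lemma span_mul a b : span_of a -> span_of b -> span_of (a *m b).
Proof.
move=> sa; elim=> {b} [h hG|b b' _ IHb _ IHb'|c b _ IH].
- exact: span_mulr.
- by rewrite mulmxDr; apply: span_add.
- by rewrite -scalemxAr; apply: span_scale.
Qed.

Lemma span0 : span_of 0.
Proof. by rewrite -[0](scale0r 1%:M); apply: span_scale; apply: span_in. Qed.

(** The vectors y a form a nonzero stable subspace, which irreducibility makes everything. It is
    obtained as a subspace U of maximal rank all of whose vectors have this form. *)
Lemma span_trans (y x : 'rV[F]_m.+1) : y != 0 -> exists2 a, span_of a & x = y *m a.
Proof.
move=> y0; pose P (U : 'M[F]_m.+1) := forall z : 'rV_m.+1, (z <= U)%MS -> exists2 a, span_of a & z = y *m a.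
have ex : exists r, `[< exists2 U, P U & \rank U = r >].
  exists 0%N; apply/asboolP; exists 0; last by rewrite mxrank0.
  by move=> z; rewrite submx0 => /eqP ->; exists 0; rewrite ?mulmx0 //; apply: span0.
have bd r : `[< exists2 U, P U & \rank U = r >] -> (r <= m.+1)%N.
  by move=> /asboolP [U _ <-]; apply: rank_leq_row.
case: (ex_maxnP ex bd) => r /asboolP [U PU rU] rmax.
have inU a : span_of a -> (y *m a <= U)%MS.
  move=> sa; pose U' := (U + <<y *m a>>)%MS.
  have PU' : P U'.
    move=> z /sub_addsmxP [[u v] ->] /=.
    have [b sb ->] := PU (u *m U) (submxMl _ _).
    have : (v *m <<y *m a>> <= y *m a)%MS by rewrite (submx_trans (submxMl _ _)) // genmxE.
    move=> /sub_rVP [c ->]; exists (b + c *: a); first by apply: span_add => //; apply: span_scale.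
    by rewrite mulmxDr -scalemxAr.
  have le : (\rank U' <= r)%N by apply: rmax; apply/asboolP; exists U'.
  have sUU' : (U <= U')%MS by apply: addsmxSl.
  have : (U' <= U)%MS by rewrite -(geq_leqif (mxrank_leqif_sup sUU')) rU.
  by apply: submx_trans; rewrite -genmxE; apply: addsmxSr.
have full : row_full U.
  apply: irr.
    apply: contraNneq y0 => U0; have := inU _ (span_in G1); rewrite mulmx1 U0 submx0.
    by move/eqP => ->.
  move=> g gG; apply/row_subP => i; rewrite row_mul.
  have [a sa ->] := PU (row i U) (row_sub i U).
  by rewrite -mulmxA; apply: inU; apply: span_mulr.
by apply: PU; apply: submx_full.
Qed.

(** For h in G both g h and h are unipotent and have the same trace, the dimension; the identity
    extends linearly to the span. *)
Lemma span_trace g a : G g -> span_of a -> \tr ((g - 1%:M) *m a) = 0.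
Proof.
move=> gG; elim=> {a} [h hG|a b _ IHa _ IHb|c a _ IH].
- by rewrite mulmxBl mul1mx linearB /= !unip_trace ?subrr //; apply: Gu => //; apply: GM.
- by rewrite mulmxDr linearD /= IHa IHb addr0.
- by rewrite -scalemxAr linearZ /= IH mulr0.
Qed.

(* As in the Lomonosov-Rosenthal proof of Burnside's theorem, an element of minimal
   nonzero rank in the span has rank one. *)
Lemma span_rank1 : exists2 T, span_of T & \rank T = 1%N.
Proof.
have ex : exists r, `[< exists2 T, span_of T & (T != 0) && (\rank T == r) >].
  exists m.+1; apply/asboolP; exists 1%:M; first exact: span_in.
  by rewrite mxrank1 eqxx andbT -mxrank_eq0 mxrank1.
case: (ex_minnP ex) => r /asboolP [T sT /andP [T0 /eqP rT]] rmin.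
exists T => //; rewrite rT; apply/eqP; rewrite eqn_leq -{2}rT lt0n mxrank_eq0 T0 andbT.
rewrite leqNgt; apply/negP => r2.
have [i1 Ti] : exists i, row i T != 0.
  apply: contrapT => /forallNP h; move/negP: T0; apply; apply/eqP/row_matrixP => i.
  by rewrite row0; apply/eqP/negPn/negP/h.
have [i2 ni2] : exists i, ~~ (row i T <= row i1 T)%MS.
  apply: contrapT => /forallNP h; have : (T <= row i1 T)%MS by apply/row_subP => i; apply/negPn/negP/h.
  by move/mxrankS; rewrite rT rank_rV => h'; have := leq_trans r2 h'; case: (_ != 0).
(* With this a the row i1 of T a T is the row i2 of T, no multiple of the row i1 of T; so T a T - l
   T is nonzero for every l. Taking for l an eigenvalue of a T on the row space of T makes its rank
   smaller than that of T. *)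
have [a sa aE] := span_trans (delta_mx 0 i2) Ti.
pose B := row_base T.
have BT : (B *m (a *m T) <= B)%MS.
  by rewrite mulmxA (submx_trans (submxMl _ _)) // eq_row_base.
pose M := B *m (a *m T) *m pinvmx B.
have ME : M *m B = B *m (a *m T) by apply: mulmxKpV.
have rpos : (0 < \rank T)%N by rewrite rT (ltn_trans _ r2).
have [l lev] : exists l, eigenvalue M l.
  have /closed_rootP [l] : size (char_poly M) != 1%N by rewrite size_char_poly eqSS -lt0n.
  by rewrite -eigenvalue_root_char; exists l.
case/eigenvalueP: lev => v vM v0.
pose T' := T *m (a *m T) - l *: T.
have sT' : span_of T'.
  apply: span_add; first by do 2!apply: span_mul => //.
  by rewrite -scaleNr; apply: span_scale.
have T'0 : T' != 0.
  apply: contraNneq ni2 => /(congr1 (fun A => (delta_mx 0 i1 : 'rV_m.+1) *m A)).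
  rewrite mulmx0 mulmxBr !mulmxA -rowE -aE -rowE -scalemxAr -rowE => /eqP.
  by rewrite subr_eq0 => /eqP ->; apply: scalemx_sub.
have : (\rank T' < r)%N; last first.
  by rewrite ltnNge rmin //; apply/asboolP; exists T'; rewrite ?T'0 ?eqxx.
have T'E : T' = T *m (a *m T - l%:M) by rewrite mulmxBr mul_mx_scalar.
have -> : \rank T' = \rank (B *m (a *m T - l%:M)).
  by rewrite T'E (eqmxMr _ (eq_row_base T)).
rewrite -rT ltn_neqAle rank_leq_row andbT; apply: contra v0 => h.
have : row_free (B *m (a *m T - l%:M)) by rewrite /row_free.
move/row_free_inj => /(_ _ v 0); rewrite mul0mx mulmxA mulmxBr -mulmxA -ME mulmxA vM.
by rewrite mul_mx_scalar -scalemxAl subrr => -> //.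
Qed.

(** For T = c r of rank one, the trace identity applied to a T b reads r b (g - 1) a c = 0. Here r b
    is an arbitrary vector, and if g were not 1, a nonzero row of g - 1 times a would be arbitrary
    as well, so that c = 0. *)
Lemma irreducible_trivial g : G g -> g = 1%:M.
Proof.
move=> gG; apply/eqP; rewrite -subr_eq0; apply/negPn/negP => n0.
have [T sT rT] := span_rank1.
have [c [r TE]] : exists (c : 'cV[F]_m.+1) (r : 'rV[F]_m.+1), T = c *m r.
  by move: (col_base T) (row_base T) (mulmx_base T); rewrite rT => c r <-; exists c, r.
have r0 : r != 0.
  by apply/eqP => e; move: rT; rewrite TE e mulmx0 mxrank0.
have [y gy] : exists i, row i (g - 1%:M) != 0.
  apply: contrapT => /forallNP h; move/negP: n0; apply; apply/eqP/row_matrixP => i.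
  by rewrite row0; apply/eqP/negPn/negP/h.
have key a (x : 'rV[F]_m.+1) : span_of a -> x *m ((g - 1%:M) *m (a *m c)) = 0.
  move=> sa; have [b sb ->] := span_trans x r0.
  have h := span_trace gG (span_mul (span_mul sa sT) sb).
  have : \tr ((r *m b) *m ((g - 1%:M) *m (a *m c))) = 0.
    by rewrite mxtrace_mulC -[RHS]h TE !mulmxA.
  by rewrite /mxtrace big_ord1 => e; apply/matrixP => i j; rewrite !ord1 e mxE.
have c0 (x : 'rV[F]_m.+1) : x *m c = 0 :> 'M_1.
  have [a sa ->] := span_trans x gy.
  by rewrite rowE -!mulmxA key.
move: rT; rewrite TE (_ : c = 0) ?mul0mx ?mxrank0 //.
by rewrite -[c]mul1mx; apply/row_matrixP => i; rewrite row_mul c0 row0.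
Qed.

End Irreducible.

(** On a minimal nonzero stable subspace W the group acts irreducibly and by unipotent matrices,
    hence trivially, so a basis vector of W is fixed. [rep] is the action in the basis B of W. *)
Lemma kolchin d (G : 'M[F]_d.+1 -> Prop) : G 1%:M -> (forall g h, G g -> G h -> G (g *m h)) ->
  (forall g, G g -> unip g) -> exists2 u : 'rV[F]_d.+1, u != 0 & forall g, G g -> u *m g = u.
Proof.
move=> G1 GM Gu.
pose stable (W : 'M[F]_d.+1) := forall g, G g -> (W *m g <= W)%MS.
have ex : exists r, `[< exists2 W, stable W & (W != 0) && (\rank W == r) >].
  exists d.+1; apply/asboolP; exists 1%:M; first by move=> g _; apply: submx1.
  by rewrite mxrank1 eqxx andbT -mxrank_eq0 mxrank1.
case: (ex_minnP ex) => r /asboolP [W sW /andP [W0 /eqP rW]] rmin.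
have [m rm] : exists m, r = m.+1.
  by exists r.-1; rewrite prednK // -rW lt0n mxrank_eq0.
rewrite rm in rW rmin; pose B : 'M[F]_(m.+1, d.+1) := castmx (rW, erefl) (row_base W).
have BW : (B :=: W)%MS.
  by apply: eqmx_trans (eqmx_cast _ _) _; apply: eq_row_base.
have Bfree : row_free B by rewrite /row_free BW rW.
have injB k (X Y : 'M[F]_(k, m.+1)) : X *m B = Y *m B -> X = Y by apply: (row_free_inj Bfree).
pose rep g := B *m g *m pinvmx B.
have repE g : G g -> rep g *m B = B *m g.
  by move=> gG; apply: mulmxKpV; rewrite (eqmxMr g BW) BW; apply: sW.
have repM g h : G g -> G h -> rep (g *m h) = rep g *m rep h.
  move=> gG hG; apply: injB; rewrite -mulmxA (repE h) // mulmxA (repE g) // repE ?mulmxA //.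
  exact: GM.
have rep1 : rep 1%:M = 1%:M.
  by apply: injB; rewrite repE // mulmx1 mul1mx.
have trivial g : G g -> rep g = 1%:M.
  move=> gG; apply: (@irreducible_trivial m (fun h => exists2 g, G g & h = rep g)).
  - by exists 1%:M.
  - by move=> _ _ [g1 h1 ->] [g2 h2 ->]; exists (g1 *m g2); rewrite ?repM //; apply: GM.
  - move=> _ [h hG ->]; have [k hk] := Gu h hG; exists k; apply: injB.
    have -> : iter k (mulmx (rep h - 1%:M)) 1%:M *m B = B *m iter k (mulmx (h - 1%:M)) 1%:M.
      elim: k {hk} => [|k IH]; first by rewrite mul1mx mulmx1.
      by rewrite !iterS -mulmxA IH !mulmxA mulmxBl repE // mul1mx mulmxBr mulmx1.
    by rewrite hk mulmx0 mul0mx.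
  - move=> U U0 sU; have rU : (m.+1 <= \rank U)%N.
      have rUB : \rank (U *m B) = \rank U by apply: mxrankMfree.
      have UB0 : U *m B != 0 by rewrite -mxrank_eq0 rUB mxrank_eq0.
      pose W' : 'M[F]_d.+1 := <<U *m B>>%MS.
      have -> : \rank U = \rank W' by rewrite genmxE.
      apply: rmin; apply/asboolP; exists W'; last by rewrite eqxx andbT -mxrank_eq0 genmxE mxrank_eq0.
      move=> h hG; rewrite genmxE (eqmxMr h (genmxE _)) -mulmxA -repE // mulmxA.
      by apply: submxMr; apply: sU; exists h.
    by rewrite /row_full eqn_leq rank_leq_col.
  - by exists g.
exists (row ord0 B).
  apply/eqP => h; have : (delta_mx 0 ord0 : 'rV[F]_m.+1) = 0.
    by apply: injB; rewrite mul0mx -rowE.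
  by move=> /matrixP /(_ 0 ord0); rewrite !mxE !eqxx => /eqP; rewrite oner_eq0.
by move=> g gG; rewrite rowE -mulmxA -repE // trivial // mul1mx.
Qed.

End Kolchin.

(** * Conjugation of unipotent groups into the lower triangular one *)

Section UnipotentConjugacy.
Context {R : realType}.
Local Notation C := R[i].

Lemma iter_mulmx_tr d (N : 'M[C]_d) k : (iter k (mulmx N) 1%:M)^T = iter k (mulmx N^T) 1%:M.
Proof.
have comm j : iter j (mulmx N^T) 1%:M *m N^T = N^T *m iter j (mulmx N^T) 1%:M.
  elim: j => [|j IH]; first by rewrite mul1mx mulmx1.
  by rewrite iterS -mulmxA IH.
by elim: k => [|k IH]; rewrite ?trmx1 // !iterS trmx_mul IH comm.
Qed.

Lemma unip_conj d (a g : 'M[C]_d) : a \in unitmx -> unip g -> unip (a *m g *m invmx a).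
Proof.
move=> aU [k gk]; exists k.
have -> : iter k (mulmx (a *m g *m invmx a - 1%:M)) 1%:M = a *m iter k (mulmx (g - 1%:M)) 1%:M *m invmx a.
  elim: k {gk} => [|k IH]; first by rewrite mulmx1 mulmxV.
  rewrite !iterS IH.
  have -> : a *m g *m invmx a - 1%:M = a *m (g - 1%:M) *m invmx a.
    by rewrite mulmxBr mulmx1 mulmxBl mulmxV.
  by rewrite !mulmxA mulmxKV.
by rewrite gk mulmx0 mul0mx.
Qed.

Lemma mid_block_mul n (g h : 'M[C]_(n.+1 + n.+1)) : (forall i, g (mid i) last' = 0) ->
  (forall j, h ord0 (mid j) = 0) -> mid_block (g *m h) = mid_block g *m mid_block h.
Proof.
move=> gl h0; apply/matrixP => i j; rewrite !mxE big_mid gl h0 mulr0 mul0r add0r addr0.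
by apply: eq_bigr => k _; rewrite !mxE.
Qed.

Lemma mid_block1 n : mid_block (1%:M : 'M[C]_(n.+1 + n.+1)) = 1%:M.
Proof. by apply/matrixP => i j; rewrite !mxE eq_mid. Qed.

Lemma mid_block_iota n (A : 'M[C]_(n + n)) : mid_block (iota_mx A) = A.
Proof. by apply/matrixP => i j; rewrite mxE iotaE. Qed.

Lemma mid_block_conj n (A B : 'M[C]_(n + n)) (K : 'M[C]_(n.+1 + n.+1)) :
  (forall i, K (mid i) last' = 0) -> (forall j, K ord0 (mid j) = 0) ->
  mid_block (iota_mx A *m K *m iota_mx B) = A *m mid_block K *m B.
Proof.
move=> Kl K0; rewrite -mulmxA mid_block_mul; first last.
- move=> j; rewrite mxE big_mid !iotaE !mulr0 add0r addr0.
  by rewrite big1 // => k _; rewrite K0 mul0r.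
- by move=> i; rewrite iotaE.
rewrite mid_block_mul //; last by move=> j; rewrite iotaE.
by rewrite !mid_block_iota mulmxA.
Qed.

Lemma utri_mid_block n (X : 'M[C]_(n.+1 + n.+1)) :
  (forall i, X ord0 i = (i == ord0)%:R) -> (forall i, X i last' = (i == last')%:R) ->
  utri (mid_block X)^T -> utri X^T.
Proof.
move=> X0 Xl Xm i j; rewrite mxE; move: i j.
apply: (@mid_ind n) => [||i]; apply: (@mid_ind n) => [||j] ji; rewrite ?X0 ?Xl ?eqI //.
- by exfalso; move: ji => /=; lia.
- by exfalso; move: ji => /=; case: i => i li /=; lia.
- by have := Xm i j ji; rewrite !mxE.
Qed.

Lemma conj_conj d (b c g : 'M[C]_d) : b \in unitmx -> c \in unitmx ->
  invmx (invmx b *m c) *m g *m (invmx b *m c) = invmx c *m (b *m g *m invmx b) *m c.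
Proof.
move=> bU cU; have U : invmx b *m c \in unitmx by rewrite unitmx_mul unitmx_inv bU cU.
have -> : invmx (invmx b *m c) = invmx c *m b; last by rewrite !mulmxA.
by apply: (can_inj (mulKmx U)); rewrite mulmxV // !mulmxA mulmxK // mulVmx.
Qed.

(** A common fixed column vector, found by [kolchin] for the transposes, is moved to the last basis
    vector. The form then forces the first row to be that of the identity, and the induction
    hypothesis applies to the middle block. *)
Theorem unipotent_conjugate n (H : 'M[C]_(n + n) -> Prop) : (forall g, H g -> Sp g) ->
  H 1%:M -> (forall g h, H g -> H h -> H (g *m h)) -> (forall g, H g -> unip g) ->
  exists2 a, Sp a & forall g, H g -> utri (invmx a *m g *m a)^T.
Proof.
elim: n H => [|n IH] H HS H1 HM Hu; first by exists 1%:M => [|g _ []//]; apply: Sp1.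
have [|||u u0 uE] := @kolchin _ _ (fun g => H g^T).
- by rewrite trmx1.
- by move=> g h gH hH; rewrite trmx_mul; apply: HM.
- by move=> g /Hu [k gk]; exists k; rewrite -[LHS]trmxK iter_mulmx_tr linearB /= trmx1 gk trmx0.
have fix_ g : H g -> g *m u^T = u^T.
  by move=> gH; rewrite -[g]trmxK -trmx_mul uE // trmxK.
have [|b gb be] := @gen_col R n u^T.
  by apply: contraNneq u0 => h; rewrite -[u]trmxK h trmx0.
have bS := gen_Sp gb; have bU := Sp_unit bS.
pose K g := b *m g *m invmx b.
have KS g : H g -> Sp (K g).
  by move=> gH; apply: Sp_mul; [apply: Sp_mul => //; apply: HS|apply: Sp_inv].
have Kl g : H g -> forall i, K g i last' = 1 * (i == last')%:R.
  move=> gH i; rewrite -mul_elast -be mulmxA mulmxKV // -mulmxA fix_ // be mul1r.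
  by rewrite mxE.
have Kl0 g : H g -> forall i, K g (mid i) last' = 0.
  by move=> gH i; rewrite Kl // eqI mulr0.
have K0 g : H g -> forall b, K g ord0 b = (b == ord0)%:R.
  by move=> gH b'; rewrite (last_col_row0 (oner_neq0 _) (KS g gH) (Kl g gH)) invr1 mul1r.
have KM g h : K (g *m h) = K g *m K h by rewrite /K !mulmxA mulmxKV.
pose H' A := exists2 g, H g & A = mid_block (K g).
have [||||a' a'S ha'] := IH H'.
- by move=> _ [g gH ->]; apply: (mid_block_Sp (oner_neq0 _) (KS g gH) (Kl g gH)).
- by exists 1%:M => //; rewrite /K mulmx1 mulmxV // mid_block1.
- move=> _ _ [g gH ->] [h hH ->]; exists (g *m h); first exact: HM.
  by rewrite KM mid_block_mul // => i; [exact: Kl0|rewrite K0 ?eqI].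
- move=> _ [g gH ->]; have [k gk] := unip_conj bU (Hu g gH); exists k.
  rewrite -/(K g) in gk.
  have r0 j (X : 'M[C]_(n.+1 + n.+1)) : (forall i, X ord0 (mid i) = 0) -> ((K g - 1%:M) *m X) ord0 (mid j) = 0.
    move=> X0; rewrite mulmxBl mul1mx mxE [(- X) _ _]mxE X0 subr0 mxE big_mid !K0 // eqxx eqI mul1r mul0r X0 add0r addr0.
    by rewrite big1 // => i _; rewrite K0 // eqI mul0r.
  have : mid_block (iter k (mulmx (K g - 1%:M)) 1%:M) = iter k (mulmx (mid_block (K g) - 1%:M)) 1%:M /\
    forall j, iter k (mulmx (K g - 1%:M)) 1%:M ord0 (mid j) = 0.
    elim: (k) => [|k' [IHk IH0]] /=; first by rewrite mid_block1; split=> // j; rewrite mxE eqI.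
    split; last by move=> j; apply: r0.
    rewrite mid_block_mul // ?IHk; last by move=> i; rewrite mxE Kl0 // !mxE eqI oppr0 addr0.
    congr (_ *m _); apply/matrixP => i j; by rewrite !mxE eq_mid.
  by rewrite gk => -[<- _]; apply/matrixP => i j; rewrite !mxE.
exists (invmx b *m iota_mx a'); first by apply: Sp_mul; [apply: Sp_inv|apply: Sp_iota].
move=> g gH; have a'U := Sp_unit a'S; have iU := Sp_unit (Sp_iota a'S).
have iV : invmx (iota_mx a') = iota_mx (invmx a').
  by rewrite -[RHS](mulKmx iU) -iota_mul mulmxV // iota1 mulmx1.
have -> : invmx (invmx b *m iota_mx a') *m g *m (invmx b *m iota_mx a') =
    iota_mx (invmx a') *m K g *m iota_mx a'.
  by rewrite -iV; apply: conj_conj.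
have A := ha' _ (ex_intro2 _ _ g gH erefl).
set X := iota_mx (invmx a') *m K g *m iota_mx a'.
have pE i : (iota_mx (invmx a') *m K g) ord0 i = (i == ord0)%:R.
  rewrite mxE big_mid !iotaE mul1r mul0r addr0 K0 // big1 ?addr0 // => k _.
  by rewrite iotaE mul0r.
have X0 i : X ord0 i = (i == ord0)%:R.
  rewrite /X mxE big_mid !pE eqxx eqI mul0r addr0 mul1r big1 ?addr0; last first.
    by move=> k _; rewrite pE eqI mul0r.
  by move: i; apply: (@mid_ind n) => [||i]; rewrite iotaE ?eqI.
have Xl i : X i last' = (i == last')%:R.
  rewrite /X -mulmxA mxE; transitivity (\sum_k iota_mx (invmx a') i k * (k == last')%:R).
    apply: eq_bigr => k _; congr (_ * _); rewrite mxE big_mid !iotaE mulr0 mulr1 add0r Kl // mul1r.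
    by rewrite big1 ?add0r // => j _; rewrite iotaE mulr0.
  rewrite (bigD1 last') //= eqxx mulr1 big1 ?addr0 => [|k /negbTE ->]; last by rewrite mulr0.
  by move: i; apply: (@mid_ind n) => [||i]; rewrite iotaE ?eqI.
have Xm i j : X (mid i) (mid j) = (invmx a' *m mid_block (K g) *m a') i j.
  by rewrite -mid_block_conj //; [rewrite [RHS]mxE|exact: Kl0|move=> k; rewrite K0 ?eqI].
apply: utri_mid_block => //; rewrite (_ : mid_block X = invmx a' *m mid_block (K g) *m a') //.
by apply/matrixP => i j; rewrite [LHS]mxE Xm.
Qed.

End UnipotentConjugacy.

(** * Products of minors as combinations of translates *)

Section CauchyBinet.
Variable F : comNzRingType.

Lemma det_mulmx_sum k N (A : 'M[F]_(k, N)) (B : 'M[F]_(N, k)) : \det (A *m B) =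
  \sum_(f : {ffun 'I_k -> 'I_N}) (\prod_i A i (f i)) * \det (\matrix_(i, j) B (f i) j).
Proof.
pose AB (s : 'S_k) i j := A i j * B j (s i).
transitivity (\sum_(f : {ffun 'I_k -> 'I_N}) \sum_(s : 'S_k) (-1) ^+ s * \prod_i AB s i (f i)).
  rewrite exchange_big; apply: eq_bigr => /= s _; rewrite -big_distrr /=.
  congr (_ * _); rewrite -(bigA_distr_bigA (AB s)) /=.
  by apply: eq_bigr => x _; rewrite mxE.
apply: eq_bigr => f _; rewrite big_distrr /=; apply: eq_bigr => s _.
rewrite mulrCA big_split //=; congr (_ * (_ * _)).
by apply: eq_bigr => x _; rewrite mxE.
Qed.

(** The sum runs over all maps f: those with a repeated value contribute 0 and each subset of
    indices occurs k! times, whence the factor. *)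
Lemma cauchy_binet k N (A : 'M[F]_(k, N)) (B : 'M[F]_(N, k)) : (k`!)%:R * \det (A *m B) =
  \sum_(f : {ffun 'I_k -> 'I_N}) \det (\matrix_(i, j) A i (f j)) * \det (\matrix_(i, j) B (f i) j).
Proof.
transitivity (\sum_(s : 'S_k) \det (A *m B)).
  by rewrite sumr_const card_Sn mulr_natl.
symmetry; transitivity (\sum_(f : {ffun 'I_k -> 'I_N}) \sum_(s : 'S_k)
   (-1) ^+ s * (\prod_i A i (f (s i))) * \det (\matrix_(i, j) B (f i) j)).
  apply: eq_bigr => f _; rewrite /determinant mulr_suml; apply: eq_bigr => s _.
  by congr (_ * _ * _); apply: eq_bigr => i _; rewrite mxE.
rewrite exchange_big /=; apply: eq_bigr => s _; rewrite det_mulmx_sum.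
rewrite (reindex_inj (h := fun f : {ffun 'I_k -> 'I_N} => [ffun i => f (s^-1%g i)])) /=; last first.
  move=> f g /ffunP fg; apply/ffunP => i; have := fg (s i); by rewrite !ffunE permK.
apply: eq_bigr => f _.
rewrite (_ : \prod_i _ = \prod_i A i (f i)); last by apply: eq_bigr => i _; rewrite ffunE permK.
rewrite (_ : \matrix_(i, j) _ = row_perm s^-1 (\matrix_(i, j) B (f i) j)); last first.
  by apply/matrixP => i j; rewrite !mxE ffunE.
rewrite row_permE det_mulmx det_perm odd_permV mulrA -[RHS]mul1r mulrA; congr (_ * _).
by rewrite -mulrA [_ * (-1) ^+ _]mulrC mulrA -signr_addb addbb mul1r.
Qed.

End CauchyBinet.

(** * Hermitian kernels and spans of their values *)

Section Gram.
Variable F : numClosedFieldType.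

Lemma gram_unit m d (B : 'M[F]_(m, d)) : row_free B -> B *m (map_mx Num.conj B)^T \in unitmx.
Proof.
move=> Bf; rewrite -row_free_unit; apply/row_freeP.
have : kermx (B *m (map_mx Num.conj B)^T) = 0.
  apply/eqP; rewrite -submx0; apply/rV_subP => v /sub_kermxP; rewrite mulmxA.
  set w := v *m B => wB.
  have : w *m (map_mx Num.conj w)^T = 0.
    by rewrite {2}/w map_mxM trmx_mul mulmxA wB mul0mx.
  move=> /matrixP /(_ 0 0); rewrite !mxE => /eqP; rewrite psumr_eq0; last first.
    by move=> j _; rewrite !mxE mul_conjC_ge0.
  move=> /allP w0; have : w = 0.
    apply/rowP => j; have := w0 j (mem_index_enum _); rewrite !mxE mul_conjC_eq0 => /eqP.
    by [].
  by move=> /eqP; rewrite /w mulmx_free_eq0 // => /eqP ->; rewrite sub0mx.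
by move/eqP; rewrite kermx_eq0 => /row_freeP.
Qed.

(** A positive kernel of finite rank with features [m j]; [Fs] selects functions known to occur
    among them. The factor kappa absorbs the k! of [cauchy_binet]. *)
Definition hkernel (G : Type) (K : G -> G -> F) (Fs : (G -> F) -> Prop) : Prop :=
  exists (J : finType) (m : J -> G -> F) (kappa : F), kappa != 0 /\
    (forall h g, kappa * K h g = \sum_j (m j h)^* * m j g) /\
    forall f, Fs f -> exists j, f = m j.

Lemma hkernel1 G : @hkernel G (fun _ _ => 1) (fun f => f = fun _ => 1).
Proof.
exists unit, (fun _ _ => 1), 1; split; first exact: oner_neq0.
by split=> [h g|f ->]; [rewrite big_const card_unit /= conjC1 mulr1 addr0|exists tt].
Qed.

(** Kernels multiply pointwise and their features multiply pairwise; thus products of minors become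
    features of a product of kernels. *)
Lemma hkernel_mul G (K K' : G -> G -> F) Fs Fs' : hkernel K Fs -> hkernel K' Fs' ->
  hkernel (fun h g => K h g * K' h g) (fun f => exists f1 f2, [/\ Fs f1, Fs' f2 & f = fun g => f1 g * f2 g]).
Proof.
move=> [J [m [k [k0 [mE mF]]]]] [J' [m' [k' [k'0 [mE' mF']]]]].
exists (J * J')%type, (fun j g => m j.1 g * m' j.2 g), (k * k'); split; first by rewrite mulf_neq0.
split=> [h g|f [f1 [f2 [/mF [j1 ->] /mF' [j2 ->] ->]]]]; last by exists (j1, j2).
rewrite mulrACA mE mE' big_distrlr /= pair_big /=; apply: eq_bigr => -[a b] _ /=.
by rewrite rmorphM /= mulrACA.
Qed.

Lemma hkernel_prod G (T : Type) (s : seq T) (K : T -> G -> G -> F) Fs :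
  (forall t, hkernel (K t) (Fs t)) ->
  hkernel (fun h g => \prod_(t <- s) K t h g)
    (fun f => exists2 fs : T -> G -> F, forall t, Fs t (fs t) & f = fun g => \prod_(t <- s) fs t g).
Proof.
move=> HK; elim: s => [|t s IH].
  have [J [m [k [k0 [mE mF]]]]] := hkernel1 G; exists J, m, k; split=> //; split.
    by move=> h g; rewrite big_nil -mE.
  by move=> f [fs _ ->]; apply: mF; apply/funext => g; rewrite big_nil.
have [J [m [k [k0 [mE mF]]]]] := hkernel_mul (HK t) IH; exists J, m, k; split=> //; split.
  by move=> h g; rewrite big_cons -mE.
move=> f [fs Hfs ->]; apply: mF; exists (fs t), (fun g => \prod_(t <- s) fs t g); split=> //.
  by exists fs.
by apply/funext => g; rewrite big_cons.
Qed.

(* Among the feature vectors of points of [P] choose a maximal linearly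
   independent family, with matrix [B]; as [B B^*] is invertible, every feature
   vector [v] is [v B^* (B B^* )^-1 B], whose coefficients are values of [K]. *)
Lemma hkernel_span G (K : G -> G -> F) Fs (P : G -> Prop) f : hkernel K Fs -> Fs f ->
  exists m (h : 'I_m -> G) (c : 'I_m -> F), (forall i, P (h i)) /\
    forall g, P g -> f g = \sum_i c i * K (h i) g.
Proof.
move=> [J [m [k [k0 [mE mF]]]]] /mF [j ->].
pose d := #|{: J}|; pose M g : 'rV[F]_d := \row_l m (enum_val l) g.
pose Q b := `[< exists h : 'I_b -> G, (forall i, P (h i)) /\ row_free (\matrix_i M (h i)) >].
have exQ : exists b, Q b.
  exists 0%N; apply/asboolP; exists (fun i : 'I_0 => match notF (ltn_ord i) with end).
  by split; [case|rewrite -row_leq_rank].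
have Qd b : Q b -> (b <= d)%N.
  by move=> /asboolP [h [_ /eqP <-]]; apply: rank_leq_col.
case: (ex_maxnP exQ Qd) => b /asboolP [h [hP hf]] bmax.
set B := \matrix_i M (h i) in hf.
have MB g : P g -> (M g <= B)%MS.
  move=> Pg; apply: contraT => nB; have := bmax b.+1; rewrite ltnn; apply.
  apply/asboolP; exists (fun i : 'I_b.+1 => if unlift ord0 i is Some j then h j else g); split.
    by move=> i; case: unliftP.
  have -> : (\matrix_i M (if unlift ord0 i is Some j then h j else g) : 'M_(b.+1, d)) =
     col_mx (M g) B :> 'M_(1 + b, d).
    apply/row_matrixP => i; rewrite rowK; case: (split_ordP i) => l ->.
      rewrite rowKu (ord1 l) row_id (_ : lshift b 0 = ord0) ?unlift_none //.
      exact: val_inj.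
    by rewrite rowKd rowK (_ : rshift 1 l = lift ord0 l) ?liftK //; apply: val_inj.
  have : (\rank B < \rank (M g + B)%MS)%N.
    by apply: rank_ltmx; rewrite ltmxE addsmxSr addsmx_sub submx_refl andbT.
  by rewrite (eqP hf) addsmxE /row_free eqn_leq rank_leq_row.
have BU := gram_unit hf.
exists b, h, (fun i => k * (invmx (B *m (map_mx Num.conj B)^T) *m B) i (enum_rank j)); split=> // g Pg.
have [x xE] := submxP (MB g Pg).
have -> : m j g = (M g *m (map_mx Num.conj B)^T *m (invmx (B *m (map_mx Num.conj B)^T) *m B)) 0 (enum_rank j).
  by rewrite xE -!mulmxA (mulmxA B) mulKVmx // -xE mxE enum_rankK.
rewrite mxE; apply: eq_bigr => i _; rewrite mulrC [k * _]mulrC -mulrA; congr (_ * _).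
rewrite mE mxE [RHS](reindex_onto enum_val enum_rank) /=; last by move=> l _; rewrite enum_rankK.
by apply: eq_big => [l|l _]; rewrite ?enum_valK ?eqxx // !mxE mulrC.
Qed.
End Gram.

Section MinorKernel.
Context {R : realType}.
Local Notation C := R[i].

Definition kle n (i : 'I_n) : (i.+1 <= n + n)%N := leq_trans (ltn_ord i) (leq_addr n n).

Definition herm n (h : 'M[C]_(n + n)) : 'M[C]_(n + n) := (map_mx Num.conj h)^T.

Lemma Sp_herm n (h : 'M[C]_(n + n)) : Sp h -> Sp (herm h).
Proof. by move=> hS; apply/Sp_tr/Sp_conj. Qed.

Lemma Dk_kernel n k (kN : (k <= n + n)%N) :
  hkernel (fun h g : 'M[C]_(n + n) => tminor kN (herm h *m g)) (fun f => exists phi, f = mxminor kN phi).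
Proof.
exists {ffun 'I_k -> 'I_(n + n)}, (fun phi : {ffun 'I_k -> 'I_(n + n)} => @mxminor R n k kN phi), (k`!)%:R.
split; first by rewrite pnatr_eq0 -lt0n fact_gt0.
split=> [h g|f [phi ->]]; last first.
  exists (finfun phi); apply/funext => g; congr (\det _); apply/matrixP => a b.
  by rewrite !mxE ffunE.
pose A : 'M[C]_(k, n + n) := \matrix_(a, c) (h c (lrow kN a))^*.
pose B : 'M[C]_(n + n, k) := \matrix_(c, b) g c (lrow kN b).
have -> : tminor kN (herm h *m g) = \det (A *m B).
  congr (\det _); apply/matrixP => a b; rewrite mxE [LHS]mxE [RHS]mxE.
  by apply: eq_bigr => c _; rewrite !mxE.
rewrite cauchy_binet; apply: eq_bigr => phi _; congr (_ * _).
  rewrite -det_tr /mxminor -det_map_mx; congr (\det _); apply/matrixP => a b.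
  by rewrite !mxE.
by congr (\det _); apply/matrixP => a b; rewrite !mxE.
Qed.

Theorem minors_span n (a : 'I_n -> nat) (phi : forall i : 'I_n, 'I_(a i) -> 'I_i.+1 -> 'I_(n + n)) :
  exists m (h : 'I_m -> 'M[C]_(n + n)) (c : 'I_m -> C), (forall l, Sp (h l)) /\
    forall g, Sp g -> \prod_i \prod_(b < a i) mxminor (kle i) (phi i b) g =
      \sum_l c l * \prod_i tminor (kle i) (h l *m g) ^+ a i.
Proof.
have K1 (i : 'I_n) := hkernel_prod (index_enum 'I_(a i)) (fun=> Dk_kernel (kle i)).
have K2 := hkernel_prod (index_enum 'I_n) K1.
have [|m [h [c [hS E]]]] := hkernel_span (@Sp R n) K2 (f := fun g => \prod_i \prod_(b < a i) mxminor (kle i) (phi i b) g).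
  exists (fun i g => \prod_(b < a i) mxminor (kle i) (phi i b) g) => // i.
  by exists (fun b => mxminor (kle i) (phi i b)) => // b; exists (phi i b).
exists m, (fun l => herm (h l)), c; split=> [l|g gS]; first exact: Sp_herm.
rewrite E //; apply: eq_bigr => l _; congr (_ * _); apply: eq_bigr => i _.
by rewrite prodr_const card_ord.
Qed.

End MinorKernel.

(** * Integral points of the polytopes *)

Section Patterns.
Local Notation V := (nat * nat)%type.

Lemma bound_add n i a a' (p p' : V -> int) m :
  bound n i (a + a') (fun v => p v + p' v) m = bound n i a p m + bound n i a' p' m.
Proof. by elim: m => //= m ->; case: ifP => _; lia. Qed.

Definition unshift (p0 : nat -> int) (q : V -> int) (v : V) : int :=
  if v.1 is m.+1 then q (m, v.2.-1) else p0 v.2.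

Definition half0 n (a : nat -> int) (p0 : nat -> int) i : int :=
  if (i.+1 < n)%N then a i - p0 (n.*2 - i.+1)%N + p0 (n.*2 - i.+2)%N else a i.

Definition row0 n (a : nat -> int) (p0 : nat -> int) : Prop := forall i, (i < n)%N ->
  ((i.+1 < n)%N -> 0 <= p0 (n.*2 - i.+1)%N <= a i) /\ 0 <= p0 i.+1 <= half0 n a p0 i.

Definition next n (a : nat -> int) (p0 : nat -> int) i : int :=
  half0 n.+1 a p0 i.+1 - p0 i.+2 + p0 i.+1.

Lemma next_bound n a (p : V -> int) i : bound n.+1 i.+1 (a i.+1) p 1 = next n a (fun b => p (0%N, b)) i.
Proof. by rewrite /next /half0 /=; case: ifP. Qed.

Lemma pattern_unshift n a p0 q : row0 n.+1 a p0 -> pattern n (next n a p0) q -> pattern n.+1 a (unshift p0 q).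
Proof.
move=> H0 H i [|m] mi lin.
  exact: (H0 i lin).
case: i mi lin => // i mi lin.
have [h1 h2] := H i m mi lin.
have bE : bound n.+1 i.+1 (a i.+1) (unshift p0 q) m.+1 = bound n i (next n a p0 i) q m.
  rewrite bound_shift // next_bound; elim: (m) => //= m' ->.
  by [].
have e1 : (n.+1.*2 - i.+2)%N = (n.*2 - i.+1).+1 by lia.
split.
  move=> lin'; rewrite bE; have := h1 lin'; rewrite /unshift /= e1 //=.
by rewrite /bound_half bE; move: h2; rewrite /unshift /bound_half /= e1 !ltnS; case: ifP => // lt;
  rewrite (_ : (n.+1.*2 - i.+3)%N = (n.*2 - i.+2).+1) //; lia.
Qed.

Lemma pattern_row0 n a p : pattern n.+1 a p -> row0 n.+1 a (fun b => p (0%N, b)).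
Proof. by move=> H i lin; apply: (H i 0%N). Qed.

Lemma next_ge0 n a p0 : row0 n.+1 a p0 -> forall i, (i < n)%N -> 0 <= next n a p0 i.
Proof. by move=> H i lin; rewrite /next; have [_] := H i.+1 lin; have [_] := H i (ltnW lin); lia. Qed.

(** A greedy splitting: in row 0 the first summand takes from each entry as much as its own bound
    allows, and the remainder obeys the bounds of the second since bounds are additive. Row 0
    determines the two weights for the lower rows, which are split by induction. *)
Lemma pattern_split n a a' p : (forall i, (i < n)%N -> 0 <= a i) -> (forall i, (i < n)%N -> 0 <= a' i) ->
  pattern n (fun i => a i + a' i) p ->
  exists p1 p2, [/\ pattern n a p1, pattern n a' p2 & {in vars n, forall v, p v = p1 v + p2 v}].
Proof.
elim: n a a' p => [|n IH] a a' p a0 a'0 H; first by exists (fun=> 0), (fun=> 0); split.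
have R0 := pattern_row0 H; set p0 := fun b => p (0%N, b) in R0.
(* For a column b beyond n, [(n.+1.*2 - b).-1] is the index of the simple root moving it. [l0] is
   the value of [half0] left for the low columns. Column n+1, where both families meet, is treated
   by [hi]. *)
pose hi b := Order.min (p0 b) (a (n.+1.*2 - b).-1).
pose l0 i := if (i.+1 < n.+1)%N then a i - hi (n.+1.*2 - i.+1)%N + hi (n.+1.*2 - i.+2)%N else a i.
pose p1 b := if (n < b)%N then hi b else Order.min (p0 b) (l0 b.-1).
pose p2 b := p0 b - p1 b.
have hiE i : (i.+1 < n.+1)%N -> p1 (n.+1.*2 - i.+1)%N = hi (n.+1.*2 - i.+1)%N.
  by move=> h; rewrite /p1 ifT //; lia.
have hiE2 i : (i.+1 < n.+1)%N -> p1 (n.+1.*2 - i.+2)%N = hi (n.+1.*2 - i.+2)%N.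
  by move=> h; rewrite /p1 ifT //; lia.
have lowE i : (i.+1 < n.+1)%N -> p1 i.+1 = Order.min (p0 i.+1) (l0 i).
  by move=> h; rewrite /p1 ifF //; lia.
have l0E i : half0 n.+1 a p1 i = l0 i.
  by rewrite /half0 /l0; case: ifP => // h; rewrite hiE // hiE2.
have hib i : (i < n.+1)%N -> [/\ 0 <= hi (n.+1.*2 - i.+1)%N <= a i &
    0 <= p0 (n.+1.*2 - i.+1)%N - hi (n.+1.*2 - i.+1)%N <= a' i].
  move=> lin; have [h1 h2] := R0 i lin; have A := a0 i lin; have A' := a'0 i lin.
  have : 0 <= p0 (n.+1.*2 - i.+1)%N <= a i + a' i.
    have [lt|] := boolP (i.+1 < n.+1)%N; first exact: h1.
    move=> ge; have -> : (n.+1.*2 - i.+1)%N = i.+1 by lia.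
    by move: h2; rewrite /half0 (negbTE ge).
  rewrite /hi (_ : (n.+1.*2 - (n.+1.*2 - i.+1)).-1 = i); last lia.
  by move=> h; split; lia.
have R1 : row0 n.+1 a p1.
  move=> i lin; split; first by move=> h; rewrite hiE //; have [] := hib i lin.
  rewrite l0E; have [_ h2] := R0 i lin; rewrite /l0; case: ifP => h.
    have [b1 _] := hib i lin; have [b2 _] := hib i.+1 h.
    by rewrite lowE // /l0 h; lia.
  have [b1 _] := hib i lin; move: b1; rewrite (_ : (n.+1.*2 - i.+1)%N = i.+1); last lia.
  by rewrite /p1 ifT //; lia.
have hsum i : half0 n.+1 (fun i => a i + a' i) p0 i = half0 n.+1 a p1 i + half0 n.+1 a' p2 i.
  by rewrite /half0 /p2; case: ifP => _; lia.
have R2 : row0 n.+1 a' p2.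
  move=> i lin; have [_ h2] := R0 i lin; split.
    by move=> h; rewrite /p2 hiE //; have [_] := hib i lin.
  have : 0 <= half0 n.+1 a' p2 i.
    rewrite /half0; case: ifP => h; last exact: a'0.
    rewrite {1}/p2 hiE // /p2 hiE2 //; have [_ b1] := hib i lin; have [_ b2] := hib i.+1 h.
    by lia.
  move: h2; rewrite hsum l0E; have [h|h] := boolP (i.+1 < n.+1)%N.
    by rewrite /p2 lowE //; lia.
  have [b0 b1] := hib i lin; move: b0 b1; rewrite (_ : (n.+1.*2 - i.+1)%N = i.+1); last lia.
  rewrite /l0 /half0 (negbTE h) => b0 b1 _ _.
  by rewrite /p2 /p1 ifT //; lia.
have nE i : bound n.+1 i.+1 (a i.+1 + a' i.+1) p 1 = next n a p1 i + next n a' p2 i.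
  by rewrite (next_bound n (fun i => a i + a' i)) -/p0 /next hsum /p2; ring.
have [q1 [q2 [Q1 Q2 qE]]] := IH _ _ (fun v => p (up v)) (next_ge0 R1) (next_ge0 R2)
  (pattern_ext (fun i _ => nE i) (pattern_shift H)).
exists (unshift p1 q1), (unshift p2 q2); split; [exact: pattern_unshift|exact: pattern_unshift|].
move=> [[|m] b] hv; rewrite /unshift /=; first by rewrite /p2 /p0; lia.
have b0 : (0 < b)%N by move: hv; rewrite mem_vars /=; lia.
rewrite -(qE (m, b.-1)) ?/up /= ?prednK //.
by move: hv; rewrite !mem_vars /=; lia.
Qed.

(** A crude bound that suffices for finiteness: [half0] and the entries of row 0 are at most 2A, and
    a gap of the next weight is at most [half0] plus one entry, which gives the factor 4 per row. *)
Lemma pattern_le n A a p : (forall i, (i < n)%N -> a i <= A) -> pattern n a p ->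
  {in vars n, forall v, p v <= 4%:Z ^+ n * A}.
Proof.
elim: n A a p => [|n IH] A a p aA H; first by [].
have R0 := pattern_row0 H; set p0 := fun b => p (0%N, b) in R0.
have A0 : 0 <= A.
  have [_] := R0 n (ltnSn n); rewrite /half0 ltnn; have := aA n (ltnSn n); lia.
have hi i : (i < n.+1)%N -> (i.+1 < n.+1)%N -> 0 <= p0 (n.+1.*2 - i.+1)%N <= A.
  by move=> lin h; have [/(_ h)] := R0 i lin; have := aA i lin; lia.
have hl : 0 <= p0 n.+1 <= A.
  by have [_] := R0 n (ltnSn n); rewrite /half0 ltnn; have := aA n (ltnSn n); lia.
have hh i : (i < n.+1)%N -> half0 n.+1 a p0 i <= A + A.
  move=> lin; rewrite /half0; have := aA i lin; case: ifP => h; last by lia.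
  have := hi i lin h; have [h'|h'] := boolP (i.+2 < n.+1)%N.
    by have := hi i.+1 h h'; lia.
  by move: hl; rewrite (_ : (n.+1.*2 - i.+2)%N = n.+1); lia.
have lo i : (i < n.+1)%N -> 0 <= p0 i.+1 <= A + A.
  by move=> lin; have [_] := R0 i lin; have := hh i lin; lia.
have E4 : 4%:Z ^+ n.+1 * A = 4%:Z ^+ n * (A + A + (A + A)) by rewrite exprS; ring.
have E1 : 1 <= 4%:Z ^+ n by rewrite exprn_ege1.
have G : A + A <= 4%:Z ^+ n.+1 * A.
  rewrite E4; apply: (@le_trans _ _ (A + A + (A + A))); first by lia.
  by rewrite ler_peMl //; lia.
move=> [[|m] b] hv.
  apply: le_trans G; have [bn|bn] := leqP b n.+1.
    move: hv; rewrite mem_vars /= => hv; have hb : (b.-1 < n.+1)%N by lia.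
    by have := lo _ hb; rewrite prednK /p0; lia.
  move: hv; rewrite mem_vars /= => hv.
  have h1 : (n.+1.*2 - b.+1 < n.+1)%N by lia.
  have h2 : ((n.+1.*2 - b.+1).+1 < n.+1)%N by lia.
  by have := hi _ h1 h2; rewrite (_ : (n.+1.*2 - (n.+1.*2 - b.+1).+1)%N = b) /p0; lia.
have b0 : (0 < b)%N by move: hv; rewrite mem_vars /=; lia.
have W i : (i < n)%N -> bound n.+1 i.+1 (a i.+1) p 1 <= A + A + (A + A).
  move=> lin; rewrite next_bound -/p0 /next; have := hh i.+1 lin.
  by have := lo i.+1 lin; have := lo i (ltnW lin); lia.
have := IH _ _ _ W (pattern_shift H) (m, b.-1).
by rewrite /up /= prednK // E4; apply; move: hv; rewrite !mem_vars /=; lia.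
Qed.

Lemma pattern_split_sum n (T : eqType) (s : seq T) (a : T -> nat -> int) p : uniq s ->
  (forall t i, (i < n)%N -> 0 <= a t i) -> pattern n (fun i => \sum_(t <- s) a t i) p ->
  exists q : T -> V -> int, (forall t, t \in s -> pattern n (a t) (q t)) /\
    {in vars n, forall v, p v = \sum_(t <- s) q t v}.
Proof.
move=> + a0; elim: s p => [|t s IH] p.
  move=> _ H; exists (fun _ _ => 0); split=> // v hv; rewrite big_nil.
  have := pattern_ge0 H hv; have := @pattern_le n 0 _ _ _ H v hv; rewrite mulr0.
  by move=> h1 h2; apply/eqP; rewrite eq_le h2 h1 // => i _; rewrite big_nil.
move=> /= /andP [ts us] H; have [|||p1 [p2 [H1 H2 pE]]] := @pattern_split n (a t) (fun i => \sum_(t <- s) a t i) p.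
- by move=> i; apply: a0.
- by move=> i lin; apply: sumr_ge0 => u _; apply: a0.
- by apply: pattern_ext H => i _; rewrite big_cons.
have [q [Hq qE]] := IH p2 us H2.
exists (fun u => if u == t then p1 else q u); split.
  move=> u; rewrite inE; case: eqP => [-> _ //|_ /=]; exact: Hq.
move=> v hv; rewrite big_cons eqxx pE // qE //; congr (_ + _).
by rewrite !big_seq; apply: eq_bigr => u us'; rewrite ifN //; apply: contraNneq ts => <-.
Qed.

End Patterns.

Section PatternLead.
Context {R : realType}.
Local Notation C := R[i].

Definition extw n (a : 'I_n -> nat) (i : nat) : int := if insub i is Some j then (a j)%:Z else 0.

(** The index type [T] lists the fundamental weights with multiplicity, the one of index i being
    taken [a i] times. The pattern splits accordingly, each part is the lowest exponent of a minor,
    and lowest exponents add up in products. *)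
Lemma pattern_lead n (a : 'I_n -> nat) p : pattern n (extw a) p ->
  exists phi : forall i : 'I_n, 'I_(a i) -> 'I_i.+1 -> 'I_(n + n),
    Lead (vars n) (fun y : nat * nat -> C => \prod_i \prod_(b < a i) mxminor (kle i) (phi i b) (umx n y))
      (fun v => `|p v|%N).
Proof.
move=> H; pose T := {i : 'I_n & 'I_(a i)}; pose tg i b : T := existT (fun i => 'I_(a i)) i b.
have [||q [Hq qE]] := @pattern_split_sum n T (index_enum T) (fun t i => (i.+1 == (tag t).+1)%:Z) p (index_enum_uniq _).
- by move=> t i _; case: eqP.
- apply: pattern_ext H => i lin; rewrite /extw insubT.
  rewrite -(@sig_big_dep _ _ _ _ _ predT (fun _ => predT) (fun (j : 'I_n) (_ : 'I_(a j)) => (i.+1 == j.+1)%:Z)) /=.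
  rewrite (bigD1 (Ordinal lin)) //= eqxx sumr_const card_ord big1 ?addr0 => [|j].
    by rewrite -mulr_natr mul1r natz.
  rewrite -val_eqE /= eqSS eq_sym => /negbTE ->; apply: big1 => //.
have L (t : T) : {f | Lead (vars n) (fun y : nat * nat -> C => mxminor (kle (tag t)) f (umx n y)) (fun v => `|q t v|%N)}.
  apply: cid; apply: fundamental_lead; first exact: ltn_ord.
  by apply: Hq; rewrite mem_index_enum.
exists (fun i b => sval (L (tg i b))).
have := Lead_prod (index_enum 'I_n) (fun i => Lead_prod (index_enum 'I_(a i)) (fun b => svalP (L (tg i b)))).
apply: Lead_eqp => v hv; apply/eqP; rewrite -eqz_nat; apply/eqP.
rewrite gez0_abs ?(pattern_ge0 H hv) // qE //.
transitivity (\sum_(t : T) q (tg (tag t) (tagged t)) v); last by apply: eq_bigr => -[].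
rewrite -(@sig_big_dep _ _ _ _ _ predT (fun _ => predT) (fun (j : 'I_n) (b : 'I_(a j)) => q (tg j b) v)) /=.
rewrite -natz natr_sum; apply: eq_bigr => i _; rewrite natr_sum; apply: eq_bigr => b _.
rewrite natz gez0_abs //; apply: pattern_ge0 hv; apply: Hq; exact: mem_index_enum.
Qed.

End PatternLead.

(** * Comparison of the polytopes with integer patterns *)

Section DeltaPattern.
Context {R : realType}.

Definition wz n (lam : 'rV[int]_n) (i : nat) : int := if insub i is Some j then lam 0 j else 0.

Definition xco n (q : {ffun xvar n -> int}) (v : nat * nat) : int :=
  if [pick k | (Defs.xrow k == v.1.+1) && (Defs.xcol k == v.2.+1)] is Some k then q k else 0.

Variables (n : nat) (lamz : 'rV[int]_n) (q : {ffun xvar n -> int}).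
Variables (lam : 'rV[R]_n) (p : {ffun xvar n -> R}) (s : R).
Hypothesis s0 : 0 < s.
Hypothesis lamE : lam = s *: map_mx intr lamz.
Hypothesis pE : forall k, p k = s * (q k)%:~R.

Let a i := wz lamz i - wz lamz i.+1.

Lemma wcoordE i : (0 < i)%N -> wcoord lam i = s * (wz lamz i.-1)%:~R.
Proof. by move=> i0; rewrite /wcoord /wz lamE; case: insub => [j|]; rewrite ?mulr0 // !mxE. Qed.

Lemma pcoordE v : pcoord p v.1.+1 v.2.+1 = s * (xco q v)%:~R.
Proof. by rewrite /pcoord /xco; case: pickP => [k _|_]; rewrite ?pE ?mulr0. Qed.

Let th := gc_theta lam (p_theta lam p).

Lemma thE m i : (0 < i <= n - m)%N -> th m i = p_theta lam p m i.
Proof. by rewrite /th /gc_theta => /andP [i0 im]; case: m im => // m ->. Qed.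

Lemma th_out m : th m (n - m).+1 = 0.
Proof.
rewrite /th /gc_theta; case: m => [|m] /=; last by rewrite ltnn.
by rewrite subn0 /wcoord insubF // ltnn.
Qed.

Lemma etaE m i : (0 < i <= n - m)%N -> p_eta lam p m.+1 i = th m i - s * (xco q (m, (n.*2 - (i + m))%N))%:~R.
Proof.
move=> hi; rewrite /p_eta /eta_step /= -thE //; congr (_ - _).
by rewrite -pcoordE /=; congr (pcoord _ _ _); lia.
Qed.

Lemma th_step m i : (0 < i <= n - m.+1)%N -> th m.+1 i = p_eta lam p m.+1 i.+1 + s * (xco q (m, (i + m)%N))%:~R.
Proof. by move=> hi; rewrite thE //= -pcoordE /= addnS. Qed.

(** The recursion for theta becomes that of [bound] on consecutive differences. At the last index
    the next theta is read as 0, and there the columns [n.*2 - i.+1] and [i.+1] of the simple root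
    coincide. *)
Lemma th_bound m i : (0 < i <= n - m)%N ->
  th m i - th m i.+1 = s * (bound n (i + m).-1 (a (i + m).-1) (xco q) m)%:~R.
Proof.
elim: m i => [|m IH] i hi.
  rewrite addn0 subn0 in hi *; rewrite [th 0 i]/th /gc_theta /= [th 0 _]/th /gc_theta /= !wcoordE //; last by lia.
  by rewrite -mulrBr -rmorphB /= /a prednK //; case/andP: hi.
rewrite addnS /=.
have h1 : (0 < i.+1 <= n - m)%N by lia.
rewrite th_step // etaE //.
have [iN|iN] := ltnP i (n - m.+1).
  have h2 : (0 < i.+2 <= n - m)%N by lia.
  rewrite th_step; last by lia.
  rewrite etaE //; have := IH _ h1; rewrite addSn /= => B.
  have -> : th m i.+1 = th m i.+2 + s * (bound n (i + m) (a (i + m)) (xco q) m)%:~R by rewrite -B addrC subrK.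
  rewrite ifT; last by lia.
  rewrite !addSn !(rmorphD, rmorphB) /=; ring.
have -> : i = (n - m.+1)%N by lia.
rewrite th_out ifF; last by lia.
have := IH _ h1; have -> : i = (n - m.+1)%N by lia.
have -> : (n - m.+1).+2 = (n - m).+1 by lia.
rewrite th_out subr0 addSn /= => ->.
rewrite !(rmorphD, rmorphB) /=.
have -> : (n.*2 - (n - m.+1 + m).+1)%N = (n - m.+1 + m).+1 by lia.
by ring.
Qed.

(** That eta lies between two theta means that the entry of the high column lies between 0 and their
    difference, which is [bound]; likewise for theta between two eta and [bound_half]. For the last
    simple root only the first kind occurs, and its column is the low one too. *)
Lemma delta'_pattern : delta'_weight lam p <-> pattern n a (xco q).
Proof.
have sle x y : (s * x%:~R <= s * y%:~R :> R) = (x <= y) by rewrite ler_pM2l // ler_int.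
rewrite /delta'_weight /gelfand_cetlin -/th.
have half m i : (0 < i)%N -> (i < n - m)%N ->
   p_eta lam p m.+1 i - p_eta lam p m.+1 i.+1 = s * (bound_half n (i + m).-1 (a (i + m).-1) (xco q) m)%:~R.
  move=> i0 iN; rewrite !etaE; [|lia|lia].
  have -> : th m i = th m i.+1 + s * (bound n (i + m).-1 (a (i + m).-1) (xco q) m)%:~R.
    by rewrite -th_bound; [ring|lia].
  rewrite /bound_half ifT; last by lia.
  have -> : (i + m).-1.+1 = (i + m)%N by lia.
  rewrite addSn; by rewrite !(rmorphD, rmorphB) /=; ring.
have first m i : (m <= i < n)%N -> th m (i - m).+1 >= p_eta lam p m.+1 (i - m).+1 /\
    p_eta lam p m.+1 (i - m).+1 >= th m (i - m).+2 <->
    0 <= xco q (m, (n.*2 - i.+1)%N) <= bound n i (a i) (xco q) m.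
  move=> hi; rewrite etaE; last by lia.
  have := @th_bound m (i - m).+1; rewrite (_ : ((i - m).+1 + m)%N = i.+1) /=; last by lia.
  move=> tb; have -> : th m (i - m).+1 = th m (i - m).+2 + s * (bound n i (a i) (xco q) m)%:~R.
    by rewrite -tb; [ring|lia].
  rewrite -!sle mulr0; split; [move=> [h1 h2]|move=> /andP [h1 h2]]; [apply/andP|]; split; lra.
have second m i : (m <= i)%N -> (i.+1 < n)%N -> p_eta lam p m.+1 (i - m).+1 >= th m.+1 (i - m).+1 /\
    th m.+1 (i - m).+1 >= p_eta lam p m.+1 (i - m).+2 <->
    0 <= xco q (m, i.+1) <= bound_half n i (a i) (xco q) m.
  move=> mi lin; rewrite th_step; last by lia.
  have := half m (i - m).+1; rewrite (_ : ((i - m).+1 + m)%N = i.+1) /=; last by lia.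
  move=> hf; have -> : p_eta lam p m.+1 (i - m).+1 = p_eta lam p m.+1 (i - m).+2 + s * (bound_half n i (a i) (xco q) m)%:~R.
    by rewrite -hf; [ring|lia|lia].
  rewrite -!sle mulr0; split; [move=> [h1 h2]|move=> /andP [h1 h2]]; [apply/andP|]; split; lra.
split=> [[H1 H2] i m mi lin|H].
  have A : 0 <= xco q (m, (n.*2 - i.+1)%N) <= bound n i (a i) (xco q) m.
    by apply/first; [lia|apply: (H1 m.+1 (i - m).+1); lia].
  split=> [//|]; have [lt|ge] := boolP (i.+1 < n)%N.
    by apply/second => //; rewrite thE; [apply: (H2 m.+1 (i - m).+1)|]; lia.
  by move: A; rewrite /bound_half (negbTE ge) (_ : (n.*2 - i.+1)%N = i.+1) //; lia.
split=> [[//|m] [//|i] hm hi|[//|m] [//|i] hm hi].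
  have := @first m (i + m)%N; rewrite addnK => F; apply/F; first by lia.
  have [h1 h2] := H (i + m)%N m (leq_addl _ _) ltac:(lia).
  have [lt|ge] := boolP ((i + m).+1 < n)%N; first exact: h1.
  by move: h2; rewrite /bound_half (negbTE ge) (_ : (n.*2 - (i + m).+1)%N = (i + m).+1) //; lia.
have := @second m (i + m)%N; rewrite addnK thE; last by lia.
move=> F; apply/F; [lia|lia|].
by have [] := H (i + m)%N m (leq_addl _ _) ltac:(lia).
Qed.

End DeltaPattern.

(** * The base point and the highest weight functions *)

Section Evaluation.
Context {R : realType} {n N : nat} (rho : spModule R n N) (X : projVariety R N).
Local Notation C := R[i].
Implicit Types (f : coordRing X) (v : 'cV[C]_N).

Lemma meval_comp k l (v : 'I_l -> C) (p : {mpoly C[k]}) (lq : k.-tuple {mpoly C[l]}) :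
  (p \mPo lq).@[v] = p.@[fun i => (tnth lq i).@[v]].
Proof.
rewrite comp_mpolyE raddf_sum [RHS]mevalE /=; apply: eq_bigr => m _.
by rewrite mevalZ rmorph_prod; congr (_ * _); apply: eq_bigr => i _; rewrite rmorphXn.
Qed.

Definition cval f v : C := pteval (repr f) v.

Lemma cval_proj p v : X v -> cval (proj_coord X p) v = pteval p v.
Proof.
move=> Xv; apply/eqP; rewrite -subr_eq0 /cval /pteval -mevalB.
have : repr (proj_coord X p) - p \in vanishing X by rewrite Quotient.idealrBE reprK.
by move/vanishingP => /(_ v Xv) /eqP.
Qed.

Lemma proj_repr f : f = proj_coord X (repr f).
Proof. by rewrite /proj_coord reprK. Qed.

Lemma cval_ext f g : (forall v, X v -> cval f v = cval g v) -> f = g.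
Proof.
move=> h; apply/eqP; rewrite -subr_eq0 (proj_repr f) (proj_repr g) -rmorphB proj_coord_eq0.
by apply/vanishingP => v Xv; rewrite /pteval mevalB; apply/eqP; rewrite subr_eq0; apply/eqP/h.
Qed.

Lemma cvalD f g v : X v -> cval (f + g) v = cval f v + cval g v.
Proof. by move=> Xv; rewrite {1}(proj_repr f) {1}(proj_repr g) -rmorphD cval_proj // /pteval mevalD. Qed.

Lemma cvalM f g v : X v -> cval (f * g) v = cval f v * cval g v.
Proof. by move=> Xv; rewrite {1}(proj_repr f) {1}(proj_repr g) -rmorphM cval_proj // /pteval mevalM. Qed.

Lemma cvalZ c f v : X v -> cval (c *: f) v = c * cval f v.
Proof.
by move=> Xv; rewrite cvalM // cval_proj // /pteval mevalC.
Qed.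

Lemma cval0 v : X v -> cval 0 v = 0.
Proof. by move=> Xv; rewrite -(rmorph0 (proj_coord X)) cval_proj // /pteval meval0. Qed.

Lemma cval1 v : X v -> cval 1 v = 1.
Proof. by move=> Xv; rewrite -(rmorph1 (proj_coord X)) cval_proj // /pteval meval1. Qed.

Lemma cval_sum (I : Type) (r : seq I) (P : pred I) (F : I -> coordRing X) v : X v ->
  cval (\sum_(i <- r | P i) F i) v = \sum_(i <- r | P i) cval (F i) v.
Proof.
by move=> Xv; apply: (big_morph (cval^~ v) (id1 := 0) (op1 := +%R)) => [f g|]; rewrite ?cvalD ?cval0.
Qed.

Lemma cval_gact g f v : X v -> cval (gact rho g f) v = cval f (rho (invmx g) *m v).
Proof.
move=> Xv; rewrite cval_proj // /pteval meval_comp; apply: meval_eq => i.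
rewrite tnth_mktuple raddf_sum mxE; apply: eq_bigr => j _.
by rewrite /= mevalZ mevalXU.
Qed.

Lemma cval_homog k f c v : graded_piece k f -> c != 0 -> X v -> cval f (c *: v) = c ^+ k * cval f v.
Proof.
by move=> [p [pk ->]] c0 Xv; rewrite !cval_proj //; [exact: pteval_homog|exact: pv_scale].
Qed.

Lemma cval_regular f x : exists P : {mpoly C[(n + n) * (n + n)]},
  forall g, Sp g -> cval f (rho g *m x) = mxeval P g.
Proof.
have [P PE] := rep_regular rho.
exists (repr f \mPo [tuple \sum_j x j 0 *: P i j | i < N]) => g gS.
rewrite /cval /pteval /mxeval meval_comp; apply: meval_eq => i.
rewrite tnth_mktuple raddf_sum mxE; apply: eq_bigr => j _.
by rewrite /= mevalZ PE // mulrC.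
Qed.

Lemma rep_inv g : Sp g -> rho (invmx g) *m rho g = 1%:M.
Proof. by move=> gS; rewrite -repM ?mulVmx ?rep1 //; [exact: Sp_unit|exact: Sp_inv]. Qed.

Lemma unip_lower d (l : 'M[C]_d) : (forall i j : 'I_d, (i <= j)%N -> l i j = (i == j)%:R) -> unip l.
Proof.
move=> ll; exists d.
have h k : forall i j : 'I_d, (i < j + k)%N -> iter k (mulmx (l - 1%:M)) 1%:M i j = 0.
  elim: k => [|k IH] i j ij; first by rewrite mxE -val_eqE ltn_eqF // -[X in (_ < X)%N]addn0.
  rewrite iterS mxE big1 // => m _; have [im|mi] := leqP i m.
    by rewrite !mxE ll // subrr mul0r.
  by rewrite IH ?mulr0 //; lia.
by apply/matrixP => i j; rewrite mxE h // (leq_trans (ltn_ord i)) ?leq_addl.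
Qed.

Definition conj_lower (a g : 'M[C]_(n + n)) : Prop := Sp g /\ utri (invmx a *m g *m a)^T.

Lemma utri_tr_inv (l : 'M[C]_(n + n)) : Sp l -> utri l^T -> utri (invmx l)^T.
Proof. by move=> lS ll; rewrite invmx_Sp // -Spinv_tr; apply: utri_Spinv. Qed.

(** All polynomials vanishing on the set are taken as equations; the affine ones expressing that
    a^-1 g a is lower unitriangular are among them and recover the set. *)
Lemma conj_lower_closed a : Sp_closed (conj_lower a).
Proof.
exists (fun p => forall g, conj_lower a g -> mxeval p g = 0) => g; split=> [h|[gS h]].
  by split=> [|f ->//]; have [] := h.
split=> // i j ji.
pose f : {mpoly C[(n + n) * (n + n)]} := \sum_k \sum_l (invmx a j k * a l i) *: 'X_(mxvec_index k l) - ((i == j)%:R)%:MP.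
have fE g' : mxeval f g' = (invmx a *m g' *m a)^T i j - (i == j)%:R.
  rewrite /mxeval /f mevalB mevalC; congr (_ - _); rewrite mxE mxE exchange_big raddf_sum /=.
  apply: eq_bigr => l _; rewrite raddf_sum mxE mulr_suml; apply: eq_bigr => k _.
  by rewrite /= mevalZ mevalXU mxvecE mulrAC.
apply/eqP; rewrite -subr_eq0 -fE; apply/eqP/h => g' [_ h'].
by rewrite fE h' // subrr.
Qed.

Lemma conj_lower_unipotent a : Sp a -> unipotent_subgroup (conj_lower a).
Proof.
move=> aS; have aU := Sp_unit aS.
split; [|split; first exact: conj_lower_closed].
  split; first by move=> g [].
  split.
    split; first exact: Sp1.
    by rewrite mulmx1 mulVmx // trmx1 => i j _; rewrite mxE.
  split=> [g h [gS gl] [hS hl]|g [gS gl]]; split.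
  - exact: Sp_mul.
  - rewrite (_ : invmx a *m (g *m h) *m a = (invmx a *m g *m a) *m (invmx a *m h *m a)); last first.
      by rewrite !mulmxA mulmxK.
    by rewrite trmx_mul; apply: utri_mul.
  - exact: Sp_inv.
  - have -> : invmx a *m invmx g *m a = invmx (invmx a *m g *m a).
      have U : invmx a *m g *m a \in unitmx by rewrite !unitmx_mul unitmx_inv aU Sp_unit.
      apply: (can_inj (mulKmx U)); rewrite mulmxV //.
      by rewrite !mulmxA mulmxK // (mulmxK (Sp_unit gS)) mulVmx.
    by apply: utri_tr_inv => //; apply: Sp_mul => //; apply: Sp_mul => //; apply: Sp_inv.
move=> g [gS gl]; have -> : g = a *m (invmx a *m g *m a) *m invmx a.
  by rewrite !mulmxA mulmxV // mul1mx mulmxK.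
apply: unip_conj => //; apply: unip_lower => i j ij.
by have := gl j i ij; rewrite mxE eq_sym.
Qed.

Lemma nonvanishing_const (c : C -> C) (P : {poly C}) : (forall s, c s = P.[s]) ->
  (forall s, c s != 0) -> c 1 = c 0.
Proof.
move=> cP c0; have [/size_poly1P [b _ Pb]|P1] := boolP (size P == 1%N).
  by rewrite !cP Pb !hornerC.
have /closed_rootP [s /rootP Ps] := P1.
by have := c0 s; rewrite cP Ps eqxx.
Qed.

(** Along [ecurve l] the scalar multiplying x is a polynomial without zeros, hence constant over an
    algebraically closed field, and it is 1 at parameter 0. *)
Lemma lower_line_fixed (x : 'cV[C]_N) l : Sp l -> utri l^T -> x != 0 ->
  (forall m, Sp m -> utri m^T -> exists c : C, c != 0 /\ rho m *m x = c *: x) -> rho l *m x = x.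
Proof.
move=> lS ll x0 H; have [P PE] := rep_regular rho.
have le : uelem l by split=> //; right.
have hs s : exists c, c != 0 /\ rho (ecurve l s) *m x = c *: x.
  apply: H; first exact: ecurve_Sp.
  move=> i j ji; rewrite !mxE; have := ll i j ji; rewrite mxE => ->.
  by case: eqP => [->|_]; rewrite ?mul0r // subnn addn0 mulr1.
have [j xj] : exists j, x j 0 != 0.
  apply: contrapT => /forallNP h; move/eqP: x0; apply; apply/matrixP => i k.
  by rewrite (ord1 k) mxE; apply/eqP/negPn/negP/h.
pose c s := (rho (ecurve l s) *m x) j 0 / x j 0.
have cE s : rho (ecurve l s) *m x = c s *: x.
  by have [b [b0 E]] := hs s; rewrite /c E mxE mulfK.
have c_neq0 s : c s != 0.
  have [b [b0 E]] := hs s; by rewrite /c E mxE mulfK.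
have Pc : polyfun (fun z : unit -> C => c (z tt)).
  rewrite /c; apply: PFmul; last exact: PFconst.
  rewrite (_ : (fun _ => _) = fun z : unit -> C => \sum_k mxeval (P j k) (ecurve l (z tt)) * x k 0); last first.
    apply/funext => z; rewrite mxE; apply: eq_bigr => k _; rewrite PE //; exact: ecurve_Sp.
  apply: PF_sum => k; apply: PFmul; last exact: PFconst.
  apply: PF_mxeval => a b; rewrite (_ : (fun _ => _) = fun z : unit -> C => l a b * z tt ^+ ((a - b) + (b - a))); last first.
    by apply/funext => z; rewrite mxE.
  by apply: PFmul; [exact: PFconst|apply: PF_exp; exact: PFvar].
have [Q QE] := PF_unit_poly Pc.
have e := nonvanishing_const QE c_neq0.
by rewrite -[X in rho X](ecurve1 l) cE e -cE ecurve0 // rep1 mul1mx.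
Qed.

(** The maximal unipotent group U of the stabilizer lies in a conjugate a U_- a^-1. This conjugate
    is unipotent, so maximality puts it inside U, and it stabilizes the line of x. The point a^-1 x
    then has its line, and so itself, fixed by U_-. *)
Theorem base_point : G_stable rho X -> horospherical rho X -> exists x, X x /\
  proj_dense (Defs.orbit rho Sp x) X /\ forall l, Sp l -> utri l^T -> rho l *m x = x.
Proof.
move=> stab [_ [x [Xx [xd [U [[[[US [U1 [UM UI]]] [Ucl Un]] Umax] Ust]]]]]].
have [a aS aE] := unipotent_conjugate US U1 UM Un.
have KU := Umax _ (conj_lower_unipotent aS) (fun g gU => conj (US g gU) (aE g gU)).
have aU := Sp_unit aS; have aI := Sp_inv aS; have X0 := stab _ _ aI Xx.
exists (rho (invmx a) *m x); split=> //; split.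
  move=> Z Zc Zo; apply: xd => // v [g [c [gS [c0 ->]]]]; apply: Zo.
  exists (g *m a), c; split; first exact: Sp_mul.
  by split=> //; rewrite mulmxA -repM ?mulmxK //; apply: Sp_mul.
move=> l lS ll; apply: lower_line_fixed => //; first exact: (pv_nonzero X0).
move=> m mS ml; have [|_ [c [c0 E]]] := Ust (a *m m *m invmx a).
  apply: KU; split; first by apply: Sp_mul => //; apply: Sp_mul.
  by rewrite !mulmxA mulVmx // mul1mx mulmxKV.
have amS : Sp (a *m m *m invmx a) by apply: Sp_mul => //; apply: Sp_mul.
by exists c; split=> //; rewrite scalemxAr -E !mulmxA -!repM // !mulmxA mulVmx // mul1mx.
Qed.

End Evaluation.

(** * Highest weight vectors as products of trailing minors *)

Section TorusMinors.
Context {R : realType}.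
Local Notation C := R[i].

(** On this curve only the trailing minor of size i+1 varies, and it crosses 0 at s = -1; so the
    exponent of a single minor can be tested, see [hw_dominant]. *)
Lemma Dk_root_curve n (i j : 'I_n) (s : C) :
  tminor (kle j) ((xmx i 1)^T *m xmx i s) = if j == i then 1 + s else 1.
Proof.
case: (eqVneq j i) => [->|ji]; last first.
  rewrite /tminor mnr_xmx_neq ?eqSS ?ltn_ord //.
  by apply: Dk_lower1; rewrite trmxK; exact: xmx_utri.
have li := ltn_ord i.
have g1 (a b : 'I_i.+1) : (xmx i 1 : 'M[C]_(n + n)) (lrow (kle i) b) (lrow (kle i) a) = (a == b)%:R.
  have la := ltn_ord a; have lb := ltn_ord b; rewrite xmxE.
  have -> : (lrow (kle i) b == o0 i) = false by rewrite -!val_eqE /=; lia.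
  have -> : (i.+1 < n)%N && (lrow (kle i) b == rev_ord (o1 i)) = false by rewrite -!val_eqE /=; lia.
  by rewrite subrr mulr0 addr0 (inj_eq (@lrow_inj _ _ _)) eq_sym.
rewrite /tminor /mxminor; transitivity (\det (diag_mx (\row_(a < i.+1) (if a == ord_max then 1 + s else 1)))).
  congr (\det _); apply/matrixP => a b; have la := ltn_ord a; have lb := ltn_ord b.
  have T x y : (xmx i 1 : 'M[C]_(n + n))^T x y = xmx i 1 y x by rewrite mxE.
  rewrite [LHS]mxE [LHS]mxE row_xmx [RHS]mxE [(\row_(_ < _) _) _ _]mxE !T g1.
  have -> : (lrow (kle i) b == o1 i) = (b == ord_max) && (i.+1 == n) by rewrite -!val_eqE /=; lia.
  have -> : (lrow (kle i) b == rev_ord (o0 i)) = (b == ord_max) by rewrite -!val_eqE /=; lia.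
  rewrite !xmxE.
  have -> : (o0 i == lrow (kle i) a) = false by rewrite -!val_eqE /=; lia.
  have -> : (lrow (kle i) a == o1 i) = (a == ord_max) && (i.+1 == n) by rewrite -!val_eqE /=; lia.
  have -> : (o0 i == rev_ord (o1 i)) = (i.+1 == n) by rewrite -!val_eqE /=; lia.
  have -> : (rev_ord (o1 i) == lrow (kle i) a) = false by rewrite -!val_eqE /=; lia.
  have -> : (lrow (kle i) a == rev_ord (o0 i)) = (a == ord_max) by rewrite -!val_eqE /=; lia.
  have -> : (rev_ord (o1 i) == o0 i) = (i.+1 == n) by rewrite -!val_eqE /=; lia.
  rewrite !eqxx; have [e|e] := eqVneq i.+1 n.
    have -> : (i.+1 < n)%N = false by lia.
    have [->|ab] := eqVneq a b; case: eqP => bm; rewrite ?bm ?eqxx //=; try ring.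
    by move: ab; rewrite bm => /negbTE ->; rewrite mulr0n /=; ring.
  have -> : (i.+1 < n)%N = true by lia.
  have [->|ab] := eqVneq a b; case: eqP => bm; rewrite ?bm ?eqxx //=; try ring.
  by move: ab; rewrite bm => /negbTE ->; rewrite mulr0n /=; ring.
rewrite det_diag (bigD1 ord_max) //= mxE eqxx big1 ?mulr1 // => a /negbTE am.
by rewrite mxE am.
Qed.

Lemma torus_rev n (t : 'M[C]_(n + n)) i : torus t -> t i i * t (rev_ord i) (rev_ord i) = 1.
Proof.
move=> [tS /is_diag_mxP td].
have := mulVmx (Sp_unit tS); rewrite invmx_Sp // => /matrixP /(_ i i); rewrite mxE.
rewrite (bigD1 i) //= big1 ?addr0; last by move=> k ki; rewrite [X in _ * X](td k i) ?mulr0.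
rewrite SpinvE mxE eqxx -[RHS]/(1 : C) => <-; rewrite mulrC; congr (_ * _).
by rewrite /sg; case: ifP; rewrite ?mulrNN !mul1r.
Qed.

Definition tdiag n (t : 'M[C]_(n + n)) (j : 'I_n) : C := t (lshift n j) (lshift n j).

Lemma tdiag_neq0 n (t : 'M[C]_(n + n)) j : torus t -> tdiag t j != 0.
Proof.
move=> tt; apply/eqP => h; have := torus_rev (lshift n j) tt; rewrite -/(tdiag t j) h mul0r.
by move/eqP; rewrite eq_sym oner_eq0.
Qed.

Lemma Dk_torus n (i : 'I_n) t : torus t -> tminor (kle i) t = \prod_(j < n | (j <= i)%N) (tdiag t j)^-1.
Proof.
move=> tt; have [tS /is_diag_mxP td] := tt.
rewrite Dk_upper; last by move=> a b ab; rewrite td // gtn_eqF.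
pose F b := if insub b is Some j then (tdiag t j)^-1 else 1.
transitivity (\prod_(a < i.+1) F a).
  apply: eq_bigr => a _; have an : (a < n)%N by have := ltn_ord a; have := ltn_ord i; lia.
  rewrite /F insubT /tdiag; have := torus_rev (lshift n (Ordinal an)) tt.
  rewrite (_ : rev_ord _ = lrow (kle i) a); last exact: val_inj.
  move=> h; apply: (mulfI (tdiag_neq0 (Ordinal an) tt)); rewrite /tdiag h mulfV //.
  exact: (tdiag_neq0 (Ordinal an) tt).
rewrite (big_ord_widen _ _ (ltn_ord i)); apply: eq_big => [a|a _]; first by rewrite ltnS.
by rewrite /F valK.
Qed.

Lemma sum_wz n (lam : 'rV[int]_n) (j : 'I_n) :
  \sum_(i < n | (j <= i)%N) (wz lam i - wz lam i.+1) = lam 0 j.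
Proof.
transitivity (\sum_(j <= i < n) (wz lam i - wz lam i.+1)); first by rewrite big_geq_mkord.
under eq_bigr do rewrite -opprB.
rewrite sumrN telescope_sumr; last by apply: ltnW.
by rewrite opprB {2}/wz insubF ?ltnn // subr0 /wz valK.
Qed.

Lemma prod_Dk_torus n (lam : 'rV[int]_n) (t : 'M[C]_(n + n)) : torus t ->
  \prod_i tminor (kle i) t ^ (wz lam i - wz lam i.+1) = (torus_char lam t)^-1.
Proof.
move=> tt; transitivity (\prod_(i < n) \prod_(j < n | (j <= i)%N) (tdiag t j)^-1 ^ (wz lam i - wz lam i.+1)).
  apply: eq_bigr => i _; rewrite Dk_torus //.
  by apply: (big_morph (fun x : C => x ^ (wz lam i - wz lam i.+1))) => [x y|]; rewrite ?expfzMl ?exp1rz.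
rewrite (exchange_big_dep predT) //= /torus_char -prodfV; apply: eq_bigr => j _.
have t0 := tdiag_neq0 j tt.
rewrite -/(tdiag t j) -(sum_wz lam j) expfV; symmetry.
apply: (big_morph (fun z : int => (tdiag t j)^-1 ^ z)) => [x y|]; last by rewrite expr0z.
by rewrite expfzDr // invr_eq0.
Qed.

End TorusMinors.

Section HighestWeight.
Context {R : realType} {n N : nat} (rho : spModule R n N) (X : projVariety R N).
Local Notation C := R[i].
Local Notation M := 'M[C]_(n + n).
Implicit Types (f : coordRing X) (v : 'cV[C]_N) (g h t : M).

Lemma Dk_regular (A : 'I_n -> nat) : exists P : {mpoly C[(n + n) * (n + n)]},
  forall g, mxeval P g = \prod_i tminor (kle i) g ^+ A i.
Proof.
exists (\prod_(i < n) (\det (\matrix_(a < i.+1, b < i.+1)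
   ('X_(mxvec_index (lrow (kle i) a) (lrow (kle i) b)) : {mpoly C[(n + n) * (n + n)]}))) ^+ A i) => g.
rewrite /mxeval rmorph_prod; apply: eq_bigr => i _; rewrite rmorphXn; congr (_ ^+ _).
rewrite -det_map_mx; congr (\det _); apply/matrixP => a b.
by rewrite !mxE /= mevalXU mxvecE.
Qed.

Hypothesis stab : G_stable rho X.

Lemma gactZ g c f : Sp g -> gact rho g (c *: f) = c *: gact rho g f.
Proof.
move=> gS; apply: cval_ext => v Xv; have X' := stab (Sp_inv gS) Xv.
apply: etrans (cval_gact rho g (c *: f) Xv) _; apply: etrans (cvalZ c f X') _.
apply: esym; apply: etrans (cvalZ c (gact rho g f) Xv) _.
by congr (_ * _); apply: cval_gact.
Qed.

Lemma gact_sum g m (F : 'I_m -> coordRing X) : Sp g ->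
  gact rho g (\sum_l F l) = \sum_l gact rho g (F l).
Proof.
move=> gS; apply: cval_ext => v Xv; have X' := stab (Sp_inv gS) Xv.
apply: etrans (cval_gact rho g (\sum_l F l) Xv) _; apply: etrans (cval_sum _ _ F X') _.
apply: esym; apply: etrans (cval_sum _ _ (fun i => gact rho g (F i)) Xv) _.
by apply: eq_bigr => l _; apply: cval_gact.
Qed.

Lemma gactM g h f : Sp g -> Sp h -> gact rho g (gact rho h f) = gact rho (g *m h) f.
Proof.
move=> gS hS; apply: cval_ext => v Xv; have X' := stab (Sp_inv gS) Xv.
apply: etrans (cval_gact rho g (gact rho h f) Xv) _; apply: etrans (cval_gact rho h f X') _.
apply: esym; apply: etrans (cval_gact rho (g *m h) f Xv) _; apply: esym.
rewrite mulmxA -repM; try exact: Sp_inv.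
congr (cval _ (rho _ *m _)); have U : g *m h \in unitmx by rewrite unitmx_mul !Sp_unit.
by apply: (can_inj (mulKmx U)); rewrite mulmxV // mulmxA mulmxK ?mulmxV ?Sp_unit.
Qed.

Lemma gact1 f : gact rho 1%:M f = f.
Proof. by apply: cval_ext => v Xv; rewrite cval_gact // invmx1 rep1 mul1mx. Qed.

Lemma irreducible_span (W : coordRing X -> Prop) w : irreducible_submodule rho W -> W w -> w != 0 ->
  forall f, W f -> exists m (h : 'I_m -> M) (c : 'I_m -> C), (forall l, Sp (h l)) /\
    f = \sum_l c l *: gact rho (h l) w.
Proof.
move=> [[W0 [WD [WZ WG]]] [_ Wirr]] Ww w0.
pose W' f := exists m (h : 'I_m -> M) (c : 'I_m -> C), (forall l, Sp (h l)) /\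
    f = \sum_l c l *: gact rho (h l) w.
have [||W'0|//] := Wirr W'.
- split; first by exists 0%N, (fun=> 1%:M), (fun=> 0); split=> [[]//|]; rewrite big_ord0.
  split; last split.
  + move=> _ _ [m1 [h1 [c1 [S1 ->]]]] [m2 [h2 [c2 [S2 ->]]]].
    exists (m1 + m2)%N, (fun i => match split i with inl j => h1 j | inr j => h2 j end),
      (fun i => match split i with inl j => c1 j | inr j => c2 j end).
    split; first by move=> i; case: split.
    apply: esym; apply: etrans (big_split_ord _ _ _) _.
    apply: f_equal2; apply: eq_bigr => i _.
      by rewrite (unsplitK (inl i)).
    by rewrite (unsplitK (inr i)).
  + move=> b _ [m [h [c [hS ->]]]]; exists m, h, (fun l => b * c l); split=> //.
    by rewrite scaler_sumr; apply: eq_bigr => l _; rewrite scalerA.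
  + move=> g _ gS [m [h [c [hS ->]]]]; exists m, (fun l => g *m h l), c; split.
      by move=> l; apply: Sp_mul.
    apply: etrans (gact_sum _ gS) _; apply: eq_bigr => l _.
    exact: (etrans (gactZ (c l) (gact rho (h l) w) gS)
      (f_equal (fun f => c l *: f) (gactM w gS (hS l)))).
- move=> _ [m [h [c [hS ->]]]].
  apply: (big_ind W); [exact: W0|exact: WD|move=> l _].
  exact: (WZ _ _ (WG _ _ (hS l) Ww)).
have : w = 0; last by move=> h; rewrite h eqxx in w0.
apply: W'0; exists 1%N, (fun=> 1%:M), (fun=> 1); split=> [_|]; first exact: Sp1.
by rewrite big_ord1 scale1r gact1.
Qed.

Variable x0 : 'cV[C]_N.
Hypotheses (Xx0 : X x0) (x0_dense : proj_dense (Defs.orbit rho Sp x0) X).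
Hypothesis x0_low : forall l, Sp l -> utri l^T -> rho l *m x0 = x0.

Definition ofun f g : C := cval f (rho g *m x0).

Lemma orbit_ext k f : graded_piece k f -> (forall g, Sp g -> ofun f g = 0) -> f = 0.
Proof.
move=> [p [pk ->]] h; apply/eqP; rewrite proj_coord_eq0; apply/vanishingP => v Xv.
have [|u [g [c [gS [c0 ->]]]]|] := x0_dense (Z' := fun v => v != 0 /\ pteval p v = 0) _ _ Xv => //.
- exists (fun q => q = p); split=> [q ->|u]; first by exists k.
  by split=> [[u0 pu]|[u0 pu]]; split=> //; [move=> q ->|apply: pu].
have X' := stab gS Xx0; split; first by apply: (pv_nonzero (pv_scale c0 X')).
have E : pteval p (rho g *m x0) = 0 by rewrite -(cval_proj p X'); apply: h.
by rewrite (pteval_homog _ _ pk) E mulr0.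
Qed.

Lemma ofun_gact h f g : Sp h -> Sp g -> ofun (gact rho h f) g = ofun f (invmx h *m g).
Proof.
move=> hS gS; have X' := stab gS Xx0.
apply: etrans (cval_gact rho h f X') _; rewrite mulmxA -repM //; exact: Sp_inv.
Qed.

Lemma ofun_comb m (c : 'I_m -> C) (F : 'I_m -> coordRing X) g : Sp g ->
  ofun (\sum_l c l *: F l) g = \sum_l c l * ofun (F l) g.
Proof.
move=> gS; have X' := stab gS Xx0.
by apply: etrans (cval_sum _ _ _ X') _; apply: eq_bigr => l _; apply: cvalZ.
Qed.

Variables (lam : 'rV[int]_n) (k : nat) (W : coordRing X -> Prop).
Hypothesis WV : V_in rho lam k W.

Let weight_gap (i : nat) : int := wz lam i - wz lam i.+1.

Section Vector.
Variable w : coordRing X.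
Hypotheses (Ww : W w) (w0 : w != 0).
Hypothesis wU : forall u, U_plus u -> gact rho u w = w.
Hypothesis wT : forall t, torus t -> gact rho t w = torus_char lam t *: w.

(** The factors act separately: l fixes x0, t contributes the inverse of its character, and w is
    invariant under the upper unipotent factor. *)
Lemma hw_cell y t l : torus t -> Sp l -> utri l^T ->
  ofun w (umx n y *m t *m l) = (torus_char lam t)^-1 * ofun w 1%:M.
Proof.
move=> tt lS ll; have tS := tt.1; have uS := umx_Sp n y; have uU := umx_U n y.
rewrite /ofun repM //; last exact: Sp_mul.
rewrite -mulmxA x0_low // repM // -mulmxA rep1 mul1mx.
have X1 := stab tS Xx0; have X2 := stab uS X1.
have -> : cval w (rho (umx n y) *m (rho t *m x0)) = cval w (rho t *m x0).
  by rewrite -[in LHS](wU uU) cval_gact // mulmxA rep_inv // mul1mx.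
have /(congr1 (fun f => cval f (rho t *m x0))) := wT tt.
rewrite cval_gact // mulmxA rep_inv // mul1mx cvalZ // => ->; rewrite mulKf //.
by apply/prodf_neq0 => j _; apply: expfz_neq0; apply: tdiag_neq0.
Qed.

Lemma hw_neq0 : ofun w 1%:M != 0.
Proof.
apply/eqP => h; move/eqP: w0; apply; apply: (orbit_ext (WV.2 _ Ww)) => g gS.
have [P PE] := cval_regular rho w x0.
rewrite /ofun PE //; apply: Sp_density gS => y t l tt lS ll.
rewrite -PE; last by apply: Sp_mul => //; apply: Sp_mul (umx_Sp n y) tt.1.
by rewrite -/(ofun w _) hw_cell // h mulr0.
Qed.

Lemma Dk_cell y t l i : torus t -> Sp l -> utri l^T ->
  tminor (kle i) (umx n y *m t *m l) = tminor (kle i) t.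
Proof.
move=> tt lS ll; have [tS /is_diag_mxP td] := tt.
rewrite /tminor mnr_mul_lower; last first.
  by move=> a b ab; have := ll b a (ltnW ab); rewrite mxE => ->; rewrite -val_eqE gtn_eqF.
rewrite -/(tminor _ _) -/(tminor _ _) (Dk_lower1 _ ll) mulr1 Dk_mul_upper; last first.
  by move=> a b ab; rewrite umx_utri ?(ltnW ab) // -val_eqE gtn_eqF.
by rewrite Dk_utri ?mul1r //; exact: umx_utri.
Qed.

Lemma hw_big_cell g : Sp g -> (forall i : 'I_n, tminor (kle i) g != 0) ->
  ofun w g = ofun w 1%:M * \prod_i tminor (kle i) g ^ weight_gap i.
Proof.
move=> gS g0; have [|y [t [l [tt lS ll E]]]] := big_cell gS.
  move=> [|j] kN jn; first by rewrite /tminor mnr0 oner_neq0.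
  by have := g0 (Ordinal jn); rewrite (bool_irrelevance kN (kle (Ordinal jn))).
rewrite E hw_cell // mulrC; congr (_ * _).
by under eq_bigr do rewrite Dk_cell //; rewrite prod_Dk_torus.
Qed.

(** On the curve of [Dk_root_curve] w equals a nonzero constant times (1 + s) to the power of the
    gap. Being polynomial in s, it has no pole at s = -1. *)
Lemma hw_dominant (i : 'I_n) : 0 <= weight_gap i.
Proof.
rewrite leNgt; apply/negP => Ai.
pose G (s : C) : M := (xmx i 1)^T *m xmx i s.
have GS s : Sp (G s) by apply: Sp_mul; [apply: Sp_tr|]; exact: Sp_xmx.
have [P PE] := cval_regular rho w x0.
have [Q QE] : exists Q : {poly C}, forall z, mxeval P (G z) = Q.[z].
  apply: (@PF_unit_poly _ (fun z : unit -> C => mxeval P (G (z tt)))).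
  apply: PF_mxeval => a b; rewrite /G; apply: PF_mulmx => c d; first exact: PFconst.
  rewrite (_ : (fun _ => _) = fun z : unit -> C => (c == d)%:R + z tt *
    (((c == o0 i) && (d == o1 i))%:R - ((i.+1 < n)%N && (c == rev_ord (o1 i)) && (d == rev_ord (o0 i)))%:R)); last first.
    by apply/funext => z; rewrite xmxE.
  by apply: PFadd; [exact: PFconst|apply: PFmul; [exact: PFvar|exact: PFconst]].
have E s : s != -1 -> Q.[s] * (1 + s) ^+ `|weight_gap i|%N = ofun w 1%:M.
  move=> s1; have s0 : 1 + s != 0 by rewrite addrC -[1]opprK subr_eq0.
  rewrite -QE -PE // -/(ofun w _) hw_big_cell //; last first.
    by move=> j; rewrite Dk_root_curve; case: ifP => _ //; exact: oner_neq0.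
  rewrite (bigD1 i) //= big1 ?mulr1; last first.
    by move=> j ji; rewrite Dk_root_curve (negbTE ji) exp1rz.
  have -> : (1 + s) ^+ `|weight_gap i|%N = (1 + s) ^ (- weight_gap i).
    by rewrite exprnP; congr (_ ^ _); lia.
  by rewrite Dk_root_curve eqxx -mulrA -expfzDr // subrr expr0z mulr1.
have : Q * (1 + 'X) ^+ `|weight_gap i|%N - (ofun w 1%:M)%:P = 0.
  apply: (@poly_fun_eq0 _ _ [:: -1]) => s; rewrite inE => s1.
  by rewrite !hornerE E // subrr.
move/(congr1 (fun q => q.[-1])); rewrite !hornerE /= subrr expr0n.
have -> : (`|weight_gap i|%N == 0%N) = false by lia.
by rewrite mulr0 sub0r => /eqP; rewrite oppr_eq0 (negbTE hw_neq0).
Qed.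

(** Dominance makes the right hand side regular on all of Sp, so the identity extends from the big
    cell by [Sp_density]. *)
Lemma hw_fun g : Sp g -> ofun w g = ofun w 1%:M * \prod_(i < n) tminor (kle i) g ^+ `|weight_gap i|%N.
Proof.
move=> gS; have [P PE] := cval_regular rho w x0.
have [Q QE] := Dk_regular (fun i => `|weight_gap i|%N).
have D y t l : torus t -> Sp l -> utri l^T -> mxeval (P - ofun w 1%:M *: Q) (umx n y *m t *m l) = 0.
  move=> tt lS ll; have gS' : Sp (umx n y *m t *m l).
    by apply: Sp_mul => //; apply: Sp_mul (umx_Sp n y) tt.1.
  rewrite /mxeval mevalB mevalZ -!/(mxeval _ _) QE -PE // -/(ofun w _).
  rewrite hw_big_cell //; last first.
    move=> i; rewrite Dk_cell // Dk_torus //; apply/prodf_neq0 => j _.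
    by rewrite invr_eq0 tdiag_neq0.
  apply/eqP; rewrite subr_eq0; apply/eqP; congr (_ * _); apply: eq_bigr => i _.
  by rewrite exprnP gez0_abs // hw_dominant.
have := Sp_density D gS; rewrite /mxeval mevalB mevalZ -!/(mxeval _ _) QE -PE //.
by move/eqP; rewrite subr_eq0 => /eqP.
Qed.

Lemma hw_gact h g : Sp h -> Sp g -> ofun (gact rho h w) g =
  ofun w 1%:M * \prod_(i < n) tminor (kle i) (invmx h *m g) ^+ `|weight_gap i|%N.
Proof.
move=> hS gS; apply: etrans (ofun_gact w hS gS) _.
by apply: hw_fun; apply: Sp_mul => //; apply: Sp_inv.
Qed.

Lemma V_functions_sub f : W f -> exists m (h : 'I_m -> M) (c : 'I_m -> C), (forall l, Sp (h l)) /\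
    forall g, Sp g -> ofun f g = \sum_l c l * \prod_(i < n) tminor (kle i) (h l *m g) ^+ `|weight_gap i|%N.
Proof.
move=> /(irreducible_span WV.1.1 Ww w0) [m [h [c [hS fE]]]].
exists m, (fun l => invmx (h l)), (fun l => c l * ofun w 1%:M).
split=> [l|g gS]; first exact: Sp_inv.
apply: etrans (f_equal (fun f => ofun f g) fE) _.
apply: etrans (ofun_comb _ _ gS) _; apply: eq_bigr => l _.
by rewrite hw_gact // mulrA.
Qed.

Lemma submodule_comb m (c : 'I_m -> C) (F : 'I_m -> coordRing X) :
  (forall l, W (F l)) -> W (\sum_l c l *: F l).
Proof.
have [[[W0 [WD [WZ _]]] _] _] := WV.1; move=> WF.
apply: (big_ind W W0 WD) => l _; exact: WZ.
Qed.

Lemma V_functions_sup m (h : 'I_m -> M) (c : 'I_m -> C) : (forall l, Sp (h l)) -> exists2 f, W f &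
    forall g, Sp g -> ofun f g = \sum_l c l * \prod_(i < n) tminor (kle i) (h l *m g) ^+ `|weight_gap i|%N.
Proof.
move=> hS; have [[[_ [_ [_ WG]]] _] _] := WV.1.
exists (\sum_l (c l / ofun w 1%:M) *: gact rho (invmx (h l)) w).
  by apply: submodule_comb => l; apply: WG Ww; apply: Sp_inv.
move=> g gS; apply: etrans (ofun_comb _ _ gS) _; apply: eq_bigr => l _.
rewrite hw_gact //; last exact: Sp_inv.
by rewrite mulrA divfK ?invmxK // hw_neq0.
Qed.

End Vector.

(** Both inclusions between V_lam, seen as functions on the group, and the span of the translates:
    the first bounds initial terms from above, the second produces functions with prescribed
    ones. *)
Theorem V_functions : exists A : 'I_n -> nat, [/\ forall i : 'I_n, (A i)%:Z = wz lam i - wz lam i.+1,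
  forall f, W f -> exists m (h : 'I_m -> M) (c : 'I_m -> C), (forall l, Sp (h l)) /\
    forall g, Sp g -> ofun f g = \sum_l c l * \prod_i tminor (kle i) (h l *m g) ^+ A i &
  forall m (h : 'I_m -> M) (c : 'I_m -> C), (forall l, Sp (h l)) -> exists2 f, W f &
    forall g, Sp g -> ofun f g = \sum_l c l * \prod_i tminor (kle i) (h l *m g) ^+ A i].
Proof.
have [w [Ww [w0 [wU wT]]]] := WV.1.2.
exists (fun i => `|weight_gap i|%N); split=> [i|f|m h c].
- by rewrite gez0_abs // (hw_dominant Ww w0 wU wT).
- exact: V_functions_sub Ww w0 wU wT _.
- exact: V_functions_sup Ww w0 wU wT _ _ _.
Qed.

End HighestWeight.

(** * The embedding into Laurent polynomials *)

Section LaurentEvaluation.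
Variables (F : numFieldType) (n r : nat) (e : 'M[int]_(r, n)).
Hypothesis e_inj : forall a b : 'rV[int]_r, a *m e = b *m e -> a = b.
Local Notation L := (groupAlg F (expo n r)).
Local Notation I := (xvar n + 'I_n + unit)%type.
Implicit Types (u v : expo n r) (f g : L).

Lemma gcoefD f g u : gcoef (f + g) u = gcoef f u + gcoef g u.
Proof. exact: monalg.mcoeffD. Qed.

Lemma gcoefB f g u : gcoef (f - g) u = gcoef f u - gcoef g u.
Proof. exact: monalg.mcoeffB. Qed.

Lemma gcoefZ c f u : gcoef (c *: f) u = c * gcoef f u.
Proof. exact: monalg.mcoeffZ. Qed.

Lemma gcoef0 u : gcoef (0 : L) u = 0.
Proof. exact: monalg.mcoeff0. Qed.

Lemma gcoef_sum (T : Type) (s : seq T) (P : pred T) (G : T -> L) u :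
  gcoef (\sum_(i <- s | P i) G i) u = \sum_(i <- s | P i) gcoef (G i) u.
Proof. by apply: (big_morph (fun f => gcoef f u)) => [f g|]; rewrite ?gcoefD ?gcoef0. Qed.

Lemma gcoefM f g u : gcoef (f * g) u =
  \sum_(k <- gsupp f) \sum_(l <- gsupp g) gcoef f k * gcoef g l *+ (k + l == u).
Proof.
rewrite gcoef_sum; apply: eq_bigr => k _; rewrite gcoef_sum; apply: eq_bigr => l _.
by rewrite gcoef_monom.
Qed.

Lemma gsupp_mul f g u : u \in gsupp (f * g) ->
  exists k l, [/\ k \in gsupp f, l \in gsupp g & u = k + l].
Proof.
rewrite gsuppP gcoefM => h; apply: contrapT => H; move/eqP: h; apply.
rewrite big_seq big1 // => k kf; rewrite big_seq big1 // => l lg.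
by case: eqP => // E; case: H; exists k, l.
Qed.

Lemma gsupp_add f g u : u \in gsupp (f + g) -> u \in gsupp f \/ u \in gsupp g.
Proof.
rewrite !gsuppP gcoefD; have [->|/eqP] := eqVneq (gcoef f u) 0; last by left; apply/eqP.
by rewrite add0r; right.
Qed.

Lemma gsupp1 u : u \in gsupp (1 : L) -> u = 0.
Proof. have [//|u0] := eqVneq u 0.
by rewrite gsuppP gcoef_monom [0 == u]eq_sym (negbTE u0) eqxx. Qed.

(* The monomial y^a is evaluated as the character of weight [a *m e] of the torus
   of rank [n]. *)
Definition ex u (i : I) : int :=
  match i with inl (inl k) => u.1.1 k | inl (inr j) => (u.1.2 *m e) 0 j | inr _ => u.2 end.

Lemma exD u v i : ex (u + v) i = ex u i + ex v i.
Proof. by case: i => [[k|j]|[]] //=; rewrite ?ffunE // mulmxDl mxE. Qed.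

Lemma ex_inj u v : ex u =1 ex v -> u = v.
Proof.
case: u v => [[p a] k] [[p' a'] k'] E.
have -> : p = p' by apply/ffunP => x; apply: (E (inl (inl x))).
have -> : a = a' by apply: e_inj; apply/rowP => j; apply: (E (inl (inr j))).
by have -> : k = k' by apply: (E (inr tt)).
Qed.

Definition torus_pt (q : I -> F) : Prop := forall i, q i != 0.
Definition chi u (q : I -> F) : F := \prod_i q i ^ ex u i.

Lemma chiD u v q : torus_pt q -> chi (u + v) q = chi u q * chi v q.
Proof.
move=> q0; rewrite /chi -big_split /=; apply: eq_bigr => i _.
by rewrite exD expfzDr.
Qed.

Lemma chi0 q : chi 0 q = 1.
Proof.
rewrite /chi big1 // => -[[k|j]|[]] _ /=; rewrite ?ffunE ?expr0z //.
by rewrite mul0mx mxE expr0z.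
Qed.

Definition ev f (q : I -> F) : F := \sum_(u <- gsupp f) gcoef f u * chi u q.

Lemma ev_widen (d : {fset expo n r}) f q : (gsupp f `<=` d)%fset -> ev f q = \sum_(u <- d) gcoef f u * chi u q.
Proof.
move=> fd; rewrite /ev (big_fset_incl _ fd) //= => u _.
by rewrite gsuppP negbK => /eqP ->; rewrite mul0r.
Qed.

Lemma evD f g q : ev (f + g) q = ev f q + ev g q.
Proof.
rewrite (ev_widen _ (gsuppD f g)) (ev_widen _ (fsubsetUl (gsupp f) (gsupp g))).
rewrite (ev_widen _ (fsubsetUr (gsupp f) (gsupp g))) -big_split /=.
by apply: eq_bigr => u _; rewrite gcoefD mulrDl.
Qed.

Lemma evZ c f q : ev (c *: f) q = c * ev f q.
Proof.
rewrite (@ev_widen (gsupp f)); last first.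
  apply/fsubsetP => u; rewrite !gsuppP gcoefZ; apply: contraNneq => ->.
  by rewrite mulr0.
by rewrite /ev mulr_sumr; apply: eq_bigr => u _; rewrite gcoefZ mulrA.
Qed.

Lemma ev0 q : ev 0 q = 0.
Proof. by rewrite -[0 : L](scale0r 0) evZ mul0r. Qed.

Lemma ev_sum (T : Type) (s : seq T) (P : pred T) (G : T -> L) q :
  ev (\sum_(i <- s | P i) G i) q = \sum_(i <- s | P i) ev (G i) q.
Proof. by apply: (big_morph (fun f => ev f q)) => [f g|]; rewrite ?evD ?ev0. Qed.

Lemma ev_monom c u q : ev (gmonom c u) q = c * chi u q.
Proof.
by rewrite (ev_widen _ (gsupp_monom c u)) big_seq_fset1 gcoef_monom eqxx.
Qed.

Lemma ev1 q : ev 1 q = 1.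
Proof. by rewrite ev_monom chi0 mulr1. Qed.

Lemma evM f g q : torus_pt q -> ev (f * g) q = ev f q * ev g q.
Proof.
move=> q0; rewrite [f * g]/(gmul f g) /gmul ev_sum /ev mulr_suml; apply: eq_bigr => k _.
rewrite -/(ev _ _) ev_sum mulr_sumr; apply: eq_bigr => l _.
by rewrite ev_monom chiD // mulrACA.
Qed.

Lemma exp2z_inj : injective (exprz (2 : F)).
Proof.
move=> a b; wlog ab : a b / a <= b.
  by move=> hw E; have [/hw h|/ltW /hw h] := leP a b; [apply: h|apply/esym/h].
have n2 : (2 : F) != 0 by rewrite pnatr_eq0.
have -> : b = a + `|b - a|%N by lia.
rewrite expfzDr // => /eqP; rewrite eq_sym -subr_eq0 -{2}[2 ^ a]mulr1 -mulrBr mulf_eq0 expfz_eq0 (negbTE n2) andbF /=.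
rewrite subr_eq0 -exprnP -natrX pnatr_eq1 -(expn0 2) eqn_exp2l // => /eqP ->.
by rewrite addr0.
Qed.

(** As e is injective, distinct exponents differ in some coordinate i of [ex], and the point equal
    to 2 at i and 1 elsewhere separates their characters. *)
Lemma ev_inj f : (forall q, torus_pt q -> ev f q = 0) -> f = 0.
Proof.
move=> h; apply: gcoefP => u; rewrite gcoef0.
have [uf|] := boolP (u \in gsupp f); last by rewrite gsuppP negbK => /eqP.
apply: (@char_independent _ _ _ torus_pt (fun x y i => x i * y i) chi _ _ _ (gsupp f) (gcoef f)) uf => //.
- by move=> x y x0 y0 i; rewrite mulf_neq0.
- move=> k x y x0 y0; rewrite /chi -big_split /=; apply: eq_bigr => i _.
  by rewrite expfzMl.
- move=> k; exists (fun=> 1) => [i|]; first exact: oner_neq0.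
  by apply/prodf_neq0 => i _; rewrite exp1rz oner_neq0.
- exact: fset_uniq.
move=> k l _ _ kl; have [i ki] : exists i, ex k i != ex l i.
  apply: contrapT => /forallNP H; move/eqP: kl; apply; apply: ex_inj => i.
  by apply/eqP/negPn/negP/H.
exists (fun j => if j == i then 2 else 1).
  by move=> j; case: ifP => _; rewrite ?pnatr_eq0 ?oner_eq0.
have E w : chi w (fun j => if j == i then 2 else 1) = 2 ^ ex w i.
  rewrite /chi (bigD1 i) //= eqxx big1 ?mulr1 // => j /negbTE ->.
  by rewrite exp1rz.
rewrite !E; apply: contra ki => /eqP E2; apply/eqP.
exact: exp2z_inj E2.
Qed.

Lemma evB f g q : ev (f - g) q = ev f q - ev g q.
Proof. by rewrite evD -scaleN1r evZ mulN1r. Qed.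

Lemma ev_ext f g : (forall q, torus_pt q -> ev f q = ev g q) -> f = g.
Proof.
move=> E; apply/eqP; rewrite -subr_eq0; apply/eqP/ev_inj => q q0.
by rewrite evB E // subrr.
Qed.

(** Q carries what is known of the exponents through sums and products, while G is the function of
    the torus points to be expanded. *)
Definition represents (Q : expo n r -> Prop) f (G : (I -> F) -> F) : Prop :=
  (forall u, u \in gsupp f -> Q u) /\ forall q, torus_pt q -> ev f q = G q.

Lemma gsupp_gmonom (c : F) u v : v \in gsupp (gmonom c u : L) -> v = u.
Proof.
have [//|vu] := eqVneq v u.
by rewrite gsuppP gcoef_monom [u == v]eq_sym (negbTE vu) mulr0n eqxx.
Qed.

Lemma represents_monom Q c u G : Q u -> (forall q, torus_pt q -> c * chi u q = G q) ->
  represents Q (gmonom c u) G.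
Proof. by move=> u0 GE; split=> [v /gsupp_gmonom -> //|q q0]; rewrite ev_monom GE. Qed.

Lemma represents_add Q f g G H : represents Q f G -> represents Q g H ->
  represents Q (f + g) (fun q => G q + H q).
Proof.
move=> [f0 fG] [g0 gH]; split=> [u /gsupp_add [/f0|/g0] //|q q0].
by rewrite evD fG // gH.
Qed.

Lemma represents_mul Q1 Q2 Q3 f g G H : (forall u v, Q1 u -> Q2 v -> Q3 (u + v)) ->
  represents Q1 f G -> represents Q2 g H -> represents Q3 (f * g) (fun q => G q * H q).
Proof.
move=> QD [f0 fG] [g0 gH]; split=> [u|q q0]; last by rewrite evM // fG // gH.
by move=> /gsupp_mul [k [l [/f0 k1 /g0 l1 ->]]]; apply: QD.
Qed.

End LaurentEvaluation.

Section Variables.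
Variable n : nat.

Definition xpair (k : xvar n) : nat * nat := ((Defs.xrow k).-1, (Defs.xcol k).-1).

Lemma vxS (k : xvar n) : ((xpair k).1.+1 = Defs.xrow k) * ((xpair k).2.+1 = Defs.xcol k).
Proof.
have := valP k; rewrite /xpair /Defs.xrow /Defs.xcol /= => /and3P [h1 h2 _].
by rewrite !prednK // (leq_trans h1) // ltnW.
Qed.

Lemma vx_inj : injective xpair.
Proof.
move=> k l h; have [k1 k2] := vxS k; have [l1 l2] := vxS l; apply: val_inj.
rewrite h l1 in k1; rewrite h l2 in k2.
by rewrite [val k]surjective_pairing [val l]surjective_pairing; congr pair; apply: val_inj.
Qed.

Lemma vx_vars k : xpair k \in vars n.
Proof.
have := valP k; rewrite mem_vars; have [k1 k2] := vxS k.
by rewrite /= -/(Defs.xrow k) -/(Defs.xcol k) -k1 -k2; lia.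
Qed.

Lemma vars_vx v : v \in vars n -> exists k, v = xpair k.
Proof.
case: v => a b; rewrite mem_vars /= => h.
have h1 : (a.+1 < (n + n).+1)%N by lia.
have h2 : (b.+1 < (n + n).+1)%N by lia.
have h3 : [&& 0 < Ordinal h1, Ordinal h1 < Ordinal h2 & Ordinal h1 + Ordinal h2 <= (n + n).+1]%N by rewrite /=; lia.
by exists (Sub (Ordinal h1, Ordinal h2) h3); rewrite /xpair /Defs.xrow /Defs.xcol SubK.
Qed.

Lemma prod_vars (F : comNzRingType) (G : nat * nat -> F) : \prod_(v <- vars n) G v = \prod_k G (xpair k).
Proof.
rewrite -(big_map xpair predT G); apply: perm_big; apply: uniq_perm; first exact: vars_uniq.
  by rewrite map_inj_uniq ?index_enum_uniq //; exact: vx_inj.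
move=> v; apply/idP/mapP => [/vars_vx [k ->]|[k _ ->]]; last exact: vx_vars.
by exists k => //; rewrite mem_index_enum.
Qed.

Lemma xco_vx (p : {ffun xvar n -> int}) k : xco p (xpair k) = p k.
Proof.
rewrite /xco; case: pickP => [l /andP [/eqP h1 /eqP h2]|/(_ k)]; last by rewrite !vxS !eqxx.
by congr (p _); apply: vx_inj; rewrite /xpair h1 h2.
Qed.

End Variables.

Section Point.
Context {R : realType} (n : nat).
Local Notation C := R[i].
Local Notation I := (xvar n + 'I_n + unit)%type.

Definition ycoord (q : I -> C) (v : nat * nat) : C :=
  if [pick k | (Defs.xrow k == v.1.+1) && (Defs.xcol k == v.2.+1)] is Some k then q (inl (inl k)) else 0.

Lemma yq_vx q k : ycoord q (xpair k) = q (inl (inl k)).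
Proof.
rewrite /ycoord; case: pickP => [l /andP [/eqP h1 /eqP h2]|/(_ k)]; last by rewrite !vxS !eqxx.
by congr (q (inl (inl _))); apply: vx_inj; rewrite /xpair h1 h2.
Qed.

(** The inverses stand in the upper half, because functions on the orbit transform by the inverse
    character, which thereby becomes the monomial t^lam. *)
Definition torus_mx (t : 'I_n -> C) : 'M[C]_(n + n) :=
  diag_mx (row_mx (\row_j (t j)^-1) (\row_j t (rev_ord j))).

Lemma tmx_torus t : (forall j, t j != 0) -> torus (torus_mx t).
Proof.
move=> t0; split; last exact: diag_mx_is_diag.
rewrite /Sp /torus_mx tr_diag_mx mul_diag_mx; apply/matrixP => i j; rewrite mul_mx_diag [LHS]mxE [X in X * _]mxE sympE.
case: eqP => [->|_]; last by rewrite !(mul0r, mulr0).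
rewrite mul1r mulrAC; set a := (X in X * _); suff -> : a = 1 by rewrite mul1r.
rewrite /a; case: (split_ordP i) => l ->.
  rewrite (_ : rev_ord (lshift n l) = rshift n (rev_ord l)); last by apply: val_inj => /=; have := ltn_ord l; lia.
  by rewrite row_mxEl row_mxEr !mxE rev_ordK mulVf.
rewrite (_ : rev_ord (rshift n l) = lshift n (rev_ord l)); last by apply: val_inj => /=; have := ltn_ord l; lia.
by rewrite row_mxEl row_mxEr !mxE mulfV.
Qed.

Lemma tmx_char t (lam : 'rV[int]_n) : (forall j, t j != 0) ->
  (torus_char lam (torus_mx t))^-1 = \prod_j t j ^ lam 0 j.
Proof.
move=> t0; rewrite /torus_char -prodfV; apply: eq_bigr => j _.
by rewrite mxE eqxx row_mxEl mxE expfV invrK.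
Qed.

Lemma PF_line (G : (nat * nat -> C) -> C) y : polyfun G -> exists P : {poly C}, forall z, G (fun v => y v + z) = P.[z].
Proof.
elim=> {G} [c|v|f g _ [P PE] _ [Q QE]|f g _ [P PE] _ [Q QE]].
- by exists c%:P => z; rewrite hornerC.
- by exists ((y v)%:P + 'X) => z; rewrite !hornerE.
- by exists (P + Q) => z; rewrite hornerD PE QE.
- by exists (P * Q) => z; rewrite hornerM PE QE.
Qed.

(** Restrict both functions to the diagonal line y + z: only finitely many z make a coordinate in
    [vars n] vanish. *)
Lemma PF_nonvanishing (G H : (nat * nat -> C) -> C) : polyfun G -> polyfun H ->
  (forall y, (forall v, v \in vars n -> y v != 0) -> G y = H y) -> forall y, G y = H y.
Proof.
move=> PG PH E y; have [P PE] := PF_line y PG; have [Q QE] := PF_line y PH.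
have PQ : P - Q = 0.
  apply: (@poly_fun_eq0 _ _ [seq - y v | v <- vars n]) => z zn.
  rewrite hornerD hornerN -PE -QE E ?subrr // => v vn.
  apply: contra zn; rewrite addrC addr_eq0 => /eqP ->.
  exact: map_f.
have := PE 0; have := QE 0; rewrite (_ : (fun v => y v + 0) = y); last by apply/funext => v; rewrite addr0.
by move=> -> ->; move/eqP: PQ; rewrite subr_eq0 => /eqP ->.
Qed.

Variables (r : nat) (e : 'M[int]_(r, n)).
Hypothesis e_inj : forall a b : 'rV[int]_r, a *m e = b *m e -> a = b.

Definition purex (u : expo n r) : Prop := [/\ forall k, 0 <= u.1.1 k, u.1.2 = 0 & u.2 = 0].

Lemma purexD u v : purex u -> purex v -> purex (u + v).
Proof.
move=> [u1 u2 u3] [v1 v2 v3]; split=> /= [k||]; rewrite ?u2 ?u3 ?v2 ?v3 ?addr0 //.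
by rewrite ffunE addr_ge0.
Qed.

Lemma purex0 : purex 0.
Proof. by split=> // k; rewrite ffunE. Qed.

Lemma PF_represents (G : (nat * nat -> C) -> C) : polyfun G ->
  exists f, represents e purex f (fun q => G (ycoord q)).
Proof.
elim=> {G} [c|v|f g _ [P PE] _ [Q QE]|f g _ [P PE] _ [Q QE]].
- exists (gmonom c 0); apply: represents_monom; first exact: purex0.
  by move=> q q0; rewrite chi0 mulr1.
- have [/vars_vx [k ->]|vn] := boolP (v \in vars n); last first.
    exists (gmonom 0 0); apply: represents_monom; first exact: purex0.
    move=> q _; rewrite mul0r /ycoord; case: pickP => // l /andP [/eqP h1 /eqP h2].
    by move/negP: vn; case; rewrite (_ : v = xpair l) ?vx_vars // /xpair h1 h2; case: (v).
  exists (gmonom 1 ([ffun l => (l == k)%:Z], 0, 0)); apply: represents_monom.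
    by split=> // l; rewrite ffunE.
  move=> q q0; rewrite mul1r yq_vx /chi (bigD1 (inl (inl k))) //= ffunE eqxx expr1z big1 ?mulr1 //.
  move=> [[l|j]|[]] /= h; rewrite ?ffunE ?expr0z //; last by rewrite mul0mx mxE expr0z.
  have -> : (l == k) = false by apply: contraNF h => /eqP ->.
  by rewrite expr0z.
- exists (P + Q); exact: represents_add.
- exists (P * Q); apply: represents_mul PE QE; exact: purexD.
Qed.

End Point.

Lemma lrmorphism_exists (F : nzRingType) (A B : lalgType F) (f : A -> B) :
  zmod_morphism f -> monoid_morphism f -> scalable f -> exists g : {lrmorphism A -> B}, g =1 f.
Proof.
move=> fB fM fZ.
pose H1 := GRing.isZmodMorphism.Build A B f fB.
pose H2 := GRing.isMonoidMorphism.Build A B f fM.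
pose H3 := GRing.isScalable.Build F A B *:%R f fZ.
pose g : {lrmorphism A -> B} := HB.pack f H1 H2 H3.
by exists g.
Qed.

Lemma big_unit (T : Type) (idx : T) (op : Monoid.law idx) (G : unit -> T) :
  \big[op/idx]_(i : unit) G i = G tt.
Proof. by rewrite (big_pred1 tt) // => -[]. Qed.

Section Embedding.
Context {R : realType} {n N : nat} (rho : spModule R n N) (X : projVariety R N).
Local Notation C := R[i].
Local Notation M := 'M[C]_(n + n).
Hypothesis stab : G_stable rho X.
Variable x0 : 'cV[C]_N.
Hypotheses (Xx0 : X x0) (x0_dense : proj_dense (Defs.orbit rho Sp x0) X).
Hypothesis x0_low : forall l, Sp l -> utri l^T -> rho l *m x0 = x0.
Context {r : nat} (e : 'M[int]_(r, n)).
Hypothesis e_inj : forall a b : 'rV[int]_r, a *m e = b *m e -> a = b.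
Local Notation I := (xvar n + 'I_n + unit)%type.
Local Notation L := (groupAlg C (expo n r)).

Lemma chi_split (u : expo n r) (q : I -> C) : chi e u q =
  (\prod_k q (inl (inl k)) ^ u.1.1 k) * (\prod_j q (inl (inr j)) ^ (u.1.2 *m e) 0 j) * q (inr tt) ^ u.2.
Proof. by rewrite /chi big_sumType big_sumType /= big_unit. Qed.

Definition orbit_pt (q : I -> C) : 'cV[C]_N :=
  q (inr tt) *: (rho (umx n (ycoord q) *m torus_mx (fun j => q (inl (inr j)))) *m x0).

Lemma tmx_pt q : torus_pt q -> torus (torus_mx (fun j : 'I_n => q (inl (inr j)) : C)).
Proof. by move=> q0; apply: tmx_torus => j; apply: q0. Qed.

Lemma Sp_pt q : torus_pt q -> Sp (umx n (ycoord q) *m torus_mx (fun j : 'I_n => q (inl (inr j)) : C)).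
Proof. by move=> q0; apply: Sp_mul; [exact: umx_Sp|exact: (tmx_pt q0).1]. Qed.

Lemma X_pt q : torus_pt q -> X (orbit_pt q).
Proof. by move=> q0; apply: pv_scale; [exact: q0|apply: stab => //; exact: Sp_pt]. Qed.

Definition Fval (f : coordRing X) (q : I -> C) : C := cval f (orbit_pt q).

Section Weight.
Variables (lam : 'rV[int]_n) (k : nat) (W : coordRing X -> Prop) (a : 'rV[int]_r).
Hypotheses (WV : V_in rho lam k W) (lamE : lam = a *m e).
Variable f : coordRing X.
Hypothesis Wf : W f.

Lemma ofun_torus g t : Sp g -> torus t ->
  ofun rho x0 f (g *m t) = (torus_char lam t)^-1 * ofun rho x0 f g.
Proof.
move=> gS tt; have [A [AE sub _]] := V_functions stab Xx0 x0_dense x0_low WV.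
have [m [h [c [hS fE]]]] := sub f Wf.
have td := is_diag_mxP tt.2.
rewrite !fE //; last by apply: Sp_mul tt.1.
rewrite mulr_sumr; apply: eq_bigr => l _; rewrite mulrCA; congr (_ * _).
rewrite -(prod_Dk_torus lam tt) -big_split /=; apply: eq_bigr => i _.
rewrite mulmxA [X in X ^+ _]/tminor mnr_mul_lower; last by move=> b d bd; rewrite td // ltn_eqF.
by rewrite exprMn mulrC -AE.
Qed.

Lemma PF_ofun : polyfun (fun y => ofun rho x0 f (umx n y)).
Proof.
have [A [AE sub _]] := V_functions stab Xx0 x0_dense x0_low WV.
have [m [h [c [hS fE]]]] := sub f Wf.
rewrite (_ : (fun _ => _) = fun y => \sum_l c l * \prod_i tminor (kle i) (h l *m umx n y) ^+ A i); last first.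
  by apply/funext => y; rewrite fE //; exact: umx_Sp.
apply: PF_sum => l; apply: PFmul; first exact: PFconst.
by apply: PF_prod => i; apply: PF_exp; apply: PF_mnr.
Qed.

Lemma Fval_V q : torus_pt q -> Fval f q = q (inr tt) ^+ k *
  ((\prod_j q (inl (inr j)) ^ lam 0 j) * ofun rho x0 f (umx n (ycoord q))).
Proof.
move=> q0; have S := Sp_pt q0.
apply: etrans (cval_homog (WV.2 f Wf) (q0 _) (stab S Xx0)) _; congr (_ * _).
apply: etrans (ofun_torus (umx_Sp n (ycoord q)) (tmx_pt q0)) _.
by congr (_ * _); apply: tmx_char => j; apply: q0.
Qed.

(** The exponents possible for a copy of V_lam in R_k. The parts in y and t are prescribed, so
    components of different weight or degree have disjoint supports. *)
Definition wsupp (u : expo n r) : Prop := [/\ forall x, 0 <= u.1.1 x, u.1.2 = a & u.2 = k%:Z].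

Lemma V_represents : exists l, represents e wsupp l (Fval f).
Proof.
have [l lE] := PF_represents e PF_ofun.
have me : represents e (fun u => u = (0, a, k%:Z)) (gmonom 1 (0, a, k%:Z) : L)
   (fun q => q (inr tt) ^+ k * (\prod_j q (inl (inr j)) ^ lam 0 j)).
  apply: represents_monom => // q q0; rewrite mul1r chi_split /= big1 ?mul1r => [|x _]; last by rewrite ffunE expr0z.
  by rewrite mulrC -lamE.
have [|H1 H2] := represents_mul (Q3 := wsupp) _ me lE.
  move=> u v -> [v1 v2 v3]; split=> /= [x||]; rewrite ?v2 ?v3 ?addr0 //.
  by rewrite ffunE ffunE add0r.
exists (gmonom 1 (0, a, k%:Z) * l); split=> // q q0; rewrite H2 // Fval_V //.
by rewrite mulrA.
Qed.

End Weight.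

Lemma represents_uniq Q Q' (l l' : L) G : represents e Q l G -> represents e Q' l' G -> l = l'.
Proof. by move=> [_ E] [_ E']; apply: (ev_ext e_inj) => q q0; rewrite E // E'. Qed.

Variable Lam : 'rV[int]_n -> Prop.
Hypothesis LamX : brion_lattice rho X Lam.
Hypothesis Lam_e : forall lam, Lam lam -> exists a : 'rV[int]_r, lam = a *m e.

Definition nonneg (u : expo n r) : Prop := (forall k, 0 <= u.1.1 k) /\ 0 <= u.2.

Lemma represents_ext Q (l : L) G H : (forall q, torus_pt q -> G q = H q) ->
  represents e Q l G -> represents e Q l H.
Proof. by move=> E [h1 h2]; split=> // q q0; rewrite h2 // E. Qed.

Lemma Fval0_represents : exists l, represents e nonneg l (Fval 0).
Proof.
exists (gmonom 0 0); apply: represents_monom; first by split=> // k; rewrite ffunE.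
by move=> q q0; rewrite mul0r; apply: esym; exact: cval0 (X_pt q0).
Qed.

Lemma represents_Fsum (T : Type) (s : seq T) (F : T -> coordRing X) :
  (forall t, exists l, represents e nonneg l (Fval (F t))) ->
  exists l, represents e nonneg l (Fval (\sum_(t <- s) F t)).
Proof.
move=> HF; elim: s => [|t s [l lE]]; first by rewrite big_nil; exact: Fval0_represents.
have [l' lE'] := HF t; exists (l' + l); rewrite big_cons.
apply: represents_ext (represents_add lE' lE) => q q0.
by apply: esym; apply: cvalD (X_pt q0).
Qed.

Lemma Fval_represents f : exists l, represents e nonneg l (Fval f).
Proof.
have -> : f = \sum_(k < mmeasure mdeg (repr f)) proj_coord X (pihomog mdeg k (repr f)).
  rewrite {1}(proj_repr f) {1}(@pihomog_partitionE N _ mdeg _ (repr f) (leqnn _)).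
  by rewrite raddf_sum.
apply: represents_Fsum => k; have [s [W [us [sE [WV [dec _]]]]]] := LamX.2.2.2 k.
have [|w [wW ->]] := dec (proj_coord X (pihomog mdeg k (repr f))).
  by exists (pihomog mdeg k (repr f)); split=> //; apply: pihomogP.
rewrite big_seq_cond big_mkcond; apply: represents_Fsum => lam; rewrite andbT.
case: ifP => [ls|_]; last exact: Fval0_represents.
have [a lamE] := Lam_e ((sE lam).1 ls).1.
have [l [lS lE]] := V_represents (WV lam ls) lamE (wW lam ls).
by exists l; split=> // u /lS [u1 _ u3]; split=> //; rewrite u3.
Qed.

End Embedding.

(** * The algebra homomorphism and its weight components *)

Section Psi.
Context {R : realType} {n N : nat} (rho : spModule R n N) (X : projVariety R N).
Local Notation C := R[i].
Local Notation M := 'M[C]_(n + n).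
Hypothesis stab : G_stable rho X.
Variable x0 : 'cV[C]_N.
Hypotheses (Xx0 : X x0) (x0_dense : proj_dense (Defs.orbit rho Sp x0) X).
Hypothesis x0_low : forall l, Sp l -> utri l^T -> rho l *m x0 = x0.
Context {r : nat} (e : 'M[int]_(r, n)).
Hypothesis e_inj : forall a b : 'rV[int]_r, a *m e = b *m e -> a = b.
Local Notation I := (xvar n + 'I_n + unit)%type.
Local Notation L := (groupAlg C (expo n r)).

Variable Lam : 'rV[int]_n -> Prop.
Hypothesis LamX : brion_lattice rho X Lam.
Hypothesis Lam_e : forall lam, Lam lam -> exists a : 'rV[int]_r, lam = a *m e.

Let Frep := Fval_represents stab Xx0 x0_dense x0_low LamX Lam_e.

(** Chosen for each f by [cid]. Since a Laurent polynomial is determined by its values at torus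
    points, the algebra laws are inherited from [Fval]. *)
Definition Psi (f : coordRing X) : L := projT1 (cid (Frep f)).

Lemma PsiP f : represents e (@nonneg n r) (Psi f) (Fval rho x0 f).
Proof. by rewrite /Psi; case: cid. Qed.

Lemma Psi_eq Q f (l : L) : represents e Q l (Fval rho x0 f) -> Psi f = l.
Proof. exact: (represents_uniq e_inj (PsiP f)). Qed.

Lemma evPsi f q : torus_pt q -> ev e (Psi f) q = Fval rho x0 f q.
Proof. exact: (PsiP f).2. Qed.

Let Xpt (q : I -> C) := @X_pt R n N rho X stab x0 Xx0 q.

Lemma PsiD f g : Psi (f + g) = Psi f + Psi g.
Proof.
apply: (ev_ext e_inj) => q q0; rewrite evD !evPsi //.
exact: (cvalD f g (Xpt q0)).
Qed.

Lemma PsiZ c f : Psi (c *: f) = c *: Psi f.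
Proof.
apply: (ev_ext e_inj) => q q0; rewrite evZ !evPsi //.
exact: (cvalZ c f (Xpt q0)).
Qed.

Lemma PsiM f g : Psi (f * g) = Psi f * Psi g.
Proof.
apply: (ev_ext e_inj) => q q0; rewrite evM // !evPsi //.
exact: (cvalM f g (Xpt q0)).
Qed.

Lemma Psi1 : Psi 1 = 1.
Proof.
apply: (ev_ext e_inj) => q q0; rewrite ev1 !evPsi //.
exact: (cval1 (Xpt q0)).
Qed.

Lemma Psi0 : Psi 0 = 0.
Proof. by rewrite -(scale0r (0 : coordRing X)) PsiZ scale0r. Qed.

Lemma PsiB f g : Psi (f - g) = Psi f - Psi g.
Proof. by rewrite PsiD -scaleN1r PsiZ scaleN1r. Qed.

Lemma Psi_sum (T : Type) (s : seq T) (P : pred T) (F : T -> coordRing X) :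
  Psi (\sum_(t <- s | P t) F t) = \sum_(t <- s | P t) Psi (F t).
Proof. exact: (big_morph Psi PsiD Psi0). Qed.

Section Weight.
Variables (lam : 'rV[int]_n) (k : nat) (W : coordRing X -> Prop) (a : 'rV[int]_r).
Hypotheses (WV : V_in rho lam k W) (lamE : lam = a *m e).
Variable f : coordRing X.
Hypothesis Wf : W f.

Lemma Psi_wsupp u : u \in gsupp (Psi f) -> wsupp k a u.
Proof.
have [l lE] := V_represents stab Xx0 x0_dense x0_low WV lamE Wf.
by rewrite (Psi_eq lE); apply: lE.1.
Qed.

Lemma PF_mon (vs : seq (nat * nat)) (p : nat * nat -> nat) : polyfun (mon vs p : _ -> C).
Proof. by apply: PF_prod => v; apply: PF_exp; apply: PFvar. Qed.

Lemma Psi_expand y : ofun rho x0 f (umx n y) =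
  \sum_(u <- gsupp (Psi f)) gcoef (Psi f) u * mon (vars n) (fun v => `|xco u.1.1 v|%N) y.
Proof.
move: y; apply: PF_nonvanishing.
- exact: (PF_ofun stab Xx0 x0_dense x0_low WV Wf).
- by apply: PF_sum => u; apply: PFmul; [exact: PFconst|exact: PF_mon].
(* With the torus and scaling coordinates equal to 1 only the x-part of the exponents is seen. This
   q is a torus point because y has no zero coordinate, which is why [PF_nonvanishing] comes
   first. *)
move=> y y0; pose q (i : I) : C := if i is inl (inl x) then y (xpair x) else 1.
have q0 : torus_pt q.
  by move=> [[x|j]|[]] /=; rewrite ?oner_neq0 //; apply/y0/vx_vars.
have := evPsi f q0; rewrite (Fval_V stab Xx0 x0_dense x0_low WV) // expr1n mul1r.
rewrite big1 ?mul1r => [|j _]; last by rewrite exp1rz.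
rewrite (@umx_ext _ _ _ y); last by move=> v /vars_vx [x ->]; rewrite yq_vx.
move=> <-; rewrite /ev !big_seq; apply: eq_bigr => u uf; congr (_ * _).
have [u1 _ _] := Psi_wsupp uf.
rewrite chi_split [X in _ * X * _]big1 ?mulr1 => [|j _]; last by rewrite exp1rz.
rewrite exp1rz mulr1 /mon prod_vars; apply: eq_bigr => x _.
by rewrite xco_vx /= -[in LHS](gez0_abs (u1 x)).
Qed.

Lemma Psi_V_eq0 : Psi f = 0 -> f = 0.
Proof.
move=> f0; apply: (orbit_ext stab Xx0 x0_dense (WV.2 f Wf)) => g gS.
have [P PE] := cval_regular rho f x0.
rewrite /ofun PE //; apply: Sp_density gS => y t l tt lS ll.
have S : Sp (umx n y *m t) by apply: Sp_mul tt.1; apply: umx_Sp.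
rewrite -PE; last exact: Sp_mul.
rewrite repM // -mulmxA x0_low //; apply: etrans (ofun_torus stab Xx0 x0_dense x0_low WV Wf (umx_Sp n y) tt) _.
rewrite Psi_expand f0 big_seq big1 ?mulr0 // => u.
by rewrite gsuppP gcoef0 eqxx.
Qed.

End Weight.

Lemma brion_choice : exists (s : nat -> seq 'rV[int]_n) (W : nat -> 'rV[int]_n -> coordRing X -> Prop),
  forall k, [/\ uniq (s k), (forall lam, lam \in s k <-> weights_in rho X Lam k lam),
    (forall lam, lam \in s k -> V_in rho lam k (W k lam)) &
    (forall f, graded_piece k f -> exists w : 'rV[int]_n -> coordRing X,
       (forall lam, lam \in s k -> W k lam (w lam)) /\ f = \sum_(lam <- s k) w lam)].
Proof.
have [s sP] := choice LamX.2.2.2; have [W WP] := choice sP.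
by exists s, W => k; have [h1 [h2 [h3 [h4 _]]]] := WP k; split.
Qed.

Variables (s : nat -> seq 'rV[int]_n) (W : nat -> 'rV[int]_n -> coordRing X -> Prop).
Hypothesis sW : forall k, [/\ uniq (s k), (forall lam, lam \in s k <-> weights_in rho X Lam k lam),
    (forall lam, lam \in s k -> V_in rho lam k (W k lam)) &
    (forall f, graded_piece k f -> exists w : 'rV[int]_n -> coordRing X,
       (forall lam, lam \in s k -> W k lam (w lam)) /\ f = \sum_(lam <- s k) w lam)].

Lemma s_e k lam : lam \in s k -> exists a : 'rV[int]_r, lam = a *m e.
Proof. by have [_ sE _ _] := sW k; move/sE => [] /Lam_e. Qed.

(** By disjointness of supports the coefficient at v belongs to one component, whose degree and
    weight are read off from the t-part and the y-part of v. *)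
Lemma Psi_comp f : exists (d : nat) (g : nat -> 'rV[int]_n -> coordRing X),
  [/\ forall k lam, lam \in s k -> W k lam (g k lam),
     f = \sum_(k < d) \sum_(lam <- s k) g k lam,
     forall (k : nat) lam v, (k < d)%N -> lam \in s k -> v.2 = k%:Z -> v.1.2 *m e = lam ->
       gcoef (Psi f) v = gcoef (Psi (g k lam)) v &
     forall v, v \in gsupp (Psi f) -> exists k : nat, [/\ (k < d)%N, v.2 = k%:Z & v.1.2 *m e \in s k]].
Proof.
have [g gP] := choice (fun k => let: And4 _ _ _ h := sW k in h (proj_coord X (pihomog mdeg k (repr f)))
   (ex_intro _ (pihomog mdeg k (repr f)) (conj (pihomogP mdeg k (repr f)) erefl))).
pose d := mmeasure mdeg (repr f).
have fE : f = \sum_(k < d) \sum_(lam <- s k) g k lam.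
  rewrite {1}(proj_repr f) {1}(@pihomog_partitionE N _ mdeg _ (repr f) (leqnn _)).
  by rewrite raddf_sum; apply: eq_bigr => k _; apply: (gP k).2.
have gW k lam : lam \in s k -> W k lam (g k lam) by move=> h; apply: (gP k).1.
have coefE v : gcoef (Psi f) v = \sum_(k < d) \sum_(lam <- s k) gcoef (Psi (g k lam)) v.
  rewrite {1}fE Psi_sum gcoef_sum; apply: eq_bigr => k _.
  by rewrite Psi_sum gcoef_sum.
have zero k lam v : lam \in s k -> v.2 != k%:Z \/ v.1.2 *m e != lam -> gcoef (Psi (g k lam)) v = 0.
  move=> ls h; apply/eqP/negPn; rewrite -gsuppP; apply/negP => vg.
  have [a aE] := s_e ls; have [_ _ V _] := sW k.
  have [_ v2 v3] := Psi_wsupp (V _ ls) aE (gW _ _ ls) vg.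
  by case: h; rewrite ?v3 ?v2 -?aE eqxx.
have one k lam v : (k < d)%N -> lam \in s k -> v.2 = k%:Z -> v.1.2 *m e = lam ->
       gcoef (Psi f) v = gcoef (Psi (g k lam)) v.
  move=> kd ls v2 v1; rewrite coefE (bigD1 (Ordinal kd)) //= [X in _ + X]big1 ?addr0; last first.
    move=> j jk; rewrite big_seq big1 // => mu mus; apply: zero => //; left.
    by rewrite v2; apply: contraNneq jk => -[h]; apply/eqP/val_inj.
  have [us _ _ _] := sW k; rewrite (bigD1_seq lam) //= big1_seq ?addr0 // => mu /andP [ml mus].
  by apply: zero => //; right; rewrite v1 eq_sym.
exists d, g; split=> // v; rewrite gsuppP => vf; apply: contrapT => H; move/eqP: vf; apply.
rewrite coefE big1 // => k _; rewrite big_seq big1 // => lam ls; apply: zero => //.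
have [v2|] := eqVneq v.2 k%:Z; last by left.
right; apply: contra_notN H => /eqP vl; exists k; split=> //; by rewrite vl.
Qed.

Lemma Psi_eq0 f : Psi f = 0 -> f = 0.
Proof.
move=> f0; have [d [g [gW fE E _]]] := Psi_comp f.
rewrite fE big1 // => k _; rewrite big_seq big1 // => lam ls.
have [a aE] := s_e ls; have [_ _ V _] := sW k.
apply: (Psi_V_eq0 (V _ ls) aE (gW _ _ ls)); apply: gcoefP => v; rewrite gcoef0.
apply/eqP/negPn; rewrite -gsuppP; apply/negP => vg.
have [_ v2 v3] := Psi_wsupp (V _ ls) aE (gW _ _ ls) vg.
move: vg; rewrite gsuppP -(E _ lam) ?v2 // ?f0 ?gcoef0 ?eqxx //.
Qed.

End Psi.

Lemma first_diff (T : eqType) (P : pred T) (vs : seq T) : has P vs ->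
  exists pre v post, [/\ vs = pre ++ v :: post, P v & all (fun u => ~~ P u) pre].
Proof.
elim: vs => [//|v vs IH] /=; have [Pv _|nPv /= /IH [pre [u [post [-> Pu Ppre]]]]] := boolP (P v).
  by exists [::], v, vs.
by exists (v :: pre), u, post; rewrite /= nPv.
Qed.

Lemma xprecE n (k l : xvar n) : xprec k l <-> vprec (xpair k) (xpair l).
Proof.
have [k1 k2] := vxS k; have [l1 l2] := vxS l; rewrite /xprec /vprec -k1 -k2 -l1 -l2.
by split=> [[h|[h1 h2]]|/orP [h|/andP [/eqP h1 h2]]]; [apply/orP; left|apply/orP; right; lia|left|right; split; lia]; lia.
Qed.

(** * Initial terms *)

Section InitialTerms.
Context {R : realType} {n N : nat} (rho : spModule R n N) (X : projVariety R N).
Local Notation C := R[i].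
Local Notation M := 'M[C]_(n + n).
Hypothesis stab : G_stable rho X.
Variable x0 : 'cV[C]_N.
Hypotheses (Xx0 : X x0) (x0_dense : proj_dense (Defs.orbit rho Sp x0) X).
Hypothesis x0_low : forall l, Sp l -> utri l^T -> rho l *m x0 = x0.
Context {r : nat} (e : 'M[int]_(r, n)).
Hypothesis e_inj : forall a b : 'rV[int]_r, a *m e = b *m e -> a = b.
Local Notation I := (xvar n + 'I_n + unit)%type.
Local Notation L := (groupAlg C (expo n r)).

Variable Lam : 'rV[int]_n -> Prop.
Hypothesis LamX : brion_lattice rho X Lam.
Hypothesis Lam_e : forall lam, Lam lam -> exists a : 'rV[int]_r, lam = a *m e.

Local Notation Psi := (Psi stab Xx0 x0_dense x0_low LamX Lam_e).

Definition expo_nat (u : expo n r) (v : nat * nat) : nat := `|xco u.1.1 v|%N.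

Section Weight.
Variables (lam : 'rV[int]_n) (k : nat) (W : coordRing X -> Prop) (a : 'rV[int]_r).
Hypotheses (WV : V_in rho lam k W) (lamE : lam = a *m e).

Lemma weight_dominant (i : 'I_n) : 0 <= wz lam i - wz lam i.+1.
Proof. by have [A [<- _ _]] := V_functions stab Xx0 x0_dense x0_low WV. Qed.

Section Function.
Variable f : coordRing X.
Hypothesis Wf : W f.

Lemma xco_ge0 (u : expo n r) v : (forall x, 0 <= u.1.1 x) -> 0 <= xco u.1.1 v.
Proof. by move=> u0; rewrite /xco; case: pickP => [x _|_]. Qed.

Lemma ew_inj u w : wsupp k a u -> wsupp k a w -> {in vars n, expo_nat u =1 expo_nat w} -> u = w.
Proof.
case: u w => [[p b] m] [[p' b'] m'] [/= u1 u2 u3] [/= w1 w2 w3] E.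
rewrite u2 w2 u3 w3; congr (_, _, _); apply/ffunP => x.
have := E _ (vx_vars x); rewrite /expo_nat /= !xco_vx => h.
by rewrite -[LHS]gez0_abs // h gez0_abs.
Qed.

(** Of all minors in the product only the one of size i+1 depends on z, affinely, and it has
    exponent lam_i - lam_(i+1). *)
Lemma ofun_deg (i : 'I_n) y : exists2 Q : {poly C}, (size Q <= (`|wz lam i - wz lam i.+1|%N).+1)%N &
  forall z, ofun rho x0 f (umx n y *m xmx i z) = Q.[z].
Proof.
have [A [AE sub _]] := V_functions stab Xx0 x0_dense x0_low WV.
have [m [h [c [hS fE]]]] := sub f Wf; rewrite -AE absz_nat.
have dP l (j : 'I_n) : exists d, forall z, tminor (kle j) (h l *m (umx n y *m xmx i z)) =
    tminor (kle j) (h l *m umx n y) + z * (if j == i then d else 0).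
  case: (eqVneq j i) => [->|ji].
    have [d dE] := mnr_xmx_eq (kle i) (lrow (kle i)) (h l *m umx n y).
    by exists d => z; rewrite mulmxA; apply: dE.
  by exists 0 => z; rewrite mulr0 addr0 mulmxA [LHS]mnr_xmx_neq ?eqSS ?ltn_ord.
have [d dE] := choice (fun x => dP x.1 x.2).
pose Q l : {poly C} := \prod_j ((tminor (kle j) (h l *m umx n y))%:P + (if j == i then d (l, j) else 0) *: 'X) ^+ A j.
exists (\sum_l c l *: Q l).
  apply: (leq_trans (size_sum _ _ _)); apply/bigmax_leqP => l _.
  apply: (leq_trans (size_scale_leq _ _)); rewrite /Q (bigD1 i) //= eqxx.
  rewrite [X in _ * X](_ : _ = (\prod_(j < n | j != i) tminor (kle j) (h l *m umx n y) ^+ A j)%:P); last first.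
    rewrite rmorph_prod; apply: eq_bigr => j /negbTE ->.
    by rewrite scale0r addr0 rmorphXn.
  rewrite mulrC mul_polyC; apply: (leq_trans (size_scale_leq _ _)).
  apply: (leq_trans (size_poly_exp_leq _ _)); rewrite ltnS -[X in (_ <= X)%N]mul1n leq_mul2r.
  apply/orP; right; rewrite -subn1 leq_subLR; apply: (leq_trans (size_polyD _ _)).
  rewrite geq_max (leq_trans (size_polyC_leq1 _)) //= (leq_trans (size_scale_leq _ _)) // size_polyX.
  by [].
move=> z; rewrite fE; last by apply: Sp_mul; [exact: umx_Sp|exact: Sp_xmx].
rewrite horner_sum; apply: eq_bigr => l _; rewrite hornerZ; congr (_ * _).
rewrite horner_prod; apply: eq_bigr => j _; rewrite horner_exp (dE (l, j)) !hornerE.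
by rewrite mulrC.
Qed.

(** A maximum for [xlt] is a lexicographic minimum of exponents, as the stripping requires. By
    [umx_xmx] right multiplication by [xmx i z] is the flow of [delta], so [ofun_deg] supplies the
    starting bound for each simple root. *)
Lemma init_pattern u : u \in gsupp (Psi f) ->
  (forall v, v \in gsupp (Psi f) -> v != u -> xlt v.1.1 u.1.1) ->
  pattern n (fun i => wz lam i - wz lam i.+1) (xco u.1.1).
Proof.
move=> uf umax; have supp v : v \in gsupp (Psi f) -> wsupp k a v := Psi_wsupp e_inj WV lamE Wf (u := v).
have u1 : forall v, 0 <= xco u.1.1 v by move=> v; apply: xco_ge0; have [] := supp u uf.
have zE : (fun v => (expo_nat u v)%:Z) = xco u.1.1.
  by apply/funext => v; rewrite /expo_nat gez0_abs.
have dist v w : v \in gsupp (Psi f) -> w \in gsupp (Psi f) -> {in vars n, expo_nat v =1 expo_nat w} -> v = w.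
  by move=> /supp hv /supp hw; apply: ew_inj.
have lexmin v pre b post : v \in gsupp (Psi f) -> vars n = pre ++ b :: post ->
    agree expo_nat (expo_nat u) pre v -> (expo_nat u b <= expo_nat v b)%N.
  move=> vf E ag; have [->//|vu] := eqVneq v u.
  have [x [xu xl]] := umax v vf vu.
  have xin : xpair x \in pre ++ b :: post by rewrite -E vx_vars.
  have bin : b \in vars n by rewrite E mem_cat inE eqxx orbT.
  move: xin; rewrite mem_cat inE => /or3P [xpre|/eqP <-|xpost].
  - move/allP: ag => /(_ _ xpre); rewrite /expo_nat !xco_vx => /eqP h.
    have [v1 _ _] := supp v vf; have [u1' _ _] := supp u uf.
    by move: xu; rewrite -[v.1.1 x]gez0_abs // h gez0_abs // ltxx.
  - have [v1 _ _] := supp v vf; have [u1' _ _] := supp u uf.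
    by rewrite /expo_nat !xco_vx -lez_nat !gez0_abs // ltW.
  have [l bE] := vars_vx bin.
  have := vars_split E xpost; rewrite bE => /xprecE /xl h.
  by rewrite /expo_nat !xco_vx h.
have bd (i : 'I_n) : deg_le (gsupp (Psi f)) (gcoef (Psi f)) expo_nat (delta n i) (expo_nat u) [::] (vars n)
    `|wz lam i - wz lam i.+1|%N.
  move=> y; have [Q Qs QE] := ofun_deg i y.
  rewrite (_ : stripped _ _ _ _ _ _ _ _ = Q) //; apply/eqP; rewrite -subr_eq0; apply/eqP.
  apply: (@poly_fun_eq0 _ _ [::]) => z _; rewrite hornerD hornerN -QE umx_xmx.
  rewrite (Psi_expand stab Xx0 x0_dense x0_low e_inj LamX Lam_e WV lamE Wf).
  apply/eqP; rewrite subr_eq0; apply/eqP; rewrite /stripped horner_sum /=; apply: eq_bigr => v _.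
  rewrite hornerZ; congr (_ * _); rewrite /fmon horner_prod; apply: eq_bigr => b _.
  by rewrite horner_exp !hornerE [z * _]mulrC.
move=> i m mi lin; have cu : gcoef (Psi f) u != 0 by rewrite -gsuppP.
have ag : agree expo_nat (expo_nat u) (vars n) u by apply/allP.
have := exponent_bounds (fset_uniq _) dist lexmin uf cu ag lin (bd (Ordinal lin)) mi.
rewrite zE /= gez0_abs ?(weight_dominant (Ordinal lin)) // => -[h1 h2].
have uE v : (expo_nat u v)%:Z = xco u.1.1 v by rewrite /expo_nat gez0_abs.
by rewrite !uE in h1 h2; split=> [/h1 ->|]; rewrite u1 // h2.
Qed.

End Function.

(** The product of minors with lowest exponent u is in V_lam by [minors_span]. [Lead_lexmin] makes u
    lexicographically least, thus greatest for [xlt], and all exponents share their y-part and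
    t-part. *)
Lemma pattern_init (u : expo n r) : u.2 = k%:Z -> u.1.2 = a -> (forall x, 0 <= u.1.1 x) ->
  pattern n (fun i => wz lam i - wz lam i.+1) (xco u.1.1) -> exists2 f, W f & is_init (Psi f) u.
Proof.
move=> u3 u2 u1 pat; have [A [AE _ sup]] := V_functions stab Xx0 x0_dense x0_low WV.
have [|phi L] := @pattern_lead R n A (xco u.1.1).
  by apply: pattern_ext pat => i lin; rewrite /extw insubT -(AE (Ordinal lin)).
have [m [h [c [hS mE]]]] := @minors_span R n A phi.
have [f Wf fE] := sup m h c hS; exists f => //.
have supp v : v \in gsupp (Psi f) -> wsupp k a v := Psi_wsupp e_inj WV lamE Wf (u := v).
have dist v w : v \in gsupp (Psi f) -> w \in gsupp (Psi f) -> {in vars n, expo_nat v =1 expo_nat w} -> v = w.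
  by move=> /supp hv /supp hw; apply: ew_inj.
have c0 v : v \in gsupp (Psi f) -> gcoef (Psi f) v != 0 by rewrite gsuppP.
have E y : \prod_i \prod_(b < A i) mxminor (kle i) (phi i b) (umx n y) =
    \sum_(v <- gsupp (Psi f)) gcoef (Psi f) v * mon (vars n) (expo_nat v) y.
  have uS := umx_Sp n y; rewrite mE // -fE //.
  exact: (Psi_expand stab Xx0 x0_dense x0_low e_inj LamX Lam_e WV lamE Wf).
have [u0 [u0f u0E lexmin]] := Lead_lexmin (vars_uniq n) (fset_uniq _) dist c0 E L.
have uu : u0 = u by apply: (ew_inj (supp _ u0f)).
rewrite {}uu in u0f u0E; split=> // v vf vu; right.
have [v1 v2 v3] := supp v vf; split; first by rewrite v3 u3.
right; split; first by rewrite v2 u2.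
have hd : has (fun b => expo_nat v b != expo_nat u b) (vars n).
  rewrite has_predC; apply/negP => /allP ha; move/eqP: vu; apply.
  by apply: dist => // b /ha /eqP.
have [pre [b [post [Eb nb pb]]]] := first_diff hd.
have ag : agree expo_nat (expo_nat u) pre v by apply: sub_all pb => x /negPn.
have bin : b \in vars n by rewrite Eb mem_cat inE eqxx orbT.
have le := lexmin v pre b post vf Eb ag; have [x bE] := vars_vx bin.
exists x; split.
  move: le nb; rewrite bE /expo_nat !xco_vx -lez_nat -eqz_nat !gez0_abs // lt_neqAle => -> ne.
  by rewrite eq_sym ne.
move=> l /xprecE lx; have := vx_vars l; rewrite {1}Eb mem_cat inE => /or3P [lpre|/eqP lb|lpost].
- move/allP: ag => /(_ _ lpre) /eqP; rewrite /expo_nat !xco_vx => vl.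
  by rewrite -[LHS]gez0_abs // vl gez0_abs.
- by move: lx; rewrite lb bE /vprec; lia.
by have := vars_split Eb lpost; move: lx; rewrite bE /vprec; lia.
Qed.

End Weight.

End InitialTerms.

(** * The semigroup of cone points *)

Section PatternAlgebra.
Local Notation V := (nat * nat)%type.

Definition weight_gap n (lam : 'rV[int]_n) (i : nat) : int := wz lam i - wz lam i.+1.

Lemma wzD n (lam mu : 'rV[int]_n) i : wz (lam + mu) i = wz lam i + wz mu i.
Proof. by rewrite /wz; case: insub => [j|]; rewrite ?mxE ?addr0. Qed.

Lemma AAD n (lam mu : 'rV[int]_n) i : weight_gap (lam + mu) i = weight_gap lam i + weight_gap mu i.
Proof. by rewrite /weight_gap !wzD; ring. Qed.

Lemma AA0 n i : weight_gap (0 : 'rV[int]_n) i = 0.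
Proof. by rewrite /weight_gap /wz; case: insub => [j|]; case: insub => [j'|]; rewrite ?mxE ?subrr. Qed.

Lemma AA_sum n k (F : 'I_k -> 'rV[int]_n) i : weight_gap (\sum_j F j) i = \sum_j weight_gap (F j) i.
Proof. by apply: (big_morph (fun lam => weight_gap lam i)) => [x y|]; rewrite ?AAD ?AA0. Qed.

Lemma xcoD n (p q : {ffun xvar n -> int}) v : xco (p + q) v = xco p v + xco q v.
Proof. by rewrite /xco; case: pickP => [k _|_]; rewrite ?ffunE ?addr0. Qed.

Lemma bound_vars n i a (p p' : V -> int) m : {in vars n, p =1 p'} -> (m <= i < n)%N ->
  bound n i a p m = bound n i a p' m.
Proof.
move=> E; elim: m => //= m IH mi; rewrite IH; last by lia.
have e1 : p (m, i.+1) = p' (m, i.+1) by apply: E; rewrite mem_vars /=; lia.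
have e2 : p (m, i) = p' (m, i) by apply: E; rewrite mem_vars /=; lia.
rewrite e1 e2; case: ifP => // lt.
have e3 : p (m, (n.*2 - i.+1)%N) = p' (m, (n.*2 - i.+1)%N) by apply: E; rewrite mem_vars /=; lia.
by have -> : p (m, (n.*2 - i.+2)%N) = p' (m, (n.*2 - i.+2)%N); [apply: E; rewrite mem_vars /=; lia|rewrite e3].
Qed.

Lemma pattern_vars n a (p p' : V -> int) : {in vars n, p =1 p'} -> pattern n a p -> pattern n a p'.
Proof.
move=> E H i m mi lin; have [h1 h2] := H i m mi lin.
have hm : (m <= i < n)%N by lia.
have e1 : p (m, i.+1) = p' (m, i.+1) by apply: E; rewrite mem_vars /=; lia.
split.
  move=> lt; rewrite -(bound_vars _ E hm) -E; first exact: h1.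
  by rewrite mem_vars /=; lia.
rewrite -e1; move: h2; rewrite /bound_half -(bound_vars _ E hm); case: ifP => // lt.
have -> : p (m, (n.*2 - i.+1)%N) = p' (m, (n.*2 - i.+1)%N) by apply: E; rewrite mem_vars /=; lia.
by have -> : p (m, (n.*2 - i.+2)%N) = p' (m, (n.*2 - i.+2)%N) by apply: E; rewrite mem_vars /=; lia.
Qed.

Lemma pattern_add n a a' (p p' : V -> int) : pattern n a p -> pattern n a' p' ->
  pattern n (fun i => a i + a' i) (fun v => p v + p' v).
Proof.
move=> H H' i m mi lin; have [h1 h2] := H i m mi lin; have [h1' h2'] := H' i m mi lin.
split; first by move=> lt; rewrite bound_add; have := h1 lt; have := h1' lt; lia.
by move: h2 h2'; rewrite /bound_half bound_add; case: ifP => _; lia.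
Qed.

Lemma pattern_zero n a : (forall i, (i < n)%N -> 0 <= a i) -> pattern n a (fun=> 0).
Proof.
move=> a0 i m mi lin; have bE m' : bound n i (a i) (fun=> 0) m' = a i.
  by elim: m' => //= m' ->; case: ifP => _; lia.
rewrite /bound_half bE; have := a0 i lin; split; first by lia.
by case: ifP => _; lia.
Qed.

Lemma pattern_eq0 n p : pattern n (fun=> 0) p -> {in vars n, forall v, p v = 0}.
Proof.
move=> H v hv; apply/eqP; rewrite eq_le (pattern_ge0 H hv) andbT.
by have := @pattern_le n 0 _ _ _ H v hv; rewrite mulr0; apply.
Qed.

End PatternAlgebra.

Section Semigroup.
Context {R : realType} {n N : nat} (rho : spModule R n N) (X : projVariety R N).
Local Notation C := R[i].
Local Notation M := 'M[C]_(n + n).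
Hypothesis stab : G_stable rho X.
Variable x0 : 'cV[C]_N.
Hypotheses (Xx0 : X x0) (x0_dense : proj_dense (Defs.orbit rho Sp x0) X).
Hypothesis x0_low : forall l, Sp l -> utri l^T -> rho l *m x0 = x0.
Context {r : nat} (e : 'M[int]_(r, n)).
Hypothesis e_inj : forall a b : 'rV[int]_r, a *m e = b *m e -> a = b.
Local Notation I := (xvar n + 'I_n + unit)%type.
Local Notation L := (groupAlg C (expo n r)).

Variable Lam : 'rV[int]_n -> Prop.
Hypothesis LamX : brion_lattice rho X Lam.
Hypothesis Lam_e : forall lam, Lam lam -> exists a : 'rV[int]_r, lam = a *m e.

Local Notation Psi := (Psi stab Xx0 x0_dense x0_low LamX Lam_e).

Hypothesis e_Lam : forall a : 'rV[int]_r, Lam (a *m e).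
Variables (s : nat -> seq 'rV[int]_n) (W : nat -> 'rV[int]_n -> coordRing X -> Prop).
Hypothesis sW : forall k, [/\ uniq (s k), (forall lam, lam \in s k <-> weights_in rho X Lam k lam),
    (forall lam, lam \in s k -> V_in rho lam k (W k lam)) &
    (forall f, graded_piece k f -> exists w : 'rV[int]_n -> coordRing X,
       (forall lam, lam \in s k -> W k lam (w lam)) /\ f = \sum_(lam <- s k) w lam)].

Let sE k lam : lam \in s k <-> weights_in rho X Lam k lam.
Proof. by have [_ h _ _] := sW k; apply: h. Qed.

Let sV k lam : lam \in s k -> V_in rho lam k (W k lam).
Proof. by have [_ _ h _] := sW k; apply: h. Qed.

Lemma W_supp k (a : 'rV[int]_r) f v : a *m e \in s k -> W k (a *m e) f -> v \in gsupp (Psi f) ->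
  wsupp k a v.
Proof. move=> us fW; exact: (Psi_wsupp e_inj (sV us) erefl fW). Qed.

(* The points of degree [k] of the cone over Delta'(X), shown below to be the initial
   exponents of degree [k]. *)
Definition cone_points (k : nat) (u : expo n r) : Prop :=
  [/\ u.2 = k%:Z, u.1.2 *m e \in s k & pattern n (weight_gap (u.1.2 *m e)) (xco u.1.1)].

Lemma AA_dominant k lam i : lam \in s k -> (i < n)%N -> 0 <= weight_gap lam i.
Proof. by move=> /sV V lin; apply: (weight_dominant stab Xx0 x0_dense x0_low V (Ordinal lin)). Qed.

Lemma InS_init k u : cone_points k u -> exists2 f, W k (u.1.2 *m e) f & is_init (Psi f) u.
Proof.
move=> [u2 us pat]; apply: (pattern_init stab Xx0 x0_dense x0_low e_inj LamX Lam_e (sV us) erefl) => //.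
by move=> x; rewrite -xco_vx; apply: pattern_ge0 pat _ (vx_vars x).
Qed.

(** The exponent u belongs to a single component and is maximal there too; as the y-part and the
    t-part are constant on it, [term_lt] reduces to [xlt]. *)
Lemma init_InS f u : is_init (Psi f) u -> exists k, cone_points k u.
Proof.
move=> [uf umax]; have [d [g [gW _ E H]]] := Psi_comp stab Xx0 x0_dense x0_low e_inj LamX Lam_e sW f.
have [k [kd u2 us]] := H u uf; exists k; split=> //.
have slice v : v \in gsupp (Psi (g k (u.1.2 *m e))) -> v \in gsupp (Psi f) /\ wsupp k u.1.2 v.
  move=> vg; have sv := W_supp us (gW _ _ us) vg; split=> //; have [_ v2 v3] := sv.
  by rewrite gsuppP (E k (u.1.2 *m e)) ?v2 // -gsuppP.
apply: (@init_pattern R n N rho X stab x0 Xx0 x0_dense x0_low r e e_inj Lam LamX Lam_e _ _ _ _ (sV us) erefl _ (gW _ _ us) u).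
  by rewrite gsuppP -(E k (u.1.2 *m e)) // -gsuppP.
move=> v /slice [vf [_ v2 v3]] vu; have [|[_ [[i []]|[] //]]] := umax v vf vu.
  by rewrite v3 u2 ltxx.
by rewrite v2 ltxx.
Qed.

Lemma InS_cone k u : (0 < k)%N -> cone_points k u <-> cone_slice rho X e k u.
Proof.
move=> k0; have kR : (k%:R : R) != 0 by rewrite pnatr_eq0 -lt0n.
have kp : 0 < (k%:R : R)^-1 by rewrite invr_gt0 ltr0n.
have mapE : map_mx intr (u.1.2 *m e) = map_mx intr u.1.2 *m map_mx intr e :> 'rV[R]_n.
  by rewrite map_mxM.
split=> [[u2 us pat]|[u2 [p [a [[Pa Da] [pE aE]]]]]].
  split=> //; exists [ffun x => k%:R^-1 * (u.1.1 x)%:~R], (k%:R^-1 *: map_mx intr u.1.2).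
  have [_ [x [Px xE]]] := (sE _ _).1 us.
  split; last by split=> [y|]; rewrite ?ffunE ?mulVKf // scalerA mulfV // scale1r.
  split; first by rewrite -scalemxAl -mapE xE scalerA mulVf // scale1r.
  by apply/(delta'_pattern kp _ _).2; [rewrite -scalemxAl -mapE|move=> y; rewrite ffunE|exact: pat].
split=> //.
  apply/sE; split; first exact: e_Lam.
  by exists (a *m map_mx intr e); split=> //; rewrite mapE aE scalemxAl.
apply/(delta'_pattern kp _ _).1: Da; first by rewrite mapE aE -scalemxAl scalerA mulVf // scale1r.
by move=> y; rewrite pE mulKf.
Qed.

End Semigroup.

Lemma gsupp_sum (F : numFieldType) n r (T : eqType) (s : seq T) (G : T -> groupAlg F (expo n r)) u :
  u \in gsupp (\sum_(i <- s) G i) -> exists2 i, i \in s & u \in gsupp (G i).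
Proof.
rewrite gsuppP gcoef_sum => h; apply: contrapT => H; move/eqP: h; apply.
rewrite big_seq big1 // => i si; apply/eqP/negPn; rewrite -gsuppP; apply/negP => ui.
by apply: H; exists i.
Qed.

Lemma gsuppZ (F : numFieldType) n r (c : F) (g : groupAlg F (expo n r)) u :
  u \in gsupp (c *: g) -> u \in gsupp g.
Proof. by rewrite !gsuppP gcoefZ; apply: contraNneq => ->; rewrite mulr0. Qed.

Section Generation.
Context {R : realType} {n N : nat} (rho : spModule R n N) (X : projVariety R N).
Local Notation C := R[i].
Local Notation M := 'M[C]_(n + n).
Hypothesis stab : G_stable rho X.
Variable x0 : 'cV[C]_N.
Hypotheses (Xx0 : X x0) (x0_dense : proj_dense (Defs.orbit rho Sp x0) X).
Hypothesis x0_low : forall l, Sp l -> utri l^T -> rho l *m x0 = x0.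
Context {r : nat} (e : 'M[int]_(r, n)).
Hypothesis e_inj : forall a b : 'rV[int]_r, a *m e = b *m e -> a = b.
Local Notation I := (xvar n + 'I_n + unit)%type.
Local Notation L := (groupAlg C (expo n r)).

Variable Lam : 'rV[int]_n -> Prop.
Hypothesis LamX : brion_lattice rho X Lam.
Hypothesis Lam_e : forall lam, Lam lam -> exists a : 'rV[int]_r, lam = a *m e.

Local Notation Psi := (Psi stab Xx0 x0_dense x0_low LamX Lam_e).

Hypothesis e_Lam : forall a : 'rV[int]_r, Lam (a *m e).
Variables (s : nat -> seq 'rV[int]_n) (W : nat -> 'rV[int]_n -> coordRing X -> Prop).
Hypothesis sW : forall k, [/\ uniq (s k), (forall lam, lam \in s k <-> weights_in rho X Lam k lam),
    (forall lam, lam \in s k -> V_in rho lam k (W k lam)) &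
    (forall f, graded_piece k f -> exists w : 'rV[int]_n -> coordRing X,
       (forall lam, lam \in s k -> W k lam (w lam)) /\ f = \sum_(lam <- s k) w lam)].

Let sE k lam : lam \in s k <-> weights_in rho X Lam k lam.
Proof. by have [_ h _ _] := sW k; apply: h. Qed.

Let sV k lam : lam \in s k -> V_in rho lam k (W k lam).
Proof. by have [_ _ h _] := sW k; apply: h. Qed.

Local Notation cone_points := (cone_points e s).

Let wsup k (a : 'rV[int]_r) f v (us : a *m e \in s k) (fW : W k (a *m e) f) (vf : v \in gsupp (Psi f)) :
  wsupp k a v := @W_supp R n N rho X stab x0 Xx0 x0_dense x0_low r e e_inj Lam LamX Lam_e s W sW k a f v us fW vf.

Lemma s_nonempty k (f : coordRing X) : graded_piece k f -> f != 0 -> exists lam, lam \in s k.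
Proof.
have [_ _ _ dec] := sW k; move=> /dec [w [_ ->]] h; apply: contrapT => /forallNP H.
by move/eqP: h; apply; rewrite big_seq big1 // => lam ls; have := H lam.
Qed.

Lemma s0_eq lam : lam \in s 0 -> lam = 0.
Proof.
move=> /sE [_ [x [_]]]; rewrite scale0r => h; apply/rowP => j.
by move/rowP: h => /(_ j); rewrite !mxE => /eqP; rewrite intr_eq0 => /eqP.
Qed.

(** The unit of R is nonzero of degree 0, so some weight occurs in that degree, and by [s0_eq] it is
    0. *)
Lemma InS00 : cone_points 0 0.
Proof.
split=> //=; rewrite mul0mx.
  have [|lam ls] := @s_nonempty 0 1 _ (oner_neq0 _); last by rewrite -(s0_eq ls).
  exists 1; split; first exact: dhomog1.
  by rewrite rmorph1.
apply: (@pattern_vars _ _ (fun=> 0)); last by apply: pattern_zero => i _; rewrite AA0.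
by move=> v /vars_vx [x ->]; rewrite xco_vx ffunE.
Qed.

Lemma InS0_eq u : cone_points 0 u -> u = 0.
Proof.
move=> [u2 us pat]; have lam0 := s0_eq us.
have u12 : u.1.2 = 0 by apply: e_inj; rewrite lam0 mul0mx.
have p0 : pattern n (fun=> 0) (xco u.1.1) by apply: pattern_ext pat => i _; rewrite lam0 AA0.
have u11 : u.1.1 = 0.
  by apply/ffunP => x; rewrite ffunE -xco_vx (pattern_eq0 p0) // vx_vars.
by rewrite [u]surjective_pairing [u.1]surjective_pairing u2 u11 u12.
Qed.

Lemma coord_graded i : graded_piece 1 (proj_coord X 'X_i).
Proof. by exists 'X_i; split=> //; rewrite dhomogX; apply/eqP; exact: mdeg1. Qed.

Lemma s1_nonempty : exists lam, lam \in s 1.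
Proof.
have [i xi] : exists i, x0 i 0 != 0.
  apply: contrapT => /forallNP h; move/eqP: (pv_nonzero Xx0); apply; apply/matrixP => i j.
  by rewrite (ord1 j) mxE; apply/eqP/negPn/negP/h.
apply: (s_nonempty (coord_graded i)); apply/eqP => h.
have := cval_proj 'X_i Xx0; rewrite h (cval0 Xx0) /pteval mevalXU => /esym/eqP.
by rewrite (negbTE xi).
Qed.

Lemma delta'_nonempty : exists p a, delta' rho X e p a.
Proof.
have [lam ls] := s1_nonempty; have [a aE] := Lam_e ((sE _ _).1 ls).1.
have u1 : cone_points 1 (0, a, 1).
  split=> //=; first by rewrite -aE.
  apply: (@pattern_vars _ _ (fun=> 0)).
    by move=> v /vars_vx [x ->]; rewrite xco_vx ffunE.
  by apply: pattern_zero => i lin; rewrite -aE; apply: (AA_dominant stab Xx0 x0_dense x0_low sW ls).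
have [_ [p [b [d _]]]] := (InS_cone e_Lam sW _ (ltn0Sn 0)).1 u1.
by exists p, b.
Qed.

(** Degree 0 needs care: [InS_cone] divides by k, and [cone_slice] at k = 0 still asks for a point
    of Delta'(X), supplied by [delta'_nonempty]. *)
Lemma InS_coneE k u : cone_points k u <-> cone_slice rho X e k u.
Proof.
have [->|k0] := posnP k; last exact: (InS_cone e_Lam sW u k0).
split=> [/InS0_eq ->|[u2 [p [a [_ [pE aE]]]]]].
  have [p [a d]] := delta'_nonempty; split=> //; exists p, a; split=> //.
  by split=> [x|]; rewrite ?ffunE ?mul0r // scale0r; apply/rowP => j; rewrite !mxE.
suff -> : u = 0 by exact: InS00.
rewrite [u]surjective_pairing [u.1]surjective_pairing u2; congr (_, _, _).
  apply/ffunP => x; have := pE x; rewrite mul0r ffunE => /eqP; rewrite intr_eq0.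
  by move/eqP.
apply/rowP => j; move/rowP: aE => /(_ j); rewrite scale0r !mxE => /eqP; rewrite intr_eq0.
by move/eqP.
Qed.

Definition s1_sum (k : nat) (a : 'rV[int]_r) : Prop := exists b : seq 'rV[int]_r,
  [/\ size b = k, forall x, x \in b -> x *m e \in s 1 & a = \sum_(x <- b) x].

Definition s1_supp (k : nat) (g : L) : Prop := forall u, u \in gsupp g -> s1_sum k u.1.2.

Lemma s1_supp_mul k l g h : s1_supp k g -> s1_supp l h -> s1_supp (k + l) (g * h).
Proof.
move=> Hg Hh _ /gsupp_mul [u [v [/Hg [b [bs bE uE]] /Hh [c [cs cE vE]] ->]]].
exists (b ++ c); split; first by rewrite size_cat bs cs.
  by move=> x; rewrite mem_cat => /orP [/bE|/cE].
by rewrite big_cat /= -uE -vE.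
Qed.

Lemma s1_supp1 : s1_supp 0 1.
Proof. by move=> u /gsupp1 ->; exists [::]; split=> //; rewrite big_nil. Qed.

Lemma s1_supp_exp k g j : s1_supp k g -> s1_supp (j * k) (g ^+ j).
Proof.
move=> Hg; elim: j => [|j IH]; first exact: s1_supp1.
by rewrite exprS mulSn; apply: s1_supp_mul.
Qed.

Lemma s1_supp_prod (T : Type) (t : seq T) (d : T -> nat) (G : T -> L) :
  (forall i, s1_supp (d i) (G i)) -> s1_supp (\sum_(i <- t) d i) (\prod_(i <- t) G i).
Proof.
move=> HG; elim: t => [|i t IH]; first by rewrite !big_nil; exact: s1_supp1.
by rewrite !big_cons; apply: s1_supp_mul.
Qed.

Lemma s1_supp_coord i : s1_supp 1 (Psi (proj_coord X 'X_i)).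
Proof.
have [_ _ _ dec] := sW 1; have [w [wW ->]] := dec _ (coord_graded i).
rewrite (Psi_sum stab Xx0 x0_dense x0_low e_inj LamX Lam_e) => u /gsupp_sum [lam ls ul].
have [a aE] := Lam_e ((sE _ _).1 ls).1; rewrite aE in ls.
have ww := wW _ ls; rewrite -aE in ww ls; rewrite aE in ls ww; rewrite aE in ul.
have [_ -> _] := wsup ls ww ul.
by exists [:: a]; split=> // [x|]; rewrite ?inE ?big_seq1 // => /eqP ->.
Qed.

(** A monomial of degree k is a product of k coordinates, each in R_1. The y-parts of exponents add
    in products, so every y-part is a sum of k weights of R_1. *)
Lemma s1_supp_graded k (f : coordRing X) : graded_piece k f -> s1_supp k (Psi f).
Proof.
move=> [p [/dhomogP pk ->]] u.
rewrite {1}[p]mpolyE raddf_sum (Psi_sum stab Xx0 x0_dense x0_low e_inj LamX Lam_e).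
move=> /gsupp_sum [m mp]; rewrite -(pk m mp) => um.
have {}um : u \in gsupp (\prod_i Psi (proj_coord X 'X_i) ^+ m i).
  apply: (@gsuppZ _ _ _ (p@_m)); rewrite mpolyXE_id in um.
  suff <- : Psi (proj_coord X (p@_m *: \prod_i 'X_i ^+ m i)) =
    p@_m *: \prod_i Psi (proj_coord X 'X_i) ^+ m i by exact: um.
  have projZ c q : proj_coord X (c *: q) = c *: proj_coord X q by rewrite -mul_mpolyC rmorphM.
  rewrite projZ (PsiZ stab Xx0 x0_dense x0_low e_inj LamX Lam_e) rmorph_prod; congr (_ *: _).
  rewrite (big_morph Psi (PsiM stab Xx0 x0_dense x0_low e_inj LamX Lam_e) (Psi1 stab Xx0 x0_dense x0_low e_inj LamX Lam_e)).
  apply: eq_bigr => i _; rewrite rmorphXn; elim: (m i) => [|j IH].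
    exact: (Psi1 stab Xx0 x0_dense x0_low e_inj LamX Lam_e).
  by rewrite !exprS (PsiM stab Xx0 x0_dense x0_low e_inj LamX Lam_e) IH.
move: um; have := @s1_supp_prod _ (index_enum 'I_N) (fun i => m i) (fun i => Psi (proj_coord X 'X_i) ^+ m i).
move=> H /H um; suff: s1_sum (\sum_i m i)%N u.1.2 by rewrite -(mdegE m).
apply: um => i; rewrite -[X in s1_supp X]muln1; apply: s1_supp_exp.
exact: s1_supp_coord.
Qed.

End Generation.

Lemma fst_sum (U V : nmodType) (T : Type) (s : seq T) (F : T -> U * V) :
  (\sum_(i <- s) F i).1 = \sum_(i <- s) (F i).1.
Proof. exact: (big_morph (fun u : U * V => u.1)). Qed.

Lemma snd_sum (U V : nmodType) (T : Type) (s : seq T) (F : T -> U * V) :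
  (\sum_(i <- s) F i).2 = \sum_(i <- s) (F i).2.
Proof. exact: (big_morph (fun u : U * V => u.2)). Qed.

Section Finiteness.
Context {R : realType} {n N : nat} (rho : spModule R n N) (X : projVariety R N).
Local Notation C := R[i].
Local Notation M := 'M[C]_(n + n).
Hypothesis stab : G_stable rho X.
Variable x0 : 'cV[C]_N.
Hypotheses (Xx0 : X x0) (x0_dense : proj_dense (Defs.orbit rho Sp x0) X).
Hypothesis x0_low : forall l, Sp l -> utri l^T -> rho l *m x0 = x0.
Context {r : nat} (e : 'M[int]_(r, n)).
Hypothesis e_inj : forall a b : 'rV[int]_r, a *m e = b *m e -> a = b.
Local Notation I := (xvar n + 'I_n + unit)%type.
Local Notation L := (groupAlg C (expo n r)).

Variable Lam : 'rV[int]_n -> Prop.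
Hypothesis LamX : brion_lattice rho X Lam.
Hypothesis Lam_e : forall lam, Lam lam -> exists a : 'rV[int]_r, lam = a *m e.

Local Notation Psi := (Psi stab Xx0 x0_dense x0_low LamX Lam_e).

Hypothesis e_Lam : forall a : 'rV[int]_r, Lam (a *m e).
Variables (s : nat -> seq 'rV[int]_n) (W : nat -> 'rV[int]_n -> coordRing X -> Prop).
Hypothesis sW : forall k, [/\ uniq (s k), (forall lam, lam \in s k <-> weights_in rho X Lam k lam),
    (forall lam, lam \in s k -> V_in rho lam k (W k lam)) &
    (forall f, graded_piece k f -> exists w : 'rV[int]_n -> coordRing X,
       (forall lam, lam \in s k -> W k lam (w lam)) /\ f = \sum_(lam <- s k) w lam)].

Let sE k lam : lam \in s k <-> weights_in rho X Lam k lam.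
Proof. by have [_ h _ _] := sW k; apply: h. Qed.

Let sV k lam : lam \in s k -> V_in rho lam k (W k lam).
Proof. by have [_ _ h _] := sW k; apply: h. Qed.

Local Notation cone_points := (cone_points e s).

Let wsup k (a : 'rV[int]_r) f v (us : a *m e \in s k) (fW : W k (a *m e) f) (vf : v \in gsupp (Psi f)) :
  wsupp k a v := @W_supp R n N rho X stab x0 Xx0 x0_dense x0_low r e e_inj Lam LamX Lam_e s W sW k a f v us fW vf.

(** A function with initial exponent u shows that its y-part is a sum of k weights of degree one;
    the pattern in the x-part is then split along this decomposition. *)
Lemma InS_gen k u : cone_points k u -> exists v : 'I_k -> expo n r, (forall j, cone_points 1 (v j)) /\ u = \sum_j v j.
Proof.
move=> uS; have [u2 us pat] := uS.
have [f fW [uf _]] := InS_init stab Xx0 x0_dense x0_low e_inj LamX Lam_e sW uS.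
have [b [bs bE uE]] := s1_supp_graded e_inj sW ((sV us).2 _ fW) uf.
have {}uE : u.1.2 = \sum_(j < k) b`_j by rewrite uE (big_nth 0) bs big_mkord.
have b1 (j : 'I_k) : b`_j *m e \in s 1 by apply: bE; rewrite mem_nth // bs.
have lamE : u.1.2 *m e = \sum_(j < k) (b`_j *m e) by rewrite uE mulmx_suml.
have [|||q [qP qE]] := @pattern_split_sum n 'I_k (index_enum 'I_k) (fun j => weight_gap (b`_j *m e)) (xco u.1.1).
- exact: index_enum_uniq.
- by move=> j i lin; apply: (AA_dominant stab Xx0 x0_dense x0_low sW (b1 j)).
- by apply: pattern_ext pat => i _; rewrite lamE AA_sum.
exists (fun j => ([ffun x => q j (xpair x)], b`_j, 1)); split=> [j|].
  split=> //; first exact: b1.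
  apply: pattern_vars (qP j _); last exact: mem_index_enum.
  by move=> v /vars_vx [x ->]; rewrite xco_vx ffunE.
rewrite [u]surjective_pairing [u.1]surjective_pairing [RHS]surjective_pairing [(\sum_j _).1]surjective_pairing.
rewrite !snd_sum !fst_sum snd_sum /= -uE u2; congr (_, _, _).
  apply/ffunP => x; rewrite -xco_vx qE ?vx_vars // sum_ffunE; apply: eq_bigr => j _.
  by rewrite ffunE.
by rewrite sumr_const card_ord natz.
Qed.

Lemma is_init_neq0 (f : coordRing X) u : is_init (Psi f) u -> f != 0.
Proof.
move=> [uf _]; apply: contraTneq uf => ->.
by rewrite (Psi0 stab Xx0 x0_dense x0_low e_inj LamX Lam_e) gsuppP gcoef0 eqxx.
Qed.

(** The point is that the sum of the two weights occurs in degree k + l: R is a domain, so the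
    product of functions with initial exponents u and v is nonzero, and all its exponents have this
    y-part. Patterns add by linearity of [bound]. *)
Lemma InS_add k l u v : cone_points k u -> cone_points l v -> cone_points (k + l) (u + v).
Proof.
move=> uS vS; have [u2 us upat] := uS; have [v2 vs vpat] := vS.
have [f fW fu] := InS_init stab Xx0 x0_dense x0_low e_inj LamX Lam_e sW uS.
have [g gW gv] := InS_init stab Xx0 x0_dense x0_low e_inj LamX Lam_e sW vS.
have fg0 : f * g != 0 by rewrite mulf_neq0 // (is_init_neq0 fu, is_init_neq0 gv).
have [w wfg] : exists w, w \in gsupp (Psi (f * g)).
  apply: contrapT => /forallNP h; move/eqP: fg0; apply.
  suff pz : Psi (f * g) = 0 by exact: (Psi_eq0 e_inj sW pz).
  by apply: gcoefP => w; rewrite gcoef0; apply/eqP/negPn; rewrite -gsuppP; apply/negP/h.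
have [d [_ [_ _ _ H]]] := Psi_comp stab Xx0 x0_dense x0_low e_inj LamX Lam_e sW (f * g).
have [j [_ w2 ws]] := H w wfg.
move: wfg; rewrite (PsiM stab Xx0 x0_dense x0_low e_inj LamX Lam_e) => /gsupp_mul [a [b [/(wsup us fW) [_ a2 a3]
  /(wsup vs gW) [_ b2 b3] wE]]].
have jE : j = (k + l)%N by move: w2; rewrite wE /= a3 b3; lia.
have lamE : (u + v).1.2 *m e = u.1.2 *m e + v.1.2 *m e by rewrite -mulmxDl.
split; first by rewrite /= u2 v2; lia.
  by move: ws; rewrite wE jE /= a2 b2.
apply: (@pattern_vars _ _ (fun x => xco u.1.1 x + xco v.1.1 x)); first by move=> x _; rewrite xcoD.
by apply: pattern_ext (pattern_add upat vpat) => i _; rewrite lamE AAD.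
Qed.

(** The y-part comes from one of the finitely many weights in [s k], through the inverse [af] of a
    -> a e on them, and the entries of the x-part are bounded by [pattern_le]. *)
Lemma InS_finite k : exists T : seq (expo n r), forall u, cone_points k u -> u \in T.
Proof.
have afP lam : exists a : 'rV[int]_r, lam \in s k -> lam = a *m e.
  have [ls|_] := boolP (lam \in s k); last by exists 0.
  by have [a aE] := Lam_e ((sE _ _).1 ls).1; exists a.
have [af afE] := choice afP.
pose A := \sum_(lam <- s k) \sum_(i < n) `|weight_gap lam i|.
have A0 : 0 <= A by apply: sumr_ge0 => lam _; apply: sumr_ge0.
have AE lam i : lam \in s k -> (i < n)%N -> weight_gap lam i <= A.
  move=> ls lin; apply: le_trans (ler_norm _) _.
  have h1 : `|weight_gap lam i| <= \sum_(j < n) `|weight_gap lam j|.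
    by rewrite (bigD1 (Ordinal lin)) //= lerDl sumr_ge0.
  apply: le_trans h1 _; rewrite /A (big_rem lam) //= lerDl.
  by apply: sumr_ge0 => mu _; apply: sumr_ge0.
pose B := absz (4%:Z ^+ n * A).
pose mk lam (phi : {ffun xvar n -> 'I_B.+1}) : expo n r :=
  ([ffun x => (phi x : nat)%:Z], af lam, k%:Z).
exists [seq mk lam phi | lam <- s k, phi <- enum {: {ffun xvar n -> 'I_B.+1}}].
move=> u [u2 us pat]; apply/allpairsP.
have le x : (`|u.1.1 x| < B.+1)%N.
  have h0 := pattern_ge0 pat (vx_vars x); have h1 := pattern_le (fun i => @AE _ i us) pat (vx_vars x).
  rewrite !xco_vx in h0 h1; rewrite ltnS -lez_nat /B !gez0_abs //.
  by rewrite mulr_ge0 // exprn_ge0.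
exists (u.1.2 *m e, [ffun x => Ordinal (le x)]); split=> //=; first by rewrite mem_enum.
have h1 : af (u.1.2 *m e) = u.1.2 by apply: e_inj; rewrite -afE.
have h2 : [ffun x => ([ffun x => Ordinal (le x)] x : nat)%:Z] = u.1.1.
  apply/ffunP => x; rewrite !ffunE /= gez0_abs // -xco_vx.
  exact: pattern_ge0 pat _ (vx_vars x).
by rewrite /mk h1 h2 -u2 -!surjective_pairing.
Qed.

End Finiteness.

(** * Subduction *)

Section TermOrder.
Variables (n r : nat).

Lemma xprec_total (k l : xvar n) : [\/ xprec k l, k = l | xprec l k].
Proof.
have : [\/ vprec (xpair k) (xpair l), xpair k = xpair l | vprec (xpair l) (xpair k)].
  case: (xpair k) (xpair l) => [a b] [c d]; rewrite /vprec /=.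
  have [ac|ca|->] := ltngtP a c; [by constructor 1|by constructor 3|].
  by have [bd|db|->] := ltngtP b d; [constructor 3|constructor 1|constructor 2].
by case=> [/xprecE h|/vx_inj h|/xprecE h]; [constructor 1|constructor 2|constructor 3].
Qed.

Lemma xprec_trans (k l m : xvar n) : xprec k l -> xprec l m -> xprec k m.
Proof. by move=> /xprecE h1 /xprecE h2; apply/xprecE; apply: vprec_trans h1 h2. Qed.

Lemma xlt_trans (p q s : {ffun xvar n -> int}) : xlt p q -> xlt q s -> xlt p s.
Proof.
move=> [k [k1 k2]] [l [l1 l2]]; case: (xprec_total k l) => [kl|kl|lk].
- by exists k; split=> [|m mk]; [rewrite -(l2 k kl)|rewrite k2 // l2 //; apply: xprec_trans mk kl].
- rewrite kl in k1 k2; exists l; split=> [|m ml]; first exact: lt_trans l1 k1.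
  by rewrite k2 // l2.
- by exists l; split=> [|m ml]; [rewrite (k2 l lk)|rewrite k2 ?l2 //; apply: xprec_trans ml lk].
Qed.

Lemma ylt_trans (a b c : 'rV[int]_r) : ylt a b -> ylt b c -> ylt a c.
Proof.
move=> [i [i1 i2]] [j [j1 j2]]; have [ij|ji|/val_inj ij] := ltngtP i j.
- by exists j; split=> [|m mj]; [rewrite i2|rewrite i2 ?j2 //; apply: ltn_trans ij mj].
- by exists i; split=> [|m mi]; [rewrite -j2|rewrite i2 // j2 //; apply: ltn_trans ji mi].
- by rewrite ij in i1 i2; exists j; split=> [|m mj]; [apply: lt_trans i1 j1|rewrite i2 // j2].
Qed.

Lemma term_lt_trans (u v w : expo n r) : term_lt u v -> term_lt v w -> term_lt u w.
Proof.
move=> [h1|[e1 h1]] [h2|[e2 h2]]; rewrite /term_lt.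
- by left; apply: lt_trans h1 h2.
- by left; rewrite -e2.
- by left; rewrite e1.
right; split; first by rewrite e1.
case: h1 h2 => [h1|[f1 h1]] [h2|[f2 h2]].
- by left; apply: ylt_trans h1 h2.
- by left; rewrite -f2.
- by left; rewrite f1.
by right; split; [rewrite f1|apply: xlt_trans h1 h2].
Qed.

Lemma term_lt_irr (u : expo n r) : ~ term_lt u u.
Proof.
case=> [|[_ [[i [h _]]|[_ [k [h _]]]]]]; first by rewrite ltxx.
  by rewrite ltxx in h.
by rewrite ltxx in h.
Qed.

Lemma term_lt_le (u v : expo n r) : term_lt u v -> u.2 <= v.2.
Proof. by case=> [/ltW|[->]]. Qed.

End TermOrder.

Section Subduction.
Variables (F : numFieldType) (n r : nat).
Local Notation L := (groupAlg F (expo n r)).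

Lemma is_init_uniq (f : L) u v : is_init f u -> is_init f v -> u = v.
Proof.
move=> [uf um] [vf vm]; apply/eqP/negPn/negP => uv.
by apply: (@term_lt_irr n r u); apply: term_lt_trans (vm u uf uv) _; apply: um => //; rewrite eq_sym.
Qed.

Lemma init_sub (g h : L) u w : is_init g u -> is_init h u -> gcoef g u = gcoef h u ->
  is_init (g - h) w -> term_lt w u.
Proof.
move=> [ug um] [uh hm] c [wf _]; have wu : w != u.
  by apply: contraTneq wf => ->; rewrite gsuppP gcoefB c subrr eqxx.
have [wg|wg] := boolP (w \in gsupp g); first exact: um.
apply: hm => //; move: wf; rewrite !gsuppP gcoefB.
by move: wg; rewrite gsuppP negbK => /eqP ->; rewrite sub0r oppr_eq0.
Qed.

Lemma finite_no_descent (u : nat -> expo n r) (T : seq (expo n r)) :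
  (forall k, term_lt (u k.+1) (u k)) -> ~ forall k, u k \in T.
Proof.
move=> dec uT; have lt k j : term_lt (u (k + j).+1) (u k).
  elim: j => [|j IH]; first by rewrite addn0.
  by apply: term_lt_trans IH; rewrite addnS.
have inj : injective u.
  have W j k : (j < k)%N -> u j <> u k.
    move=> jk E; have := lt j (k - j).-1; rewrite (_ : (j + (k - j).-1).+1 = k); last by lia.
    by rewrite E; apply: term_lt_irr.
  by move=> j k E; have [h|h|//] := ltngtP j k; [case: (W _ _ h E)|case: (W _ _ h (esym E))].
have := @uniq_leq_size _ [seq u k | k <- iota 0 (size T).+1] T.
rewrite size_map size_iota ltnn map_inj_uniq // iota_uniq => H.
by have : false by apply: H => // _ /mapP [k _ ->].
Qed.

End Subduction.

Theorem theorem6p1 (R : realType) (n N : nat)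
  (rho : spModule R n N) (X : projVariety R N)
  (Xstable : G_stable rho X) (Xhoro : horospherical rho X)
  (Lam : 'rV[int]_n -> Prop) (LamX : brion_lattice rho X Lam)
  (r : nat) (e : 'M[int]_(r, n)) (eLam : lattice_basis Lam e) :
  exists Psi : {lrmorphism coordRing X -> groupAlg R[i] (expo n r)},
    injective Psi /\ (forall f, in_Fxyt (Psi f)) /\
    let A := fun g => exists f, g = Psi f in
    (exists s (f : 'I_s -> groupAlg R[i] (expo n r)), sagbi_basis A f) /\
    (forall u : expo n r, init_semigroup A u <-> exists k, cone_slice rho X e k u).
Proof.
have [x0 [Xx0 [x0d x0l]]] := base_point Xstable Xhoro.
have e_inj (a b : 'rV[int]_r) : a *m e = b *m e -> a = b.
  move=> ab; have [c [_ cu]] := (eLam 0).1 LamX.1.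
  have h1 : c = 0 by apply: cu; rewrite mul0mx.
  have h2 : c = a - b by apply: cu; rewrite mulmxBl ab subrr.
  by apply/eqP; rewrite -subr_eq0 -h2 h1.
have e_Lam (a : 'rV[int]_r) : Lam (a *m e).
  by apply/(eLam _).2; exists a; split=> // b /e_inj.
have Lam_e lam : Lam lam -> exists a : 'rV[int]_r, lam = a *m e.
  by move=> /(eLam _).1 [a [aE _]]; exists a.
pose P := Psi Xstable Xx0 x0d x0l LamX Lam_e.
have [s [W sW]] := brion_choice LamX.
have PB : zmod_morphism P by move=> f g; apply: PsiB.
have PM : monoid_morphism P by split; [apply: Psi1|move=> f g; apply: PsiM].
have PZ : scalable P by move=> c f; apply: PsiZ.
have [Q QE] := lrmorphism_exists PB PM PZ.
have P_init u : (exists f, is_init (P f) u) <-> exists k, cone_points e s k u.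
  split=> [[f fu]|[k uS]]; first exact: (init_InS e_inj sW fu).
  by have [f _ fu] := InS_init Xstable Xx0 x0d x0l e_inj LamX Lam_e sW uS; exists f.
have A_init u : init_semigroup (fun g => exists f, g = Q f) u <-> exists k, cone_points e s k u.
  rewrite -P_init; split=> [[_ [[f ->] fu]]|[f fu]]; first by exists f; rewrite -QE.
  by exists (P f); split=> //; exists f; rewrite QE.
exists Q; split.
  move=> f g; rewrite !QE => h; apply/eqP; rewrite -subr_eq0; apply/eqP.
  suff pz : P (f - g) = 0 by exact: (Psi_eq0 e_inj sW pz).
  by rewrite PB h subrr.
split; first by move=> f u; rewrite QE => /(PsiP _ _ _ _ _ _ _).1.
split; last first.
  move=> u; rewrite A_init; split=> -[k h]; exists k;
  by apply/(InS_coneE Xstable Xx0 x0d x0l e_inj Lam_e e_Lam sW k u).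
have [T1 T1E] := InS_finite e_inj Lam_e sW 1.
(* The SAGBI basis has one element for each cone point of degree one. *)
pose T := [seq u <- undup T1 | `[< cone_points e s 1 u >]].
have TE u : u \in T <-> cone_points e s 1 u.
  by rewrite mem_filter mem_undup; split=> [/andP [/asboolP]//|h]; rewrite (T1E u h) andbT; apply/asboolP.
have uT : uniq T by rewrite filter_uniq // undup_uniq.
have Fex u : exists f, cone_points e s 1 u -> is_init (Q f) u.
  have [h|h] := pselect (cone_points e s 1 u); last by exists 0.
  by have [f _ fu] := InS_init Xstable Xx0 x0d x0l e_inj LamX Lam_e sW h; exists f; rewrite QE.
have [F FE] := choice Fex.
pose m (i : 'I_(size T)) := nth 0 T i.
have mS i : cone_points e s 1 (m i) by apply/TE; apply: mem_nth.
exists (size T), (fun i => Q (F (m i))); split; first by move=> i; exists (F (m i)).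
exists m; split; first by move=> i; apply: FE.
split.
  move=> u; rewrite A_init; split=> [[k]|[d ->]].
    move=> /(InS_gen Xstable Xx0 x0d x0l e_inj LamX Lam_e sW) [v [vS ->]].
    have vT j : v j \in T by apply/TE.
    pose ix j : 'I_(size T) := Ordinal (etrans (index_mem (v j) T) (vT j)).
    have vE j : v j = m (ix j) by rewrite /m /= nth_index.
    exists (fun i => #|[set j | ix j == i]|).
    rewrite (partition_big ix predT) //=; apply: eq_bigr => i _.
    rewrite (eq_bigr (fun=> m i)) => [|j /eqP <- //].
    by rewrite sumr_const cardsE.
  apply: (big_ind (fun u => exists k, cone_points e s k u)).
  - exists 0%N; exact: (InS00 e sW).
  - move=> v w [k ku] [l lv]; exists (k + l)%N.
    exact: (InS_add Xstable Xx0 x0d x0l e_inj LamX Lam_e sW ku lv).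
  move=> i _; exists (d i); elim: (d i) => [|j IH]; first exact: (InS00 e sW).
  rewrite mulrS -[j.+1]add1n.
  exact: (InS_add Xstable Xx0 x0d x0l e_inj LamX Lam_e sW (mS i) IH).
move=> g [f0 gE] [h [h0 hS]].
have hA k : exists f, h k = Q f.
  elim: k => [|k [f hk]]; first by exists f0; rewrite h0.
  have [d [c [_ [_ [_ ->]]]]] := hS k.
  have prodE : Q (\prod_i F (m i) ^+ d i) = \prod_i Q (F (m i)) ^+ d i.
    by rewrite rmorph_prod; apply: eq_bigr => i _; rewrite rmorphXn.
  by exists (f - c *: \prod_i F (m i) ^+ d i); rewrite hk -prodE !QE PB PZ.
have hI k : exists u, is_init (h k) u by have [d [c [hu _]]] := hS k; eexists; exact: hu.
have [u uI] := choice hI.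
have udec k : term_lt (u k.+1) (u k).
  have [d [c [gu [hu [ce E]]]]] := hS k.
  have Eu := is_init_uniq (uI k) gu; rewrite Eu.
  by apply: (init_sub gu hu ce); rewrite -E.
have uS k : exists j, cone_points e s j (u k).
  by apply/A_init; exists (h k).
have [fin finE] := choice (InS_finite e_inj Lam_e sW).
(* The exponent of t is compared before all others, so degrees never increase: every [u k] lies in
   the finite set of cone points of degree at most K, where a strict descent cannot go on for
   ever. *)
have u_le k : (u k).2 <= (u 0%N).2.
  by elim: k => // k IH; apply: le_trans (term_lt_le (udec k)) IH.
have [K [K2 _ _]] := uS 0%N.
apply: (@finite_no_descent n r u (flatten [seq fin j | j <- iota 0 K.+1]) udec) => k.
have [j jS] := uS k; apply/flattenP; exists (fin j); last exact: finE.
apply: map_f; rewrite mem_iota /= add0n ltnS; have [j2 _ _] := jS.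
by have := u_le k; rewrite j2 K2 lez_nat.
Qed.
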